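(* Let $N\ge 3$ be an integer. All notions used are defined in the context. Provided the magnitude $|\Lambda|$ of the negative cosmological constant is sufficiently large, there exist non-embedded, static, spherically symmetric, purely magnetic solutions of $\mathfrak{su}(N)$ Einstein-Yang-Mills theory, both solitons and black holes, lying in a neighbourhood of stable embedded $\mathfrak{su}(2)$ solutions (solitons or black holes respectively), which have no instabilities in the gravitational sector of linear, spherically symmetric perturbations.
   Context: **Static solutions.** The metric is $ds^2=-\bar\mu\bar S^2dt^2+\bar\mu^{-1}dr^2+r^2d\theta^2+r^2\sin^2\theta\,d\phi^2$ with $\bar\mu(r)=1-\frac{2\bar m(r)}{r}-\frac{\Lambda r^2}{3}$, $\Lambda<0$. The purely magnetic gauge field is described by real functions $\bar\omega_1(r),\dots,\bar\omega_{N-1}(r)$, none identically zero; by convention $\bar\omega_0\equiv\bar\omega_N\equiv0$. A prime is $d/dr$. The field equations are $$\bar m'=\bar\mu\bar\Gamma+r^2\bar\Pi,\qquad \frac{\bar S'}{\bar S}=\frac{2\bar\Gamma}{r},\qquad r^2\bar\mu\,\bar\omega_j''+\Big(2\bar m-2r^3\bar\Pi-\frac{2\Lambda r^3}{3}\Big)\bar\omega_j'+W_j\bar\omega_j=0,$$ with $\bar\Gamma=\sum_{j=1}^{N-1}\bar\omega_j'^2$, $\bar\Pi=\frac1{4r^4}\sum_{j=1}^N(\bar\omega_j^2-\bar\omega_{j-1}^2-N-1+2j)^2$, $W_j=1-\bar\omega_j^2+\frac12(\bar\omega_{j-1}^2+\bar\omega_{j+1}^2)$. A *black hole* has a regular non-extremal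 event horizon at some $r=r_h>0$, where $\bar\mu$ has a single zero, and is regular with $\bar\mu>0$ for $r>r_h$. A *soliton* is regular for all $r\ge0$, with $\bar m=O(r^3)$, $\bar S=S_0+O(r^2)$, $\bar\omega_j=\pm\sqrt{j(N-j)}+O(r^2)$ as $r\to0$. In both cases, as $r\to\infty$, $\bar m=M+O(r^{-1})$, $\bar S=1+O(r^{-1})$, $\bar\omega_j=\bar\omega_{j,\infty}+c_jr^{-1}+O(r^{-2})$ with constants $M,\bar\omega_{j,\infty},c_j$. **Embedded $\mathfrak{su}(2)$ solutions** are those of the form $\bar\omega_j(r)=\pm\sqrt{j(N-j)}\,\bar\omega(r)$ for all $j$, with a single function $\bar\omega$. Other solutions are *non-embedded*. **Neighbourhood.** Near the horizon a black hole is determined by $\Lambda$, $r_h$ and the $N-1$ initial parameters $\bar\omega_j(r_h)$; near the origin a soliton is determined by $\Lambda$ and $N-1$ initial parameters appearing in the power series of the gauge field functions at $r=0$ (up to order $r^N$). A solution is in a neighbourhood of another if its initial parameters are close to those of the other. **Tortoise coordinate.** $dr_*/dr=1/(\bar\mu\bar S)$; write $\partial=\partial_{r_*}$. **Perturbations.** Linear, spherically symmetric perturbations, in the gauge where the electric perturbations vanish and with time dependence $e^{i\sigma t}$, decouple into two sectors. Only bound state perturbations are considered, i.e. those vanishing at the origin (soliton) or event horizon (black hole) and at infinity. *Gravitational sector* (even parity). After elimination of the metric perturbations, $\delta\omega=(\delta\omega_1,\dots,\delta\omega_{N-1})^T$ (the perturbations of the $\bar\omega_j$) satisfies $\sigma^2\delta\omega=-\partial^2\delta\omega+\mathcal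 M\,\delta\omega$, where $\mathcal M$ is the symmetric matrix $$\mathcal M_{j,k}=\frac{\bar\mu\bar S^2}{r^2}\Big[(2\bar\omega_j^2-W_j)\delta_{j,k}-\bar\omega_j\bar\omega_k(\delta_{j+1,k}+\delta_{j-1,k})\Big]-\frac{4\mathcal Q}{\bar\mu\bar S r}(\partial\bar\omega_j)(\partial\bar\omega_k)-\frac{4\bar S}{r^3}\Big[W_j\bar\omega_j\partial\bar\omega_k+W_k\bar\omega_k\partial\bar\omega_j\Big],$$ $$\mathcal Q=\frac{\partial\bar\mu}{\bar\mu}+\frac{\partial\bar S}{\bar S}+\frac{\bar\mu\bar S}{r}.$$ *No instabilities in the gravitational sector* means that there is no nonzero bound state solution $\delta\omega$ of this equation with $\sigma^2<0$. *Sphaleronic sector* (odd parity). The variables are $\Psi=(\delta\epsilon,\delta\Phi)^T$ with $\delta\epsilon=(\delta\epsilon_1,\dots,\delta\epsilon_N)^T$, $\sum_j\delta\epsilon_j=0$, and $\delta\Phi=(\delta\Phi_1,\dots,\delta\Phi_{N-1})^T$. Let $h=\bar S\sqrt{\bar\mu}/r$; let $\mathcal F$ be the $N\times(N-1)$ matrix with $\mathcal F_{j,j}=\bar\omega_j$, $\mathcal F_{j+1,j}=-\bar\omega_j$ and other entries $0$; let $\mathcal K$ be the symmetric tridiagonal $N\times N$ matrix with $\mathcal K_{j,j}=-\bar\omega_{j-1}^2-\bar\omega_j^2$, $\mathcal K_{j,j+1}=\bar\omega_j^2$; let $\mathcal W=h^2\,\mathrm{Diag}(W_1,\dots,W_{N-1})$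 and $\mathcal X=2h\,\partial\mathcal F^T+(\partial h)\mathcal F^T$. Put $$\mathcal U\Psi=\begin{pmatrix} -h^2\mathcal K\,\delta\epsilon+h\mathcal F\,\partial\delta\Phi-h(\partial\mathcal F)\delta\Phi\\ -\partial^2\delta\Phi-h\mathcal F^T\partial\delta\epsilon-\mathcal X\,\delta\epsilon-\mathcal W\,\delta\Phi\end{pmatrix}.$$ *No instabilities in the sphaleronic sector* means that there is no nonzero bound state $\Psi$ with $\mathcal U\Psi=\sigma^2\Psi$, $\sigma^2<0$, satisfying the strong Gauss constraint $\partial(h^{-1}\delta\epsilon)+\mathcal F\,\delta\Phi=0$. A solution is *stable* (under linear, spherically symmetric perturbations) if it has no instabilities in either sector. *)

(* Defs.v *)
From Stdlib Require Import Reals.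
From Coquelicot Require Import Coquelicot.

Open Scope R_scope.

(* Everything is a function of the areal radius r; only values on the region
   r > r0 (r0 = 0 for a soliton, r0 = r_h for a black hole) and, for a black
   hole, near r = r_h are ever used.  Gauge indices are natural numbers j,
   with 1 <= j <= N - 1 the physical range for the magnetic functions. *)
Record background := Background {
  mass : R -> R;          (* \bar m *)
  lapse : R -> R;         (* \bar S *)
  gauge : nat -> R -> R   (* \bar\omega_j *)
}.

Definition is_bigO (F : (R -> Prop) -> Prop) (f g : R -> R) : Prop :=
  exists K : R, F (fun r => Rabs (f r) <= K * Rabs (g r)).

Definition kron (i j : nat) : R := if Nat.eqb i j then 1 else 0.

Definition mu (Lam : R) (b : background) (r : R) : R :=
  1 - 2 * mass b r / r - Lam * r ^ 2 / 3.

Definition Gam (N : nat) (b : background) (r : R) : R :=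
  sum_n_m (fun j => (Derive (gauge b j) r) ^ 2) 1 (N - 1).

Definition Pi (N : nat) (b : background) (r : R) : R :=
  / (4 * r ^ 4) *
  sum_n_m (fun j => ((gauge b j r) ^ 2 - (gauge b (j - 1) r) ^ 2
                     - INR N - 1 + 2 * INR j) ^ 2) 1 N.

Definition W (b : background) (j : nat) (r : R) : R :=
  1 - (gauge b j r) ^ 2
  + / 2 * ((gauge b (j - 1) r) ^ 2 + (gauge b (j + 1) r) ^ 2).

Definition field_equations (N : nat) (Lam : R) (b : background) (r : R) : Prop :=
  Derive (mass b) r = mu Lam b r * Gam N b r + r ^ 2 * Pi N b r /\
  Derive (lapse b) r / lapse b r = 2 * Gam N b r / r /\
  forall j : nat, (1 <= j <= N - 1)%nat ->
    r ^ 2 * mu Lam b r * Derive_n (gauge b j) 2 r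
    + (2 * mass b r - 2 * r ^ 3 * Pi N b r - 2 * Lam * r ^ 3 / 3)
      * Derive (gauge b j) r
    + W b j r * gauge b j r = 0.

(* f is twice differentiable near r, with second derivative continuous at r. *)
Definition C2_at (f : R -> R) (r : R) : Prop :=
  locally r (fun x => ex_derive f x /\ ex_derive (Derive f) x) /\
  continuous (Derive_n f 2) r.

Definition regular_at (N : nat) (b : background) (r : R) : Prop :=
  C2_at (mass b) r /\ C2_at (lapse b) r /\
  forall j : nat, (1 <= j <= N - 1)%nat -> C2_at (gauge b j) r.

Definition gauge_convention (N : nat) (r0 : R) (b : background) : Prop :=
  (forall r : R, gauge b 0%nat r = 0 /\ gauge b N r = 0) /\
  forall j : nat, (1 <= j <= N - 1)%nat -> exists r : R, r0 < r /\ gauge b j r <> 0.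

Definition asymptotics (N : nat) (b : background) : Prop :=
  (exists M : R,
     is_bigO (Rbar_locally p_infty) (fun r => mass b r - M) (fun r => / r)) /\
  is_bigO (Rbar_locally p_infty) (fun r => lapse b r - 1) (fun r => / r) /\
  forall j : nat, (1 <= j <= N - 1)%nat -> exists winf c : R,
    is_bigO (Rbar_locally p_infty)
      (fun r => gauge b j r - winf - c / r) (fun r => / r ^ 2).

Definition is_sign (e : R) : Prop := e = 1 \/ e = -1.

(* sqrt (j (N - j)) *)
Definition vac (N j : nat) : R := sqrt (INR j * (INR N - INR j)).

(* The lapse is nowhere zero and tends to 1 at infinity, so it is positive. *)
Definition black_hole (N : nat) (Lam rh : R) (b : background) : Prop :=
  0 < rh /\
  gauge_convention N rh b /\
  (forall r : R, rh <= r ->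
     regular_at N b r /\ 0 < lapse b r /\ field_equations N Lam b r) /\
  mu Lam b rh = 0 /\ Derive (mu Lam b) rh <> 0 /\
  (forall r : R, rh < r -> 0 < mu Lam b r) /\
  asymptotics N b.

Definition soliton (N : nat) (Lam : R) (b : background) : Prop :=
  gauge_convention N 0 b /\
  (forall r : R, 0 < r ->
     regular_at N b r /\ 0 < lapse b r /\ 0 < mu Lam b r /\
     field_equations N Lam b r) /\
  is_bigO (at_right 0) (mass b) (fun r => r ^ 3) /\
  (exists S0 : R, 0 < S0 /\
     is_bigO (at_right 0) (fun r => lapse b r - S0) (fun r => r ^ 2)) /\
  (forall j : nat, (1 <= j <= N - 1)%nat -> exists e : R, is_sign e /\
     is_bigO (at_right 0) (fun r => gauge b j r - e * vac N j) (fun r => r ^ 2)) /\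
  asymptotics N b.

Definition embedded (N : nat) (r0 : R) (b : background) : Prop :=
  exists (w : R -> R) (e : nat -> R), (forall j : nat, is_sign (e j)) /\
    forall (j : nat) (r : R), (1 <= j <= N - 1)%nat -> r0 < r ->
      gauge b j r = e j * vac N j * w r.

Definition close_at_horizon (N : nat) (rh eps : R) (b b' : background) : Prop :=
  forall j : nat, (1 <= j <= N - 1)%nat ->
    Rabs (gauge b j rh - gauge b' j rh) < eps.

(* a j k is the coefficient of r^k (0 <= k <= N) in the power series of the
   j-th gauge field function at the origin. *)
Definition origin_coefficients (N : nat) (b : background) (a : nat -> nat -> R) : Prop :=
  forall j : nat, (1 <= j <= N - 1)%nat ->
    is_bigO (at_right 0)
      (fun r => gauge b j r - sum_n (fun k => a j k * r ^ k) N)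
      (fun r => r ^ (N + 1)).

(* The N - 1 free parameters of a soliton are coordinates on the coefficient
   vectors of orders 2, ..., N: at order k the part lying in the kernel of
   A - k (k - 1), where A is the symmetric matrix obtained by linearising the
   term - W_j omega_j at omega_j(0).  The remaining coefficients up to order N
   are determined by these and Lambda.  All coefficients are compared here;
   the order-zero ones record the choice of signs. *)
Definition close_at_origin (N : nat) (eps : R) (b b' : background) : Prop :=
  exists a a' : nat -> nat -> R,
    origin_coefficients N b a /\ origin_coefficients N b' a' /\
    forall j k : nat, (1 <= j <= N - 1)%nat -> (k <= N)%nat ->
      Rabs (a j k - a' j k) < eps.

(* Derivative with respect to the tortoise coordinate, d r_* / d r = 1/(mu S). *)
Definition dstar (Lam : R) (b : background) (f : R -> R) (r : R) : R :=
  mu Lam b r * lapse b r * Derive f r.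

Definition vanishes_at_ends (r0 : R) (f : R -> R) : Prop :=
  filterlim f (at_right r0) (locally 0) /\
  filterlim f (Rbar_locally p_infty) (locally 0).

Definition twice_diff (Lam r0 : R) (b : background) (f : R -> R) : Prop :=
  forall r : R, r0 < r -> ex_derive f r /\ ex_derive (dstar Lam b f) r.

Definition Qgrav (Lam : R) (b : background) (r : R) : R :=
  dstar Lam b (mu Lam b) r / mu Lam b r
  + dstar Lam b (lapse b) r / lapse b r
  + mu Lam b r * lapse b r / r.

Definition Mgrav (Lam : R) (b : background) (j k : nat) (r : R) : R :=
  mu Lam b r * (lapse b r) ^ 2 / r ^ 2 *
    ((2 * (gauge b j r) ^ 2 - W b j r) * kron j k
     - gauge b j r * gauge b k r * (kron (j + 1) k + kron (j - 1) k))
  - 4 * Qgrav Lam b r / (mu Lam b r * lapse b r * r)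
    * dstar Lam b (gauge b j) r * dstar Lam b (gauge b k) r
  - 4 * lapse b r / r ^ 3 *
    (W b j r * gauge b j r * dstar Lam b (gauge b k) r
     + W b k r * gauge b k r * dstar Lam b (gauge b j) r).

(* sig2 is sigma^2.  It is real and so are the coefficients of the equations,
   so real and imaginary parts of a mode are modes: real amplitudes suffice. *)
Definition grav_mode (N : nat) (Lam r0 : R) (b : background)
    (sig2 : R) (dw : nat -> R -> R) : Prop :=
  forall j : nat, (1 <= j <= N - 1)%nat ->
    twice_diff Lam r0 b (dw j) /\ vanishes_at_ends r0 (dw j) /\
    forall r : R, r0 < r ->
      sig2 * dw j r =
      - dstar Lam b (dstar Lam b (dw j)) r
      + sum_n_m (fun k => Mgrav Lam b j k r * dw k r) 1 (N - 1).

Definition no_grav_instability (N : nat) (Lam r0 : R) (b : background) : Prop :=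
  ~ exists (sig2 : R) (dw : nat -> R -> R),
      sig2 < 0 /\ grav_mode N Lam r0 b sig2 dw /\
      exists (j : nat) (r : R), (1 <= j <= N - 1)%nat /\ r0 < r /\ dw j r <> 0.

Definition hfun (Lam : R) (b : background) (r : R) : R :=
  lapse b r * sqrt (mu Lam b r) / r.

(* Row index 1 <= j <= N, column index 1 <= k <= N - 1. *)
Definition Fmat (b : background) (j k : nat) (r : R) : R :=
  kron j k * gauge b k r - kron j (k + 1) * gauge b k r.

(* Row and column indices between 1 and N. *)
Definition Kmat (b : background) (j k : nat) (r : R) : R :=
  kron j k * (- (gauge b (j - 1) r) ^ 2 - (gauge b j r) ^ 2)
  + kron (j + 1) k * (gauge b j r) ^ 2
  + kron j (k + 1) * (gauge b k r) ^ 2.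

(* Row index 1 <= j <= N - 1, column index 1 <= k <= N. *)
Definition Xmat (Lam : R) (b : background) (j k : nat) (r : R) : R :=
  2 * hfun Lam b r * dstar Lam b (Fmat b k j) r
  + dstar Lam b (hfun Lam b) r * Fmat b k j r.

(* The two blocks of U Psi, with Psi = (de, dPhi). *)
Definition Ueps (N : nat) (Lam : R) (b : background) (de dPhi : nat -> R -> R)
    (j : nat) (r : R) : R :=
  - (hfun Lam b r) ^ 2 * sum_n_m (fun k => Kmat b j k r * de k r) 1 N
  + hfun Lam b r *
    sum_n_m (fun k => Fmat b j k r * dstar Lam b (dPhi k) r) 1 (N - 1)
  - hfun Lam b r *
    sum_n_m (fun k => dstar Lam b (Fmat b j k) r * dPhi k r) 1 (N - 1).

Definition Uphi (N : nat) (Lam : R) (b : background) (de dPhi : nat -> R -> R)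
    (j : nat) (r : R) : R :=
  - dstar Lam b (dstar Lam b (dPhi j)) r
  - hfun Lam b r * sum_n_m (fun k => Fmat b k j r * dstar Lam b (de k) r) 1 N
  - sum_n_m (fun k => Xmat Lam b j k r * de k r) 1 N
  - (hfun Lam b r) ^ 2 * W b j r * dPhi j r.

Definition sphal_mode (N : nat) (Lam r0 : R) (b : background)
    (sig2 : R) (de dPhi : nat -> R -> R) : Prop :=
  (forall j : nat, (1 <= j <= N)%nat ->
     (forall r : R, r0 < r -> ex_derive (de j) r) /\
     vanishes_at_ends r0 (de j) /\
     forall r : R, r0 < r -> Ueps N Lam b de dPhi j r = sig2 * de j r) /\
  (forall j : nat, (1 <= j <= N - 1)%nat ->
     twice_diff Lam r0 b (dPhi j) /\
     vanishes_at_ends r0 (dPhi j) /\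
     forall r : R, r0 < r -> Uphi N Lam b de dPhi j r = sig2 * dPhi j r) /\
  (forall r : R, r0 < r -> sum_n_m (fun j => de j r) 1 N = 0).

Definition strong_gauss (N : nat) (Lam r0 : R) (b : background)
    (de dPhi : nat -> R -> R) : Prop :=
  forall (j : nat) (r : R), (1 <= j <= N)%nat -> r0 < r ->
    dstar Lam b (fun x => / hfun Lam b x * de j x) r
    + sum_n_m (fun k => Fmat b j k r * dPhi k r) 1 (N - 1) = 0.

Definition no_sphal_instability (N : nat) (Lam r0 : R) (b : background) : Prop :=
  ~ exists (sig2 : R) (de dPhi : nat -> R -> R),
      sig2 < 0 /\ sphal_mode N Lam r0 b sig2 de dPhi /\
      strong_gauss N Lam r0 b de dPhi /\
      ((exists (j : nat) (r : R), (1 <= j <= N)%nat /\ r0 < r /\ de j r <> 0) \/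
       (exists (j : nat) (r : R), (1 <= j <= N - 1)%nat /\ r0 < r /\ dPhi j r <> 0)).

Definition stable (N : nat) (Lam r0 : R) (b : background) : Prop :=
  no_grav_instability N Lam r0 b /\ no_sphal_instability N Lam r0 b.

(* Main.v *)
Require Import Defs.
From Stdlib Require Import Reals Lra Lia Arith ClassicalEpsilon FunctionalExtensionality.
From Coquelicot Require Import Coquelicot.

Open Scope R_scope.

(* The reference solution is vacuum: (Schwarzschild-)anti-de Sitter space with omega_j = sqrt (j (N - j)). On it W_j = 0 and Pi = 0. The argument works for every Lam < 0, so the bound L0 = 1 is arbitrary.

   Neighbouring solutions. In the coordinate s = (r - rh) / (1 + r - rh), which makes infinity a regular point, the field equations are a singular integral system on [0, 1] whose integral operators are averages against powers of s. Its linearisation at the vacuum has the alternating-sign vector altern N, with eigenvalue N (N - 1), as an eigenvector; a solution with leading part al * altern N, growing like r^N at the origin for solitons, is a fixed point of a contraction in an exponentially weighted norm for all small al. As omega_1 and omega_2 move in opposite directions, it is not embedded. For black holes, the formula for the fixed point shows that the solution is smooth enough to be continued through the horizon.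

   Gravitational stability. Close to the vacuum the potential matrix is positive definite, since y -> sum y_j (2 y_j - y_(j-1) - y_(j+1)) is. So the square norm of a mode with sigma^2 < 0 is convex in the tortoise coordinate and vanishes at both ends.

   Sphaleronic stability of the vacuum. The Gauss constraint turns the system into -d^2 y = (sigma^2 + h^2 K) y for y = epsilon / h, with K negative semidefinite, and the same argument applies to solitons. At a horizon 1 / h is infinite and y need not vanish, but its tortoise derivative is bounded there, and over an infinite tortoise length this rules out a nonzero solution. *)

(** Why the top eigenvalue: with leading power r^k, the two averages acting on the next order gain
    only 1/k and 1/(k+1), while the linearised gauge matrix can cost its full norm. A contraction
    needs N(N-1) < k(k+1), and among the eigenvalues k(k-1) with k = 2, ..., N only k = N satisfies
    it. The room is of order 1/N, so the norm must be sharp: weighting the components by the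
    absolute values of the eigenvector makes the sup norm of the matrix equal to its top eigenvalue.

    Why an integral system: the origin and the horizon are singular points of the field equations,
    where standard existence theorems for differential equations do not apply, whereas an average
    against s^k is bounded there. Solitons and black holes differ only in the exponents and
    coefficients of one system, solved on the whole interval at once, without matching.

    The amplitude [al] is divided out of the gauge perturbations and of the momenta mu omega', so
    that it multiplies the nonlinear sources only; the mass correction is of order [al] squared.
    Hence the radius of the ball can be fixed before [al] is made small. *)

Lemma cont_plus (f g : R -> R) (x : R) :
  continuous f x -> continuous g x -> continuous (fun t => f t + g t) x.
Proof. exact (@continuous_plus _ _ _ f g x). Qed.

Lemma cont_minus (f g : R -> R) (x : R) :
  continuous f x -> continuous g x -> continuous (fun t => f t - g t) x.
Proof. exact (@continuous_minus _ _ _ f g x). Qed.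

Lemma cont_opp (f : R -> R) (x : R) :
  continuous f x -> continuous (fun t => - f t) x.
Proof. exact (@continuous_opp _ _ _ f x). Qed.

Lemma cont_mult (f g : R -> R) (x : R) :
  continuous f x -> continuous g x -> continuous (fun t => f t * g t) x.
Proof. exact (@continuous_mult _ _ f g x). Qed.

Lemma cont_pow (f : R -> R) (n : nat) (x : R) :
  continuous f x -> continuous (fun t => f t ^ n) x.
Proof.
  intros Hf; induction n as [|n IH]; simpl.
  - apply continuous_const.
  - apply cont_mult; assumption.
Qed.

Lemma cont_inv (f : R -> R) (x : R) :
  continuous f x -> f x <> 0 -> continuous (fun t => / f t) x.
Proof. exact (@continuous_Rinv_comp f x). Qed.

Lemma cont_div (f g : R -> R) (x : R) :
  continuous f x -> continuous g x -> g x <> 0 ->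
  continuous (fun t => f t / g t) x.
Proof. intros Hf Hg H; apply cont_mult; [|apply cont_inv]; assumption. Qed.

Lemma cont_sum (F : nat -> R -> R) (a b : nat) (x : R) :
  (forall j, (a <= j <= b)%nat -> continuous (F j) x) ->
  continuous (fun t => sum_n_m (fun j => F j t) a b) x.
Proof.
  destruct (Nat.le_gt_cases a b) as [Hab|Hab].
  - intros H. induction Hab as [|m Hm IH].
    + apply (continuous_ext (F a)).
      { intros t; symmetry; apply (sum_n_n (fun j => F j t)). }
      apply H; lia.
    + apply (continuous_ext (fun t => sum_n_m (fun j => F j t) a m + F (S m) t)).
      { intros t; symmetry; apply (sum_n_Sm (fun j => F j t)); lia. }
      apply cont_plus; [apply IH; intros j Hj; apply H; lia | apply H; lia].
  - intros _. apply (continuous_ext (fun _ => 0)).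
    { intros t; symmetry; apply (sum_n_m_zero (fun j => F j t)); lia. }
    apply continuous_const.
Qed.

Ltac cont1 :=
  match goal with
  | H : ?P |- ?P => exact H
  | |- continuous (fun _ => ?c) _ => apply continuous_const
  | |- continuous (fun t => t) _ => apply continuous_id
  | |- continuous (Rmult ?c) ?x => apply (cont_mult (fun _ => c) (fun t => t) x)
  | |- continuous (Rplus ?c) ?x => apply (cont_plus (fun _ => c) (fun t => t) x)
  | |- continuous (Rminus ?c) ?x => apply (cont_minus (fun _ => c) (fun t => t) x)
  | |- continuous (fun t => @?f t + @?g t) ?x => apply (cont_plus f g x)
  | |- continuous (fun t => @?f t - @?g t) ?x => apply (cont_minus f g x)
  | |- continuous (fun t => - @?f t) ?x => apply (cont_opp f x)
  | |- continuous (fun t => @?f t / @?g t) ?x => apply (cont_div f g x)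
  | |- continuous (fun t => @?f t * @?g t) ?x => apply (cont_mult f g x)
  | |- continuous (fun t => @?f t ^ ?n) ?x => apply (cont_pow f n x)
  | |- continuous (fun t => / @?f t) ?x => apply (cont_inv f x)
  | |- continuous (fun t => sum_n_m (fun j => @?F t j) ?a ?b) ?x =>
      apply (cont_sum (fun j t => F t j) a b x); intros; cbv beta
  end.
Ltac cont := repeat (cbv beta; cont1).

Ltac Rring :=
  match goal with |- @eq _ ?a ?b => change (@eq R a b) end; ring.

(** * Finite sums of real numbers *)

Lemma sumR_ext (a b : nat -> R) (n m : nat) :
  (forall j, (n <= j <= m)%nat -> a j = b j) -> sum_n_m a n m = sum_n_m b n m.
Proof. exact (sum_n_m_ext_loc a b n m). Qed.

Lemma sumR_S (a : nat -> R) (n m : nat) :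
  (n <= S m)%nat -> sum_n_m a n (S m) = sum_n_m a n m + a (S m).
Proof. exact (sum_n_Sm a n m). Qed.

Lemma sumR_empty (a : nat -> R) (n m : nat) : (m < n)%nat -> sum_n_m a n m = 0.
Proof. exact (sum_n_m_zero a n m). Qed.

Lemma sumR_scal (c : R) (a : nat -> R) (n m : nat) :
  sum_n_m (fun j => c * a j) n m = c * sum_n_m a n m.
Proof. exact (sum_n_m_mult_l c a n m). Qed.

Lemma sumR_plus (a b : nat -> R) (n m : nat) :
  sum_n_m (fun j => a j + b j) n m = sum_n_m a n m + sum_n_m b n m.
Proof. exact (sum_n_m_plus a b n m). Qed.

Lemma sumR_minus (a b : nat -> R) (n m : nat) :
  sum_n_m (fun j => a j - b j) n m = sum_n_m a n m - sum_n_m b n m.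
Proof.
  rewrite (sumR_ext _ (fun j => a j + (-1) * b j)) by (intros; ring).
  rewrite sumR_plus, sumR_scal; Rring.
Qed.

Lemma sumR_ind (P : R -> Prop) (a : nat -> R) (n m : nat) :
  P 0 -> (forall x j, (n <= j <= m)%nat -> P x -> P (x + a j)) -> P (sum_n_m a n m).
Proof.
  intros H0 HS.
  destruct (Nat.le_gt_cases n m) as [H|H].
  - revert HS; induction H as [|m Hm IH]; intros HS.
    + rewrite sum_n_n. replace (a n) with (0 + a n) by ring. apply HS; [lia|assumption].
    + rewrite sumR_S by lia. apply HS; [lia|]. apply IH. intros; apply HS; [lia|assumption].
  - rewrite sumR_empty by lia; assumption.
Qed.

Lemma sumR_zero (a : nat -> R) (n m : nat) :
  (forall j, (n <= j <= m)%nat -> a j = 0) -> sum_n_m a n m = 0.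
Proof.
  intros H. apply (sumR_ind (fun x => x = 0)); [reflexivity|].
  intros x j Hj ->; rewrite (H j Hj); ring.
Qed.

Lemma sumR_nonneg (a : nat -> R) (n m : nat) :
  (forall j, (n <= j <= m)%nat -> 0 <= a j) -> 0 <= sum_n_m a n m.
Proof.
  intros H. apply (sumR_ind (fun x => 0 <= x)); [lra|].
  intros x j Hj Hx. specialize (H j Hj); lra.
Qed.

Lemma sumR_le (a b : nat -> R) (n m : nat) :
  (forall j, (n <= j <= m)%nat -> a j <= b j) -> sum_n_m a n m <= sum_n_m b n m.
Proof.
  intros H. cut (0 <= sum_n_m (fun j => b j - a j) n m).
  { rewrite sumR_minus; lra. }
  apply sumR_nonneg; intros j Hj; specialize (H j Hj); lra.
Qed.

Lemma sumR_abs_le (a b : nat -> R) (n m : nat) :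
  (forall j, (n <= j <= m)%nat -> Rabs (a j) <= b j) ->
  Rabs (sum_n_m a n m) <= sum_n_m b n m.
Proof.
  intros H. apply Rabs_le; split.
  - replace (- sum_n_m b n m) with (sum_n_m (fun j => (-1) * b j) n m)
      by (rewrite sumR_scal; Rring).
    apply sumR_le; intros j Hj; specialize (H j Hj); apply Rabs_le_between in H; lra.
  - apply sumR_le; intros j Hj; specialize (H j Hj); apply Rabs_le_between in H; lra.
Qed.

Lemma sumR_abs_const (a : nat -> R) (K : R) (n : nat) :
  (forall j, (1 <= j <= n)%nat -> Rabs (a j) <= K) ->
  Rabs (sum_n_m a 1 n) <= INR n * K.
Proof.
  intros H. apply Rle_trans with (1 := sumR_abs_le a (fun _ => K) 1 n H).
  rewrite sum_n_m_const. replace (S n - 1)%nat with n by lia. lra.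
Qed.

Lemma sumR_term_le (a : nat -> R) (n m i : nat) :
  (forall j, (n <= j <= m)%nat -> 0 <= a j) -> (n <= i <= m)%nat ->
  a i <= sum_n_m a n m.
Proof.
  intros H Hi.
  rewrite (sum_n_m_Chasles a n (i - 1) m) by lia.
  replace (S (i - 1)) with (if Nat.eqb i 0 then S (0 - 1) else i)
    by (destruct (Nat.eqb_spec i 0); lia).
  destruct (Nat.eqb_spec i 0) as [->|Hi0].
  - destruct n; [|lia]. destruct m.
    + simpl. rewrite (sum_n_n a 0). rewrite (sumR_empty a 1 0) by lia.
      unfold plus; simpl; lra.
    + simpl. rewrite (sum_n_n a 0).
      pose proof (sumR_nonneg a 1 (S m)) as Hs. unfold plus; simpl.
      assert (0 <= sum_n_m a 1 (S m)) by (apply Hs; intros; apply H; lia). lra.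
  - rewrite (sum_Sn_m a i m) by lia. unfold plus; simpl.
    assert (0 <= sum_n_m a n (i - 1)) by (apply sumR_nonneg; intros; apply H; lia).
    assert (0 <= sum_n_m a (S i) m) by (apply sumR_nonneg; intros; apply H; lia).
    lra.
Qed.

Lemma is_derive_sum (F F' : nat -> R -> R) (a b : nat) (x : R) :
  (forall j, (a <= j <= b)%nat -> is_derive (F j) x (F' j x)) ->
  is_derive (fun t => sum_n_m (fun j => F j t) a b) x (sum_n_m (fun j => F' j x) a b).
Proof.
  destruct (Nat.le_gt_cases a b) as [Hab|Hab].
  - intros H. induction Hab as [|m Hm IH].
    + rewrite sum_n_n. apply (is_derive_ext (F a)).
      { intros t; symmetry; apply (sum_n_n (fun j => F j t)). }
      apply H; lia.
    + rewrite sumR_S by lia.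
      apply (is_derive_ext (fun t => sum_n_m (fun j => F j t) a m + F (S m) t)).
      { intros t; symmetry; apply (sum_n_Sm (fun j => F j t)); lia. }
      apply (is_derive_plus (fun t => sum_n_m (fun j => F j t) a m) (F (S m)));
        [apply IH; intros j Hj; apply H; lia | apply H; lia].
  - intros _. rewrite sumR_empty by lia. apply (is_derive_ext (fun _ => 0)).
    { intros t; symmetry; apply (sum_n_m_zero (fun j => F j t)); lia. }
    apply (is_derive_const 0).
Qed.

(** * Monotonicity and comparison of integrals *)

Lemma nonneg_derive_mono (f f' : R -> R) (a b : R) :
  a <= b -> (forall x, a <= x <= b -> continuous f x) ->
  (forall x, a < x < b -> is_derive f x (f' x)) ->
  (forall x, a < x < b -> 0 <= f' x) -> f a <= f b.
Proof.
  intros Hab Hc Hd Hp.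
  destruct Hab as [Hab| ->]; [|lra].

  (* [MVT_gen] places its point in the closed interval, but nothing is known about [f'] at the two
     ends. The default value 0 there gives [f b - f a = 0], which is harmless. *)
  destruct (MVT_gen f a b (fun x => if Rlt_dec a x then if Rlt_dec x b then f' x else 0 else 0))
    as [c [Hc1 Hc2]];
    rewrite ?Rmin_left, ?Rmax_right in * by lra.
  - intros x Hx. destruct (Rlt_dec a x); [|lra]. destruct (Rlt_dec x b); [|lra]. now apply Hd.
  - intros x Hx. apply continuity_pt_filterlim. apply (Hc x Hx).
  - destruct (Rlt_dec a c); [destruct (Rlt_dec c b)|].
    + assert (0 <= f' c) by (apply Hp; lra). nra.
    + lra.
    + lra.
Qed.

(** Comparing derivatives of [H] and of the integral avoids integrating the majorant [h]: any
    explicit primitive will do, and the majorant is needed in the open interval only. *)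
Lemma RInt_abs_le_primitive (f H h : R -> R) (s : R) :
  0 <= s -> (forall t, continuous f t) ->
  (forall t, 0 <= t <= s -> continuous H t) ->
  (forall t, 0 < t < s -> is_derive H t (h t)) ->
  (forall t, 0 < t < s -> Rabs (f t) <= h t) ->
  Rabs (RInt f 0 s) <= H s - H 0.
Proof.
  intros Hs Hf HcH HdH Hle.
  assert (Hd : forall t, is_derive (fun x => RInt f 0 x) t (f t)).
  { intros t. apply (is_derive_RInt f _ 0); [|apply Hf].
    exists (mkposreal 1 Rlt_0_1); intros y _.
    apply (RInt_correct f). apply (ex_RInt_continuous f); intros; apply Hf. }
  assert (Hc : forall t, continuous (fun x => RInt f 0 x) t).
  { intros t. apply (ex_derive_continuous (fun x => RInt f 0 x)). now exists (f t). }
  apply Rabs_le; split.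
  - assert (E : H 0 + RInt f 0 0 <= H s + RInt f 0 s).
    { apply (nonneg_derive_mono (fun t => H t + RInt f 0 t) (fun t => h t + f t)); trivial.
      - intros; apply cont_plus; auto.
      - intros x Hx. apply (is_derive_plus H (fun x => RInt f 0 x)); auto.
      - intros x Hx. specialize (Hle x Hx). apply Rabs_le_between in Hle; lra. }
    rewrite RInt_point in E. unfold zero in E; simpl in E; lra.
  - assert (E : H 0 - RInt f 0 0 <= H s - RInt f 0 s).
    { apply (nonneg_derive_mono (fun t => H t - RInt f 0 t) (fun t => h t - f t)); trivial.
      - intros; apply cont_minus; auto.
      - intros x Hx. apply (is_derive_minus H (fun x => RInt f 0 x)); auto.
      - intros x Hx. specialize (Hle x Hx). apply Rabs_le_between in Hle; lra. }
    rewrite RInt_point in E. unfold zero in E; simpl in E; lra.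
Qed.

Lemma is_derive_primitive (f : R -> R) (a t : R) :
  (forall t, continuous f t) -> is_derive (fun x => RInt f a x) t (f t).
Proof.
  intros Hf. apply (is_derive_RInt f _ a); [|apply Hf].
  exists (mkposreal 1 Rlt_0_1); intros y _.
  apply (RInt_correct f). apply (ex_RInt_continuous f); intros; apply Hf.
Qed.

(** Functions on [0, 1] are represented by functions on R that factor through [clamp]. Continuity is
    then ordinary continuity at every real number, without one-sided variants at the two ends. *)
Definition clamp (s : R) : R := Rmax 0 (Rmin s 1).

Lemma clamp_range (s : R) : 0 <= clamp s <= 1.
Proof.
  unfold clamp; split; [apply Rmax_l|].
  apply Rmax_lub; [lra|apply Rmin_r].
Qed.

Lemma clamp_id (s : R) : 0 <= s <= 1 -> clamp s = s.
Proof. intros H; unfold clamp. rewrite Rmin_left, Rmax_right; lra. Qed.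

Lemma clamp_idem (s : R) : clamp (clamp s) = clamp s.
Proof. apply clamp_id, clamp_range. Qed.

Lemma cont_clamp (s : R) : continuous clamp s.
Proof.
  apply filterlim_locally; intros eps.
  exists eps; intros y Hy. refine (Rle_lt_trans _ _ _ _ Hy).
  change (Rabs (clamp y - clamp s) <= Rabs (y - s)).
  unfold clamp, Rmax, Rmin.
  destruct (Rle_dec y 1), (Rle_dec s 1); repeat destruct (Rle_dec 0 _);
  apply Rabs_le; pose proof (Rle_abs (y - s)); pose proof (Rle_abs (- (y - s)));
  rewrite Rabs_Ropp in *; lra.
Qed.

(** * Averaging operators *)

(* [avg k f s] is the average of [f (s tau)] over [0, 1] against [tau ^ k], written without the substitution. *)
Definition avg (k : nat) (f : R -> R) (s : R) : R :=
  if Req_EM_T s 0 then f 0 / INR (S k)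
  else / s ^ S k * RInt (fun t => t ^ k * f t) 0 s.

Lemma ex_RInt_cont (f : R -> R) (a b : R) :
  (forall t, continuous f t) -> ex_RInt f a b.
Proof. intros H; apply (ex_RInt_continuous f); intros; apply H. Qed.

Lemma RInt_pow (k : nat) (s : R) : RInt (fun t => t ^ k) 0 s = s ^ S k / INR (S k).
Proof.
  assert (Hk : INR (S k) <> 0) by (apply not_0_INR; lia).
  apply is_RInt_unique.
  replace (s ^ S k / INR (S k)) with (minus (s ^ S k / INR (S k)) (0 ^ S k / INR (S k))).
  2:{ unfold minus, plus, opp; simpl. rewrite Rmult_0_l. unfold Rdiv. ring. }
  apply (is_RInt_derive (fun t => t ^ S k / INR (S k))).
  - intros x _. auto_derive; trivial. simpl pred. field. exact Hk.
  - intros x _. cont.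
Qed.

(** Only the point 0 is delicate. Subtracting [f 0] under the integral leaves an integrand of size
    |y|^k times the oscillation of [f], and the prefactor cancels the resulting |y|^(k+1). *)
Lemma avg_cont (k : nat) (f : R -> R) :
  (forall t, continuous f t) -> forall s, continuous (avg k f) s.
Proof.
  intros Hf s.
  assert (Hg : forall t, continuous (fun t => t ^ k * f t) t) by (intros; cont; apply Hf).
  destruct (Req_EM_T s 0) as [->|Hs].
  - apply filterlim_locally; intros eps.
    assert (Hk : 0 < INR (S k)) by (apply lt_0_INR; lia).
    assert (Hk1 : 1 <= INR (S k)) by (rewrite S_INR; pose proof (pos_INR k); lra).
    destruct (proj1 (filterlim_locally _ _) (Hf 0) (pos_div_2 eps)) as [d Hd].
    exists d. intros y Hy. change (Rabs (avg k f y - avg k f 0) < eps).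
    unfold avg at 2. destruct (Req_EM_T 0 0) as [_|]; [|lra].
    unfold avg. destruct (Req_EM_T y 0) as [->|Hy0].
    { rewrite Rminus_eq_0, Rabs_R0; apply eps. }
    assert (Hyk : y ^ S k <> 0) by (apply pow_nonzero; exact Hy0).
    replace (/ y ^ S k * RInt (fun t => t ^ k * f t) 0 y - f 0 / INR (S k))
      with (/ y ^ S k * RInt (fun t => t ^ k * (f t - f 0)) 0 y).
    2:{ replace (f 0 / INR (S k)) with (/ y ^ S k * (f 0 * RInt (fun t => t ^ k) 0 y)).
        2:{ rewrite RInt_pow. field. split; [lra| exact Hyk]. }
        rewrite <- Rmult_minus_distr_l. f_equal.
        rewrite <- (RInt_scal (fun t => t ^ k)) by (apply ex_RInt_cont; intros; cont).
        rewrite <- (RInt_minus (fun t => t ^ k * f t)).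
        - apply RInt_ext; intros; unfold minus, plus, opp, scal; simpl; unfold mult; simpl; ring.
        - apply ex_RInt_cont, Hg.
        - apply (@ex_RInt_scal R_NormedModule). apply ex_RInt_cont; intros; cont. }
    rewrite Rabs_mult, Rabs_inv.
    assert (B : Rabs (RInt (fun t => t ^ k * (f t - f 0)) 0 y) <= Rabs y ^ S k * (eps / 2)).
    { pose proof (norm_RInt_le_const_abs (fun t => t ^ k * (f t - f 0)) 0 y
        (RInt (fun t => t ^ k * (f t - f 0)) 0 y) (Rabs y ^ k * (eps / 2))) as N.
      replace (Rabs y ^ S k * (eps / 2)) with (Rabs (y - 0) * (Rabs y ^ k * (eps / 2)))
        by (rewrite Rminus_0_r; simpl; ring).
      apply N.
      - intros x Hx. change (Rabs (x ^ k * (f x - f 0)) <= Rabs y ^ k * (eps / 2)).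
        assert (Hxy : Rabs x <= Rabs y).
        { unfold Rmin, Rmax in Hx. destruct (Rle_dec 0 y);
          [rewrite !Rabs_pos_eq by lra; lra|rewrite (Rabs_left1 x), (Rabs_left1 y) by lra; lra]. }
        rewrite Rabs_mult, <- RPow_abs. apply Rmult_le_compat.
        + apply pow_le, Rabs_pos.
        + apply Rabs_pos.
        + apply pow_incr; split; [apply Rabs_pos|exact Hxy].
        + left. apply (Hd x). change (Rabs (x - 0) < d). rewrite Rminus_0_r.
          refine (Rle_lt_trans _ _ _ Hxy _). change (Rabs (y - 0) < d) in Hy.
          rewrite Rminus_0_r in Hy; exact Hy.
      - apply (RInt_correct (fun t => t ^ k * (f t - f 0))). apply ex_RInt_cont; intros; cont; apply Hf. }
    assert (Hp : 0 < Rabs y ^ S k) by (apply pow_lt, Rabs_pos_lt; exact Hy0).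
    rewrite <- RPow_abs.
    apply Rle_lt_trans with (/ Rabs y ^ S k * (Rabs y ^ S k * (eps / 2))).
    { apply Rmult_le_compat_l; [left; apply Rinv_0_lt_compat; exact Hp|exact B]. }
    rewrite <- Rmult_assoc, Rinv_l, Rmult_1_l by lra. destruct eps; simpl; lra.
  - apply (continuous_ext_loc _ (fun s => / s ^ S k * RInt (fun t => t ^ k * f t) 0 s)).
    + assert (Hp : 0 < Rabs s) by (apply Rabs_pos_lt; exact Hs).
      exists (mkposreal _ Hp). intros y Hy. change (Rabs (y - s) < Rabs s) in Hy.
      unfold avg. destruct (Req_EM_T y 0) as [->|]; [|reflexivity].
      rewrite Rminus_0_l, Rabs_Ropp in Hy. lra.
    + apply cont_mult.
      * apply cont_inv; [cont|]. apply pow_nonzero, Hs.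
      * apply (ex_derive_continuous (fun s => RInt (fun t => t ^ k * f t) 0 s)).
        exists (s ^ k * f s). apply (is_derive_primitive (fun t => t ^ k * f t) 0 s Hg).
Qed.

Lemma avg_pow (k : nat) (f : R -> R) (s : R) :
  s ^ S k * avg k f s = RInt (fun t => t ^ k * f t) 0 s.
Proof.
  unfold avg. destruct (Req_EM_T s 0) as [->|Hs].
  - rewrite RInt_point. unfold zero; simpl; ring.
  - rewrite <- Rmult_assoc, Rinv_r, Rmult_1_l; [reflexivity|apply pow_nonzero, Hs].
Qed.

(** This turns a fixed point of an integral system back into a solution of differential equations:
    an average carried by [s ^ S k] has derivative [s ^ k] times its source. *)
Lemma avg_derive (k : nat) (f : R -> R) (s : R) :
  (forall t, continuous f t) ->
  is_derive (fun s => s ^ S k * avg k f s) s (s ^ k * f s).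
Proof.
  intros Hf. apply (is_derive_ext (fun s => RInt (fun t => t ^ k * f t) 0 s)).
  { intros t; symmetry; apply avg_pow. }
  apply (is_derive_primitive (fun t => t ^ k * f t)). intros; cont; apply Hf.
Qed.

Lemma avg_minus (k : nat) (f g : R -> R) (s : R) :
  (forall t, continuous f t) -> (forall t, continuous g t) ->
  avg k f s - avg k g s = avg k (fun t => f t - g t) s.
Proof.
  intros Hf Hg. unfold avg. destruct (Req_EM_T s 0) as [->|Hs].
  { unfold Rdiv; ring. }
  rewrite <- Rmult_minus_distr_l. f_equal.
  rewrite <- (RInt_minus (fun t => t ^ k * f t) (fun t => t ^ k * g t))
    by (apply ex_RInt_cont; intros; cont; auto).
  apply RInt_ext; intros; unfold minus, plus, opp; simpl; ring.
Qed.

Lemma avg_plus (k : nat) (f g : R -> R) (s : R) :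
  (forall t, continuous f t) -> (forall t, continuous g t) ->
  avg k (fun t => f t + g t) s = avg k f s + avg k g s.
Proof.
  intros Hf Hg.
  rewrite <- (Rplus_minus (avg k f s) (avg k (fun t => f t + g t) s)).
  rewrite avg_minus by (intros; cont; auto). f_equal.
  f_equal. apply functional_extensionality; intros; ring.
Qed.

Lemma avg_scal (k : nat) (c : R) (f : R -> R) (s : R) :
  (forall t, continuous f t) ->
  avg k (fun t => c * f t) s = c * avg k f s.
Proof.
  intros Hf. unfold avg. destruct (Req_EM_T s 0) as [->|Hs].
  { unfold Rdiv; ring. }
  rewrite (RInt_ext _ (fun t => scal c (t ^ k * f t)))
    by (intros; unfold scal; simpl; unfold mult; simpl; ring).
  rewrite (RInt_scal (fun t => t ^ k * f t)) by (apply ex_RInt_cont; intros; cont; auto).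
  unfold scal; simpl; unfold mult; simpl; ring.
Qed.

Lemma avg_zero (k : nat) (s : R) : avg k (fun _ => 0) s = 0.
Proof.
  transitivity (avg k (fun _ => 0 * 0) s); [now rewrite Rmult_0_l|].
  rewrite (avg_scal k 0 (fun _ => 0)) by (intros; apply continuous_const). ring.
Qed.

(** The sharp contraction estimates reduce to this: exhibit a primitive [H] of a majorant of the
    integrand and compare it with the target [v]. The exponent [e] allows for a power of [s] kept in
    front of the average. *)
Lemma avg_bound (k e : nat) (f v H h : R -> R) (s : R) :
  0 < s -> (forall t, continuous f t) ->
  (forall t, 0 <= t <= s -> continuous H t) ->
  (forall t, 0 < t < s -> is_derive H t (h t)) ->
  (forall t, 0 < t < s -> t ^ k * Rabs (f t) <= h t) ->
  s ^ e * (H s - H 0) <= s ^ S k * v s ->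
  Rabs (s ^ e * avg k f s) <= v s.
Proof.
  intros Hs Hf HcH HdH Hle Hv.
  assert (Hp : 0 < s ^ S k) by (apply pow_lt, Hs).
  assert (He : 0 < s ^ e) by (apply pow_lt, Hs).
  apply Rmult_le_reg_l with (1 := Hp).
  replace (s ^ S k * Rabs (s ^ e * avg k f s))
    with (s ^ e * Rabs (RInt (fun t => t ^ k * f t) 0 s)).
  2:{ rewrite <- avg_pow. rewrite !Rabs_mult, (Rabs_pos_eq (s ^ S k)), (Rabs_pos_eq (s ^ e)) by lra. ring. }
  refine (Rle_trans _ _ _ _ Hv). apply Rmult_le_compat_l; [lra|].
  apply (RInt_abs_le_primitive (fun t => t ^ k * f t) H h s); trivial; [lra| |].
  - intros; cont; apply Hf.
  - intros t Ht. rewrite Rabs_mult, (Rabs_pos_eq (t ^ k)) by (apply pow_le; lra). auto.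
Qed.

Lemma cont_le_limit (f g : R -> R) (a b x : R) :
  a < b -> a <= x <= b -> (forall t, a <= t <= b -> continuous f t) ->
  (forall t, a <= t <= b -> continuous g t) ->
  (forall t, a < t < b -> f t <= g t) -> f x <= g x.
Proof.
  intros Hab Hx Hf Hg H.
  destruct (Rle_or_lt (f x) (g x)) as [|Hlt]; [assumption|exfalso].
  assert (Hc : continuous (fun t => f t - g t) x) by (apply cont_minus; auto).
  assert (He : 0 < f x - g x) by lra.
  destruct (proj1 (filterlim_locally _ _) Hc (mkposreal _ He)) as [d Hd].
  assert (Hdp := cond_pos d).
  (* A point close to [x], taken towards the farther end of the interval so that it stays strictly
     inside. *)
  set (y := if Rle_dec x ((a + b) / 2) then x + Rmin (d / 2) ((b - a) / 4)
            else x - Rmin (d / 2) ((b - a) / 4)).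
  assert (Hm : 0 < Rmin (d / 2) ((b - a) / 4)) by (apply Rmin_pos; lra).
  pose proof (Rmin_l (d / 2) ((b - a) / 4)). pose proof (Rmin_r (d / 2) ((b - a) / 4)).
  assert (Hy : a < y < b) by (unfold y; destruct (Rle_dec _ _); lra).
  assert (Hyx : Rabs (y - x) < d).
  { unfold y; destruct (Rle_dec _ _); apply Rabs_def1; lra. }
  specialize (Hd y Hyx). change (Rabs (f y - g y - (f x - g x)) < f x - g x) in Hd.
  apply Rabs_def2 in Hd. specialize (H y Hy). lra.
Qed.

(** * A contraction principle in weighted norms *)

Lemma pow_small (th K eps : R) :
  0 <= th < 1 -> 0 < eps -> exists n, K * th ^ n < eps.
Proof.
  intros Hth He.
  destruct (Rle_or_lt K 0) as [HK|HK].
  { exists 0%nat; simpl; lra. }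
  assert (Hk : 0 < eps / K) by (apply Rdiv_lt_0_compat; lra).
  destruct (pow_lt_1_zero th) with (y := eps / K) as [n Hn].
  { rewrite Rabs_pos_eq; lra. } { exact Hk. }
  exists n. specialize (Hn n (Nat.le_refl n)).
  rewrite Rabs_pos_eq in Hn by (apply pow_le; lra).
  apply Rmult_lt_compat_l with (r := K) in Hn; [|lra].
  replace (K * (eps / K)) with eps in Hn by (field; lra). exact Hn.
Qed.

(** Banach's theorem without a metric space. The weighted distance is replaced by its admissible
    bounds [d], so that no supremum has to exist; limits are taken pointwise and the weighted
    estimates are passed to them. Closedness of [P] is required under weighted uniform
    approximation. *)
Lemma weighted_contraction_fixed_point (I : Type) (Wt : I -> R)
    (P : (I -> R) -> Prop) (T : (I -> R) -> I -> R) (th : R) (f0 : I -> R) :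
  0 <= th < 1 -> (forall i, 0 <= Wt i) -> P f0 -> (forall f, P f -> P (T f)) ->
  (forall f g d, 0 <= d -> P f -> P g -> (forall i, Rabs (f i - g i) <= d * Wt i) ->
     forall i, Rabs (T f i - T g i) <= th * d * Wt i) ->
  (forall (fn : nat -> I -> R) f, (forall n, P (fn n)) ->
     (forall eps, 0 < eps -> exists n, forall i, Rabs (fn n i - f i) <= eps * Wt i) -> P f) ->
  (exists D, 0 <= D /\ forall i, Rabs (T f0 i - f0 i) <= D * Wt i) ->
  exists f, P f /\ forall i, T f i = f i.
Proof.
  intros Hth HW P0 PT HT Hcl [D [HD HD0]].
  set (fn := fun n => Nat.iter n T f0).
  assert (Pn : forall n, P (fn n)) by (induction n; simpl; auto).
  assert (Hstep : forall n i, Rabs (fn (S n) i - fn n i) <= th ^ n * D * Wt i).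
  { induction n as [|n IH]; intros i; simpl pow.
    - rewrite Rmult_1_l. apply HD0.
    - rewrite Rmult_assoc with (r1 := th). apply (HT (fn (S n)) (fn n)); auto.
      apply Rmult_le_pos; [apply pow_le|]; lra. }
  (* The sum of the geometric series of the steps. Writing [D] as (1 - th) K makes the bound on
     partial sums telescope to th^n - th^(n+k). *)
  set (K := D / (1 - th)).
  assert (HK : 0 <= K).
  { unfold K, Rdiv. apply Rmult_le_pos; [lra|]. left; apply Rinv_0_lt_compat; lra. }
  assert (HKD : D = K - th * K) by (unfold K; field; lra).
  assert (Hcau : forall n k i, Rabs (fn (n + k)%nat i - fn n i) <= (th ^ n - th ^ (n + k)) * K * Wt i).
  { intros n k i; induction k as [|k IH].
    - rewrite Nat.add_0_r, !Rminus_eq_0, Rabs_R0. lra.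
    - rewrite <- plus_n_Sm.
      replace (fn (S (n + k)) i - fn n i)
        with ((fn (S (n + k)) i - fn (n + k)%nat i) + (fn (n + k)%nat i - fn n i)) by ring.
      apply Rle_trans with (1 := Rabs_triang _ _).
      specialize (Hstep (n + k)%nat i).
      replace (th ^ S (n + k)) with (th * th ^ (n + k)) by reflexivity.
      rewrite HKD in Hstep. nra. }
  assert (Hcau' : forall n m i, (n <= m)%nat -> Rabs (fn m i - fn n i) <= K * th ^ n * Wt i).
  { intros n m i Hnm. replace m with (n + (m - n))%nat by lia.
    apply Rle_trans with (1 := Hcau n (m - n)%nat i).
    apply Rmult_le_compat_r; [apply HW|].
    assert (0 <= th ^ (n + (m - n))) by (apply pow_le; lra). nra. }
  assert (Hlim : forall i, is_lim_seq (fun n => fn n i) (real (Lim_seq (fun n => fn n i)))).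
  { intros i. apply Lim_seq_correct'. apply ex_lim_seq_cauchy_corr.
    intros eps. destruct (pow_small th (2 * K * Wt i) eps Hth (cond_pos eps)) as [n0 Hn0].
    exists n0. intros n m Hn Hm.
    replace (fn n i - fn m i) with ((fn n i - fn n0 i) - (fn m i - fn n0 i)) by ring.
    apply Rle_lt_trans with (1 := Rabs_triang _ _). rewrite Rabs_Ropp.
    pose proof (Hcau' n0 n i Hn). pose proof (Hcau' n0 m i Hm). lra. }
  set (f := fun i => real (Lim_seq (fun n => fn n i))).
  assert (Hconv : forall n i, Rabs (fn n i - f i) <= K * th ^ n * Wt i).
  { intros n i. rewrite Rabs_minus_sym.
    pose proof (is_lim_seq_le_loc (fun m => Rabs (fn m i - fn n i)) (fun _ => K * th ^ n * Wt i)
      (Finite (Rabs (f i - fn n i))) (Finite (K * th ^ n * Wt i))) as L. simpl in L. apply L.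
    - exists n. intros m Hm. apply Hcau', Hm.
    - apply (is_lim_seq_abs (fun m => fn m i - fn n i) (Finite (f i - fn n i))).
      apply is_lim_seq_minus'; [apply Hlim|apply is_lim_seq_const].
    - apply is_lim_seq_const. }
  assert (Pf : P f).
  { apply (Hcl fn f Pn). intros eps He.
    destruct (pow_small th K eps Hth He) as [n Hn]. exists n. intros i.
    apply Rle_trans with (1 := Hconv n i). apply Rmult_le_compat_r; [apply HW|lra]. }
  exists f; split; [exact Pf|]. intros i.
  apply Rminus_diag_uniq, Rabs_eq_0, Rle_antisym; [|apply Rabs_pos].
  apply le_epsilon; intros eps He.
  destruct (pow_small th (2 * K * Wt i) eps Hth He) as [n Hn].
  assert (Hn1 := Hconv (S n) i).
  assert (H1 : Rabs (T f i - T (fn n) i) <= th * (K * th ^ n) * Wt i).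
  { apply HT; auto.
    - apply Rmult_le_pos; [exact HK|apply pow_le; lra].
    - intros k; rewrite Rabs_minus_sym; apply Hconv. }
  replace (T f i - f i) with ((T f i - T (fn n) i) + (fn (S n) i - f i)) by (simpl; ring).
  apply Rle_trans with (1 := Rabs_triang _ _).
  assert (E : th * (K * th ^ n) * Wt i <= K * th ^ n * Wt i).
  { apply Rmult_le_compat_r; [apply HW|].
    assert (0 <= K * th ^ n) by (apply Rmult_le_pos; [exact HK|apply pow_le; lra]). nra. }
  assert (E2 : K * th ^ S n * Wt i <= K * th ^ n * Wt i).
  { apply Rmult_le_compat_r; [apply HW|]. apply Rmult_le_compat_l; [exact HK|].
    simpl. assert (0 <= th ^ n) by (apply pow_le; lra). nra. }
  lra.
Qed.

Lemma uniform_limit_cont (f : R -> R) (x : R) :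
  (forall eps, 0 < eps -> exists g, continuous g x /\ forall y, Rabs (g y - f y) <= eps) ->
  continuous f x.
Proof.
  intros H. apply filterlim_locally; intros eps.
  assert (He : 0 < eps / 4) by (destruct eps; simpl; lra).
  destruct (H _ He) as [g [Hg Hgf]].
  destruct (proj1 (filterlim_locally _ _) Hg (mkposreal _ He)) as [d Hd].
  exists d; intros y Hy. specialize (Hd y Hy).
  change (Rabs (g y - g x) < eps / 4) in Hd. change (Rabs (f y - f x) < eps).
  pose proof (Hgf x). pose proof (Hgf y).
  apply Rabs_def2 in Hd. apply Rabs_le_between in H0. apply Rabs_le_between in H1.
  apply Rabs_def1; lra.
Qed.

(** * Singular integral systems with a small nonlinear part *)

Section AbstractSystem.

Variables (I : Type) (act : I -> bool) (wc : I -> R) (w : R -> R) (wcm wm : R)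
  (e k : I -> nat) (lin : I -> (I -> R -> R) -> R -> R) (d : I -> R -> R) (th D : R).

(** Weight zero on inactive components forces them to vanish in the ball, so index ranges need no
    separate bookkeeping there. *)
Definition wgt (c : I) (s : R) : R := if act c then wc c * w (clamp s) else 0.

Definition in_ball (C : R) (f : I -> R -> R) : Prop :=
  (forall c s, continuous (f c) s) /\
  (forall c s, f c s = f c (clamp s)) /\
  (forall c s, Rabs (f c s) <= C * wgt c s).

Definition near (r : R) (f g : I -> R -> R) : Prop :=
  forall c s, Rabs (f c s - g c s) <= r * wgt c s.

(* [nice] is stable under algebraic operations, so that sources need no estimate by hand. The factor [w] in the Lipschitz bound is what makes the averages contract. *)
Definition nice (C al0 : R) (A : Type) (F : A -> R -> (I -> R -> R) -> R -> R) : Prop :=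
  exists K, 0 <= K /\ forall i al, Rabs al <= al0 ->
    (forall f, in_ball C f ->
       (forall s, continuous (F i al f) s) /\
       (forall s, F i al f s = F i al f (clamp s)) /\
       (forall s, Rabs (F i al f s) <= K)) /\
    (forall f g r, in_ball C f -> in_ball C g -> 0 <= r -> near r f g ->
       forall s, Rabs (F i al f s - F i al g s) <= K * r * w (clamp s)).

Hypothesis w_cont : forall s, continuous w s.
Hypothesis w_mono : forall s t, 0 <= s -> s <= t -> t <= 1 -> w s <= w t.
Hypothesis w_nonneg : forall s, 0 <= s <= 1 -> 0 <= w s.
Hypothesis w_le : forall s, 0 <= s <= 1 -> w s <= wm.
Hypothesis wc_ge : forall c, act c = true -> 1 <= wc c <= wcm.
Hypothesis th_range : 0 <= th < 1.
Hypothesis D_nonneg : 0 <= D.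
Hypothesis lin_cont : forall c f, (forall c s, continuous (f c) s) ->
  forall s, continuous (lin c f) s.
Hypothesis lin_minus : forall c f g s,
  lin c f s - lin c g s = lin c (fun c s => f c s - g c s) s.
Hypothesis lin_contract : forall f r, 0 <= r -> (forall c s, continuous (f c) s) ->
  (forall c s, 0 <= s <= 1 -> Rabs (f c s) <= r * wgt c s) ->
  forall c s, act c = true -> 0 < s < 1 ->
  Rabs (s ^ e c * avg (k c) (lin c f) s) <= th * r * wc c * w s.
Hypothesis d_cont : forall c s, act c = true -> continuous (d c) s.
Hypothesis d_bound : forall c s, act c = true -> 0 < s < 1 ->
  Rabs (s ^ e c * avg (k c) (d c) s) <= D * wc c * w s.

Lemma wgt_nonneg c s : 0 <= wgt c s.
Proof.
  unfold wgt. pose proof (wc_ge c). destruct (act c); [|lra].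
  apply Rmult_le_pos; [specialize (H eq_refl); lra|]. apply w_nonneg, clamp_range.
Qed.

Lemma wgt_clamp c s : wgt c (clamp s) = wgt c s.
Proof. unfold wgt; now rewrite clamp_idem. Qed.

Lemma wm_nonneg : 0 <= wm.
Proof. apply Rle_trans with (w 0); [apply w_nonneg|apply w_le]; lra. Qed.

(** An increasing weight can be evaluated at the end point and taken out of the average. The
    remaining factor 1/(n+1) is given away, which is affordable for everything but the sharp linear
    estimates of the soliton. *)
Lemma avg_weight_bound (f : R -> R) (K s : R) (n : nat) :
  0 <= K -> (forall t, continuous f t) -> 0 < s < 1 ->
  (forall t, 0 < t < s -> Rabs (f t) <= K * w t) ->
  Rabs (s ^ 0 * avg n f s) <= K * w s.
Proof.
  intros HK Hf Hs Hb.
  assert (Hn : 0 < INR (S n)) by (apply lt_0_INR; lia).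
  apply (avg_bound n 0 f (fun s => K * w s) (fun t => K * w s * (t ^ S n / INR (S n)))
    (fun t => K * w s * t ^ n)); try lra; trivial.
  - intros; cont; apply Rgt_not_eq, Hn.
  - intros t Ht. auto_derive; trivial.
    change (Init.Nat.pred (S n)) with n. field. apply Rgt_not_eq, Hn.
  - intros t Ht. rewrite Rmult_comm. apply Rmult_le_compat_r; [apply pow_le; lra|].
    apply Rle_trans with (1 := Hb t Ht). apply Rmult_le_compat_l; [exact HK|].
    apply w_mono; lra.
  - assert (Hp : 0 <= s ^ S n) by (apply pow_le; lra).
    assert (Hw : 0 <= K * w s) by (apply Rmult_le_pos; [lra|apply w_nonneg; lra]).
    replace (0 ^ S n) with 0 by (simpl; ring). simpl pow at 1.
    assert (s ^ S n / INR (S n) <= s ^ S n).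
    { apply Rmult_le_reg_r with (1 := Hn). unfold Rdiv. rewrite Rmult_assoc, Rinv_l by lra.
      assert (1 <= INR (S n)) by (rewrite S_INR; pose proof (pos_INR n); lra). nra. }
    unfold Rdiv at 2. rewrite Rmult_0_l, Rmult_0_r, Rminus_0_r, Rmult_1_l. nra.
Qed.

Section NiceCalculus.

Variables (C al0 : R) (C_nonneg : 0 <= C) (al0_nonneg : 0 <= al0).

Lemma nice_fun (A : Type) (g : A -> R -> R) (K : R) :
  (forall i s, continuous (g i) s) -> (forall i s, g i s = g i (clamp s)) ->
  (forall i s, Rabs (g i s) <= K) -> nice C al0 A (fun i _ _ s => g i s).
Proof.
  intros H1 H2 H3. exists (Rabs K). split; [apply Rabs_pos|]. intros i al _. split.
  - intros f _. repeat split; auto. intros s; apply Rle_trans with (1 := H3 i s), Rle_abs.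
  - intros f g' r _ _ Hr _ s. rewrite Rminus_eq_0, Rabs_R0.
    apply Rmult_le_pos; [apply Rmult_le_pos; [apply Rabs_pos|exact Hr]|].
    apply w_nonneg, clamp_range.
Qed.

Lemma nice_amp (A : Type) : nice C al0 A (fun _ al _ _ => al).
Proof.
  exists al0. split; [exact al0_nonneg|]. intros i al Hal. split.
  - intros f _. repeat split; auto. intros s; apply continuous_const.
  - intros f g' r _ _ Hr _ s. rewrite Rminus_eq_0, Rabs_R0.
    apply Rmult_le_pos; [apply Rmult_le_pos; [exact al0_nonneg|exact Hr]|].
    apply w_nonneg, clamp_range.
Qed.

Lemma wgt_le_w c s : wgt c s <= Rabs wcm * w (clamp s).
Proof.
  unfold wgt. pose proof (wc_ge c). pose proof (w_nonneg _ (clamp_range s)).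
  pose proof (Rle_abs wcm). pose proof (Rabs_pos wcm).
  destruct (act c); [apply Rmult_le_compat_r; [trivial|specialize (H eq_refl); lra]|].
  apply Rmult_le_pos; trivial.
Qed.

Lemma nice_coord (A : Type) (g : A -> I) : nice C al0 A (fun i _ f s => f (g i) s).
Proof.
  pose proof wm_nonneg as Hwm. pose proof (Rabs_pos wcm) as Hwc.
  exists (Rabs wcm * (C * wm + 1)). split; [apply Rmult_le_pos; nra|].
  intros i al _. split.
  - intros f [Hf1 [Hf2 Hf3]]. repeat split; auto.
    intros s. apply Rle_trans with (1 := Hf3 (g i) s).
    apply Rle_trans with (C * (Rabs wcm * wm)); [|nra].
    apply Rmult_le_compat_l; [exact C_nonneg|]. apply Rle_trans with (1 := wgt_le_w _ _).
    apply Rmult_le_compat_l; [exact Hwc|apply w_le, clamp_range].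
  - intros f f' r _ _ Hr H s. apply Rle_trans with (1 := H (g i) s).
    pose proof (wgt_le_w (g i) s). pose proof (w_nonneg _ (clamp_range s)).
    assert (0 <= C * wm) by (apply Rmult_le_pos; lra).
    apply Rle_trans with (r * (Rabs wcm * w (clamp s))).
    + apply Rmult_le_compat_l; trivial.
    + replace (Rabs wcm * (C * wm + 1) * r * w (clamp s))
        with ((C * wm + 1) * (r * (Rabs wcm * w (clamp s)))) by ring.
      assert (0 <= r * (Rabs wcm * w (clamp s))) by (repeat apply Rmult_le_pos; trivial). nra.
Qed.

Lemma nice_plus (A : Type) (F G : A -> R -> (I -> R -> R) -> R -> R) :
  nice C al0 A F -> nice C al0 A G -> nice C al0 A (fun i al f s => F i al f s + G i al f s).
Proof.
  intros [K [HK H]] [K' [HK' H']]. exists (K + K'); split; [lra|].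
  intros i al Hal. destruct (H i al Hal) as [H1 H2]. destruct (H' i al Hal) as [H1' H2'].
  split.
  - intros f Hf. destruct (H1 f Hf) as [A1 [A2 A3]]. destruct (H1' f Hf) as [B1 [B2 B3]].
    split; [|split].
    + intros s; apply cont_plus; auto.
    + intros s; rewrite <- A2, <- B2; reflexivity.
    + intros s; apply Rle_trans with (1 := Rabs_triang _ _). apply Rplus_le_compat; auto.
  - intros f g r Hf Hg Hr Hn s.
    replace (F i al f s + G i al f s - (F i al g s + G i al g s))
      with ((F i al f s - F i al g s) + (G i al f s - G i al g s)) by ring.
    apply Rle_trans with (1 := Rabs_triang _ _).
    pose proof (H2 f g r Hf Hg Hr Hn s). pose proof (H2' f g r Hf Hg Hr Hn s). lra.
Qed.

Lemma nice_mult (A : Type) (F G : A -> R -> (I -> R -> R) -> R -> R) :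
  nice C al0 A F -> nice C al0 A G -> nice C al0 A (fun i al f s => F i al f s * G i al f s).
Proof.
  intros [K [HK H]] [K' [HK' H']]. exists (2 * (K * K')); split; [nra|].
  intros i al Hal. destruct (H i al Hal) as [H1 H2]. destruct (H' i al Hal) as [H1' H2'].
  split.
  - intros f Hf. destruct (H1 f Hf) as [A1 [A2 A3]]. destruct (H1' f Hf) as [B1 [B2 B3]].
    split; [|split].
    + intros s; apply cont_mult; auto.
    + intros s; rewrite <- A2, <- B2; reflexivity.
    + intros s. rewrite Rabs_mult. apply Rle_trans with (K * K'); [|nra].
      apply Rmult_le_compat; auto; apply Rabs_pos.
  - intros f g r Hf Hg Hr Hn s.
    replace (F i al f s * G i al f s - F i al g s * G i al g s)
      with ((F i al f s - F i al g s) * G i al f s + F i al g s * (G i al f s - G i al g s)) by ring.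
    apply Rle_trans with (1 := Rabs_triang _ _). rewrite !Rabs_mult.
    pose proof (H2 f g r Hf Hg Hr Hn s) as E1. pose proof (H2' f g r Hf Hg Hr Hn s) as E2.
    destruct (H1 g Hg) as [_ [_ A3]]. destruct (H1' f Hf) as [_ [_ B3]].
    apply Rle_trans with (K * r * w (clamp s) * K' + K * (K' * r * w (clamp s))).
    + apply Rplus_le_compat; apply Rmult_le_compat; auto; apply Rabs_pos.
    + right; ring.
Qed.

Lemma nice_num (A : Type) (x : R) : nice C al0 A (fun _ _ _ _ => x).
Proof.
  apply (nice_fun A (fun _ _ => x) (Rabs x)); intros; [apply continuous_const|reflexivity|lra].
Qed.

Lemma nice_opp (A : Type) (F : A -> R -> (I -> R -> R) -> R -> R) :
  nice C al0 A F -> nice C al0 A (fun i al f s => - F i al f s).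
Proof.
  intros [K [HK H]]. exists K; split; [exact HK|].
  intros i al Hal. destruct (H i al Hal) as [H1 H2]. split.
  - intros f Hf. destruct (H1 f Hf) as [A1 [A2 A3]]. split; [|split].
    + intros s; apply cont_opp; auto.
    + intros s; rewrite <- A2; reflexivity.
    + intros s; rewrite Rabs_Ropp; auto.
  - intros f g r Hf Hg Hr Hn s.
    replace (- F i al f s - - F i al g s) with (- (F i al f s - F i al g s)) by ring.
    rewrite Rabs_Ropp; auto.
Qed.

Lemma nice_minus (A : Type) (F G : A -> R -> (I -> R -> R) -> R -> R) :
  nice C al0 A F -> nice C al0 A G -> nice C al0 A (fun i al f s => F i al f s - G i al f s).
Proof. intros HF HG. apply (nice_plus A F (fun i al f s => - G i al f s)); [|apply nice_opp]; trivial. Qed.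

Lemma nice_sq (A : Type) (F : A -> R -> (I -> R -> R) -> R -> R) :
  nice C al0 A F -> nice C al0 A (fun i al f s => F i al f s ^ 2).
Proof.
  intros HF. apply (nice_mult A F (fun i al f s => F i al f s * 1)); [exact HF|].
  apply (nice_mult A F (fun _ _ _ _ => 1)); [exact HF|apply nice_num].
Qed.

Lemma nice_inv (A : Type) (F : A -> R -> (I -> R -> R) -> R -> R) (c : R) :
  0 < c -> (forall i al f s, Rabs al <= al0 -> in_ball C f -> c <= F i al f s) ->
  nice C al0 A F -> nice C al0 A (fun i al f s => / F i al f s).
Proof.
  intros Hc Hlow [K [HK H]].
  assert (Hci : 0 < / c) by (apply Rinv_0_lt_compat, Hc).
  exists (/ c + K * (/ c * / c)); split; [assert (0 <= K * (/ c * / c)) by (apply Rmult_le_pos; nra); lra|].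
  intros i al Hal. destruct (H i al Hal) as [H1 H2].
  assert (Hi : forall f s, in_ball C f -> 0 < / F i al f s <= / c).
  { intros f s Hf. specialize (Hlow i al f s Hal Hf). split.
    - apply Rinv_0_lt_compat; lra.
    - apply Rinv_le_contravar; lra. }
  assert (HKc : 0 <= K * (/ c * / c)) by (apply Rmult_le_pos; nra).
  split.
  - intros f Hf. destruct (H1 f Hf) as [A1 [A2 A3]]. split; [|split].
    + intros s; apply cont_inv; auto. specialize (Hlow i al f s Hal Hf). lra.
    + intros s; rewrite <- A2; reflexivity.
    + intros s. specialize (Hi f s Hf). rewrite Rabs_pos_eq by lra. lra.
  - intros f g r Hf Hg Hr Hn s.
    pose proof (Hlow i al f s Hal Hf). pose proof (Hlow i al g s Hal Hg).
    replace (/ F i al f s - / F i al g s)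
      with (- (F i al f s - F i al g s) * (/ F i al f s * / F i al g s)) by (field; lra).
    rewrite Rabs_mult, Rabs_Ropp.
    pose proof (Hi f s Hf). pose proof (Hi g s Hg).
    rewrite (Rabs_pos_eq (_ * _)) by (apply Rmult_le_pos; lra).
    apply Rle_trans with (K * r * w (clamp s) * (/ c * / c)).
    + apply Rmult_le_compat; auto; [apply Rabs_pos|apply Rmult_le_pos; lra|].
      apply Rmult_le_compat; lra.
    + replace (K * r * w (clamp s) * (/ c * / c)) with (K * (/ c * / c) * (r * w (clamp s))) by ring.
      rewrite !Rmult_assoc with (r3 := w (clamp s)).
      apply Rmult_le_compat_r; [|lra]. apply Rmult_le_pos; [exact Hr|apply w_nonneg, clamp_range].
Qed.

Lemma nice_sum (A : Type) (F : A -> nat -> R -> (I -> R -> R) -> R -> R) (m : nat) :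
  nice C al0 (A * nat) (fun p => F (fst p) (snd p)) ->
  nice C al0 A (fun i al f s => sum_n_m (fun j => F i j al f s) 1 m).
Proof.
  intros [K [HK H]]. exists (INR m * K); split; [apply Rmult_le_pos; [apply pos_INR|exact HK]|].
  intros i al Hal. split.
  - intros f Hf. split; [|split].
    + intros s. apply (cont_sum (fun j => F i j al f)). intros j _.
      apply (proj1 (H (i, j) al Hal) f Hf).
    + intros s. apply sumR_ext. intros j _. apply (proj1 (H (i, j) al Hal) f Hf).
    + intros s. apply sumR_abs_const. intros j _. apply (proj1 (H (i, j) al Hal) f Hf).
  - intros f g r Hf Hg Hr Hn s. rewrite <- sumR_minus.
    replace (INR m * K * r * w (clamp s)) with (INR m * (K * r * w (clamp s))) by ring.
    apply sumR_abs_const. intros j _. apply (proj2 (H (i, j) al Hal) f g r Hf Hg Hr Hn s).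
Qed.

(** Membership in the ball asks for a bound by the weight, which may vanish at the origin, and not
    just for boundedness. A prefactor of the size of the weight provides it. *)
Lemma nice_gain (A : Type) (g : R -> R) (F : A -> R -> (I -> R -> R) -> R -> R) (K0 : R) :
  0 <= K0 -> (forall s, 0 <= s <= 1 -> Rabs (g s) <= K0 * w s) -> nice C al0 A F ->
  exists K, 0 <= K /\ forall i al f s, Rabs al <= al0 -> in_ball C f -> 0 <= s <= 1 ->
    Rabs (g s * F i al f s) <= K * w s.
Proof.
  intros HK0 Hg [K [HK H]]. exists (K0 * K); split; [nra|].
  intros i al f s Hal Hf Hs. rewrite Rabs_mult.
  apply Rle_trans with (K0 * w s * K); [|right; ring].
  apply Rmult_le_compat; auto; try apply Rabs_pos. apply (proj1 (H i al Hal) f Hf).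
Qed.

End NiceCalculus.

Variable n : I -> R -> (I -> R -> R) -> R -> R.

(** The linear part [lin] has to contract by itself, [d] is the inhomogeneity left by the leading
    terms, and the amplitude damps [n] only. *)
Definition sysmap (al : R) (f : I -> R -> R) (c : I) (s : R) : R :=
  if act c then
    clamp s ^ e c * avg (k c) (fun t => lin c f t + d c t + al * n c al f t) (clamp s)
  else 0.

(** After averaging, the nonlinear part must be of the size of the weight. Either the source has
    this size, or the power of [s] standing in front of the average has it. *)
Hypothesis n_gain : forall C, 0 < C -> exists al0 K, 0 < al0 /\ 0 <= K /\
  nice C al0 {c | act c = true} (fun c => n (proj1_sig c)) /\
  forall c al f, act c = true -> Rabs al <= al0 -> in_ball C f ->
    (e c = 0%nat /\ forall s, 0 <= s <= 1 -> Rabs (n c al f s) <= K * w s) \/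
    (forall s, 0 <= s <= 1 -> s ^ e c <= K * w s).

Lemma abstract_fixed_point :
  exists C al0, 0 < C /\ 0 < al0 /\ forall al, Rabs al <= al0 -> exists f,
    in_ball C f /\ forall c s, f c s = sysmap al f c s.
Proof.
  (* This radius satisfies th C + (D + 1) <= C: the linear part takes th C, the source takes D, and
     the spare 1 is for the nonlinear part. The constants of the latter depend on [C], so the
     amplitude is restricted afterwards. *)
  set (C := (D + 1) * (2 / (1 - th))).
  assert (Hth : 0 < 2 / (1 - th)) by (apply Rdiv_lt_0_compat; lra).
  assert (HC : 0 < C) by (unfold C; apply Rmult_lt_0_compat; lra).
  assert (HCD : D + 1 = (1 - th) / 2 * C) by (unfold C; field; lra).
  destruct (n_gain C HC) as [al1 [K1 [Hal1 [HK1 [[K [HK Hn]] Hgain]]]]].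
  pose proof wm_nonneg as Hwm.
  (* Dominates the Lipschitz constant [K], the gain [K1] and their product, which all occur
     below. *)
  set (Kt := (K + 1) * (K1 + 1)).
  assert (HKt : 1 <= Kt) by (unfold Kt; nra).
  set (al0 := Rmin al1 ((1 - th) / 2 / Kt)).
  assert (Hal0 : 0 < al0).
  { apply Rmin_pos; [exact Hal1|]. apply Rdiv_lt_0_compat; lra. }
  exists C, (Rmin al0 (1 / Kt)); split; [exact HC|]; split.
  { apply Rmin_pos; [exact Hal0|apply Rdiv_lt_0_compat; lra]. }
  intros al Hal.
  assert (Hala : Rabs al <= al1).
  { apply Rle_trans with (1 := Hal). apply Rle_trans with al0; apply Rmin_l. }
  assert (Halb : Rabs al * Kt <= (1 - th) / 2).
  { apply Rle_trans with ((1 - th) / 2 / Kt * Kt); [|right; field; lra].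
    apply Rmult_le_compat_r; [lra|]. apply Rle_trans with (1 := Hal).
    apply Rle_trans with al0; [apply Rmin_l|apply Rmin_r]. }
  assert (Hgc : forall f, in_ball C f -> forall c, act c = true ->
     (forall s, continuous (lin c f) s) /\ (forall s, continuous (n c al f) s) /\
     (forall s, continuous (fun t => lin c f t + d c t + al * n c al f t) s)).
  { intros f Hf c Hc.
    assert (L : forall s, continuous (lin c f) s) by (apply lin_cont, Hf).
    assert (N : forall s, continuous (n c al f) s).
    { apply (proj1 (Hn (exist _ c Hc) al Hala) f Hf). }
    repeat split; trivial. intros s; cont; auto. }

  (* All bounds are proved inside (0, 1) and reach the end points by continuity. *)
  assert (Hext : forall (u v : R -> R), (forall s, continuous u s) ->
     (forall s, continuous v s) -> (forall s, 0 < s < 1 -> Rabs (u s) <= v s) ->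
     forall s, Rabs (u (clamp s)) <= v (clamp s)).
  { intros u v Hu Hv H s.
    apply (cont_le_limit (fun s => Rabs (u s)) v 0 1); auto; try lra.
    - apply clamp_range.
    - intros t _. apply (continuous_comp u Rabs); [apply Hu|apply continuous_Rabs]. }
  assert (Tc : forall f, in_ball C f -> forall c s, continuous (sysmap al f c) s).
  { intros f Hf c s. unfold sysmap. destruct (act c) eqn:Hc; [|apply continuous_const].
    apply cont_mult; [apply cont_pow, cont_clamp|].
    apply (continuous_comp clamp); [apply cont_clamp|].
    apply avg_cont. apply (Hgc f Hf c Hc). }
  assert (Hnb : forall f, in_ball C f -> forall c s, act c = true -> 0 < s < 1 ->
     Rabs (s ^ e c * avg (k c) (n c al f) s) <= Kt * wc c * w s).
  { intros f Hf c s Hc Hs.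
    destruct (Hgc f Hf c Hc) as [_ [Nc _]].
    assert (Hw := w_nonneg s ltac:(lra)). pose proof (wc_ge c Hc).
    apply Rle_trans with (Kt * w s); [|assert (0 <= Kt * w s) by nra; nra].
    destruct (Hgain c al f Hc Hala Hf) as [[He Hb]|Hb].
    - rewrite He. apply Rle_trans with (K1 * w s).
      + apply avg_weight_bound; trivial. intros t Ht; apply Hb; lra.
      + apply Rmult_le_compat_r; [lra|unfold Kt; nra].
    - destruct (proj1 (Hn (exist _ c Hc) al Hala) f Hf) as [_ [_ Hb2]]; simpl in Hb2.
      assert (A : Rabs (s ^ 0 * avg (k c) (n c al f) s) <= K).
      { apply (avg_bound (k c) 0 (n c al f) (fun _ => K)
          (fun t => K * (t ^ S (k c) / INR (S (k c)))) (fun t => K * t ^ k c)); try lra; trivial.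
        - intros; cont. apply not_0_INR; lia.
        - intros t Ht. assert (INR (S (k c)) <> 0) by (apply not_0_INR; lia).
          auto_derive; trivial. change (Init.Nat.pred (S (k c))) with (k c).
          field. trivial.
        - intros t Ht. rewrite Rmult_comm. apply Rmult_le_compat_r; [apply pow_le; lra|auto].
        - assert (Hp : 0 <= s ^ S (k c)) by (apply pow_le; lra).
          replace (0 ^ S (k c)) with 0 by (simpl; ring). simpl pow at 1.
          assert (Hi : 0 < INR (S (k c))) by (apply lt_0_INR; lia).
          assert (s ^ S (k c) / INR (S (k c)) <= s ^ S (k c)).
          { apply Rmult_le_reg_r with (1 := Hi). unfold Rdiv. rewrite Rmult_assoc, Rinv_l by lra.
            assert (1 <= INR (S (k c))) by (rewrite S_INR; pose proof (pos_INR (k c)); lra). nra. }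
          unfold Rdiv at 2. rewrite Rmult_0_l, Rmult_0_r, Rminus_0_r, Rmult_1_l. nra. }
      rewrite pow_O, Rmult_1_l in A. rewrite Rabs_mult.
      rewrite (Rabs_pos_eq (s ^ e c)) by (apply pow_le; lra).
      specialize (Hb s ltac:(lra)).
      assert (0 <= s ^ e c) by (apply pow_le; lra).
      apply Rle_trans with (K1 * w s * K).
      + apply Rmult_le_compat; trivial. apply Rabs_pos.
      + unfold Kt. nra. }
  (* Unknowns are indexed by component and point together. The factor (1 + th)/2 spends half of the
     gap 1 - th on the nonlinear part. *)
  destruct (weighted_contraction_fixed_point (I * R)
    (fun i => wgt (fst i) (snd i))
    (fun f => in_ball C (fun c s => f (c, s)))
    (fun f i => sysmap al (fun c s => f (c, s)) (fst i) (snd i))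
    ((1 + th) / 2) (fun _ => 0)) as [f [Pf Hf]].
  - lra.
  - intros; apply wgt_nonneg.
  - split; [intros; apply continuous_const|]. split; [reflexivity|].
    intros c s. rewrite Rabs_R0. apply Rmult_le_pos; [lra|apply wgt_nonneg].
  - intros f Hf. split; [|split].
    + intros c s; apply (Tc _ Hf).
    + intros c s; unfold sysmap; simpl; now rewrite clamp_idem.
    + intros c s. simpl. unfold sysmap, wgt. destruct (act c) eqn:Hc.
      2:{ rewrite Rabs_R0; lra. }
      set (ff := fun c s => f (c, s)) in *.
      destruct (Hgc ff Hf c Hc) as [Lc [Nc Sc]].
      apply (Hext (fun s => s ^ e c * avg (k c) (fun t => lin c ff t + d c t + al * n c al ff t) s)
        (fun s => C * (wc c * w s))).
      * intros; cont; apply avg_cont, Sc.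
      * intros; cont; apply w_cont.
      * intros t Ht.
        rewrite (avg_plus (k c) (fun t => lin c ff t + d c t)) by (intros; cont; auto).
        rewrite (avg_plus (k c) (lin c ff)) by (intros; auto).
        rewrite avg_scal by auto.
        rewrite !Rmult_plus_distr_l.
        apply Rle_trans with (1 := Rabs_triang _ _).
        apply Rle_trans with (1 := Rplus_le_compat_r _ _ _ (Rabs_triang _ _)).
        assert (A1 : Rabs (t ^ e c * avg (k c) (lin c ff) t) <= th * C * wc c * w t).
        { apply lin_contract; trivial; [lra|apply Hf|]. intros; apply Hf. }
        pose proof (d_bound c t Hc Ht) as A2.
        pose proof (Hnb ff Hf c t Hc Ht) as A3.
        replace (t ^ e c * (al * avg (k c) (n c al ff) t))
          with (al * (t ^ e c * avg (k c) (n c al ff) t)) by ring.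
        rewrite (Rabs_mult al).
        assert (A4 : Rabs al * Rabs (t ^ e c * avg (k c) (n c al ff) t) <= Rabs al * Kt * wc c * w t).
        { rewrite !Rmult_assoc. apply Rmult_le_compat_l; [apply Rabs_pos|]. lra. }
        assert (Hww : 0 <= wc c * w t).
        { apply Rmult_le_pos; [pose proof (wc_ge c Hc); lra|apply w_nonneg; lra]. }
        assert (A5 : Rabs al * Kt * wc c * w t <= 1 * (wc c * w t)).
        { rewrite Rmult_assoc. apply Rmult_le_compat_r; [exact Hww|]. lra. }
        assert (A6 : (D + 1) * (wc c * w t) <= (1 - th) * C * (wc c * w t)).
        { apply Rmult_le_compat_r; [exact Hww|]. nra. }
        lra.
  - intros f g r Hr Hf Hg Hfg [c s]; simpl.
    unfold sysmap, wgt. destruct (act c) eqn:Hc.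
    2:{ rewrite Rminus_eq_0, Rabs_R0. lra. }
    set (ff := fun c s => f (c, s)) in *. set (gg := fun c s => g (c, s)) in *.
    destruct (Hgc ff Hf c Hc) as [Lc [Nc Sc]].
    destruct (Hgc gg Hg c Hc) as [Lc' [Nc' Sc']].
    rewrite <- Rmult_minus_distr_l.
    apply (Hext (fun s => s ^ e c * (avg (k c) (fun t => lin c ff t + d c t + al * n c al ff t) s
        - avg (k c) (fun t => lin c gg t + d c t + al * n c al gg t) s))
        (fun s => (1 + th) / 2 * r * (wc c * w s))).
    + intros; cont; apply avg_cont; trivial.
    + intros; cont; try lra; apply w_cont.
    + intros t Ht. rewrite avg_minus by trivial.
      assert (Lfg : forall t, continuous (lin c (fun c s => ff c s - gg c s)) t).
      { apply lin_cont. intros c0 s0. apply cont_minus; [apply Hf|apply Hg]. }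
      replace (fun t => _ - _) with
        (fun t => lin c (fun c s => ff c s - gg c s) t + al * (n c al ff t - n c al gg t)).
      2:{ apply functional_extensionality; intros x. rewrite <- lin_minus. ring. }
      rewrite avg_plus by (intros; cont; auto).
      rewrite avg_scal by (intros; cont; auto).
      rewrite Rmult_plus_distr_l.
      apply Rle_trans with (1 := Rabs_triang _ _).
      assert (A1 : Rabs (t ^ e c * avg (k c) (lin c (fun c s => ff c s - gg c s)) t)
         <= th * r * wc c * w t).
      { apply lin_contract; trivial.
        - intros c0 s0; apply cont_minus; [apply Hf|apply Hg].
        - intros c0 s0 _. apply (Hfg (c0, s0)). }
      assert (A2 : Rabs (t ^ 0 * avg (k c) (fun t => n c al ff t - n c al gg t) t) <= K * r * w t).
      { apply avg_weight_bound; trivial.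
        - apply Rmult_le_pos; lra.
        - intros; cont; auto.
        - intros x Hx.
          destruct (Hn (exist _ c Hc) al Hala) as [_ HL]. simpl in HL.
          rewrite <- (clamp_id x) at 3 by lra.
          apply (HL ff gg r Hf Hg Hr). intros c0 s0; apply (Hfg (c0, s0)). }
      rewrite pow_O, Rmult_1_l in A2.
      replace (t ^ e c * (al * avg (k c) (fun t0 => n c al ff t0 - n c al gg t0) t))
        with (al * (t ^ e c * avg (k c) (fun t0 => n c al ff t0 - n c al gg t0) t)) by ring.
      rewrite (Rabs_mult al), !(Rabs_mult (t ^ e c)).
      rewrite (Rabs_pos_eq (t ^ e c)) by (apply pow_le; lra).
      assert (Hte : 0 <= t ^ e c <= 1).
      { split; [apply pow_le; lra|]. rewrite <- (pow1 (e c)). apply pow_incr; lra. }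
      assert (Hw := w_nonneg t ltac:(lra)). pose proof (wc_ge c Hc) as Hwc.
      set (Q := Rabs (avg (k c) (fun t0 => n c al ff t0 - n c al gg t0) t)) in *.
      assert (A3 : t ^ e c * Q <= K * r * w t).
      { apply Rle_trans with (1 * Q); [|lra]. apply Rmult_le_compat_r; [apply Rabs_pos|lra]. }
      assert (A4 : Rabs al * (t ^ e c * Q) <= Rabs al * (K * r * w t)).
      { apply Rmult_le_compat_l; [apply Rabs_pos|exact A3]. }
      assert (Hrw : 0 <= r * w t) by (apply Rmult_le_pos; lra).
      assert (A5 : Rabs al * K <= (1 - th) / 2).
      { apply Rle_trans with (2 := Halb). apply Rmult_le_compat_l; [apply Rabs_pos|unfold Kt; nra]. }
      assert (A6 : Rabs al * (K * r * w t) <= (1 - th) / 2 * (r * w t)).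
      { replace (Rabs al * (K * r * w t)) with (Rabs al * K * (r * w t)) by ring.
        apply Rmult_le_compat_r; trivial. }
      assert (A7 : r * w t <= wc c * (r * w t)) by nra.
      assert (A8 : (1 - th) / 2 * (r * w t) <= (1 - th) / 2 * (wc c * (r * w t)))
        by (apply Rmult_le_compat_l; lra).
      rewrite Rabs_mult, (Rabs_pos_eq (t ^ e c)) in A1 by lra.
      replace ((1 + th) / 2 * r * (wc c * w t))
        with (th * r * wc c * w t + (1 - th) / 2 * (wc c * (r * w t))) by field.
      apply Rplus_le_compat; lra.
  - intros fn f Hfn Hlim. split; [|split].
    + intros c s. apply uniform_limit_cont. intros eps Heps.
      set (B := Rabs wcm * wm + 1).
      assert (HB : 0 < B) by (unfold B; assert (0 <= Rabs wcm * wm) by (apply Rmult_le_pos; [apply Rabs_pos|lra]); lra).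
      destruct (Hlim (eps / B)) as [m Hm]; [apply Rdiv_lt_0_compat; lra|].
      exists (fun s => fn m (c, s)). split; [apply (Hfn m)|].
      intros y. apply Rle_trans with (1 := Hm (c, y)). simpl.
      apply Rle_trans with (eps / B * B); [|right; field; lra].
      apply Rmult_le_compat_l; [left; apply Rdiv_lt_0_compat; lra|].
      unfold wgt, B. assert (0 <= Rabs wcm * wm) by (apply Rmult_le_pos; [apply Rabs_pos|lra]).
      destruct (act c) eqn:Hc; [|lra].
      assert (wc c * w (clamp y) <= Rabs wcm * wm); [|lra].
      pose proof (wc_ge c Hc). pose proof (Rle_abs wcm).
      pose proof (w_nonneg _ (clamp_range y)). pose proof (w_le _ (clamp_range y)).
      apply Rmult_le_compat; lra.
    + intros c s. apply Rminus_diag_uniq, Rabs_eq_0, Rle_antisym; [|apply Rabs_pos].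
      apply le_epsilon; intros eps Heps.
      set (B := wgt c s + 1). assert (HB : 0 < B) by (unfold B; pose proof (wgt_nonneg c s); lra).
      destruct (Hlim (eps / (2 * B))) as [m Hm]; [apply Rdiv_lt_0_compat; lra|].
      pose proof (Hm (c, s)) as H1. pose proof (Hm (c, clamp s)) as H2. simpl in H1, H2.
      rewrite wgt_clamp in H2.
      pose proof (proj1 (proj2 (Hfn m)) c s) as H3. simpl in H3. rewrite <- H3 in H2.
      assert (H4 : eps / (2 * B) * wgt c s <= eps / 2).
      { apply Rle_trans with (eps / (2 * B) * B); [|right; field; lra].
        apply Rmult_le_compat_l; [left; apply Rdiv_lt_0_compat; lra|unfold B; lra]. }
      apply Rabs_le_between in H1. apply Rabs_le_between in H2. apply Rabs_le; lra.
    + intros c s. apply le_epsilon; intros eps Heps.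
      set (B := wgt c s + 1). assert (HB : 0 < B) by (unfold B; pose proof (wgt_nonneg c s); lra).
      destruct (Hlim (eps / B)) as [m Hm]; [apply Rdiv_lt_0_compat; lra|].
      specialize (Hm (c, s)). simpl in Hm.
      pose proof (proj2 (proj2 (Hfn m)) c s) as H3. simpl in H3.
      assert (H4 : eps / B * wgt c s <= eps).
      { apply Rle_trans with (eps / B * B); [|right; field; lra].
        apply Rmult_le_compat_l; [left; apply Rdiv_lt_0_compat; lra|unfold B; lra]. }
      apply Rabs_le_between in Hm. apply Rabs_le_between in H3. apply Rabs_le; lra.
  - exists (C * 1 + 0). split; [lra|]. intros [c s]; simpl.
    rewrite Rminus_0_r.
    set (f0 := fun (_ : I) (_ : R) => 0).
    assert (H0 : in_ball C f0).
    { split; [intros; apply continuous_const|]. split; [reflexivity|].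
      intros c0 s0. unfold f0; rewrite Rabs_R0. apply Rmult_le_pos; [lra|apply wgt_nonneg]. }
    unfold sysmap, wgt. destruct (act c) eqn:Hc; [|rewrite Rabs_R0; lra].
    destruct (Hgc f0 H0 c Hc) as [Lc [Nc Sc]].
    apply (Hext (fun s => s ^ e c * avg (k c) (fun t => lin c f0 t + d c t + al * n c al f0 t) s)
        (fun s => (C * 1 + 0) * (wc c * w s))).
    + intros; cont; apply avg_cont, Sc.
    + intros; cont; apply w_cont.
    + intros t Ht.
      rewrite (avg_plus (k c) (fun t => lin c f0 t + d c t)) by (intros; cont; auto).
      rewrite (avg_plus (k c) (lin c f0)) by (intros; auto).
      rewrite avg_scal by auto.
      rewrite !Rmult_plus_distr_l.
      apply Rle_trans with (1 := Rabs_triang _ _).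
      apply Rle_trans with (1 := Rplus_le_compat_r _ _ _ (Rabs_triang _ _)).
      assert (A1 : Rabs (t ^ e c * avg (k c) (lin c f0) t) <= th * C * wc c * w t).
      { apply lin_contract; trivial; [lra|apply H0|]. intros; apply H0. }
      pose proof (d_bound c t Hc Ht) as A2.
      pose proof (Hnb f0 H0 c t Hc Ht) as A3.
      replace (t ^ e c * (al * avg (k c) (n c al f0) t))
        with (al * (t ^ e c * avg (k c) (n c al f0) t)) by ring.
      rewrite (Rabs_mult al).
      assert (A4 : Rabs al * Rabs (t ^ e c * avg (k c) (n c al f0) t) <= Rabs al * Kt * wc c * w t).
      { rewrite !Rmult_assoc. apply Rmult_le_compat_l; [apply Rabs_pos|]. lra. }
      assert (Hww : 0 <= wc c * w t).
      { apply Rmult_le_pos; [pose proof (wc_ge c Hc); lra|apply w_nonneg; lra]. }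
      assert (A5 : Rabs al * Kt * wc c * w t <= 1 * (wc c * w t)).
      { rewrite Rmult_assoc. apply Rmult_le_compat_r; [exact Hww|]. lra. }
      assert (A6 : (D + 1) * (wc c * w t) <= (1 - th) * C * (wc c * w t)).
      { apply Rmult_le_compat_r; [exact Hww|]. nra. }
      lra.
  - exists (fun c s => f (c, s)). split; [exact Pf|].
    intros c s. symmetry. apply (Hf (c, s)).
Qed.

End AbstractSystem.

(** * The gauge system in the compactified coordinate *)

(** N! times the binomial coefficient. The surplus factor N! makes the lower bound 1 immediate,
    since j! and (N-j)! are both at most N!. *)
Definition qbin (N j : nat) : R :=
  INR (fact N) * INR (fact N) / (INR (fact j) * INR (fact (N - j))).

(* [perron N] is the positive eigenvector, for the top eigenvalue [N (N - 1)], of the matrix of absolute values of the linearised gauge term. *)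
Definition perron (N j : nat) : R := vac N j * qbin N j.

(** The linearised gauge matrix has negative off-diagonal entries, and alternating signs conjugate
    it to its matrix of absolute values. So [perron] with alternating signs is an eigenvector for
    the same top eigenvalue, and its absolute values are again [perron]. *)
Definition altern (N j : nat) : R := (-1) ^ j * perron N j.

(* The linearisation of [- W_j omega_j] at [omega_j = v_j]. *)
Definition linW (v x : nat -> R) (j : nat) : R :=
  v j * (2 * v j * x j - v (j - 1)%nat * x (j - 1)%nat - v (j + 1)%nat * x (j + 1)%nat).

Lemma fact_INR_pos n : 0 < INR (fact n).
Proof. apply lt_0_INR, lt_O_fact. Qed.

Lemma vac_nonneg N j : 0 <= vac N j.
Proof. apply sqrt_pos. Qed.

Lemma vac_sq N j : (j <= N)%nat -> vac N j * vac N j = INR j * (INR N - INR j).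
Proof.
  intros H. apply sqrt_sqrt. apply Rmult_le_pos; [apply pos_INR|].
  apply le_INR in H; lra.
Qed.

Lemma vac_0 N : vac N 0 = 0.
Proof. unfold vac; simpl INR. rewrite Rmult_0_l; apply sqrt_0. Qed.

(** [sqrt] is 0 on negative numbers, so [vac] extends by zero beyond [N]. Together with [vac_0] this
    removes the boundary terms from all tridiagonal expressions. *)
Lemma vac_out N j : (N <= j)%nat -> vac N j = 0.
Proof.
  intros H. apply sqrt_neg_0. apply le_INR in H. pose proof (pos_INR j). nra.
Qed.

Lemma vac_sq_ge N j : (1 <= j <= N - 1)%nat -> 1 <= vac N j * vac N j.
Proof.
  intros H. rewrite vac_sq by lia.
  assert (1 <= INR j) by (apply (le_INR 1); lia).
  assert (1 <= INR N - INR j) by (rewrite <- minus_INR by lia; apply (le_INR 1); lia). nra.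
Qed.

Lemma vac_ge_1 N j : (1 <= j <= N - 1)%nat -> 1 <= vac N j.
Proof. intros H. pose proof (vac_sq_ge N j H). pose proof (vac_nonneg N j). nra. Qed.

Lemma vac_le N j : vac N j <= INR N.
Proof.
  destruct (Nat.le_gt_cases j N) as [H|H].
  - pose proof (vac_sq N j H). pose proof (vac_nonneg N j). pose proof (pos_INR j).
    apply le_INR in H. destruct (Rle_or_lt (vac N j) (INR N)); [trivial|nra].
  - rewrite vac_out by lia. apply pos_INR.
Qed.

Lemma qbin_pos N j : 0 < qbin N j.
Proof.
  unfold qbin. apply Rdiv_lt_0_compat; apply Rmult_lt_0_compat; apply fact_INR_pos.
Qed.

Lemma qbin_ge_1 N j : (j <= N)%nat -> 1 <= qbin N j.
Proof.
  intros H. pose proof (fact_INR_pos j). pose proof (fact_INR_pos (N - j)).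
  unfold qbin. apply Rmult_le_reg_r with (INR (fact j) * INR (fact (N - j))); [nra|].
  rewrite Rmult_1_l. unfold Rdiv. rewrite Rmult_assoc, Rinv_l, Rmult_1_r by nra.
  apply Rmult_le_compat; try lra; apply le_INR, fact_le; lia.
Qed.

Lemma qbin_le N j : qbin N j <= INR (fact N) * INR (fact N).
Proof.
  pose proof (fact_INR_pos N).
  assert (1 <= INR (fact j)) by (apply (le_INR 1); pose proof (lt_O_fact j); lia).
  assert (1 <= INR (fact (N - j))) by (apply (le_INR 1); pose proof (lt_O_fact (N - j)); lia).
  unfold qbin. apply Rmult_le_reg_r with (INR (fact j) * INR (fact (N - j))); [nra|].
  unfold Rdiv. rewrite Rmult_assoc, Rinv_l, Rmult_1_r by nra.
  assert (1 <= INR (fact j) * INR (fact (N - j))) by nra.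
  assert (0 <= INR (fact N) * INR (fact N)) by nra. nra.
Qed.

Lemma qbin_succ N j : (j < N)%nat ->
  INR (j + 1) * qbin N (j + 1) = (INR N - INR j) * qbin N j.
Proof.
  intros H. pose proof (fact_INR_pos j). pose proof (fact_INR_pos (N - (j + 1))).
  unfold qbin. replace (N - j)%nat with (S (N - (j + 1))) by lia.
  replace (INR N - INR j) with (INR (S (N - (j + 1)))).
  2:{ replace (S (N - (j + 1))) with (N - j)%nat by lia. apply minus_INR; lia. }
  replace (j + 1)%nat with (S j) in * by lia.
  rewrite (fact_simpl j), (fact_simpl (N - S j)), !mult_INR.
  assert (0 < INR (S j)) by (apply lt_0_INR; lia).
  assert (0 < INR (S (N - S j))) by (apply lt_0_INR; lia).
  field. repeat split; apply Rgt_not_eq; trivial.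
Qed.

Lemma perron_nonneg N j : 0 <= perron N j.
Proof.
  apply Rmult_le_pos; [apply vac_nonneg|left; apply qbin_pos].
Qed.

Lemma perron_bounds N j : (1 <= j <= N - 1)%nat ->
  1 <= perron N j <= INR N * (INR (fact N) * INR (fact N)).
Proof.
  intros H. unfold perron.
  pose proof (vac_ge_1 N j H). pose proof (vac_le N j).
  pose proof (qbin_ge_1 N j ltac:(lia)). pose proof (qbin_le N j). split; [nra|].
  apply Rmult_le_compat; lra.
Qed.

Lemma perron_le N j : perron N j <= INR N * (INR (fact N) * INR (fact N)).
Proof.
  unfold perron. apply Rmult_le_compat; [apply vac_nonneg|left; apply qbin_pos|apply vac_le|apply qbin_le].
Qed.

(** The binomial recursion makes all three terms multiples of one factor. What remains is the
    identity 2J(M-J) + J(J-1) + (M-J)(M-J-1) = M(M-1). *)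
Lemma perron_eigen N j : (1 <= j <= N - 1)%nat ->
  vac N j * (2 * vac N j * perron N j + vac N (j - 1) * perron N (j - 1)
    + vac N (j + 1) * perron N (j + 1)) = INR N * (INR N - 1) * perron N j.
Proof.
  intros H. unfold perron.
  rewrite <- !Rmult_assoc.
  replace (2 * vac N j * vac N j) with (2 * (INR j * (INR N - INR j))) by (rewrite <- vac_sq by lia; ring).
  rewrite !vac_sq by lia.
  pose proof (qbin_succ N j ltac:(lia)) as E1.
  pose proof (qbin_succ N (j - 1) ltac:(lia)) as E2.
  replace (j - 1 + 1)%nat with j in E2 by lia.
  rewrite plus_INR, minus_INR in * by lia. change (INR 1) with 1 in *.
  set (J := INR j) in *. set (M := INR N) in *.
  replace ((J - 1) * (M - (J - 1)) * qbin N (j - 1)) with ((J - 1) * (J * qbin N j))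
    by (rewrite E2; ring).
  replace ((J + 1) * (M - (J + 1)) * qbin N (j + 1)) with ((M - J - 1) * ((M - J) * qbin N j))
    by (rewrite <- E1; ring).
  ring.
Qed.

(** With Perron weights the sup norm of the matrix is its top eigenvalue; equality is attained by
    [altern]. A cruder norm would not leave room for a contraction in the soliton case. *)
Lemma linW_bound N (x : nat -> R) (r : R) (j : nat) :
  (1 <= j <= N - 1)%nat -> (forall i, Rabs (x i) <= r * perron N i) ->
  Rabs (linW (vac N) x j) <= INR N * (INR N - 1) * (r * perron N j).
Proof.
  intros Hj H. unfold linW.
  replace (INR N * (INR N - 1) * (r * perron N j)) with (r * (INR N * (INR N - 1) * perron N j)) by ring.
  rewrite <- (perron_eigen N j Hj).
  rewrite Rabs_mult, (Rabs_pos_eq (vac N j)) by apply vac_nonneg.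
  rewrite <- Rmult_assoc, (Rmult_comm r), (Rmult_assoc (vac N j)).
  apply Rmult_le_compat_l; [apply vac_nonneg|].
  pose proof (H j) as A. pose proof (H (j - 1)%nat) as B. pose proof (H (j + 1)%nat) as D.
  pose proof (vac_nonneg N j). pose proof (vac_nonneg N (j - 1)). pose proof (vac_nonneg N (j + 1)).
  apply Rabs_le_between in A. apply Rabs_le_between in B. apply Rabs_le_between in D.
  apply Rabs_le; split; nra.
Qed.

Lemma linW_altern N (c : R) (j : nat) : (1 <= j <= N - 1)%nat ->
  linW (vac N) (fun i => c * altern N i) j = INR N * (INR N - 1) * (c * altern N j).
Proof.
  intros Hj. unfold linW, altern.
  replace (INR N * (INR N - 1) * (c * ((-1) ^ j * perron N j)))
    with (c * (-1) ^ j * (INR N * (INR N - 1) * perron N j)) by ring.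
  rewrite <- (perron_eigen N j Hj).
  destruct j as [|j]; [lia|]. replace (S j - 1)%nat with j by lia.
  replace (S j + 1)%nat with (S (S j)) by lia. simpl pow. ring.
Qed.

Lemma altern_abs N j : Rabs (altern N j) = perron N j.
Proof.
  unfold altern. rewrite Rabs_mult, pow_1_abs, Rmult_1_l. apply Rabs_pos_eq, perron_nonneg.
Qed.

(* [W_j omega_j] at [omega_j = v_j + eps x_j] is [- eps (linW v x j + eps quadW v eps x j)]. *)
Definition quadW (v : nat -> R) (eps : R) (x : nat -> R) (j : nat) : R :=
  v j * (x j ^ 2 - / 2 * (x (j - 1)%nat ^ 2 + x (j + 1)%nat ^ 2))
  + x j * (2 * v j * x j - v (j - 1)%nat * x (j - 1)%nat - v (j + 1)%nat * x (j + 1)%nat)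
  + eps * x j * (x j ^ 2 - / 2 * (x (j - 1)%nat ^ 2 + x (j + 1)%nat ^ 2)).

(** The magnetic energy sum of [Pi] with its factor 4 eps^2 removed. It starts at order eps^2
    because every bracket vanishes on the vacuum. *)
Definition energy (N : nat) (v : nat -> R) (eps : R) (x : nat -> R) : R :=
  / 4 * sum_n_m (fun j => (2 * v j * x j + eps * x j ^ 2
    - 2 * v (j - 1)%nat * x (j - 1)%nat - eps * x (j - 1)%nat ^ 2) ^ 2) 1 N.

(** Remainders, after removal of leading terms, amplitude and powers of s: [cX] for the gauge
    functions, [cY] for the momenta mu omega', [cZ] for the mass. *)
Inductive comp := cX (j : nat) | cY (j : nat) | cZ.

Definition in_range (N j : nat) : bool := andb (Nat.leb 1 j) (Nat.leb j (N - 1)).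

Lemma in_range_spec N j : in_range N j = true <-> (1 <= j <= N - 1)%nat.
Proof. unfold in_range. rewrite Bool.andb_true_iff, !Nat.leb_le. tauto. Qed.

Definition comp_active (N : nat) (c : comp) : bool :=
  match c with cX j => in_range N j | cY j => in_range N j | cZ => true end.

(** [L] balances the two halves of the first order system: the step from momenta to gauge functions
    costs a factor [L], and the step back gains it. *)
Definition comp_weight (N : nat) (L : R) (c : comp) : R :=
  match c with cX j => perron N j | cY j => L * perron N j | cZ => 1 end.

Section GaugeSystem.

Variables (N : nat) (L Kc amin : R) (eX eZ kX kY kZ : nat) (w : R -> R) (wm : R).
Variables (a0 b phi psi chi theta : R -> R) (eta : nat -> R) (dX dY : nat -> R -> R) (th D : R).

Hypothesis HN : (3 <= N)%nat.

Notation v := (vac N).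
Notation xi := (altern N).

Definition sysX (f : comp -> R -> R) (j : nat) (s : R) : R := xi j + f (cX j) s.
Definition sysY (f : comp -> R -> R) (j : nat) (s : R) : R := eta j + f (cY j) s.
(** Up to the factor s^eX this is mu (1-s)^2, with vacuum value [a0]; the mass correction enters it
    linearly. *)
Definition sysA (al : R) (f : comp -> R -> R) (s : R) : R := a0 s - al * (theta s * f cZ s).

Definition sys_exp (c : comp) : nat := match c with cX _ => eX | cY _ => 0 | cZ => eZ end.
Definition sys_ker (c : comp) : nat := match c with cX _ => kX | cY _ => kY | cZ => kZ end.

Definition sys_lin (c : comp) (f : comp -> R -> R) (s : R) : R :=
  match c with
  | cX j => f (cY j) s * / a0 s
  | cY j => b s * linW v (fun i => f (cX i) s) j
  | cZ => 0
  end.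

Definition sys_src (c : comp) (s : R) : R :=
  match c with cX j => dX j s | cY j => dY j s | cZ => 0 end.

(** For [cX]: the linear part uses 1/a0 in place of 1/A, and the difference, divided by the
    amplitude, is stored here. For [cY]: the terms of W_j omega_j beyond the linear one, and the
    friction due to the lapse. For [cZ]: kinetic and magnetic energy. *)
Definition sys_nonlin (c : comp) (al : R) (f : comp -> R -> R) (s : R) : R :=
  match c with
  | cX j => theta s * (f cZ s * sysY f j s * / a0 s * / sysA al f s)
  | cY j => b s * phi s * quadW v (al * phi s) (fun i => sysX f i s) j
            - psi s * (al * sum_n_m (fun i => (sysY f i s * / sysA al f s) ^ 2) 1 (N - 1) * sysY f j s)
  | cZ => chi s * sum_n_m (fun i => sysY f i s ^ 2 * / sysA al f s) 1 (N - 1)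
          + b s * energy N v (al * phi s) (fun i => sysX f i s)
  end.

Hypothesis HL : 1 <= L.
Hypothesis HKc : 0 <= Kc.
Hypothesis Hamin : 0 < amin.
Hypothesis w_cont : forall s, continuous w s.
Hypothesis w_mono : forall s t, 0 <= s -> s <= t -> t <= 1 -> w s <= w t.
Hypothesis w_nonneg : forall s, 0 <= s <= 1 -> 0 <= w s.
Hypothesis w_le : forall s, 0 <= s <= 1 -> w s <= wm.

Definition coef (g : R -> R) : Prop :=
  (forall s, continuous g s) /\ (forall s, g s = g (clamp s)) /\ (forall s, Rabs (g s) <= Kc).

Hypothesis a0_coef : coef a0.
Hypothesis b_coef : coef b.
Hypothesis phi_coef : coef phi.
Hypothesis psi_coef : coef psi.
Hypothesis chi_coef : coef chi.
Hypothesis theta_coef : coef theta.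
Hypothesis a0_ge : forall s, amin <= a0 s.
Hypothesis eta_le : forall j, Rabs (eta j) <= Kc.
Hypothesis theta_gain : forall s, 0 <= s <= 1 -> Rabs (theta s) <= Kc * w s.
Hypothesis bphi_gain : forall s, 0 <= s <= 1 -> Rabs (b s * phi s) <= Kc * w s.
Hypothesis psi_gain : forall s, 0 <= s <= 1 -> Rabs (psi s) <= Kc * w s.
Hypothesis eX_gain : eX = 0%nat \/ forall s, 0 <= s <= 1 -> 1 <= Kc * w s.
Hypothesis eZ_gain : forall s, 0 <= s <= 1 -> s ^ eZ <= Kc * w s.

Notation act := (comp_active N).
Notation wc := (comp_weight N L).

Hypothesis th_range : 0 <= th < 1.
Hypothesis D_nonneg : 0 <= D.
Hypothesis dX_cont : forall j s, continuous (dX j) s.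
Hypothesis dY_cont : forall j s, continuous (dY j) s.
Hypothesis X_contract : forall r f j s, 0 <= r -> (forall s, continuous f s) ->
  (forall s, 0 <= s <= 1 -> Rabs (f s) <= r * (L * perron N j * w s)) ->
  (1 <= j <= N - 1)%nat -> 0 < s < 1 ->
  Rabs (s ^ eX * avg kX (fun s => f s * / a0 s) s) <= th * r * perron N j * w s.
Hypothesis Y_contract : forall r f j s, 0 <= r -> (forall s, continuous f s) ->
  (forall s, 0 <= s <= 1 -> Rabs (f s) <= INR N * (INR N - 1) * (r * perron N j * w s)) ->
  (1 <= j <= N - 1)%nat -> 0 < s < 1 ->
  Rabs (s ^ 0 * avg kY (fun s => b s * f s) s) <= th * r * (L * perron N j) * w s.
Hypothesis dX_bound : forall j s, (1 <= j <= N - 1)%nat -> 0 < s < 1 ->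
  Rabs (s ^ eX * avg kX (dX j) s) <= D * perron N j * w s.
Hypothesis dY_bound : forall j s, (1 <= j <= N - 1)%nat -> 0 < s < 1 ->
  Rabs (s ^ 0 * avg kY (dY j) s) <= D * (L * perron N j) * w s.

Let wcm := L * (INR N * (INR (fact N) * INR (fact N))).

Lemma comp_weight_range c : act c = true -> 1 <= wc c <= wcm.
Proof.
  assert (H1 : 1 <= INR N * (INR (fact N) * INR (fact N))).
  { pose proof (perron_bounds N 1 ltac:(lia)); lra. }
  destruct c as [j|j|]; simpl; intros Hc; unfold wcm.
  - apply in_range_spec in Hc. pose proof (perron_bounds N j Hc). nra.
  - apply in_range_spec in Hc. pose proof (perron_bounds N j Hc). nra.
  - nra.
Qed.

Lemma nice_quadW (C al0 : R) : 0 <= C -> 0 <= al0 ->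
  nice comp act wc w C al0 nat
    (fun j al f s => quadW v (al * phi s) (fun i => sysX f i s) j).
Proof.
  intros HC Hal.
  pose proof comp_weight_range as Hwc.
  set (A := @nice comp act wc w C al0).
  assert (Nx : forall (T : Type) (g : T -> nat), A T (fun i _ f s => sysX f (g i) s)).
  { intros T g. unfold sysX. apply (nice_plus _ _ _ _ _ _ T (fun i _ _ _ => xi (g i))).
    - apply nice_fun with (K := INR N * (INR (fact N) * INR (fact N))); trivial.
      + intros; apply continuous_const.
      + intros; rewrite altern_abs; apply perron_le.
    - apply (nice_coord comp act wc w wcm wm w_nonneg w_le Hwc C al0 HC T (fun i => cX (g i))). }
  assert (Nv : forall (T : Type) (g : T -> nat), A T (fun i _ f s => v (g i))).
  { intros T g. apply nice_fun with (g := fun i (_ : R) => v (g i)) (K := INR N); trivial.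
    - intros; apply continuous_const.
    - intros. rewrite Rabs_pos_eq; [apply vac_le|apply vac_nonneg]. }
  assert (Np : forall T, A T (fun i al f s => al * phi s)).
  { intros T. apply (nice_mult _ _ _ _ _ _ T (fun _ al _ _ => al) (fun _ _ _ s => phi s)).
    - apply nice_amp; trivial.
    - apply nice_fun with (g := fun _ s => phi s) (K := Kc); trivial; intros; apply phi_coef. }
  unfold quadW.
  pose proof (Nx nat (fun j => j)) as X0. pose proof (Nx nat (fun j => (j - 1)%nat)) as X1.
  pose proof (Nx nat (fun j => (j + 1)%nat)) as X2.
  pose proof (Nv nat (fun j => j)) as V0. pose proof (Nv nat (fun j => (j - 1)%nat)) as V1.
  pose proof (Nv nat (fun j => (j + 1)%nat)) as V2. pose proof (Np nat) as P0.
  assert (Nn : forall x, A nat (fun _ _ _ _ => x)) by (intros; apply nice_num; trivial).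
  unfold A in *.
  pose proof (Nn 2). pose proof (Nn (/ 2)).
  assert (Q : A nat (fun j al f s => sysX f j s ^ 2 - / 2 * (sysX f (j - 1) s ^ 2 + sysX f (j + 1) s ^ 2))).
  { unfold A. apply nice_minus; [apply nice_sq; trivial|].
    apply (nice_mult _ _ _ _ _ _ nat (fun _ _ _ _ => / 2)); trivial.
    apply nice_plus; apply nice_sq; trivial. }
  unfold A in *.
  apply nice_plus; [apply nice_plus|].
  - apply (nice_mult _ _ _ _ _ _ nat (fun j _ _ _ => v j)); trivial.
  - apply nice_mult; trivial.
    apply (nice_minus comp act wc w C al0 nat
      (fun j _ f s => 2 * v j * sysX f j s - v (j - 1)%nat * sysX f (j - 1) s)); trivial;
    [apply nice_minus; trivial|].
    + apply (nice_mult _ _ _ _ _ _ nat (fun j _ _ _ => 2 * v j)); trivial.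
      apply (nice_mult _ _ _ _ _ _ nat (fun j _ _ _ => 2)); trivial.
    + apply (nice_mult _ _ _ _ _ _ nat (fun j _ _ _ => v (j - 1)%nat)); trivial.
    + apply (nice_mult _ _ _ _ _ _ nat (fun j _ _ _ => v (j + 1)%nat)); trivial.
  - apply nice_mult; trivial. apply nice_mult; trivial.
Qed.

Lemma nice_energy (C al0 : R) : 0 <= C -> 0 <= al0 ->
  nice comp act wc w C al0 nat
    (fun _ al f s => energy N v (al * phi s) (fun i => sysX f i s)).
Proof.
  intros HC Hal.
  pose proof comp_weight_range as Hwc.
  set (A := @nice comp act wc w C al0).
  set (T := (nat * nat)%type).
  assert (Nx : forall (g : T -> nat), A T (fun i _ f s => sysX f (g i) s)).
  { intros g. unfold sysX. apply (nice_plus _ _ _ _ _ _ T (fun i _ _ _ => xi (g i))).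
    - apply nice_fun with (K := INR N * (INR (fact N) * INR (fact N))); trivial.
      + intros; apply continuous_const.
      + intros; rewrite altern_abs; apply perron_le.
    - apply (nice_coord comp act wc w wcm wm w_nonneg w_le Hwc C al0 HC T (fun i => cX (g i))). }
  assert (Nv : forall (g : T -> nat), A T (fun i _ f s => v (g i))).
  { intros g. apply nice_fun with (g := fun i (_ : R) => v (g i)) (K := INR N); trivial.
    - intros; apply continuous_const.
    - intros. rewrite Rabs_pos_eq; [apply vac_le|apply vac_nonneg]. }
  assert (P0 : A T (fun i al f s => al * phi s)).
  { apply (nice_mult _ _ _ _ _ _ T (fun _ al _ _ => al) (fun _ _ _ s => phi s)).
    - apply nice_amp; trivial.
    - apply nice_fun with (g := fun _ s => phi s) (K := Kc); trivial; intros; apply phi_coef. }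
  unfold energy.
  pose proof (Nx snd) as X0. pose proof (Nx (fun p => (snd p - 1)%nat)) as X1.
  pose proof (Nv snd) as V0. pose proof (Nv (fun p => (snd p - 1)%nat)) as V1.
  assert (N2 : A T (fun _ _ _ _ => 2)) by (apply nice_num; trivial).
  unfold A in *.
  apply (nice_mult _ _ _ _ _ _ nat (fun _ _ _ _ => / 4)); [apply nice_num; trivial|].
  apply (nice_sum comp act wc w C al0 nat (fun _ j al f s =>
    (2 * v j * sysX f j s + al * phi s * sysX f j s ^ 2
    - 2 * v (j - 1)%nat * sysX f (j - 1) s - al * phi s * sysX f (j - 1) s ^ 2) ^ 2)).
  simpl. apply (nice_sq comp act wc w w_nonneg C al0).
  apply nice_minus; [apply nice_minus; [apply nice_plus|]|].
  - apply (nice_mult _ _ _ _ _ _ T (fun p _ _ _ => 2 * v (snd p))); trivial.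
    apply (nice_mult _ _ _ _ _ _ T (fun j _ _ _ => 2)); trivial.
  - apply (nice_mult _ _ _ _ _ _ T (fun _ al _ s => al * phi s)); trivial.
    apply (nice_sq comp act wc w w_nonneg C al0 T (fun p al f s => sysX f (snd p) s)); trivial.
  - apply (nice_mult _ _ _ _ _ _ T (fun p _ _ _ => 2 * v (snd p - 1)%nat)); trivial.
    apply (nice_mult _ _ _ _ _ _ T (fun j _ _ _ => 2)); trivial.
  - apply (nice_mult _ _ _ _ _ _ T (fun _ al _ s => al * phi s)); trivial.
    apply (nice_sq comp act wc w w_nonneg C al0 T (fun p al f s => sysX f (snd p - 1) s)); trivial.
Qed.

(** For small amplitude the mass correction uses up at most half of the vacuum lower bound, so mu
    stays positive and no further horizon forms. *)
Lemma sysA_ge (C : R) : 0 < C -> exists al0, 0 < al0 /\ forall al f s,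
  Rabs al <= al0 -> in_ball comp act wc w C f -> amin / 2 <= sysA al f s.
Proof.
  intros HC.
  assert (Hwm : 0 <= wm).
  { apply Rle_trans with (w 0); [apply w_nonneg|apply w_le]; lra. }
  set (K := Kc * (C * wm) + 1).
  assert (HK : 0 < K).
  { unfold K. assert (0 <= Kc * (C * wm)) by (apply Rmult_le_pos; [lra|apply Rmult_le_pos; lra]). lra. }
  exists (amin / 2 / K); split; [apply Rdiv_lt_0_compat; lra|].
  intros al f s Hal [_ [_ Hf]]. specialize (Hf cZ s). unfold wgt in Hf; simpl in Hf.
  pose proof (a0_ge s). destruct theta_coef as [_ [_ Ht]]. specialize (Ht s).
  assert (E : Rabs (al * (theta s * f cZ s)) <= amin / 2 / K * K).
  { rewrite !Rabs_mult. apply Rmult_le_compat; try apply Rabs_pos; trivial.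
    { apply Rmult_le_pos; apply Rabs_pos. }
    apply Rle_trans with (Kc * (C * wm)); [|unfold K; lra].
    apply Rmult_le_compat; try apply Rabs_pos; trivial.
    apply Rle_trans with (1 := Hf). pose proof (w_le _ (clamp_range s)).
    apply Rmult_le_compat_l; lra. }
  replace (amin / 2 / K * K) with (amin / 2) in E by (field; lra).
  apply Rabs_le_between in E. unfold sysA. lra.
Qed.

(** For [cY] the weight comes from the prefactors b phi and psi, for [cZ] from the power s^eZ
    outside the average. For [cX] it comes from [theta] when [eX] is 0 (solitons), or from a weight
    bounded below (black holes). *)
Lemma sys_nonlin_gain : forall C, 0 < C -> exists al0 K, 0 < al0 /\ 0 <= K /\
  nice comp act wc w C al0 {c | act c = true} (fun c => sys_nonlin (proj1_sig c)) /\
  forall c al f, act c = true -> Rabs al <= al0 -> in_ball comp act wc w C f ->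
    (sys_exp c = 0%nat /\ forall s, 0 <= s <= 1 -> Rabs (sys_nonlin c al f s) <= K * w s) \/
    (forall s, 0 <= s <= 1 -> s ^ sys_exp c <= K * w s).
Proof.
  intros C HC. destruct (sysA_ge C HC) as [al0 [Hal0 HA]].
  pose proof comp_weight_range as Hwc.
  assert (HC' : 0 <= C) by lra. assert (Hal' : 0 <= al0) by lra.
  set (A := @nice comp act wc w C al0).
  assert (Nz : forall T : Type, A T (fun _ _ f s => f cZ s)).
  { intros T. apply (nice_coord comp act wc w wcm wm w_nonneg w_le Hwc C al0 HC' T (fun _ => cZ)). }
  assert (Ny : forall (T : Type) (g : T -> nat), A T (fun i _ f s => sysY f (g i) s)).
  { intros T g. unfold sysY. apply (nice_plus _ _ _ _ _ _ T (fun i _ _ _ => eta (g i))).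
    - apply nice_fun with (K := Kc); trivial. intros; apply continuous_const.
    - apply (nice_coord comp act wc w wcm wm w_nonneg w_le Hwc C al0 HC' T (fun i => cY (g i))). }
  assert (Nc : forall (T : Type) g, coef g -> A T (fun _ _ _ s => g s)).
  { intros T g Hg. apply nice_fun with (g := fun _ s => g s) (K := Kc); trivial; intros; apply Hg. }
  assert (Nal : forall T, A T (fun _ al _ _ => al)) by (intros; apply nice_amp; trivial).
  assert (NA : forall T, A T (fun _ al f s => sysA al f s)).
  { intros T. unfold sysA. apply (nice_minus _ _ _ _ _ _ T (fun _ _ _ s => a0 s)).
    - apply Nc, a0_coef.
    - apply (nice_mult _ _ _ _ _ _ T (fun _ al _ _ => al)); [apply Nal|].
      apply (nice_mult _ _ _ _ _ _ T (fun _ _ _ s => theta s)); [apply Nc, theta_coef|apply Nz]. }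
  assert (Hal1 : forall (T : Type) (i : T) (al : R) f (s : R), Rabs al <= al0 ->
     in_ball comp act wc w C f -> amin / 2 <= sysA al f s) by (intros; apply HA; trivial).
  assert (NAi : forall T, A T (fun _ al f s => / sysA al f s)).
  { intros T. apply (nice_inv comp act wc w w_nonneg C al0 T (fun _ al f s => sysA al f s) (amin / 2));
    [lra| |apply NA]. intros; apply HA; trivial. }
  assert (Na0i : forall T, A T (fun _ _ _ s => / a0 s)).
  { intros T. apply (nice_inv comp act wc w w_nonneg C al0 T (fun _ _ _ s => a0 s) amin);
    [lra| |apply Nc, a0_coef]. intros; apply a0_ge. }
  assert (NX : A nat (fun j al f s => f cZ s * sysY f j s * / a0 s * / sysA al f s)).
  { apply (nice_mult _ _ _ _ _ _ nat (fun j al f s => f cZ s * sysY f j s * / a0 s)); [|apply NAi].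
    apply (nice_mult _ _ _ _ _ _ nat (fun j al f s => f cZ s * sysY f j s)); [|apply Na0i].
    apply nice_mult; [apply Nz|apply (Ny nat (fun j => j))]. }
  assert (NY1 : A nat (fun j al f s => quadW v (al * phi s) (fun i => sysX f i s) j))
    by (apply nice_quadW; trivial).
  assert (NY2 : A nat (fun j al f s =>
     al * sum_n_m (fun i => (sysY f i s * / sysA al f s) ^ 2) 1 (N - 1) * sysY f j s)).
  { apply nice_mult; [|apply (Ny nat (fun j => j))].
    apply (nice_mult _ _ _ _ _ _ nat (fun _ al _ _ => al)); [apply Nal|].
    apply (nice_sum comp act wc w C al0 nat (fun _ i al f s => (sysY f i s * / sysA al f s) ^ 2)).
    simpl. apply (nice_sq comp act wc w w_nonneg C al0 (nat * nat)
      (fun p al f s => sysY f (snd p) s * / sysA al f s)).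
    apply nice_mult; [apply Ny|apply NAi]. }
  assert (NZ1 : A nat (fun _ al f s => sum_n_m (fun i => sysY f i s ^ 2 * / sysA al f s) 1 (N - 1))).
  { apply (nice_sum comp act wc w C al0 nat (fun _ i al f s => sysY f i s ^ 2 * / sysA al f s)).
    simpl. apply nice_mult; [|apply NAi].
    apply (nice_sq comp act wc w w_nonneg C al0 (nat * nat) (fun p al f s => sysY f (snd p) s)). apply Ny. }
  assert (NZ2 : A nat (fun _ al f s => energy N v (al * phi s) (fun i => sysX f i s)))
    by (apply nice_energy; trivial).
  assert (MX : A nat (fun j => sys_nonlin (cX j))).
  { simpl. apply (nice_mult _ _ _ _ _ _ nat (fun _ _ _ s => theta s)); [apply Nc, theta_coef|exact NX]. }
  assert (MY : A nat (fun j => sys_nonlin (cY j))).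
  { simpl. apply nice_minus; trivial.
    - apply (nice_mult _ _ _ _ _ _ nat (fun _ _ _ s => b s * phi s)); [|exact NY1].
      apply (nice_mult _ _ _ _ _ _ nat (fun _ _ _ s => b s)); apply Nc; [apply b_coef|apply phi_coef].
    - apply (nice_mult _ _ _ _ _ _ nat (fun _ _ _ s => psi s)); [apply Nc, psi_coef|exact NY2]. }
  assert (MZ : A nat (fun _ => sys_nonlin cZ)).
  { simpl. apply nice_plus; trivial.
    - apply (nice_mult _ _ _ _ _ _ nat (fun _ _ _ s => chi s)); [apply Nc, chi_coef|exact NZ1].
    - apply (nice_mult _ _ _ _ _ _ nat (fun _ _ _ s => b s)); [apply Nc, b_coef|exact NZ2]. }
  destruct (nice_gain comp act wc w C al0 nat theta _ Kc HKc theta_gain NX) as [K1 [HK1 G1]].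
  destruct (nice_gain comp act wc w C al0 nat (fun s => b s * phi s) _ Kc HKc bphi_gain NY1) as [K2 [HK2 G2]].
  destruct (nice_gain comp act wc w C al0 nat psi _ Kc HKc psi_gain NY2) as [K3 [HK3 G3]].
  exists al0, (K1 + K2 + K3 + Kc); split; [exact Hal0|]; split; [lra|]; split.
  - destruct MX as [M1 [HM1 MX]]. destruct MY as [M2 [HM2 MY]]. destruct MZ as [M3 [HM3 MZ]].
    exists (M1 + M2 + M3); split; [lra|].
    (* The three kinds of components have separate constants; each estimate is weakened to their sum
       so that one constant serves all. *)
    assert (Up : forall K (T : Type) (F : T -> R -> (comp -> R -> R) -> R -> R) (i : T) al,
      K <= M1 + M2 + M3 ->
      (forall f, in_ball comp act wc w C f ->
       (forall s, continuous (F i al f) s) /\ (forall s, F i al f s = F i al f (clamp s)) /\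
       (forall s, Rabs (F i al f s) <= K)) /\
      (forall f g r, in_ball comp act wc w C f -> in_ball comp act wc w C g -> 0 <= r ->
         near comp act wc w r f g ->
       forall s, Rabs (F i al f s - F i al g s) <= K * r * w (clamp s)) ->
      (forall f, in_ball comp act wc w C f ->
       (forall s, continuous (F i al f) s) /\ (forall s, F i al f s = F i al f (clamp s)) /\
       (forall s, Rabs (F i al f s) <= M1 + M2 + M3)) /\
      (forall f g r, in_ball comp act wc w C f -> in_ball comp act wc w C g -> 0 <= r ->
         near comp act wc w r f g ->
       forall s, Rabs (F i al f s - F i al g s) <= (M1 + M2 + M3) * r * w (clamp s))).
    { intros K T F i al HKK [H1 H2]. split.
      - intros f Hf. destruct (H1 f Hf) as [B1 [B2 B3]]. repeat split; trivial.
        intros s; specialize (B3 s); lra.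
      - intros f g r Hf Hg Hr Hn s. apply Rle_trans with (1 := H2 f g r Hf Hg Hr Hn s).
        rewrite !Rmult_assoc. apply Rmult_le_compat_r; [|exact HKK].
        apply Rmult_le_pos; [exact Hr|apply w_nonneg, clamp_range]. }
    intros [[j|j|] Hc] al Hal; simpl proj1_sig.
    + apply (Up M1 nat (fun j => sys_nonlin (cX j)) j al); [lra|apply MX, Hal].
    + apply (Up M2 nat (fun j => sys_nonlin (cY j)) j al); [lra|apply MY, Hal].
    + apply (Up M3 nat (fun _ => sys_nonlin cZ) 0%nat al); [lra|apply (MZ 0%nat), Hal].
  - intros [j|j|] al f Hc Hal Hf; simpl sys_exp.
    + destruct eX_gain as [->|HeX].
      * left; split; [reflexivity|]. intros s Hs.
        pose proof (w_nonneg s Hs). apply Rle_trans with (1 := G1 j al f s Hal Hf Hs). apply Rmult_le_compat_r; lra.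
      * right. intros s Hs. apply Rle_trans with 1.
        { rewrite <- (pow1 eX). apply pow_incr; lra. }
        pose proof (w_nonneg s Hs). specialize (HeX s Hs).
        apply Rle_trans with (1 := HeX). apply Rmult_le_compat_r; lra.
    + left; split; [reflexivity|]. intros s Hs. pose proof (w_nonneg s Hs).
      pose proof (G2 j al f s Hal Hf Hs) as E2. pose proof (G3 j al f s Hal Hf Hs) as E3.
      cbv beta in E2, E3. simpl sys_nonlin.
      unfold Rminus. apply Rle_trans with (1 := Rabs_triang _ _). rewrite Rabs_Ropp.
      apply Rle_trans with (K2 * w s + K3 * w s); [apply Rplus_le_compat; [exact E2|exact E3]|].
      rewrite <- Rmult_plus_distr_r. apply Rmult_le_compat_r; lra.
    + right. intros s Hs. pose proof (w_nonneg s Hs). apply Rle_trans with (1 := eZ_gain s Hs).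
      apply Rmult_le_compat_r; lra.
Qed.

Lemma gauge_system_solution :
  exists C al0, 0 < C /\ 0 < al0 /\ forall al, Rabs al <= al0 -> exists f,
    in_ball comp act wc w C f /\
    (forall s, amin / 2 <= sysA al f s) /\
    forall c s, f c s = sysmap comp act sys_exp sys_ker sys_lin sys_src sys_nonlin al f c s.
Proof.
  destruct (abstract_fixed_point comp act wc w wcm wm sys_exp sys_ker sys_lin sys_src th D
    w_cont w_mono w_nonneg w_le comp_weight_range th_range D_nonneg) with (n := sys_nonlin)
    as [C [al0 [HC [Hal0 H]]]].
  - intros [j|j|] f Hf s.
    + change (continuous (fun s => f (cY j) s * / a0 s) s). cont; [apply Hf|apply a0_coef|]. pose proof (a0_ge s). lra.
    + change (continuous (fun s => b s * linW v (fun i => f (cX i) s) j) s).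
      unfold linW. cont; try apply Hf; apply b_coef.
    + apply (continuous_const 0).
  - intros [j|j|] f g s; simpl; unfold linW; ring.
  - intros f r Hr Hf Hb [j|j|] s Hc Hs; simpl in *.
    + apply in_range_spec in Hc as Hj. apply X_contract; trivial.
      intros t Ht. apply Rle_trans with (1 := Hb (cY j) t Ht).
      unfold wgt; simpl. rewrite Hc, clamp_id by trivial. lra.
    + apply in_range_spec in Hc as Hj.
      apply (Y_contract r (fun s => linW v (fun i => f (cX i) s) j)); trivial.
      * intros t. unfold linW. cont; apply Hf.
      * intros t Ht.
        replace (r * perron N j * w t) with (r * w t * perron N j) by ring.
        apply linW_bound; trivial. intros i.
        apply Rle_trans with (1 := Hb (cX i) t Ht). unfold wgt; simpl.
        rewrite clamp_id by trivial. pose proof (perron_nonneg N i). pose proof (w_nonneg t Ht).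
        destruct (in_range N i); [lra|]. rewrite Rmult_0_r.
        apply Rmult_le_pos; trivial. apply Rmult_le_pos; trivial.
    + replace (avg kZ (sys_lin cZ f) s) with 0 by (symmetry; apply (avg_zero kZ s)).
      rewrite !Rmult_0_r, Rabs_R0. pose proof (w_nonneg s ltac:(lra)).
      repeat apply Rmult_le_pos; lra.
  - intros [j|j|] s Hc; [apply dX_cont|apply dY_cont|apply (continuous_const 0)].
  - intros [j|j|] s Hc Hs; simpl in *.
    + apply dX_bound; trivial. now apply in_range_spec.
    + apply dY_bound; trivial. now apply in_range_spec.
    + replace (avg kZ (sys_src cZ) s) with 0 by (symmetry; apply (avg_zero kZ s)).
      rewrite !Rmult_0_r, Rabs_R0. pose proof (w_nonneg s ltac:(lra)).
      repeat apply Rmult_le_pos; lra.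
  - apply sys_nonlin_gain.
  - destruct (sysA_ge C HC) as [al1 [Hal1 HA]].
    exists C, (Rmin al0 al1). split; [exact HC|]. split; [apply Rmin_pos; trivial|].
    intros al Hal. destruct (H al) as [f [Hf Hfix]].
    { apply Rle_trans with (1 := Hal), Rmin_l. }
    exists f; split; [exact Hf|]; split; [|exact Hfix].
    intros s; apply HA; trivial. apply Rle_trans with (1 := Hal), Rmin_r.
Qed.

End GaugeSystem.

(** * First order form of the field equations *)

Definition C1_beyond (r0 : R) (f : R -> R) : Prop :=
  forall r, r0 < r -> ex_derive f r /\ continuous (Derive f) r.

Lemma locally_beyond (r0 r : R) (P : R -> Prop) :
  r0 < r -> (forall x, r0 < x -> P x) -> locally r P.
Proof.
  intros Hr H. assert (Hp : 0 < r - r0) by lra.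
  exists (mkposreal _ Hp). intros y Hy. apply H.
  change (Rabs (y - r) < r - r0) in Hy. apply Rabs_def2 in Hy. lra.
Qed.

Lemma C1_of_derive (r0 : R) (f g : R -> R) :
  (forall r, r0 < r -> is_derive f r (g r)) -> (forall r, r0 < r -> continuous g r) ->
  C1_beyond r0 f.
Proof.
  intros Hd Hc r Hr. split; [exists (g r); auto|].
  apply (continuous_ext_loc _ g); [|auto].
  apply (locally_beyond r0); trivial. intros x Hx. symmetry; apply is_derive_unique; auto.
Qed.

Lemma C1_derive (r0 : R) (f : R -> R) (r : R) :
  C1_beyond r0 f -> r0 < r -> is_derive f r (Derive f r).
Proof. intros Hf Hr. apply Derive_correct, Hf, Hr. Qed.

Lemma C1_cont (r0 : R) (f : R -> R) (r : R) :
  C1_beyond r0 f -> r0 < r -> continuous f r.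
Proof. intros Hf Hr. apply (ex_derive_continuous f), Hf, Hr. Qed.

Lemma C1_const (r0 c : R) : C1_beyond r0 (fun _ => c).
Proof.
  apply (C1_of_derive r0 _ (fun _ => 0)).
  - intros; apply (is_derive_const c).
  - intros; apply continuous_const.
Qed.

Lemma C1_id (r0 : R) : C1_beyond r0 (fun x => x).
Proof.
  apply (C1_of_derive r0 _ (fun _ => 1)).
  - intros; apply (is_derive_id r).
  - intros; apply continuous_const.
Qed.

Lemma C1_plus (r0 : R) (f g : R -> R) :
  C1_beyond r0 f -> C1_beyond r0 g -> C1_beyond r0 (fun x => f x + g x).
Proof.
  intros Hf Hg. apply (C1_of_derive r0 _ (fun x => Derive f x + Derive g x)).
  - intros r Hr. apply (is_derive_plus f g); eapply C1_derive; eauto.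
  - intros r Hr. apply cont_plus; [apply Hf|apply Hg]; trivial.
Qed.

Lemma C1_mult (r0 : R) (f g : R -> R) :
  C1_beyond r0 f -> C1_beyond r0 g -> C1_beyond r0 (fun x => f x * g x).
Proof.
  intros Hf Hg. apply (C1_of_derive r0 _ (fun x => Derive f x * g x + f x * Derive g x)).
  - intros r Hr. apply (is_derive_mult f g); [eapply C1_derive; eauto..|].
    intros; apply Rmult_comm.
  - intros r Hr. pose proof (C1_cont r0 f r Hf Hr). pose proof (C1_cont r0 g r Hg Hr).
    destruct (Hf r Hr). destruct (Hg r Hr). cont.
Qed.

Lemma C1_opp (r0 : R) (f : R -> R) : C1_beyond r0 f -> C1_beyond r0 (fun x => - f x).
Proof.
  intros Hf. apply (C1_of_derive r0 _ (fun x => - Derive f x)).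
  - intros r Hr. apply (is_derive_opp f); eapply C1_derive; eauto.
  - intros r Hr. apply cont_opp, Hf, Hr.
Qed.

Lemma C1_minus (r0 : R) (f g : R -> R) :
  C1_beyond r0 f -> C1_beyond r0 g -> C1_beyond r0 (fun x => f x - g x).
Proof. intros Hf Hg. apply (C1_plus r0 f (fun x => - g x)); [|apply C1_opp]; trivial. Qed.

Lemma C1_pow (r0 : R) (f : R -> R) (n : nat) :
  C1_beyond r0 f -> C1_beyond r0 (fun x => f x ^ n).
Proof.
  intros Hf. induction n as [|n IH]; simpl; [apply C1_const|apply C1_mult; trivial].
Qed.

Lemma C1_inv (r0 : R) (f : R -> R) :
  C1_beyond r0 f -> (forall r, r0 < r -> f r <> 0) -> C1_beyond r0 (fun x => / f x).
Proof.
  intros Hf H0. apply (C1_of_derive r0 _ (fun x => - Derive f x / f x ^ 2)).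
  - intros r Hr. apply (is_derive_inv f); [eapply C1_derive; eauto|auto].
  - intros r Hr. apply cont_div.
    + apply cont_opp, Hf, Hr.
    + apply cont_pow. eapply C1_cont; eauto.
    + apply pow_nonzero; auto.
Qed.

Lemma C1_sum (r0 : R) (F : nat -> R -> R) (a b : nat) :
  (forall j, C1_beyond r0 (F j)) -> C1_beyond r0 (fun x => sum_n_m (fun j => F j x) a b).
Proof.
  intros HF. apply (C1_of_derive r0 _ (fun x => sum_n_m (fun j => Derive (F j) x) a b)).
  - intros r Hr. apply (is_derive_sum F (fun j => Derive (F j))). intros j _.
    apply (C1_derive r0); auto.
  - intros r Hr. apply (cont_sum (fun j => Derive (F j))). intros j _. apply HF, Hr.
Qed.

Ltac smooth1 :=
  match goal with
  | H : ?P |- ?P => exact H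
  | |- C1_beyond _ (fun _ => ?c) => apply C1_const
  | |- C1_beyond _ (fun x => x) => apply C1_id
  | |- C1_beyond ?r0 (fun x => @?f x + @?g x) => apply (C1_plus r0 f g)
  | |- C1_beyond ?r0 (fun x => @?f x - @?g x) => apply (C1_minus r0 f g)
  | |- C1_beyond ?r0 (fun x => - @?f x) => apply (C1_opp r0 f)
  | |- C1_beyond ?r0 (fun x => @?f x * @?g x) => apply (C1_mult r0 f g)
  | |- C1_beyond ?r0 (fun x => @?f x / @?g x) =>
      apply (C1_mult r0 f (fun x => / g x)); [|apply (C1_inv r0 g)]
  | |- C1_beyond ?r0 (fun x => / @?f x) => apply (C1_inv r0 f)
  | |- C1_beyond ?r0 (fun x => @?f x ^ ?n) => apply (C1_pow r0 f n)
  | |- C1_beyond ?r0 (fun x => sum_n_m (fun j => @?F x j) ?a ?b) =>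
      apply (C1_sum r0 (fun j x => F x j) a b); intros; cbv beta
  end.
Ltac smooth := repeat (cbv beta; smooth1).

Lemma C2_of_derive (r0 : R) (f g : R -> R) (r : R) :
  (forall r, r0 < r -> is_derive f r (g r)) -> C1_beyond r0 g -> r0 < r -> C2_at f r.
Proof.
  intros Hd Hg Hr.
  assert (E : forall x, r0 < x -> locally x (fun y => Derive f y = g y)).
  { intros x Hx. apply (locally_beyond r0); trivial. intros y Hy; apply is_derive_unique; auto. }
  split.
  - apply (locally_beyond r0); trivial. intros x Hx. split; [exists (g x); auto|].
    apply (ex_derive_ext_loc g).
    + apply (locally_beyond r0); trivial. intros y Hy; symmetry; apply is_derive_unique; auto.
    + apply Hg, Hx.
  - apply (continuous_ext_loc _ (Derive g)); [|apply Hg, Hr].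
    apply (locally_beyond r0); trivial. intros x Hx. simpl. symmetry. apply Derive_ext_loc, E, Hx.
Qed.

(* [P j] stands for [mu omega_j']. *)
Definition flow (N : nat) (Lam r0 : R) (b : background) (P : nat -> R -> R) : Prop :=
  forall r, r0 < r ->
    0 < mu Lam b r /\ 0 < lapse b r /\
    (forall j, is_derive (gauge b j) r (P j r / mu Lam b r)) /\
    (forall j, is_derive (P j) r
       (- (2 / r * sum_n_m (fun i => (P i r / mu Lam b r) ^ 2) 1 (N - 1) * P j r)
        - W b j r * gauge b j r / r ^ 2)) /\
    is_derive (mass b) r
      (mu Lam b r * sum_n_m (fun i => (P i r / mu Lam b r) ^ 2) 1 (N - 1) + r ^ 2 * Pi N b r) /\
    is_derive (lapse b) r
      (lapse b r * (2 / r * sum_n_m (fun i => (P i r / mu Lam b r) ^ 2) 1 (N - 1))).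

Lemma mu_derive (Lam : R) (b : background) (r m' : R) :
  r <> 0 -> is_derive (mass b) r m' ->
  is_derive (mu Lam b) r (- 2 * m' / r + 2 * mass b r / r ^ 2 - 2 * Lam * r / 3).
Proof.
  intros Hr Hm. unfold mu.
  replace (- 2 * m' / r + 2 * mass b r / r ^ 2 - 2 * Lam * r / 3)
    with (0 - (2 * m' * r - 2 * mass b r * 1) / r ^ 2 - Lam * (2 * r) / 3) by (field; trivial).
  apply (is_derive_minus (fun r => 1 - 2 * mass b r / r) (fun r => Lam * r ^ 2 / 3)).
  - apply (is_derive_minus (fun _ => 1) (fun r => 2 * mass b r / r)).
    + apply (is_derive_const 1).
    + apply (is_derive_div (fun r => 2 * mass b r) (fun r => r)); trivial.
      * apply (is_derive_scal (mass b)); trivial.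
      * apply (is_derive_id r).
  - auto_derive; trivial. field.
Qed.

Section Flow.

Variables (N : nat) (Lam r0 : R) (b : background) (P : nat -> R -> R).
Hypothesis r0_nonneg : 0 <= r0.
Hypothesis Hflow : flow N Lam r0 b P.

Lemma flow_Gam r : r0 < r ->
  Gam N b r = sum_n_m (fun i => (P i r / mu Lam b r) ^ 2) 1 (N - 1).
Proof.
  intros Hr. apply sumR_ext. intros j _. f_equal.
  apply is_derive_unique. apply (Hflow r Hr).
Qed.

Lemma flow_mass_cont r : r0 < r -> continuous (mass b) r.
Proof.
  intros Hr. apply (ex_derive_continuous (mass b)).
  destruct (Hflow r Hr) as [_ [_ [_ [_ [Hm _]]]]]. eexists; exact Hm.
Qed.

Lemma flow_mu_cont r : r0 < r -> continuous (mu Lam b) r.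
Proof.
  intros Hr. unfold mu. cont; try lra. apply flow_mass_cont, Hr.
Qed.

Lemma flow_gauge_cont j r : r0 < r -> continuous (gauge b j) r.
Proof.
  intros Hr. apply (ex_derive_continuous (gauge b j)).
  destruct (Hflow r Hr) as [_ [_ [Hg _]]]. eexists; apply Hg.
Qed.

Lemma flow_P_cont j r : r0 < r -> continuous (P j) r.
Proof.
  intros Hr. apply (ex_derive_continuous (P j)).
  destruct (Hflow r Hr) as [_ [_ [_ [Hg _]]]]. eexists; apply Hg.
Qed.

Lemma flow_mu_neq r : r0 < r -> mu Lam b r <> 0.
Proof. intros Hr. destruct (Hflow r Hr); lra. Qed.

Ltac flow_cont :=
  cont;
  match goal with
  | |- continuous (P ?j) _ => apply (flow_P_cont j); assumption
  | |- continuous (fun x => P ?j x) _ => apply (flow_P_cont j); assumption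
  | |- continuous (mu Lam b) _ => apply flow_mu_cont; assumption
  | |- continuous (fun x => mu Lam b x) _ => apply flow_mu_cont; assumption
  | |- continuous (gauge b ?j) _ => apply (flow_gauge_cont j); assumption
  | |- continuous (fun x => gauge b ?j x) _ => apply (flow_gauge_cont j); assumption
  | |- mu Lam b _ <> 0 => assumption
  | |- _ ^ _ <> 0 => apply pow_nonzero; lra
  | |- 4 * _ <> 0 => apply Rmult_integral_contrapositive_currified; [lra|apply pow_nonzero; lra]
  | |- _ <> 0 => lra
  end.

Lemma flow_P_C1 j : C1_beyond r0 (P j).
Proof.
  apply (C1_of_derive r0 _ (fun r => - (2 / r * sum_n_m (fun i => (P i r / mu Lam b r) ^ 2) 1 (N - 1) * P j r)
        - W b j r * gauge b j r / r ^ 2)).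
  - intros r Hr; apply (Hflow r Hr).
  - intros r Hr. pose proof (flow_mu_neq r Hr). unfold W.
    flow_cont.
Qed.

Lemma flow_gauge_C1 j : C1_beyond r0 (gauge b j).
Proof.
  apply (C1_of_derive r0 _ (fun r => P j r / mu Lam b r)).
  - intros r Hr; apply (Hflow r Hr).
  - intros r Hr. cont; [apply flow_P_cont|apply flow_mu_cont|apply flow_mu_neq]; trivial.
Qed.

Lemma flow_mass_C1 : C1_beyond r0 (mass b).
Proof.
  apply (C1_of_derive r0 _ (fun r => mu Lam b r * sum_n_m (fun i => (P i r / mu Lam b r) ^ 2) 1 (N - 1) + r ^ 2 * Pi N b r)).
  - intros r Hr; apply (Hflow r Hr).
  - intros r Hr. pose proof (flow_mu_neq r Hr). unfold Pi.
    flow_cont.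
Qed.

Lemma flow_mu_C1 : C1_beyond r0 (mu Lam b).
Proof.
  pose proof flow_mass_C1. unfold mu. smooth; intros; lra.
Qed.

Lemma flow_ratio_C1 j : C1_beyond r0 (fun r => P j r / mu Lam b r).
Proof.
  pose proof (flow_P_C1 j). pose proof flow_mu_C1. smooth. apply flow_mu_neq.
Qed.

Lemma flow_Gam_C1 : C1_beyond r0 (fun r => sum_n_m (fun i => (P i r / mu Lam b r) ^ 2) 1 (N - 1)).
Proof.
  apply (C1_sum r0 (fun i r => (P i r / mu Lam b r) ^ 2)).
  intros j. pose proof (flow_ratio_C1 j). apply (C1_pow r0 (fun r => P j r / mu Lam b r)), H.
Qed.

Lemma flow_lapse_C1 : C1_beyond r0 (lapse b).
Proof.
  apply (C1_of_derive r0 _ (fun r => lapse b r * (2 / r * sum_n_m (fun i => (P i r / mu Lam b r) ^ 2) 1 (N - 1)))).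
  - intros r Hr; apply (Hflow r Hr).
  - intros r Hr. apply cont_mult.
    + apply (ex_derive_continuous (lapse b)).
      destruct (Hflow r Hr) as [_ [_ [_ [_ [_ Hl]]]]]. eexists; exact Hl.
    + apply (cont_mult (fun r => 2 / r)); [cont; lra|]. apply (C1_cont r0 _ r flow_Gam_C1 Hr).
Qed.

Lemma flow_Pi_C1 : C1_beyond r0 (Pi N b).
Proof.
  unfold Pi. smooth; try apply flow_gauge_C1.
  intros; apply Rmult_integral_contrapositive_currified; [lra|apply pow_nonzero; lra].
Qed.

(** A bootstrap: the right-hand sides of the flow are built from functions already known to be C1,
    so the solutions are C2. *)
Lemma flow_regular r : r0 < r -> regular_at N b r.
Proof.
  intros Hr. pose proof flow_mu_C1. pose proof flow_Gam_C1. pose proof flow_Pi_C1.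
  pose proof flow_lapse_C1.
  split; [|split].
  - apply (C2_of_derive r0 _ (fun r => mu Lam b r * sum_n_m (fun i => (P i r / mu Lam b r) ^ 2) 1 (N - 1) + r ^ 2 * Pi N b r)); trivial.
    + intros x Hx; apply (Hflow x Hx).
    + smooth.
  - apply (C2_of_derive r0 _ (fun r => lapse b r * (2 / r * sum_n_m (fun i => (P i r / mu Lam b r) ^ 2) 1 (N - 1)))); trivial.
    + intros x Hx; apply (Hflow x Hx).
    + smooth. intros; lra.
  - intros j _. apply (C2_of_derive r0 _ (fun r => P j r / mu Lam b r)); trivial.
    + intros x Hx; apply (Hflow x Hx).
    + apply flow_ratio_C1.
Qed.

Lemma flow_mu_derive r : r0 < r ->
  is_derive (mu Lam b) r
    (- 2 * (mu Lam b r * Gam N b r + r ^ 2 * Pi N b r) / r + 2 * mass b r / r ^ 2 - 2 * Lam * r / 3).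
Proof.
  intros Hr. apply mu_derive; [lra|]. rewrite flow_Gam by trivial. apply (Hflow r Hr).
Qed.

(** The second order gauge equation is the derivative of P / mu. The [Gam] term in mu', supplied by
    the mass equation, cancels the lapse friction in P'. *)
Lemma flow_field_equations r : r0 < r -> field_equations N Lam b r.
Proof.
  intros Hr. pose proof (flow_Gam r Hr) as HG.
  destruct (Hflow r Hr) as [Hmu [Hl [Hg [HP [Hm HS]]]]]. rewrite <- HG in HP, Hm, HS.
  split; [|split].
  - apply is_derive_unique, Hm.
  - rewrite (is_derive_unique _ _ _ HS). field. lra.
  - intros j _.
    rewrite (is_derive_unique _ _ _ (Hg j)).
    assert (E : Derive_n (gauge b j) 2 r = Derive (fun r => P j r / mu Lam b r) r).
    { simpl. apply Derive_ext_loc. apply (locally_beyond r0); trivial.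
      intros x Hx. apply is_derive_unique, (Hflow x Hx). }
    rewrite E.
    rewrite (is_derive_unique _ _ _ (is_derive_div _ _ _ _ _ (HP j) (flow_mu_derive r Hr) ltac:(lra))).
    field. split; lra.
Qed.

End Flow.

(** * Compactified radius and asymptotics *)

(* Compactified radius: [s = sigma rh r] runs over [(0, 1)] and [r (1 - s) = rhoS rh s]. *)
Definition sigma (rh r : R) : R := (r - rh) / (1 + (r - rh)).

Definition rhoS (rh s : R) : R := s + rh * (1 - s).

(** This is (1-s)^2 mu at r = rhoS / (1-s). The factor removes the growth of mu at infinity, leaving
    the positive value -Lam/3 at s = 1. *)
Definition AS (Lam rh : R) (m : R -> R) (s : R) : R :=
  (1 - s) ^ 2 - Lam / 3 * rhoS rh s ^ 2 - 2 * m s * (1 - s) ^ 3 / rhoS rh s.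

Definition omS (N : nat) (u : nat -> R -> R) (j : nat) (s : R) : R := vac N j + u j s.

Definition WS (N : nat) (u : nat -> R -> R) (j : nat) (s : R) : R :=
  1 - omS N u j s ^ 2 + / 2 * (omS N u (j - 1) s ^ 2 + omS N u (j + 1) s ^ 2).

Definition PiS (N : nat) (u : nat -> R -> R) (s : R) : R :=
  sum_n_m (fun j => (omS N u j s ^ 2 - omS N u (j - 1) s ^ 2 - INR N - 1 + 2 * INR j) ^ 2) 1 N.

Definition GS (N : nat) (Lam rh : R) (p : nat -> R -> R) (m : R -> R) (s : R) : R :=
  sum_n_m (fun j => (p j s / AS Lam rh m s) ^ 2) 1 (N - 1).

Definition lapse_rate (N : nat) (Lam rh : R) (p : nat -> R -> R) (m : R -> R) (s : R) : R :=
  2 * (1 - s) ^ 3 / rhoS rh s * GS N Lam rh p m s.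

Definition p_rate (N : nat) (Lam rh : R) (u p : nat -> R -> R) (m : R -> R) (j : nat) (s : R) : R :=
  - (lapse_rate N Lam rh p m s * p j s) - WS N u j s * omS N u j s / rhoS rh s ^ 2.

Definition m_rate (N : nat) (Lam rh : R) (u p : nat -> R -> R) (m : R -> R) (s : R) : R :=
  AS Lam rh m s * GS N Lam rh p m s + PiS N u s / (4 * rhoS rh s ^ 2).

(** Infinity, s = 1, is included as a point of continuity, whereas s = 0 is left open: the origin
    and the horizon need different arguments. *)
Definition profile (N : nat) (Lam rh : R) (u p : nat -> R -> R) (m : R -> R) : Prop :=
  (forall s, 0 < s < 1 ->
     0 < AS Lam rh m s /\
     (forall j, is_derive (u j) s (p j s / AS Lam rh m s)) /\
     (forall j, is_derive (p j) s (p_rate N Lam rh u p m j s)) /\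
     is_derive m s (m_rate N Lam rh u p m s)) /\
  (forall s, 0 < s <= 1 ->
     (forall j, continuous (u j) s) /\ (forall j, continuous (p j) s) /\ continuous m s).

(** Only radii beyond [rh] are constrained, so that a black hole may be continued through its
    horizon in any smooth way. Integrating the lapse rate from s = 1 normalises the lapse to 1 at
    infinity. *)
Definition represents (N : nat) (Lam rh : R) (u p : nat -> R -> R) (m : R -> R) (b : background) : Prop :=
  forall r, rh < r ->
    (forall j, gauge b j r = omS N u j (sigma rh r)) /\
    mass b r = m (sigma rh r) /\
    lapse b r = exp (RInt (lapse_rate N Lam rh p m) 1 (sigma rh r)).

Lemma sigma_range rh r : rh < r -> 0 < sigma rh r < 1.
Proof.
  intros H. unfold sigma. split.
  - apply Rdiv_lt_0_compat; lra.
  - apply Rmult_lt_reg_r with (1 + (r - rh)); [lra|]. unfold Rdiv.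
    rewrite Rmult_assoc, Rinv_l by lra. lra.
Qed.

Lemma sigma_compl rh r : rh < r -> 1 - sigma rh r = / (1 + (r - rh)).
Proof. intros H. unfold sigma. field. lra. Qed.

Lemma sigma_rho rh r : rh < r -> rhoS rh (sigma rh r) = r * (1 - sigma rh r).
Proof. intros H. unfold rhoS. rewrite (sigma_compl rh r H). unfold sigma. field. lra. Qed.

Lemma sigma_derive rh r : rh < r -> is_derive (sigma rh) r ((1 - sigma rh r) ^ 2).
Proof.
  intros H. rewrite sigma_compl by trivial. unfold sigma. auto_derive; [lra|]. field. lra.
Qed.

Lemma comp_sigma_derive rh f r f' :
  rh < r -> is_derive f (sigma rh r) f' ->
  is_derive (fun r => f (sigma rh r)) r ((1 - sigma rh r) ^ 2 * f').
Proof. intros Hr Hf. apply (is_derive_comp f (sigma rh)); [exact Hf|apply sigma_derive, Hr]. Qed.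

Lemma rhoS_pos rh s : 0 <= rh -> 0 < s <= 1 -> 0 < rhoS rh s.
Proof. intros H Hs. unfold rhoS. nra. Qed.

Lemma lipschitz_at_one (f f' : R -> R) :
  (forall s, 0 < s <= 1 -> continuous f s) ->
  (forall s, 0 < s < 1 -> is_derive f s (f' s)) ->
  (forall s, 0 < s <= 1 -> continuous f' s) ->
  exists K, 0 <= K /\ forall s, / 2 <= s <= 1 -> Rabs (f s - f 1) <= K * (1 - s).
Proof.
  intros Hc Hd Hc'.
  destruct (continuity_ab_maj (fun s => Rabs (f' s)) (/ 2) 1) as [x [Hx _]]; [lra| |].
  { intros c Hcc. apply continuity_pt_filterlim.
    apply (continuous_comp f' Rabs); [apply Hc'; lra|apply continuous_Rabs]. }
  exists (Rabs (f' x)); split; [apply Rabs_pos|].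
  intros s Hs. destruct (Req_dec s 1) as [->|Hs1].
  { rewrite !Rminus_eq_0, Rabs_R0. lra. }
  apply Rabs_le; split.
  - assert (E : Rabs (f' x) * s - f s <= Rabs (f' x) * 1 - f 1); [|lra].
    apply (nonneg_derive_mono (fun s => Rabs (f' x) * s - f s) (fun s => Rabs (f' x) * 1 - f' s)).
    + lra.
    + intros y Hy. apply cont_minus; [cont|apply Hc; lra].
    + intros y Hy. apply (is_derive_minus (fun s => Rabs (f' x) * s) f); [|apply Hd; lra].
      apply (is_derive_scal (fun s => s)). apply (is_derive_id y).
    + intros y Hy. specialize (Hx y ltac:(lra)). simpl in Hx.
      pose proof (Rle_abs (f' y)). lra.
  - assert (E : f s + Rabs (f' x) * s <= f 1 + Rabs (f' x) * 1); [|lra].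
    apply (nonneg_derive_mono (fun s => f s + Rabs (f' x) * s) (fun s => f' s + Rabs (f' x) * 1)).
    + lra.
    + intros y Hy. apply cont_plus; [apply Hc; lra|cont].
    + intros y Hy. apply (is_derive_plus f (fun s => Rabs (f' x) * s)); [apply Hd; lra|].
      apply (is_derive_scal (fun s => s)). apply (is_derive_id y).
    + intros y Hy. specialize (Hx y ltac:(lra)). simpl in Hx.
      pose proof (Rle_abs (- f' y)). rewrite Rabs_Ropp in *. lra.
Qed.

Lemma quadratic_at_one (f f' : R -> R) (K : R) :
  0 <= K ->
  (forall s, 0 < s <= 1 -> continuous f s) ->
  (forall s, 0 < s < 1 -> is_derive f s (f' s)) ->
  (forall s, / 2 <= s <= 1 -> Rabs (f' s - f' 1) <= K * (1 - s)) ->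
  forall s, / 2 <= s < 1 -> Rabs (f s - f 1 + (1 - s) * f' 1) <= K * (1 - s) ^ 2.
Proof.
  intros HK0 Hc Hd HK s Hs.
  (* At the end points the derivative is replaced by [f' 1], which is itself a value of [f'] on
     [s, 1]; so every case yields a point of that interval. *)
  destruct (MVT_gen f s 1 (fun x => if Rlt_dec x 1 then if Rlt_dec s x then f' x else f' 1 else f' 1)) as [c [Hc1 Hc2]];
    rewrite ?Rmin_left, ?Rmax_right in * by lra.
  - intros x Hx. destruct (Rlt_dec x 1); [|lra]. destruct (Rlt_dec s x); [|lra]. apply Hd; lra.
  - intros x Hx. apply continuity_pt_filterlim. apply (Hc x); lra.
  - assert (E : exists y, s <= y <= 1 /\ f 1 - f s = f' y * (1 - s)).
    { destruct (Rlt_dec c 1); [destruct (Rlt_dec s c)|].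
      - exists c; split; [lra|exact Hc2].
      - exists 1; split; [lra|exact Hc2].
      - exists 1; split; [lra|exact Hc2]. }
    destruct E as [y [Hy E]].
    replace (f s - f 1 + (1 - s) * f' 1) with (- ((1 - s) * (f' y - f' 1))) by lra.
    rewrite Rabs_Ropp, Rabs_mult, (Rabs_pos_eq (1 - s)) by lra.
    specialize (HK y ltac:(lra)).
    assert (K * (1 - y) <= K * (1 - s)) by (apply Rmult_le_compat_l; lra).
    apply Rle_trans with ((1 - s) * (K * (1 - s))); [|right; ring].
    apply Rmult_le_compat_l; lra.
Qed.

Section Profile.

Variables (N : nat) (Lam rh : R) (u p : nat -> R -> R) (m : R -> R) (b : background).
Hypothesis HLam : Lam < 0.
Hypothesis Hrh : 0 <= rh.
Hypothesis Hprof : profile N Lam rh u p m.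
Hypothesis Hrep : represents N Lam rh u p m b.

Lemma AS_pos s : 0 < s <= 1 -> 0 < AS Lam rh m s.
Proof.
  intros Hs. destruct (Req_dec s 1) as [->|Hs1].
  - unfold AS, rhoS. replace (1 - 1) with 0 by ring. simpl. unfold Rdiv. rewrite !Rmult_0_l, !Rmult_0_r.
    rewrite Rmult_0_l. nra.
  - apply Hprof; lra.
Qed.

Lemma rhoS_cont s : continuous (rhoS rh) s.
Proof. unfold rhoS; cont. Qed.

Lemma AS_cont s : 0 < s <= 1 -> continuous (AS Lam rh m) s.
Proof.
  intros Hs. destruct Hprof as [_ Hc]. destruct (Hc s Hs) as [_ [_ Hm]].
  pose proof (rhoS_cont s). pose proof (rhoS_pos rh s Hrh Hs).
  unfold AS. cont; lra.
Qed.

Lemma GS_cont s : 0 < s <= 1 -> continuous (GS N Lam rh p m) s.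
Proof.
  intros Hs. destruct Hprof as [_ Hc]. destruct (Hc s Hs) as [_ [Hp _]].
  pose proof (AS_cont s Hs). pose proof (AS_pos s Hs).
  unfold GS. cont; [apply Hp|lra].
Qed.

Lemma lapse_rate_cont s : 0 < s <= 1 -> continuous (lapse_rate N Lam rh p m) s.
Proof.
  intros Hs. pose proof (GS_cont s Hs). pose proof (rhoS_cont s). pose proof (rhoS_pos rh s Hrh Hs).
  unfold lapse_rate. cont; lra.
Qed.

Lemma omS_cont j s : 0 < s <= 1 -> continuous (omS N u j) s.
Proof.
  intros Hs. destruct Hprof as [_ Hc]. destruct (Hc s Hs) as [Hu _].
  unfold omS. cont. apply Hu.
Qed.

Lemma p_rate_cont j s : 0 < s <= 1 -> continuous (p_rate N Lam rh u p m j) s.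
Proof.
  intros Hs. destruct Hprof as [_ Hc]. destruct (Hc s Hs) as [_ [Hp _]].
  pose proof (lapse_rate_cont s Hs). pose proof (rhoS_cont s). pose proof (rhoS_pos rh s Hrh Hs).
  pose proof (Hp j). pose proof (omS_cont j s Hs). pose proof (omS_cont (j - 1) s Hs).
  pose proof (omS_cont (j + 1) s Hs).
  unfold p_rate, WS. cont. apply pow_nonzero; lra.
Qed.

Lemma m_rate_cont s : 0 < s <= 1 -> continuous (m_rate N Lam rh u p m) s.
Proof.
  intros Hs. pose proof (rhoS_cont s). pose proof (rhoS_pos rh s Hrh Hs).
  pose proof (AS_cont s Hs). pose proof (GS_cont s Hs).
  unfold m_rate, PiS. cont; try apply omS_cont; trivial.
  apply Rmult_integral_contrapositive_currified; [lra|apply pow_nonzero; lra].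
Qed.

Lemma lapse_rate_nonneg s : 0 < s <= 1 -> 0 <= lapse_rate N Lam rh p m s.
Proof.
  intros Hs. pose proof (rhoS_pos rh s Hrh Hs). unfold lapse_rate, Rdiv.
  assert (0 <= (1 - s) ^ 3) by (apply pow_le; lra).
  apply Rmult_le_pos; [apply Rmult_le_pos; [lra|left; apply Rinv_0_lt_compat; trivial]|].
  apply sumR_nonneg. intros; apply pow2_ge_0.
Qed.

Lemma lapse_near_one : exists K, 0 <= K /\ forall s, / 2 <= s < 1 ->
  Rabs (exp (RInt (lapse_rate N Lam rh p m) 1 s) - 1) <= K * (1 - s).
Proof.
  destruct (continuity_ab_maj (lapse_rate N Lam rh p m) (/ 2) 1) as [x [Hx Hx2]]; [lra| |].
  { intros c Hc. apply continuity_pt_filterlim. apply lapse_rate_cont; lra. }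
  exists (lapse_rate N Lam rh p m x). split; [apply lapse_rate_nonneg; lra|].
  intros s Hs.
  assert (Hex : ex_RInt (lapse_rate N Lam rh p m) s 1).
  { apply (ex_RInt_continuous (lapse_rate N Lam rh p m)). intros z Hz.
    rewrite Rmin_left, Rmax_right in Hz by lra. apply lapse_rate_cont; lra. }
  rewrite <- (opp_RInt_swap (lapse_rate N Lam rh p m)) by exact Hex.
  unfold opp; simpl.
  assert (A : 0 <= RInt (lapse_rate N Lam rh p m) s 1).
  { apply RInt_ge_0; trivial; [lra|]. intros; apply lapse_rate_nonneg; lra. }
  assert (B : RInt (lapse_rate N Lam rh p m) s 1 <= (1 - s) * lapse_rate N Lam rh p m x).
  { apply Rle_trans with (RInt (fun _ => lapse_rate N Lam rh p m x) s 1).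
    - apply RInt_le; trivial; [lra|apply ex_RInt_const|]. intros y Hy. apply Hx; lra.
    - rewrite RInt_const. right; reflexivity. }
  set (I := RInt _ s 1) in *. pose proof (exp_ineq1_le (- I)).
  assert (exp (- I) <= 1) by (rewrite <- exp_0; destruct (Req_dec I 0) as [->|]; [rewrite Ropp_0; lra|left; apply exp_increasing; lra]).
  apply Rabs_le; lra.
Qed.

Lemma lapse_rate_derive s : 0 < s < 1 ->
  is_derive (fun s => RInt (lapse_rate N Lam rh p m) 1 s) s (lapse_rate N Lam rh p m s).
Proof.
  intros Hs. apply (is_derive_RInt (lapse_rate N Lam rh p m) _ 1).
  - assert (Hm : 0 < Rmin s (1 - s)) by (apply Rmin_pos; lra).
    exists (mkposreal _ Hm). intros x Hx. change (Rabs (x - s) < Rmin s (1 - s)) in Hx.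
    pose proof (Rmin_l s (1 - s)). pose proof (Rmin_r s (1 - s)). apply Rabs_def2 in Hx.
    apply (RInt_correct (lapse_rate N Lam rh p m)).
    apply (ex_RInt_continuous (lapse_rate N Lam rh p m)).
    intros z Hz. rewrite Rmin_right, Rmax_left in Hz by lra. apply lapse_rate_cont; lra.
  - apply lapse_rate_cont; lra.
Qed.

Lemma mu_sigma r : rh < r ->
  mu Lam b r = AS Lam rh m (sigma rh r) / (1 - sigma rh r) ^ 2.
Proof.
  intros Hr. destruct (Hrep r Hr) as [_ [Hm _]].
  pose proof (sigma_range rh r Hr). unfold mu, AS. rewrite Hm, sigma_rho by trivial.
  field. lra.
Qed.

(** The chain rule with dsigma/dr = (1-s)^2. Since mu is AS / (1-s)^2, the sum of squares of omega'
    acquires the factor (1-s)^4. *)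
Lemma profile_flow : flow N Lam rh b (fun j r => p j (sigma rh r)).
Proof.
  intros r Hr. pose proof (sigma_range rh r Hr) as Hs.
  pose proof (sigma_rho rh r Hr) as Hrho.
  destruct (proj1 Hprof _ Hs) as [HA [Hu [Hp Hm]]].
  destruct (Hrep r Hr) as [Eg [Em El]].
  pose proof (mu_sigma r Hr) as Hmu.
  set (s := sigma rh r) in *.
  assert (Hs2 : 0 < (1 - s) ^ 2) by (apply pow_lt; lra).
  assert (Hmupos : 0 < mu Lam b r) by (rewrite Hmu; apply Rdiv_lt_0_compat; trivial).
  assert (HG : sum_n_m (fun i => (p i s / mu Lam b r) ^ 2) 1 (N - 1) = (1 - s) ^ 4 * GS N Lam rh p m s).
  { unfold GS. rewrite <- sumR_scal. apply sumR_ext. intros i _. rewrite Hmu. field. split; lra. }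
  assert (Hloc : forall (f g : R -> R) l, (forall r, rh < r -> f r = g r) ->
     is_derive f r l -> is_derive g r l).
  { intros f g l Hfg. apply is_derive_ext_loc. apply (locally_beyond rh); trivial. }
  split; [exact Hmupos|]. split; [|split; [|split; [|split]]].
  - rewrite El. apply exp_pos.
  - intros j. apply (Hloc (fun r => omS N u j (sigma rh r))).
    { intros x Hx. symmetry. apply (Hrep x Hx). }
    replace (p j s / mu Lam b r) with ((1 - s) ^ 2 * (0 + p j s / AS Lam rh m s))
      by (rewrite Hmu; field; split; lra).
    apply comp_sigma_derive; trivial. unfold omS.
    apply (is_derive_plus (fun _ => vac N j) (u j)); [apply (is_derive_const (vac N j))|apply Hu].
  - intros j. rewrite HG.
    replace (- (2 / r * ((1 - s) ^ 4 * GS N Lam rh p m s) * p j s) - W b j r * gauge b j r / r ^ 2)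
      with ((1 - s) ^ 2 * p_rate N Lam rh u p m j s).
    { apply (comp_sigma_derive rh (p j)); [trivial|apply Hp]. }
    unfold p_rate, lapse_rate. rewrite Hrho. unfold W, WS. rewrite !Eg. fold s. field. split; lra.
  - rewrite HG.
    apply (Hloc (fun r => m (sigma rh r))).
    { intros x Hx. symmetry. apply (Hrep x Hx). }
    replace (mu Lam b r * ((1 - s) ^ 4 * GS N Lam rh p m s) + r ^ 2 * Pi N b r)
      with ((1 - s) ^ 2 * m_rate N Lam rh u p m s).
    { apply comp_sigma_derive; trivial. }
    unfold m_rate, Pi. rewrite Hmu, Hrho.
    replace (sum_n_m _ 1 N) with (PiS N u s).
    2:{ apply sumR_ext. intros j _. rewrite !Eg. reflexivity. }
    field. split; lra.
  - rewrite HG.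
    apply (Hloc (fun r => exp (RInt (lapse_rate N Lam rh p m) 1 (sigma rh r)))).
    { intros x Hx. symmetry. apply (Hrep x Hx). }
    rewrite El.
    replace (exp (RInt (lapse_rate N Lam rh p m) 1 s) * (2 / r * ((1 - s) ^ 4 * GS N Lam rh p m s)))
      with ((1 - s) ^ 2 * (lapse_rate N Lam rh p m s * exp (RInt (lapse_rate N Lam rh p m) 1 s))).
    2:{ unfold lapse_rate at 1. rewrite Hrho. field. split; lra. }
    apply (comp_sigma_derive rh (fun s => exp (RInt (lapse_rate N Lam rh p m) 1 s))); trivial.
    apply (is_derive_comp exp (fun s => RInt (lapse_rate N Lam rh p m) 1 s)).
    + apply is_derive_exp.
    + apply lapse_rate_derive, Hs.
Qed.

Definition AS' (s : R) : R :=
  - 2 * (1 - s) - Lam / 3 * (2 * rhoS rh s * (1 - rh))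
  - (2 * m_rate N Lam rh u p m s * (1 - s) ^ 3 / rhoS rh s
     - 2 * m s * 3 * (1 - s) ^ 2 / rhoS rh s
     - 2 * m s * (1 - s) ^ 3 * (1 - rh) / rhoS rh s ^ 2).

Lemma AS_derive s : 0 < s < 1 -> is_derive (AS Lam rh m) s (AS' s).
Proof.
  intros Hs. destruct (proj1 Hprof s Hs) as [_ [_ [_ Hm]]].
  pose proof (rhoS_pos rh s Hrh ltac:(lra)) as Hr.
  assert (Hd : is_derive (rhoS rh) s (1 - rh)) by (unfold rhoS; auto_derive; trivial; ring).
  assert (E : is_derive (fun s => 2 * m s * (1 - s) ^ 3 / rhoS rh s) s
    (((2 * m_rate N Lam rh u p m s * (1 - s) ^ 3 + 2 * m s * (- 3 * (1 - s) ^ 2)) * rhoS rh s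
      - 2 * m s * (1 - s) ^ 3 * (1 - rh)) / rhoS rh s ^ 2)).
  { apply (is_derive_div (fun s => 2 * m s * (1 - s) ^ 3) (rhoS rh)); trivial; [|lra].
    apply (is_derive_mult (fun s => 2 * m s) (fun s => (1 - s) ^ 3)).
    - apply (is_derive_scal m), Hm.
    - auto_derive; trivial. ring.
    - intros; apply Rmult_comm. }
  assert (E2 : is_derive (fun s => (1 - s) ^ 2 - Lam / 3 * rhoS rh s ^ 2) s
     (- 2 * (1 - s) - Lam / 3 * (2 * rhoS rh s * (1 - rh)))).
  { unfold rhoS. auto_derive; trivial. ring. }
  replace (AS' s) with ((- 2 * (1 - s) - Lam / 3 * (2 * rhoS rh s * (1 - rh)))
    - (((2 * m_rate N Lam rh u p m s * (1 - s) ^ 3 + 2 * m s * (- 3 * (1 - s) ^ 2)) * rhoS rh s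
      - 2 * m s * (1 - s) ^ 3 * (1 - rh)) / rhoS rh s ^ 2)).
  2:{ unfold AS'. field. lra. }
  apply (is_derive_minus (fun s => (1 - s) ^ 2 - Lam / 3 * rhoS rh s ^ 2)
    (fun s => 2 * m s * (1 - s) ^ 3 / rhoS rh s)); trivial.
Qed.

(** The ratio is du_j/ds. Its Lipschitz bound at s = 1 is what makes the remainder of the expansion
    of omega_j at infinity quadratic. *)
Lemma ratio_lipschitz j : exists K, 0 <= K /\ forall s, / 2 <= s <= 1 ->
  Rabs (p j s / AS Lam rh m s - p j 1 / AS Lam rh m 1) <= K * (1 - s).
Proof.
  apply (lipschitz_at_one (fun s => p j s / AS Lam rh m s)
    (fun s => (p_rate N Lam rh u p m j s * AS Lam rh m s - p j s * AS' s) / AS Lam rh m s ^ 2)).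
  - intros s Hs. pose proof (AS_pos s Hs). apply cont_div; [|apply AS_cont, Hs|lra].
    apply (proj2 Hprof s Hs).
  - intros s Hs. pose proof (AS_pos s ltac:(lra)).
    apply is_derive_div; [apply (proj1 Hprof s Hs)|apply AS_derive, Hs|lra].
  - intros s Hs. pose proof (AS_pos s Hs). pose proof (AS_cont s Hs). pose proof (p_rate_cont j s Hs).
    pose proof (m_rate_cont s Hs). pose proof (rhoS_cont s). pose proof (rhoS_pos rh s Hrh Hs).
    destruct (proj2 Hprof s Hs) as [_ [Hp Hm]]. pose proof (Hp j).
    unfold AS'. cont; try (apply pow_nonzero); lra.
Qed.

(** The threshold makes 1 + r - rh at least 2 and at least r/2. The last estimate says that 1 - s is
    1/r up to order 1/r^2, so expansions in 1 - s become expansions in 1/r. *)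
Lemma sigma_far r : 2 * rh + 2 < r ->
  / 2 <= sigma rh r < 1 /\ 0 < 1 - sigma rh r <= 2 / r /\
  Rabs ((1 - sigma rh r) - / r) <= 2 * (1 + rh) * / r ^ 2.
Proof.
  intros Hr. assert (Hr' : rh < r) by lra.
  pose proof (sigma_range rh r Hr') as Hs. pose proof (sigma_compl rh r Hr') as E.
  assert (E2 : 1 - sigma rh r <= 2 / r).
  { rewrite E. apply Rmult_le_reg_r with (r * (1 + (r - rh))); [nra|].
    replace (/ (1 + (r - rh)) * (r * (1 + (r - rh)))) with r by (field; lra).
    replace (2 / r * (r * (1 + (r - rh)))) with (2 * (1 + (r - rh))) by (field; lra). lra. }
  repeat split; try lra.
  - assert (1 - sigma rh r <= / 2); [|lra].
    rewrite E. apply Rinv_le_contravar; lra.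
  - rewrite E.
    replace (/ (1 + (r - rh)) - / r) with ((rh - 1) * (/ (1 + (r - rh)) * / r)) by (field; lra).
    rewrite Rabs_mult. rewrite <- E at 1.
    assert (0 < / r) by (apply Rinv_0_lt_compat; lra).
    rewrite (Rabs_pos_eq (_ * / r)) by (apply Rmult_le_pos; lra).
    replace (2 * (1 + rh) * / r ^ 2) with ((1 + rh) * (2 / r * / r)) by (field; lra).
    apply Rmult_le_compat; [apply Rabs_pos|apply Rmult_le_pos; lra| |].
    + apply Rabs_le; lra.
    + apply Rmult_le_compat_r; lra.
Qed.

Lemma profile_asymptotics : asymptotics N b.
Proof.
  split; [|split].
  - destruct (lipschitz_at_one m (m_rate N Lam rh u p m)) as [K [HK HL]].
    { intros s Hs; apply (proj2 Hprof s Hs). }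
    { intros s Hs; apply (proj1 Hprof s Hs). }
    { apply m_rate_cont. }
    exists (m 1), (K * 2), (2 * rh + 2). intros r Hr.
    destruct (sigma_far r Hr) as [Hs [Hs2 _]].
    destruct (Hrep r ltac:(lra)) as [_ [-> _]].
    rewrite (Rabs_pos_eq (/ r)) by (left; apply Rinv_0_lt_compat; lra).
    apply Rle_trans with (1 := HL (sigma rh r) ltac:(lra)).
    rewrite Rmult_assoc. apply Rmult_le_compat_l; [exact HK|apply Hs2].
  - destruct lapse_near_one as [K [HK HL]].
    exists (K * 2), (2 * rh + 2). intros r Hr.
    destruct (sigma_far r Hr) as [Hs [Hs2 _]].
    destruct (Hrep r ltac:(lra)) as [_ [_ ->]].
    rewrite (Rabs_pos_eq (/ r)) by (left; apply Rinv_0_lt_compat; lra).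
    apply Rle_trans with (1 := HL (sigma rh r) ltac:(lra)).
    rewrite Rmult_assoc. apply Rmult_le_compat_l; [exact HK|apply Hs2].
  - intros j _. destruct (ratio_lipschitz j) as [K [HK HL]].
    (* The coefficient c_j is minus the s-derivative at s = 1, because s - 1 behaves like -1/r. *)
    exists (omS N u j 1), (- (p j 1 / AS Lam rh m 1)).
    set (g := p j 1 / AS Lam rh m 1).
    exists (K * 4 + Rabs g * (2 * (1 + rh))), (2 * rh + 2). intros r Hr.
    destruct (sigma_far r Hr) as [Hs [Hs2 Hs3]].
    destruct (Hrep r ltac:(lra)) as [-> _].
    assert (Hi : 0 < / r) by (apply Rinv_0_lt_compat; lra).
    assert (Q : Rabs (u j (sigma rh r) - u j 1 + (1 - sigma rh r) * g) <= K * (1 - sigma rh r) ^ 2).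
    { apply (quadratic_at_one (u j) (fun s => p j s / AS Lam rh m s)); trivial.
      - intros s Hss; apply (proj2 Hprof s Hss).
      - intros s Hss; apply (proj1 Hprof s Hss). }
    unfold omS.
    replace (vac N j + u j (sigma rh r) - (vac N j + u j 1) - - g / r)
      with ((u j (sigma rh r) - u j 1 + (1 - sigma rh r) * g) - g * ((1 - sigma rh r) - / r))
      by (field; lra).
    apply Rle_trans with (1 := Rabs_triang _ _). rewrite Rabs_Ropp, Rabs_mult.
    rewrite (Rabs_pos_eq (/ r ^ 2)) by (left; apply Rinv_0_lt_compat, pow_lt; lra).
    rewrite Rmult_plus_distr_r. apply Rplus_le_compat.
    + apply Rle_trans with (1 := Q). rewrite Rmult_assoc. apply Rmult_le_compat_l; [exact HK|].
      replace (4 * / r ^ 2) with ((2 / r) ^ 2) by (field; lra).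
      apply pow_incr; lra.
    + rewrite Rmult_assoc. apply Rmult_le_compat_l; [apply Rabs_pos|exact Hs3].
Qed.

End Profile.

(** * Discrete inequalities *)

Lemma sumR_cauchy (a b : nat -> R) (n m : nat) :
  sum_n_m (fun j => a j * b j) n m ^ 2 <=
  sum_n_m (fun j => a j ^ 2) n m * sum_n_m (fun j => b j ^ 2) n m.
Proof.
  set (A := sum_n_m (fun j => a j ^ 2) n m). set (B := sum_n_m (fun j => b j ^ 2) n m).
  set (S := sum_n_m (fun j => a j * b j) n m).
  assert (HA : 0 <= A) by (apply sumR_nonneg; intros; apply pow2_ge_0).
  destruct (Req_dec A 0) as [HA0|HA0].
  - assert (HS : S = 0).
    { apply sumR_zero. intros j Hj.
      assert (a j ^ 2 <= A) by (apply (sumR_term_le (fun j => a j ^ 2)); trivial; intros; apply pow2_ge_0).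
      pose proof (pow2_ge_0 (a j)). assert (a j = 0) as -> by nra. ring. }
    rewrite HS, HA0. simpl. lra.
  - assert (H : 0 <= sum_n_m (fun j => (A * b j - S * a j) ^ 2) n m)
      by (apply sumR_nonneg; intros; apply pow2_ge_0).
    rewrite (sumR_ext _ (fun j => A ^ 2 * b j ^ 2 + ((- 2 * A * S) * (a j * b j) + S ^ 2 * a j ^ 2))) in H
      by (intros; ring).
    rewrite !sumR_plus, !sumR_scal in H. fold A B S in H.
    assert (0 <= A * (A * B - S ^ 2)) by lra.
    assert (0 < A) by lra. nra.
Qed.

Definition guard (c : bool) (x : R) : R := if c then x else 0.

Lemma sum_kron_l (f : nat -> R) (i a b : nat) :
  sum_n_m (fun k => kron i k * f k) a b
  = guard (andb (Nat.leb a i) (Nat.leb i b)) (f i).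
Proof.
  unfold guard.
  destruct (Nat.leb_spec a i) as [Ha|Ha]; destruct (Nat.leb_spec i b) as [Hb|Hb]; simpl.
  2-4: apply sumR_zero; intros j Hj; unfold kron; destruct (Nat.eqb_spec i j); [lia|ring].
  induction Hb as [|b Hb IH].
  - destruct i as [|i].
    + replace a with 0%nat by lia. rewrite sum_n_n. unfold kron; simpl; ring.
    + rewrite sumR_S by lia. rewrite sumR_zero.
      * unfold kron. rewrite Nat.eqb_refl. ring.
      * intros j Hj. unfold kron. destruct (Nat.eqb_spec (S i) j); [lia|ring].
  - rewrite sumR_S, IH by lia. unfold kron. destruct (Nat.eqb_spec i (S b)); [lia|ring].
Qed.

Lemma sum_kron_succ (f : nat -> R) (i a b : nat) :
  (1 <= i)%nat ->
  sum_n_m (fun k => kron i (k + 1) * f k) a b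
  = guard (andb (Nat.leb a (i - 1)) (Nat.leb (i - 1) b)) (f (i - 1)%nat).
Proof.
  intros Hi. rewrite <- (sum_kron_l f (i - 1) a b). apply sumR_ext. intros j _.
  f_equal. unfold kron. destruct (Nat.eqb_spec i (j + 1)); destruct (Nat.eqb_spec (i - 1) j); trivial; lia.
Qed.

(** Summation by parts for a weighted discrete Laplacian, with the right boundary term kept. It is
    used with constant weights for the gravitational potential and with weights v_j^2 for the
    sphaleronic one. *)
Lemma dirichlet_form (c y : nat -> R) (n : nat) :
  c 0%nat * y 0%nat = 0 ->
  sum_n_m (fun j => y j * ((c (j - 1)%nat + c j) * y j - c j * y (j + 1)%nat
     - c (j - 1)%nat * y (j - 1)%nat)) 1 n
  = sum_n_m (fun j => c (j - 1)%nat * (y j - y (j - 1)%nat) ^ 2) 1 n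
    + c n * y n * (y n - y (n + 1)%nat).
Proof.
  intros H0. induction n as [|n IH].
  - rewrite !sumR_empty by lia. rewrite H0. Rring.
  - rewrite !sumR_S by lia. rewrite IH.
    replace (S n - 1)%nat with n by lia. replace (n + 1)%nat with (S n) by lia. Rring.
Qed.

(** Cauchy-Schwarz for the telescoping sum of differences, proved by induction with a weighted
    arithmetic-geometric mean inequality at each step. *)
Lemma discrete_poincare (y : nat -> R) (n : nat) :
  y 0%nat = 0 -> y n ^ 2 <= INR n * sum_n_m (fun j => (y j - y (j - 1)%nat) ^ 2) 1 n.
Proof.
  intros H0. induction n as [|n IH].
  - rewrite H0. simpl. lra.
  - rewrite sumR_S by lia. replace (S n - 1)%nat with n by lia.
    set (T := sum_n_m _ 1 n) in *. rewrite S_INR.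
    assert (HT : 0 <= T) by (apply sumR_nonneg; intros; apply pow2_ge_0).
    pose proof (pos_INR n) as Hn. set (d := y (S n) - y n).
    replace (y (S n)) with (y n + d) by (unfold d; ring).
    destruct n as [|n].
    + rewrite H0. simpl INR. nra.
    + set (k := INR (S n)) in *. assert (1 <= k) by (unfold k; rewrite S_INR; pose proof (pos_INR n); lra).

      (* 2 y d <= y^2 / k + k d^2 *)
      assert (E : 2 * y (S n) * d <= y (S n) ^ 2 / k + k * d ^ 2).
      { apply Rmult_le_reg_r with k; [lra|].
        replace ((y (S n) ^ 2 / k + k * d ^ 2) * k) with (y (S n) ^ 2 + k ^ 2 * d ^ 2) by (field; lra).
        pose proof (pow2_ge_0 (y (S n) - k * d)). nra. }
      assert (E2 : y (S n) ^ 2 / k <= T).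
      { apply Rmult_le_reg_r with k; [lra|]. unfold Rdiv. rewrite Rmult_assoc, Rinv_l by lra. lra. }
      nra.
Qed.

(** A crude spectral gap 1/N^2 for the Dirichlet Laplacian: each y_j^2 is at most N times the
    Dirichlet sum, and there are fewer than N of them. *)
Lemma dirichlet_lower_bound (N : nat) (y : nat -> R) :
  (1 <= N)%nat -> y 0%nat = 0 -> y N = 0 ->
  sum_n_m (fun j => y j ^ 2) 1 (N - 1) <=
  INR N ^ 2 * sum_n_m (fun j => y j * (2 * y j - y (j + 1)%nat - y (j - 1)%nat)) 1 (N - 1).
Proof.
  intros HN H0 HyN.
  rewrite (sumR_ext (fun j => y j * (2 * y j - y (j + 1)%nat - y (j - 1)%nat))
    (fun j => y j * ((1 + 1) * y j - 1 * y (j + 1)%nat - 1 * y (j - 1)%nat))) by (intros; ring).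
  rewrite (dirichlet_form (fun _ => 1) y (N - 1)) by (rewrite H0; ring).
  replace (N - 1 + 1)%nat with N by lia. rewrite HyN.
  set (Q := sum_n_m (fun j => 1 * (y j - y (j - 1)%nat) ^ 2) 1 (N - 1)).
  assert (HQ : 0 <= Q) by (apply sumR_nonneg; intros; pose proof (pow2_ge_0 (y j - y (j - 1)%nat)); lra).
  assert (Hq : forall j, (1 <= j <= N - 1)%nat -> y j ^ 2 <= INR N * Q).
  { intros j Hj. apply Rle_trans with (1 := discrete_poincare y j H0).
    apply Rmult_le_compat; [apply pos_INR|apply sumR_nonneg; intros; apply pow2_ge_0|apply le_INR; lia|].
    unfold Q. rewrite (sum_n_m_Chasles _ 1 j (N - 1)) by lia. unfold plus; simpl.
    assert (0 <= sum_n_m (fun j => 1 * (y j - y (j - 1)%nat) ^ 2) (S j) (N - 1))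
      by (apply sumR_nonneg; intros i _; pose proof (pow2_ge_0 (y i - y (i - 1)%nat)); lra).
    rewrite (sumR_ext (fun j => (y j - y (j - 1)%nat) ^ 2) (fun j => 1 * (y j - y (j - 1)%nat) ^ 2)) by (intros; ring).
    simpl in *. lra. }
  apply Rle_trans with (sum_n_m (fun _ => INR N * Q) 1 (N - 1)); [apply sumR_le, Hq|].
  rewrite sum_n_m_const. replace (S (N - 1) - 1)%nat with (N - 1)%nat by lia.
  rewrite minus_INR by lia. simpl INR. pose proof (pos_INR N).
  assert (0 <= INR N * Q) by (apply Rmult_le_pos; trivial).
  pose proof (pow2_ge_0 (y (N - 1)%nat)). pose proof (pow2_ge_0 (INR N)).
  assert (0 <= INR N ^ 2 * y (N - 1)%nat ^ 2) by (apply Rmult_le_pos; trivial). nra.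
Qed.

(** * Vanishing of modes by convexity in the tortoise coordinate *)

Lemma derive_pos_right (g : R -> R) (c l : R) :
  is_derive g c l -> 0 < l -> exists d, 0 < d /\ forall x, c < x < c + d -> g c < g x.
Proof.
  intros Hg Hl. apply is_derive_Reals in Hg.
  destruct (Hg l Hl) as [d Hd]. exists d; split; [apply cond_pos|].
  intros x Hx. specialize (Hd (x - c) ltac:(lra)).
  rewrite Rabs_pos_eq in Hd by lra. specialize (Hd ltac:(lra)).
  replace (c + (x - c)) with x in Hd by ring. apply Rabs_def2 in Hd.
  assert (0 < (g x - g c) / (x - c)) by lra.
  assert (g x - g c = (g x - g c) / (x - c) * (x - c)) by (field; lra). nra.
Qed.

(** Weak monotonicity holds on both halves; positivity of the derivative at the midpoint supplies
    the strict increase. *)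
Lemma pos_derive_incr (f f' : R -> R) (a b : R) :
  a < b -> (forall x, a <= x <= b -> continuous f x) ->
  (forall x, a < x < b -> is_derive f x (f' x)) ->
  (forall x, a < x < b -> 0 < f' x) -> f a < f b.
Proof.
  intros Hab Hc Hd Hp.
  assert (H1 : f a <= f ((a + b) / 2)).
  { apply (nonneg_derive_mono f f'); [lra|intros; apply Hc; lra|intros; apply Hd; lra|].
    intros; left; apply Hp; lra. }
  assert (H2 : f ((a + b) / 2) <= f b).
  { apply (nonneg_derive_mono f f'); [lra|intros; apply Hc; lra|intros; apply Hd; lra|].
    intros; left; apply Hp; lra. }
  destruct (derive_pos_right f ((a + b) / 2) _ (Hd ((a + b) / 2) ltac:(lra)) (Hp ((a + b) / 2) ltac:(lra))) as [d [Hd0 Hd1]].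
  set (x := (a + b) / 2 + Rmin (d / 2) ((b - a) / 4)).
  assert (Hm : 0 < Rmin (d / 2) ((b - a) / 4)) by (apply Rmin_pos; lra).
  pose proof (Rmin_l (d / 2) ((b - a) / 4)). pose proof (Rmin_r (d / 2) ((b - a) / 4)).
  assert (f ((a + b) / 2) < f x) by (apply Hd1; unfold x; lra).
  assert (f x <= f b).
  { apply (nonneg_derive_mono f f'); [unfold x; lra|intros y Hy; apply Hc; unfold x in Hy; lra|intros y Hy; apply Hd; unfold x in Hy; lra|].
    intros y Hy; left; apply Hp; unfold x in Hy; lra. }
  lra.
Qed.

Section TortoiseForm.

Variables (n : nat) (Lam r0 : R) (b : background) (y : nat -> R -> R).
Hypothesis Hpos : forall r, r0 < r -> 0 < mu Lam b r * lapse b r.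
Hypothesis Hy : forall j, (1 <= j <= n)%nat -> twice_diff Lam r0 b (y j).

Definition norm2 (r : R) : R := sum_n_m (fun j => y j r ^ 2) 1 n.
(** Half of the tortoise derivative of [norm2]. Working with it avoids introducing the tortoise
    coordinate as an actual function. *)
Definition flux (r : R) : R := sum_n_m (fun j => y j r * dstar Lam b (y j) r) 1 n.

Lemma mu_lapse_neq r : r0 < r -> lapse b r <> 0 /\ mu Lam b r <> 0.
Proof.
  intros Hr. pose proof (Hpos r Hr) as H.
  split; intros E; rewrite E in H; rewrite ?Rmult_0_l, ?Rmult_0_r in H; lra.
Qed.

Lemma norm2_nonneg r : 0 <= norm2 r.
Proof. apply sumR_nonneg; intros; apply pow2_ge_0. Qed.

Lemma norm2_pos j r : (1 <= j <= n)%nat -> y j r <> 0 -> 0 < norm2 r.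
Proof.
  intros Hj H. apply Rlt_le_trans with (y j r ^ 2); [nra|].
  apply (sumR_term_le (fun j => y j r ^ 2)); trivial. intros; apply pow2_ge_0.
Qed.

Lemma norm2_zero r j : norm2 r = 0 -> (1 <= j <= n)%nat -> y j r = 0.
Proof.
  intros H Hj. destruct (Req_dec (y j r) 0); trivial.
  pose proof (norm2_pos j r Hj H0). lra.
Qed.

Lemma norm2_derive r : r0 < r ->
  is_derive norm2 r (2 * flux r / (mu Lam b r * lapse b r)).
Proof.
  intros Hr. pose proof (Hpos r Hr).
  replace (2 * flux r / (mu Lam b r * lapse b r))
    with (sum_n_m (fun j => 2 * y j r * Derive (y j) r) 1 n).
  2:{ unfold flux, dstar, Rdiv. rewrite Rmult_comm, <- sumR_scal, <- sumR_scal.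
      apply sumR_ext. intros. field. apply mu_lapse_neq, Hr. }
  apply (is_derive_sum (fun j r => y j r ^ 2) (fun j r => 2 * y j r * Derive (y j) r)).
  intros j Hj. destruct (Hy j Hj r Hr) as [Hd _]. apply Derive_correct in Hd.
  replace (2 * y j r * Derive (y j) r) with (INR 2 * Derive (y j) r * y j r ^ Init.Nat.pred 2) by (simpl; ring).
  apply (is_derive_pow (y j) 2), Hd.
Qed.

Lemma flux_derive r : r0 < r ->
  is_derive flux r
    ((sum_n_m (fun j => dstar Lam b (y j) r ^ 2) 1 n
      + sum_n_m (fun j => y j r * dstar Lam b (dstar Lam b (y j)) r) 1 n)
     / (mu Lam b r * lapse b r)).
Proof.
  intros Hr. pose proof (Hpos r Hr).
  replace (_ / _) with (sum_n_m (fun j => Derive (y j) r * dstar Lam b (y j) r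
    + y j r * Derive (dstar Lam b (y j)) r) 1 n).
  2:{ rewrite <- sumR_plus. unfold Rdiv. rewrite Rmult_comm, <- sumR_scal.
      apply sumR_ext. intros j _. destruct (mu_lapse_neq r Hr).
      set (Y := dstar Lam b (y j)).
      replace (dstar Lam b Y r) with (mu Lam b r * lapse b r * Derive Y r) by reflexivity.
      replace (Y r) with (mu Lam b r * lapse b r * Derive (y j) r) by reflexivity.
      field. split; trivial. }
  apply (is_derive_sum (fun j r => y j r * dstar Lam b (y j) r)
    (fun j r => Derive (y j) r * dstar Lam b (y j) r + y j r * Derive (dstar Lam b (y j)) r)).
  intros j Hj. destruct (Hy j Hj r Hr) as [Hd Hd2].
  apply (is_derive_mult (y j) (dstar Lam b (y j))); [apply Derive_correct, Hd|apply Derive_correct, Hd2|].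
  intros; apply Rmult_comm.
Qed.

Lemma norm2_cont r : r0 < r -> continuous norm2 r.
Proof. intros Hr. apply (ex_derive_continuous norm2). eexists; apply norm2_derive, Hr. Qed.

Lemma flux_cont r : r0 < r -> continuous flux r.
Proof. intros Hr. apply (ex_derive_continuous flux). eexists; apply flux_derive, Hr. Qed.

Lemma norm2_vanishes (F : (R -> Prop) -> Prop) {FF : Filter F} :
  (forall j, (1 <= j <= n)%nat -> filterlim (y j) F (locally 0)) ->
  filterlim norm2 F (locally 0).
Proof.
  intros H. unfold norm2. clear Hy.
  induction n as [|k IH].
  - apply (filterlim_ext (fun _ => 0)); [|apply filterlim_const].
    intros x. rewrite sumR_empty by lia. reflexivity.
  - apply (filterlim_ext (fun r => sum_n_m (fun j => y j r ^ 2) 1 k + y (S k) r * y (S k) r)).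
    { intros x. rewrite sumR_S by lia. Rring. }
    replace 0 with (0 + 0 * 0) by ring.
    apply (filterlim_comp_2 (G := locally 0) (H := locally (0 * 0))
      (fun r => sum_n_m (fun j => y j r ^ 2) 1 k) (fun r => y (S k) r * y (S k) r) Rplus).
    + apply IH. intros j Hj; apply H; lia.
    + apply (filterlim_comp_2 (G := locally 0) (H := locally 0)
        (y (S k)) (y (S k)) Rmult).
      * apply H; lia.
      * apply H; lia.
      * apply (filterlim_mult (K := R_AbsRing) 0 0).
    + apply (filterlim_plus (K := R_AbsRing) (V := R_NormedModule) 0 (0 * 0)).
Qed.

(** At an interior maximum of [norm2] the flux vanishes, yet its derivative is positive there, so
    [norm2] would increase strictly just to the right. *)
Lemma maximum_principle :
  (forall j, (1 <= j <= n)%nat -> vanishes_at_ends r0 (y j)) ->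
  (forall r, r0 < r -> 0 < norm2 r ->
     0 < sum_n_m (fun j => y j r * dstar Lam b (dstar Lam b (y j)) r) 1 n) ->
  forall j r, (1 <= j <= n)%nat -> r0 < r -> y j r = 0.
Proof.
  intros Hends Hform j r1 Hj Hr1.
  apply norm2_zero; trivial. apply Rle_antisym; [|apply norm2_nonneg].
  destruct (Rle_or_lt (norm2 r1) 0) as [|HE]; [trivial|exfalso].
  assert (L0 : filterlim norm2 (at_right r0) (locally 0)).
  { apply (norm2_vanishes (at_right r0)). intros i Hi; apply Hends, Hi. }
  assert (Li : filterlim norm2 (Rbar_locally p_infty) (locally 0)).
  { apply (norm2_vanishes (Rbar_locally p_infty)). intros i Hi; apply Hends, Hi. }
  destruct (proj1 (filterlim_locally _ _) L0 (mkposreal _ HE)) as [d Hd].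
  destruct (proj1 (filterlim_locally _ _) Li (mkposreal _ HE)) as [M HM].
  (* Near each end [norm2] is below its value at [r1]. Points [a] and [c] there enclose [r1], and
     the maximum on [a, c] is therefore interior. *)
  set (a := r0 + Rmin (d / 2) ((r1 - r0) / 2)).
  assert (Hdp := cond_pos d).
  assert (Hm : 0 < Rmin (d / 2) ((r1 - r0) / 2)) by (apply Rmin_pos; lra).
  pose proof (Rmin_l (d / 2) ((r1 - r0) / 2)). pose proof (Rmin_r (d / 2) ((r1 - r0) / 2)).
  assert (Ha : norm2 a < norm2 r1).
  { specialize (Hd a). assert (Q : ball r0 d a) by (change (Rabs (a - r0) < d); unfold a; apply Rabs_def1; lra).
    specialize (Hd Q ltac:(unfold a; lra)). change (Rabs (norm2 a - 0) < norm2 r1) in Hd.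
    apply Rabs_def2 in Hd. lra. }
  set (c := Rmax (M + 1) (r1 + 1)).
  pose proof (Rmax_l (M + 1) (r1 + 1)). pose proof (Rmax_r (M + 1) (r1 + 1)).
  assert (Hc : norm2 c < norm2 r1).
  { specialize (HM c ltac:(unfold c; lra)). change (Rabs (norm2 c - 0) < norm2 r1) in HM.
    apply Rabs_def2 in HM. lra. }
  destruct (continuity_ab_maj norm2 a c) as [x [Hx Hxr]].
  { unfold a, c; lra. }
  { intros z Hz. apply continuity_pt_filterlim. apply norm2_cont. unfold a in Hz; lra. }
  assert (Hx1 : norm2 r1 <= norm2 x) by (apply Hx; unfold a, c; lra).
  assert (Hxa : a < x) by (destruct (Req_dec a x) as [<-|]; lra).
  assert (Hxc : x < c) by (destruct (Req_dec x c) as [->|]; lra).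
  assert (Hxr0 : r0 < x) by (unfold a in Hxa; lra).
  assert (HF : flux x = 0).
  { pose proof (norm2_derive x Hxr0) as D. pose proof (Hpos x Hxr0).
    apply Rle_antisym.
    - destruct (Rle_or_lt (flux x) 0) as [|Hf]; [trivial|exfalso].
      destruct (derive_pos_right norm2 x _ D) as [e [He1 He2]].
      { apply Rdiv_lt_0_compat; lra. }
      set (z := x + Rmin (e / 2) ((c - x) / 2)).
      assert (0 < Rmin (e / 2) ((c - x) / 2)) by (apply Rmin_pos; lra).
      pose proof (Rmin_l (e / 2) ((c - x) / 2)). pose proof (Rmin_r (e / 2) ((c - x) / 2)).
      specialize (He2 z ltac:(unfold z; lra)). specialize (Hx z ltac:(unfold z; lra)). lra.
    - destruct (Rle_or_lt 0 (flux x)) as [|Hf]; [trivial|exfalso].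
      (* Reflection turns the one-sided statement to the right into the one to the left. *)
      destruct (derive_pos_right (fun t => norm2 (- t)) (- x) (- (2 * flux x / (mu Lam b x * lapse b x)))) as [e [He1 He2]].
      { replace (- (2 * flux x / (mu Lam b x * lapse b x)))
          with (scal (-1) (2 * flux x / (mu Lam b x * lapse b x)))
          by (unfold scal; simpl; unfold mult; simpl; ring).
        apply (is_derive_comp norm2 (fun t => - t)); [rewrite Ropp_involutive; exact D|].
        auto_derive; trivial. }
      { apply Ropp_0_gt_lt_contravar. unfold Rdiv.
        assert (0 < / (mu Lam b x * lapse b x)) by (apply Rinv_0_lt_compat; lra). nra. }
      set (z := - x + Rmin (e / 2) ((x - a) / 2)).
      assert (0 < Rmin (e / 2) ((x - a) / 2)) by (apply Rmin_pos; lra).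
      pose proof (Rmin_l (e / 2) ((x - a) / 2)). pose proof (Rmin_r (e / 2) ((x - a) / 2)).
      specialize (He2 z ltac:(unfold z; lra)). specialize (Hx (- z) ltac:(unfold z; lra)).
      rewrite Ropp_involutive in He2. lra. }
  destruct (derive_pos_right flux x _ (flux_derive x Hxr0)) as [e [He1 He2]].
  { apply Rdiv_lt_0_compat; [|apply Hpos, Hxr0].
    assert (0 <= sum_n_m (fun j => dstar Lam b (y j) x ^ 2) 1 n) by (apply sumR_nonneg; intros; apply pow2_ge_0).
    pose proof (Hform x Hxr0 ltac:(lra)). lra. }
  set (z := x + Rmin (e / 2) ((c - x) / 2)).
  assert (0 < Rmin (e / 2) ((c - x) / 2)) by (apply Rmin_pos; lra).
  pose proof (Rmin_l (e / 2) ((c - x) / 2)). pose proof (Rmin_r (e / 2) ((c - x) / 2)).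
  assert (Hinc : norm2 x < norm2 z).
  { apply (pos_derive_incr norm2 (fun r => 2 * flux r / (mu Lam b r * lapse b r))).
    - unfold z; lra.
    - intros t Ht. apply norm2_cont; lra.
    - intros t Ht. apply norm2_derive; lra.
    - intros t Ht. apply Rdiv_lt_0_compat; [|apply Hpos; lra].
      specialize (He2 t ltac:(unfold z in Ht; lra)). lra. }
  specialize (Hx z ltac:(unfold z; lra)). lra.
Qed.

(* At a horizon the tortoise length is infinite, so boundedness of the tortoise derivative replaces the boundary condition there. *)
Lemma horizon_principle (kap eta K : R) :
  0 < kap -> 0 < eta -> 0 < K ->
  (forall j, (1 <= j <= n)%nat -> filterlim (y j) (Rbar_locally p_infty) (locally 0)) ->
  (forall r, r0 < r -> kap * norm2 r <=
     sum_n_m (fun j => y j r * dstar Lam b (dstar Lam b (y j)) r) 1 n) ->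
  (exists r2, r0 < r2 /\ forall r, r0 < r <= r2 ->
     sum_n_m (fun j => dstar Lam b (y j) r ^ 2) 1 n <= eta /\
     mu Lam b r * lapse b r <= K * (r - r0)) ->
  forall j r, (1 <= j <= n)%nat -> r0 < r -> y j r = 0.
Proof.
  intros Hkap Heta HK Hinf Hform [r2 [Hr2 Hnear]] j r1 Hj Hr1.
  apply norm2_zero; trivial. apply Rle_antisym; [|apply norm2_nonneg].
  destruct (Rle_or_lt (norm2 r1) 0) as [|HE]; [trivial|exfalso].
  assert (Li : filterlim norm2 (Rbar_locally p_infty) (locally 0)) by (apply (norm2_vanishes (Rbar_locally p_infty)), Hinf).
  set (F' := fun r => (sum_n_m (fun j => dstar Lam b (y j) r ^ 2) 1 n
      + sum_n_m (fun j => y j r * dstar Lam b (dstar Lam b (y j)) r) 1 n) / (mu Lam b r * lapse b r)).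
  assert (HF' : forall r, r0 < r -> kap * norm2 r / (mu Lam b r * lapse b r) <= F' r).
  { intros r Hr. unfold F', Rdiv. apply Rmult_le_compat_r.
    - left; apply Rinv_0_lt_compat, Hpos, Hr.
    - assert (0 <= sum_n_m (fun j => dstar Lam b (y j) r ^ 2) 1 n) by (apply sumR_nonneg; intros; apply pow2_ge_0).
      pose proof (Hform r Hr). lra. }
  assert (HF0 : forall r, r0 < r -> 0 <= F' r).
  { intros r Hr. apply Rle_trans with (2 := HF' r Hr). unfold Rdiv.
    apply Rmult_le_pos; [apply Rmult_le_pos; [lra|apply norm2_nonneg]|left; apply Rinv_0_lt_compat, Hpos, Hr]. }
  assert (Hmono : forall s t, r0 < s -> s <= t -> flux s <= flux t).
  { intros s t Hs Hst. apply (nonneg_derive_mono flux F'); trivial.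
    - intros; apply flux_cont; lra.
    - intros x Hx. apply flux_derive; lra.
    - intros; apply HF0; lra. }
  (* The flux is nondecreasing. If it were positive somewhere, [norm2] would increase from there on
     and could not tend to 0 at infinity. *)
  assert (Hneg : forall r, r0 < r -> flux r <= 0).
  { intros r Hr. destruct (Rle_or_lt (flux r) 0) as [|Hf]; [trivial|exfalso].
    assert (Hinc : forall t, r < t -> norm2 r < norm2 t).
    { intros t Ht. apply (pos_derive_incr norm2 (fun r => 2 * flux r / (mu Lam b r * lapse b r))); trivial.
      - intros z Hz. apply norm2_cont; lra.
      - intros z Hz. apply norm2_derive; lra.
      - intros z Hz. apply Rdiv_lt_0_compat; [|apply Hpos; lra].
        pose proof (Hmono r z Hr ltac:(lra)). lra. }
    assert (Hp1 : 0 < norm2 (r + 1)).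
    { pose proof (Hinc (r + 1) ltac:(lra)). pose proof (norm2_nonneg r). lra. }
    assert (Hinc2 : forall t, r + 1 <= t -> norm2 (r + 1) <= norm2 t).
    { intros t Ht. apply (nonneg_derive_mono norm2 (fun r => 2 * flux r / (mu Lam b r * lapse b r))); trivial.
      - intros z Hz. apply norm2_cont; lra.
      - intros z Hz. apply norm2_derive; lra.
      - intros z Hz. left. apply Rdiv_lt_0_compat; [|apply Hpos; lra].
        pose proof (Hmono r z Hr ltac:(lra)). lra. }
    destruct (proj1 (filterlim_locally _ _) Li (mkposreal _ Hp1)) as [M HM].
    set (c := Rmax (M + 1) (r + 1)).
    pose proof (Rmax_l (M + 1) (r + 1)). pose proof (Rmax_r (M + 1) (r + 1)).
    specialize (HM c ltac:(unfold c; lra)). change (Rabs (norm2 c - 0) < norm2 (r + 1)) in HM.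
    apply Rabs_def2 in HM. pose proof (Hinc2 c ltac:(unfold c; lra)). lra. }
  assert (Hdec : forall r, r0 < r -> r <= r1 -> norm2 r1 <= norm2 r).
  { intros r Hr Hrr. cut (- norm2 r <= - norm2 r1); [lra|].
    apply (nonneg_derive_mono (fun r => - norm2 r) (fun r => - (2 * flux r / (mu Lam b r * lapse b r)))); trivial.
    - intros z Hz. apply cont_opp, norm2_cont; lra.
    - intros z Hz. apply (is_derive_opp norm2), norm2_derive; lra.
    - intros z Hz. unfold Rdiv.
      assert (0 < / (mu Lam b z * lapse b z)) by (apply Rinv_0_lt_compat, Hpos; lra).
      pose proof (Hneg z ltac:(lra)). nra. }
  set (r3 := Rmin r2 ((r0 + r1) / 2)).
  assert (Hr3 : r0 < r3) by (apply Rmin_glb_lt; lra).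
  pose proof (Rmin_l r2 ((r0 + r1) / 2)) as Hr32. pose proof (Rmin_r r2 ((r0 + r1) / 2)) as Hr31.
  fold r3 in Hr32, Hr31.
  assert (Hlt : forall r, r0 < r <= r3 -> flux r < 0).
  { intros r Hr. apply Rlt_le_trans with (flux r1); [|apply Hneg, Hr1].
    apply (pos_derive_incr flux F'); [lra|intros; apply flux_cont; lra|intros; apply flux_derive; lra|].
    intros z Hz. apply Rlt_le_trans with (2 := HF' z ltac:(lra)).
    pose proof (Hdec z ltac:(lra) ltac:(lra)). apply Rdiv_lt_0_compat; [nra|apply Hpos; lra]. }
  (* A Riccati inequality: Cauchy-Schwarz gives flux^2 <= eta norm2, so the lower bound kap norm2 /
     (mu S) on the derivative of the flux becomes c flux^2 / (r - r0), where mu S <= K (r - r0) is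
     used. *)
  set (c := kap / (eta * K)).
  assert (Hc : 0 < c) by (unfold c; apply Rdiv_lt_0_compat; nra).
  assert (Hkey : forall r, r0 < r <= r3 -> c / (r - r0) <= F' r / flux r ^ 2).
  { intros r Hr. destruct (Hnear r ltac:(lra)) as [Hn1 Hn2]. pose proof (Hlt r Hr) as Hl.
    pose proof (sumR_cauchy (fun j => y j r) (fun j => dstar Lam b (y j) r) 1 n) as CS.
    cbv beta in CS. fold (flux r) in CS. fold (norm2 r) in CS.
    assert (HFF : 0 < flux r ^ 2) by nra.
    pose proof (norm2_nonneg r). pose proof (Hpos r ltac:(lra)) as Hp.
    assert (CS2 : flux r ^ 2 <= norm2 r * eta).
    { apply Rle_trans with (1 := CS). apply Rmult_le_compat_l; trivial. }
    apply Rmult_le_reg_r with (1 := HFF).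
    replace (F' r / flux r ^ 2 * flux r ^ 2) with (F' r) by (field; lra).
    apply Rle_trans with (2 := HF' r ltac:(lra)).
    apply Rle_trans with (c / (r - r0) * (norm2 r * eta)).
    { apply Rmult_le_compat_l; trivial. left; apply Rdiv_lt_0_compat; lra. }
    replace (c / (r - r0) * (norm2 r * eta)) with (kap * norm2 r * / (K * (r - r0))) by (unfold c; field; lra).
    unfold Rdiv. apply Rmult_le_compat_l; [nra|]. apply Rinv_le_contravar; trivial. }
  (* The integrated Riccati inequality. The logarithm reflects the infinite tortoise length of the
     horizon. *)
  assert (HH : forall r, r0 < r <= r3 -> - / flux r - c * ln (r - r0) <= - / flux r3 - c * ln (r3 - r0)).
  { intros r Hr.
    assert (D : forall x, r0 < x <= r3 -> is_derive (fun r => - / flux r - c * ln (r - r0)) x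
      (F' x / flux x ^ 2 - c / (x - r0))).
    { intros x Hx. pose proof (Hlt x Hx).
      replace (F' x / flux x ^ 2 - c / (x - r0)) with (- (- F' x / flux x ^ 2) - c * / (x - r0)) by (field; lra).
      apply (is_derive_minus (fun r => - / flux r) (fun r => c * ln (r - r0))).
      - apply (is_derive_opp (fun r => / flux r)). apply (is_derive_inv flux); [apply flux_derive; lra|lra].
      - auto_derive; [lra|]. field. lra. }
    apply (nonneg_derive_mono (fun r => - / flux r - c * ln (r - r0)) (fun x => F' x / flux x ^ 2 - c / (x - r0))).
    - lra.
    - intros x Hx. apply (ex_derive_continuous (fun r => - / flux r - c * ln (r - r0))).
      eexists; apply D; lra.
    - intros x Hx. apply D; lra.
    - intros x Hx. pose proof (Hkey x ltac:(lra)). lra. }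
  (* Moving inwards until the logarithm has dropped by [T] lowers the bound on -1/flux to 0,
     contradicting the negativity of the flux. *)
  set (T := - / flux r3 / c).
  assert (HT : 0 < T).
  { unfold T. apply Rdiv_lt_0_compat; [|lra]. rewrite <- Rinv_opp. apply Rinv_0_lt_compat.
    pose proof (Hlt r3 ltac:(lra)). lra. }
  set (r := r0 + (r3 - r0) * exp (- T)).
  assert (He : 0 < exp (- T) <= 1).
  { split; [apply exp_pos|]. rewrite <- exp_0. left; apply exp_increasing; lra. }
  assert (Hr : r0 < r <= r3) by (unfold r; nra).
  specialize (HH r Hr).
  assert (E : ln (r - r0) = ln (r3 - r0) - T).
  { replace (r - r0) with ((r3 - r0) * exp (- T)) by (unfold r; ring).
    rewrite ln_mult, ln_exp by lra. ring. }
  rewrite E in HH.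
  assert (E2 : c * T = - / flux r3).
  { unfold T. field. split; [|lra]. pose proof (Hlt r3 ltac:(lra)). lra. }
  assert (0 < - / flux r).
  { rewrite <- Rinv_opp. apply Rinv_0_lt_compat. pose proof (Hlt r Hr). lra. }
  nra.
Qed.

End TortoiseForm.

(** * Gravitational stability near the vacuum *)

Section Gravitational.

Variables (N : nat) (Lam r0 : R) (b : background) (P : nat -> R -> R).
Hypothesis HN : (2 <= N)%nat.
Hypothesis HLam : Lam < 0.
Hypothesis r0_nonneg : 0 <= r0.
Hypothesis Hflow : flow N Lam r0 b P.
Hypothesis Hends : forall r, r0 < r -> gauge b 0%nat r = 0 /\ gauge b N r = 0.

Let q (r : R) : R := 1 - Lam * r ^ 2 - 2 * r ^ 2 * Pi N b r.

(** The field equations make the [Gam] terms of mu' and S' cancel, so no gauge derivative remains in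
    Q. *)
Lemma Qgrav_eq r : r0 < r -> Qgrav Lam b r = lapse b r * q r / r.
Proof.
  intros Hr. destruct (Hflow r Hr) as [Hmu [Hl [_ [_ [_ HS]]]]].
  rewrite <- (flow_Gam N Lam r0 b P Hflow r Hr) in HS.
  unfold Qgrav, dstar.
  rewrite (is_derive_unique _ _ _ HS).
  rewrite (is_derive_unique _ _ _ (flow_mu_derive N Lam r0 b P r0_nonneg Hflow r Hr)).
  assert (Em : 2 * mass b r = r * (1 - Lam * r ^ 2 / 3 - mu Lam b r)) by (unfold mu; field; lra).
  replace (2 * mass b r / r ^ 2) with ((1 - Lam * r ^ 2 / 3 - mu Lam b r) / r) by (rewrite Em; field; lra).
  unfold q. field. repeat split; lra.
Qed.

(** The row sum with both neighbours written for every j: a neighbour of index 0 or N carries a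
    vanishing gauge function and may be included. *)
Lemma Mgrav_sum (v : nat -> R) (j : nat) (r : R) :
  (1 <= j <= N - 1)%nat -> r0 < r ->
  sum_n_m (fun k => Mgrav Lam b j k r * v k) 1 (N - 1) =
  mu Lam b r * lapse b r ^ 2 / r ^ 2 *
    ((2 * gauge b j r ^ 2 - W b j r) * v j
     - gauge b j r * (gauge b (j + 1) r * v (j + 1)%nat + gauge b (j - 1) r * v (j - 1)%nat)
     - 4 * q r * Derive (gauge b j) r * sum_n_m (fun k => Derive (gauge b k) r * v k) 1 (N - 1)
     - 4 / r * (W b j r * gauge b j r * sum_n_m (fun k => Derive (gauge b k) r * v k) 1 (N - 1)
       + Derive (gauge b j) r * sum_n_m (fun k => W b k r * gauge b k r * v k) 1 (N - 1))).
Proof.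
  intros Hj Hr. destruct (Hflow r Hr) as [Hmu [Hl _]].
  set (c := mu Lam b r * lapse b r ^ 2 / r ^ 2).
  set (D := fun k => Derive (gauge b k) r).
  rewrite (sumR_ext _ (fun k =>
     c * (2 * gauge b j r ^ 2 - W b j r) * (kron j k * v k)
     - c * gauge b j r * (kron (j + 1) k * (gauge b k r * v k))
     - c * gauge b j r * (kron (j - 1) k * (gauge b k r * v k))
     - c * 4 * q r * D j * (D k * v k)
     - c * (4 / r) * W b j r * gauge b j r * (D k * v k)
     - c * (4 / r) * D j * (W b k r * gauge b k r * v k))).
  2:{ intros k _. unfold Mgrav. rewrite (Qgrav_eq r Hr). unfold dstar, c, D. field. split; lra. }
  rewrite !sumR_minus, !sumR_scal, !sum_kron_l.
  destruct (Hends r Hr) as [E0 EN].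
  replace (guard (andb (Nat.leb 1 j) (Nat.leb j (N - 1))) (v j)) with (v j).
  2:{ destruct (Nat.leb_spec 1 j); destruct (Nat.leb_spec j (N - 1)); simpl; trivial; lia. }
  replace (guard (andb (Nat.leb 1 (j + 1)) (Nat.leb (j + 1) (N - 1))) (gauge b (j + 1) r * v (j + 1)%nat))
    with (gauge b (j + 1) r * v (j + 1)%nat).
  2:{ destruct (Nat.leb_spec 1 (j + 1)); destruct (Nat.leb_spec (j + 1) (N - 1)); simpl; trivial; try lia.
      replace (j + 1)%nat with N by lia. rewrite EN; ring. }
  replace (guard (andb (Nat.leb 1 (j - 1)) (Nat.leb (j - 1) (N - 1))) (gauge b (j - 1) r * v (j - 1)%nat))
    with (gauge b (j - 1) r * v (j - 1)%nat).
  2:{ destruct (Nat.leb_spec 1 (j - 1)); destruct (Nat.leb_spec (j - 1) (N - 1)); simpl; trivial; try lia.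
      replace (j - 1)%nat with 0%nat by lia. rewrite E0; ring. }
  unfold D; cbv beta. Rring.
Qed.

Variable delta : R.
Hypothesis delta_range : 0 <= delta <= 1.
(** The bracket collects the error terms: 1 from W, 4N from the Q term, and 4N plus 4N(N+1)^2 from
    splitting the cross term. The right side is half of the coercivity constant 1/(2N^2). *)
Hypothesis delta_small :
  delta * (1 + 8 * INR N + 4 * INR N * (INR N + 1) ^ 2) <= / (4 * INR N ^ 2).
(** The bounds match the growth of the potential: [q] can grow like r^2 at infinity, and the cross
    term carries a factor 1/r, which is large near the origin of a soliton. *)
Hypothesis Hsmall : forall r j, r0 < r -> (1 <= j <= N - 1)%nat ->
  1 / 2 <= gauge b j r ^ 2 /\ Rabs (gauge b j r) <= INR N + 1 /\ Rabs (W b j r) <= delta /\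
  Derive (gauge b j) r ^ 2 * (1 - Lam * r ^ 2) <= delta /\
  (Derive (gauge b j) r / r) ^ 2 <= delta.

(** After removal of the factor mu S^2 / r^2, the main part is the Dirichlet form of y_j = omega_j
    v_j, which controls sum v_j^2 since omega_j^2 >= 1/2. Every other term contains W or omega' and
    is absorbed. *)
Lemma Mgrav_form_pos (v : nat -> R) (r : R) : r0 < r ->
  0 <= sum_n_m (fun j => v j * sum_n_m (fun k => Mgrav Lam b j k r * v k) 1 (N - 1)) 1 (N - 1).
Proof.
  intros Hr. destruct (Hflow r Hr) as [Hmu [Hl _]].
  set (c := mu Lam b r * lapse b r ^ 2 / r ^ 2).
  assert (Hc : 0 < c).
  { unfold c. apply Rdiv_lt_0_compat; [|nra]. apply Rmult_lt_0_compat; nra. }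
  set (D := fun k => Derive (gauge b k) r).
  set (om := fun k => gauge b k r).
  set (Dv := sum_n_m (fun k => D k * v k) 1 (N - 1)).
  set (Hv := sum_n_m (fun k => W b k r * om k * v k) 1 (N - 1)).
  set (y := fun k => om k * v k).
  set (V := sum_n_m (fun k => v k ^ 2) 1 (N - 1)).
  set (Y := sum_n_m (fun j => y j * (2 * y j - y (j + 1)%nat - y (j - 1)%nat)) 1 (N - 1)).
  set (WV := sum_n_m (fun j => W b j r * v j ^ 2) 1 (N - 1)).
  rewrite (sumR_ext _ (fun j =>
     c * (y j * (2 * y j - y (j + 1)%nat - y (j - 1)%nat))
     - c * (W b j r * v j ^ 2)
     - c * (4 * q r * Dv + 4 / r * Hv) * (D j * v j)
     - c * (4 / r * Dv) * (W b j r * om j * v j))).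
  2:{ intros j Hj. rewrite (Mgrav_sum v j r Hj Hr). fold c.
      unfold Dv, Hv, y, D, om; cbv beta. Rring. }
  rewrite !sumR_minus, !sumR_scal. fold Y WV Dv Hv.
  replace (c * Y - c * WV - c * (4 * q r * Dv + 4 / r * Hv) * Dv - c * (4 / r * Dv) * Hv)
    with (c * (Y - WV - 4 * q r * Dv ^ 2 - 8 * (Dv / r) * Hv)) by (field; lra).
  apply Rmult_le_pos; [lra|].
  assert (HV : 0 <= V) by (apply sumR_nonneg; intros; apply pow2_ge_0).
  assert (HNp : 2 <= INR N) by (apply (le_INR 2); lia).
  assert (HN1 : INR (N - 1) <= INR N) by (apply le_INR; lia).
  pose proof (pos_INR (N - 1)) as HN0.
  assert (A1 : V <= 2 * (INR N ^ 2 * Y)).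
  { apply Rle_trans with (2 * sum_n_m (fun j => y j ^ 2) 1 (N - 1)).
    - rewrite <- sumR_scal. apply sumR_le. intros j Hj.
      destruct (Hsmall r j Hr Hj) as [H1 _]. unfold y, om.
      pose proof (pow2_ge_0 (v j)). replace ((gauge b j r * v j) ^ 2) with (gauge b j r ^ 2 * v j ^ 2) by ring. nra.
    - apply Rmult_le_compat_l; [lra|]. destruct (Hends r Hr) as [E0 EN].
      apply dirichlet_lower_bound; [lia|unfold y, om; rewrite E0; ring|unfold y, om; rewrite EN; ring]. }
  assert (A2 : WV <= delta * V).
  { unfold V. rewrite <- sumR_scal. apply sumR_le. intros j Hj.
    destruct (Hsmall r j Hr Hj) as [_ [_ [H1 _]]]. apply Rabs_le_between in H1.
    pose proof (pow2_ge_0 (v j)). apply Rmult_le_compat_r; lra. }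
  assert (Bound : forall a : nat -> R, forall t, 0 <= t -> (forall j, (1 <= j <= N - 1)%nat -> a j ^ 2 <= t) ->
     sum_n_m (fun k => a k * v k) 1 (N - 1) ^ 2 <= INR N * t * V).
  { intros a t Ht Ha. apply Rle_trans with (1 := sumR_cauchy a v 1 (N - 1)).
    apply Rmult_le_compat_r; trivial.
    apply Rle_trans with (sum_n_m (fun _ => t) 1 (N - 1)); [apply sumR_le, Ha|].
    rewrite sum_n_m_const. replace (S (N - 1) - 1)%nat with (N - 1)%nat by lia.
    apply Rmult_le_compat_r; trivial. }
  assert (Hlr : 0 < 1 - Lam * r ^ 2) by nra.
  assert (A3 : q r * Dv ^ 2 <= INR N * delta * V).
  { assert (HPi : 0 <= Pi N b r).
    { unfold Pi. apply Rmult_le_pos.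
      - left. apply Rinv_0_lt_compat. apply Rmult_lt_0_compat; [lra|apply pow_lt; lra].
      - apply sumR_nonneg; intros; apply pow2_ge_0. }
    apply Rle_trans with ((1 - Lam * r ^ 2) * Dv ^ 2).
    - apply Rmult_le_compat_r; [apply pow2_ge_0|]. unfold q. nra.
    - assert (Dv ^ 2 <= INR N * (delta / (1 - Lam * r ^ 2)) * V).
      { apply Bound; [unfold Rdiv; apply Rmult_le_pos; [lra|left; apply Rinv_0_lt_compat, Hlr]|].
        intros j Hj. destruct (Hsmall r j Hr Hj) as [_ [_ [_ [H1 _]]]]. fold (D j) in H1.
        apply Rmult_le_reg_r with (1 := Hlr). unfold Rdiv. rewrite Rmult_assoc, Rinv_l by lra. lra. }
      apply Rle_trans with ((1 - Lam * r ^ 2) * (INR N * (delta / (1 - Lam * r ^ 2)) * V)).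
      + apply Rmult_le_compat_l; lra.
      + right; field; lra. }
  assert (A4 : (Dv / r) ^ 2 <= INR N * delta * V).
  { replace (Dv / r) with (sum_n_m (fun k => D k / r * v k) 1 (N - 1)).
    - apply (Bound (fun k => D k / r)); [lra|]. intros j Hj. apply (Hsmall r j Hr Hj).
    - rewrite (sumR_ext _ (fun k => / r * (D k * v k))) by (intros; field; lra).
      rewrite sumR_scal. fold Dv. unfold Rdiv. Rring. }
  assert (A5 : Hv ^ 2 <= INR N * (delta * (INR N + 1) ^ 2) * V).
  { apply (Bound (fun k => W b k r * om k)).
    - apply Rmult_le_pos; [lra|apply pow2_ge_0].
    - intros j Hj. destruct (Hsmall r j Hr Hj) as [_ [H1 [H2 _]]].
      rewrite Rpow_mult_distr. fold (om j) in H1.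
      rewrite <- (pow2_abs (W b j r)), <- (pow2_abs (om j)).
      apply Rmult_le_compat; try apply pow2_ge_0.
      + pose proof (Rabs_pos (W b j r)). nra.
      + apply pow_incr. split; [apply Rabs_pos|exact H1]. }
  assert (A6 : 8 * (Dv / r) * Hv <= 4 * (INR N * delta * V) + 4 * (INR N * (delta * (INR N + 1) ^ 2) * V)).
  { pose proof (pow2_ge_0 (Dv / r - Hv)). nra. }
  assert (A7 : delta * V + 4 * (INR N * delta * V) + 4 * (INR N * delta * V)
      + 4 * (INR N * (delta * (INR N + 1) ^ 2) * V) <= / (4 * INR N ^ 2) * V).
  { apply Rle_trans with (delta * (1 + 8 * INR N + 4 * INR N * (INR N + 1) ^ 2) * V); [right; ring|].
    apply Rmult_le_compat_r; trivial. }
  assert (A8 : / (4 * INR N ^ 2) * V <= Y).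
  { apply Rmult_le_reg_l with (4 * INR N ^ 2); [nra|].
    rewrite <- Rmult_assoc, Rinv_r by nra.
    assert (0 <= INR N ^ 2 * Y) by lra. lra. }
  lra.
Qed.

Lemma gravitational_stability : no_grav_instability N Lam r0 b.
Proof.
  intros [sig2 [dw [Hs [Hm [j0 [r1 [Hj0 [Hr1 Hne]]]]]]]]. apply Hne.
  apply (maximum_principle (N - 1) Lam r0 b dw); trivial.
  - intros r Hr. destruct (Hflow r Hr) as [H1 [H2 _]]. apply Rmult_lt_0_compat; trivial.
  - intros j Hj. apply (Hm j Hj).
  - intros j Hj. apply (Hm j Hj).
  - intros r Hr HE.
    rewrite (sumR_ext _ (fun j => dw j r * sum_n_m (fun k => Mgrav Lam b j k r * dw k r) 1 (N - 1)
       + (- sig2) * dw j r ^ 2)).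
    2:{ intros j Hj. destruct (Hm j Hj) as [_ [_ He]]. specialize (He r Hr).
        replace (dstar Lam b (dstar Lam b (dw j)) r) with
          (sum_n_m (fun k => Mgrav Lam b j k r * dw k r) 1 (N - 1) - sig2 * dw j r) by lra. Rring. }
    rewrite sumR_plus, sumR_scal.
    pose proof (Mgrav_form_pos (fun k => dw k r) r Hr). cbv beta in H.
    unfold norm2 in HE. nra.
Qed.

End Gravitational.

(* The vacuum gauge field on (Schwarzschild-)anti-de Sitter space of mass [M]. *)
Definition vacuum (N : nat) (M : R) : background :=
  Background (fun _ => M) (fun _ => 1) (fun j _ => vac N j).

(** * Vacuum identities *)

Lemma vac_sq_all N j : (j <= N)%nat -> vac N j ^ 2 = INR j * (INR N - INR j).
Proof. intros H. rewrite <- vac_sq by trivial. ring. Qed.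

Lemma vacuum_W N M j r : (1 <= j <= N - 1)%nat -> W (vacuum N M) j r = 0.
Proof.
  intros Hj. unfold W; simpl gauge. rewrite !vac_sq_all by lia.
  rewrite plus_INR, minus_INR by lia. simpl INR. field.
Qed.

Lemma vacuum_Pi N M r : Pi N (vacuum N M) r = 0.
Proof.
  unfold Pi. rewrite sumR_zero; [ring|]. intros j Hj. simpl gauge. rewrite !vac_sq_all by lia.
  rewrite minus_INR by lia. simpl INR. ring.
Qed.

Lemma vacuum_W_gauge N M j r : W (vacuum N M) j r * gauge (vacuum N M) j r = 0.
Proof.
  destruct (Nat.eq_dec j 0) as [->|]; [simpl gauge; rewrite vac_0; ring|].
  destruct (Nat.le_gt_cases j (N - 1)); [rewrite vacuum_W by lia; ring|].
  simpl gauge. rewrite vac_out by lia. ring.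
Qed.

Lemma vacuum_flow N Lam r0 M : 0 <= r0 ->
  (forall r, r0 < r -> 0 < mu Lam (vacuum N M) r) ->
  flow N Lam r0 (vacuum N M) (fun _ _ => 0).
Proof.
  intros H0 Hmu r Hr. pose proof (Hmu r Hr).
  assert (E : sum_n_m (fun i => (0 / mu Lam (vacuum N M) r) ^ 2) 1 (N - 1) = 0).
  { apply sumR_zero. intros. field. lra. }
  rewrite E, vacuum_Pi.
  split; [trivial|]. split; [simpl; lra|]. split; [|split; [|split]].
  - intros j. replace (0 / mu Lam (vacuum N M) r) with 0 by (field; lra). apply (is_derive_const (vac N j)).
  - intros j. rewrite vacuum_W_gauge. replace (_ - _) with 0 by (field; lra). apply (is_derive_const 0).
  - replace (_ + _) with 0 by ring. apply (is_derive_const M).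
  - replace (_ * _) with 0 by ring. apply (is_derive_const 1).
Qed.

(** All quantities measured by [delta] vanish on the vacuum, so [delta = 0] is allowed. *)
Lemma vacuum_no_grav_instability N Lam r0 M : (2 <= N)%nat -> Lam < 0 -> 0 <= r0 ->
  (forall r, r0 < r -> 0 < mu Lam (vacuum N M) r) ->
  no_grav_instability N Lam r0 (vacuum N M).
Proof.
  intros HN HLam H0 Hmu.
  apply (gravitational_stability N Lam r0 (vacuum N M) (fun _ _ => 0)) with (delta := 0); trivial.
  - apply vacuum_flow; trivial.
  - intros r Hr; simpl. split; [apply vac_0|apply vac_out; lia].
  - lra.
  - rewrite Rmult_0_l. left. apply Rinv_0_lt_compat.
    assert (2 <= INR N) by (apply (le_INR 2); lia). nra.
  - intros r j Hr Hj. simpl gauge. rewrite vacuum_W by trivial.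
    replace (Derive (fun _ => vac N j) r) with 0 by (symmetry; apply Derive_const).
    pose proof (vac_sq_ge N j Hj). pose proof (vac_le N j). pose proof (vac_nonneg N j).
    repeat split.
    + nra.
    + rewrite Rabs_pos_eq by trivial. lra.
    + rewrite Rabs_R0; lra.
    + simpl. lra.
    + unfold Rdiv. rewrite Rmult_0_l. simpl; lra.
Qed.

(** * Sphaleronic stability of the vacuum *)

Section Sphaleronic.

Variables (N : nat) (Lam r0 M : R).
Hypothesis HN : (2 <= N)%nat.
Hypothesis r0_nonneg : 0 <= r0.
Hypothesis Hmu : forall r, r0 < r -> 0 < mu Lam (vacuum N M) r.

Notation b := (vacuum N M).
Notation v := (vac N).

Lemma Fmat_sum (X : nat -> R) (j : nat) (r : R) : (1 <= j <= N)%nat ->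
  sum_n_m (fun k => Fmat b j k r * X k) 1 (N - 1) = v j * X j - v (j - 1)%nat * X (j - 1)%nat.
Proof.
  intros Hj. unfold Fmat; simpl gauge.
  rewrite (sumR_ext _ (fun k => kron j k * (v k * X k) - kron j (k + 1) * (v k * X k))) by (intros; ring).
  rewrite sumR_minus, sum_kron_l, sum_kron_succ by lia. f_equal; [|f_equal].
  - destruct (Nat.leb_spec 1 j); destruct (Nat.leb_spec j (N - 1)); simpl; trivial; try lia.
    rewrite vac_out by lia; ring.
  - destruct (Nat.leb_spec 1 (j - 1)); destruct (Nat.leb_spec (j - 1) (N - 1)); simpl; trivial; try lia.
    replace (j - 1)%nat with 0%nat by lia. rewrite vac_0; ring.
Qed.

Lemma Kmat_sum (X : nat -> R) (j : nat) (r : R) : (1 <= j <= N)%nat ->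
  sum_n_m (fun k => Kmat b j k r * X k) 1 N =
  - ((v (j - 1)%nat ^ 2 + v j ^ 2) * X j - v j ^ 2 * X (j + 1)%nat - v (j - 1)%nat ^ 2 * X (j - 1)%nat).
Proof.
  intros Hj. unfold Kmat; simpl gauge.
  rewrite (sumR_ext _ (fun k => (- v (j - 1)%nat ^ 2 - v j ^ 2) * (kron j k * X k)
     + (v j ^ 2 * (kron (j + 1) k * X k) + kron j (k + 1) * (v k ^ 2 * X k)))) by (intros; ring).
  rewrite !sumR_plus, !sumR_scal, !sum_kron_l, sum_kron_succ by lia.
  replace (guard (andb (Nat.leb 1 j) (Nat.leb j N)) (X j)) with (X j).
  2:{ destruct (Nat.leb_spec 1 j); destruct (Nat.leb_spec j N); simpl; trivial; lia. }
  replace (v j ^ 2 * (guard (andb (Nat.leb 1 (j + 1)) (Nat.leb (j + 1) N)) (X (j + 1)%nat)))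
    with (v j ^ 2 * X (j + 1)%nat).
  2:{ destruct (Nat.leb_spec 1 (j + 1)); destruct (Nat.leb_spec (j + 1) N); simpl; trivial; try lia.
      rewrite vac_out by lia; ring. }
  replace (guard (andb (Nat.leb 1 (j - 1)) (Nat.leb (j - 1) N)) (v (j - 1)%nat ^ 2 * X (j - 1)%nat))
    with (v (j - 1)%nat ^ 2 * X (j - 1)%nat).
  2:{ destruct (Nat.leb_spec 1 (j - 1)); destruct (Nat.leb_spec (j - 1) N); simpl; trivial; try lia.
      replace (j - 1)%nat with 0%nat by lia. rewrite vac_0; ring. }
  Rring.
Qed.

Lemma hfun_pos r : r0 < r -> 0 < hfun Lam b r.
Proof.
  intros Hr. unfold hfun. simpl lapse. rewrite Rmult_1_l. apply Rdiv_lt_0_compat; [|lra].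
  apply sqrt_lt_R0, Hmu, Hr.
Qed.

Lemma vacuum_mu_derive r : r0 < r -> ex_derive (mu Lam b) r.
Proof.
  intros Hr. eexists. apply mu_derive with (m' := 0); [lra|]. apply (is_derive_const M).
Qed.

Lemma hfun_derive r : r0 < r -> ex_derive (hfun Lam b) r.
Proof.
  intros Hr. unfold hfun. simpl lapse.
  apply (ex_derive_div (fun r => 1 * sqrt (mu Lam b r)) (fun r => r)); [|apply ex_derive_id|lra].
  apply (ex_derive_scal (fun r => sqrt (mu Lam b r))).
  destruct (vacuum_mu_derive r Hr) as [l Hl].
  eexists. apply (is_derive_sqrt (mu Lam b)); [exact Hl|apply Hmu, Hr].
Qed.

Section Mode.

Variables (sig2 : R) (de dPhi : nat -> R -> R).
Hypothesis Hsig : sig2 < 0.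
Hypothesis Hmode : sphal_mode N Lam r0 b sig2 de dPhi.
Hypothesis Hgauss : strong_gauss N Lam r0 b de dPhi.

Definition gvar (j : nat) (r : R) : R := / hfun Lam b r * de j r.

Lemma gvar_dstar j r : (1 <= j <= N)%nat -> r0 < r ->
  dstar Lam b (gvar j) r = v (j - 1)%nat * dPhi (j - 1)%nat r - v j * dPhi j r.
Proof.
  intros Hj Hr. pose proof (Hgauss j r Hj Hr) as H.
  rewrite (Fmat_sum (fun k => dPhi k r) j r Hj) in H.
  change (dstar Lam b (gvar j) r + (v j * dPhi j r - v (j - 1)%nat * dPhi (j - 1)%nat r) = 0) in H. lra.
Qed.

Lemma vPhi_derive k r : r0 < r -> ex_derive (fun r => v k * dPhi k r) r.
Proof.
  intros Hr. destruct (Nat.eq_dec k 0) as [->|Hk0].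
  - apply (ex_derive_ext (fun _ => 0)); [intros; rewrite vac_0; Rring|apply ex_derive_const].
  - destruct (Nat.le_gt_cases k (N - 1)) as [Hk|Hk].
    + apply (ex_derive_scal (dPhi k)). destruct Hmode as [_ [H _]].
      destruct (H k ltac:(lia)) as [Ht _]. apply (Ht r Hr).
    + apply (ex_derive_ext (fun _ => 0)); [intros; rewrite vac_out by lia; Rring|apply ex_derive_const].
Qed.

(** The variables [de] are only assumed once differentiable. The second derivative exists because
    the Gauss constraint writes the first one through [dPhi]. *)
Lemma gvar_twice_diff j : (1 <= j <= N)%nat -> twice_diff Lam r0 b (gvar j).
Proof.
  intros Hj r Hr. split.
  - unfold gvar. apply (ex_derive_mult (fun r => / hfun Lam b r) (de j)).
    + apply (ex_derive_inv (hfun Lam b)); [apply hfun_derive, Hr|].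
      pose proof (hfun_pos r Hr); lra.
    + destruct Hmode as [H _]. destruct (H j Hj) as [Hd _]. apply Hd, Hr.
  - apply (ex_derive_ext_loc (fun r => v (j - 1)%nat * dPhi (j - 1)%nat r - v j * dPhi j r)).
    + apply (locally_beyond r0); trivial. intros x Hx. symmetry; apply gvar_dstar; trivial.
    + apply (ex_derive_minus (fun r => v (j - 1)%nat * dPhi (j - 1)%nat r) (fun r => v j * dPhi j r));
      apply vPhi_derive, Hr.
Qed.

Lemma vPhi_dstar k r : r0 < r -> dstar Lam b (fun r => v k * dPhi k r) r = v k * dstar Lam b (dPhi k) r.
Proof. intros Hr. unfold dstar. rewrite Derive_scal. ring. Qed.

(** The Gauss constraint is differentiated, and the derivatives of [dPhi] are eliminated with the
    upper block of the pulsation equations. The terms with the derivative of F vanish because the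
    vacuum gauge functions are constant. *)
Lemma gvar_dstar2 j r : (1 <= j <= N)%nat -> r0 < r ->
  dstar Lam b (dstar Lam b (gvar j)) r =
  - sig2 * gvar j r + hfun Lam b r ^ 2 *
    ((v (j - 1)%nat ^ 2 + v j ^ 2) * gvar j r - v j ^ 2 * gvar (j + 1) r
      - v (j - 1)%nat ^ 2 * gvar (j - 1) r).
Proof.
  intros Hj Hr. pose proof (hfun_pos r Hr) as Hh.
  assert (E : dstar Lam b (dstar Lam b (gvar j)) r =
     v (j - 1)%nat * dstar Lam b (dPhi (j - 1)%nat) r - v j * dstar Lam b (dPhi j) r).
  { rewrite <- !vPhi_dstar by trivial. unfold dstar at 1.
    rewrite (Derive_ext_loc (dstar Lam b (gvar j)) (fun r => v (j - 1)%nat * dPhi (j - 1)%nat r - v j * dPhi j r)).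
    - rewrite Derive_minus by (apply vPhi_derive, Hr). unfold dstar. ring.
    - apply (locally_beyond r0); trivial. intros x Hx. apply gvar_dstar; trivial. }
  rewrite E. destruct Hmode as [H _]. destruct (H j Hj) as [_ [_ He]]. specialize (He r Hr).
  unfold Ueps in He.
  rewrite (Fmat_sum (fun k => dstar Lam b (dPhi k) r) j r Hj) in He.
  rewrite (Kmat_sum (fun k => de k r) j r Hj) in He.
  rewrite (sumR_zero (fun k => dstar Lam b (Fmat b j k) r * dPhi k r)) in He.
  2:{ intros k _. unfold dstar, Fmat; simpl gauge. rewrite Derive_const. ring. }
  unfold gvar.
  apply Rmult_eq_reg_l with (hfun Lam b r); [|lra].
  replace (hfun Lam b r * (v (j - 1)%nat * dstar Lam b (dPhi (j - 1)%nat) r - v j * dstar Lam b (dPhi j) r))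
    with (- (hfun Lam b r * (v j * dstar Lam b (dPhi j) r - v (j - 1)%nat * dstar Lam b (dPhi (j - 1)%nat) r))) by ring.
  replace (hfun Lam b r * (v j * dstar Lam b (dPhi j) r - v (j - 1)%nat * dstar Lam b (dPhi (j - 1)%nat) r))
    with (sig2 * de j r - hfun Lam b r ^ 2 *
     ((v (j - 1)%nat ^ 2 + v j ^ 2) * de j r - v j ^ 2 * de (j + 1)%nat r - v (j - 1)%nat ^ 2 * de (j - 1)%nat r))
    by lra.
  field. lra.
Qed.

Lemma gvar_form r : r0 < r ->
  - sig2 * norm2 N gvar r <= sum_n_m (fun j => gvar j r * dstar Lam b (dstar Lam b (gvar j)) r) 1 N.
Proof.
  intros Hr.
  rewrite (sumR_ext _ (fun j => - sig2 * gvar j r ^ 2 + hfun Lam b r ^ 2 *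
    (gvar j r * ((v (j - 1)%nat ^ 2 + v j ^ 2) * gvar j r - v j ^ 2 * gvar (j + 1) r
      - v (j - 1)%nat ^ 2 * gvar (j - 1) r)))).
  2:{ intros j Hj. rewrite gvar_dstar2 by trivial. Rring. }
  rewrite sumR_plus, !sumR_scal. fold (norm2 N gvar r).
  rewrite (dirichlet_form (fun j => v j ^ 2) (fun j => gvar j r) N) by (rewrite vac_0; ring).
  rewrite (vac_out N N) by lia.
  assert (0 <= sum_n_m (fun j => v (j - 1)%nat ^ 2 * (gvar j r - gvar (j - 1) r) ^ 2) 1 N).
  { apply sumR_nonneg. intros. apply Rmult_le_pos; apply pow2_ge_0. }
  pose proof (pow2_ge_0 (hfun Lam b r)). nra.
Qed.

(** If epsilon vanishes, the Gauss constraint says that v_i Phi_i does not depend on i; it is 0 at i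
    = 0, and v_i is nonzero in range. *)
Lemma trivial_mode :
  (forall j r, (1 <= j <= N)%nat -> r0 < r -> gvar j r = 0) ->
  (forall j r, (1 <= j <= N)%nat -> r0 < r -> de j r = 0) /\
  (forall j r, (1 <= j <= N - 1)%nat -> r0 < r -> dPhi j r = 0).
Proof.
  intros H0. split.
  - intros j r Hj Hr. specialize (H0 j r Hj Hr). unfold gvar in H0. pose proof (hfun_pos r Hr) as Hh.
    replace (de j r) with (hfun Lam b r * (/ hfun Lam b r * de j r)) by (field; lra). rewrite H0; ring.
  - intros j r Hj Hr.
    assert (Hd : forall i, (1 <= i <= N)%nat -> v i * dPhi i r = v (i - 1)%nat * dPhi (i - 1)%nat r).
    { intros i Hi. pose proof (gvar_dstar i r Hi Hr) as E.
      replace (dstar Lam b (gvar i) r) with 0 in E; [lra|].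
      unfold dstar. rewrite (Derive_ext_loc (gvar i) (fun _ => 0)); [rewrite Derive_const; ring|].
      apply (locally_beyond r0); trivial. intros x Hx; apply H0; trivial. }
    assert (Hz : forall i, (i <= N)%nat -> v i * dPhi i r = 0).
    { induction i as [|i IH]; intros Hi; [rewrite vac_0; ring|].
      rewrite Hd by lia. replace (S i - 1)%nat with i by lia. apply IH; lia. }
    specialize (Hz j ltac:(lia)). pose proof (vac_ge_1 N j Hj).
    apply Rmult_integral in Hz. destruct Hz; [lra|trivial].
Qed.

Lemma gvar_at_infinity j : Lam < 0 -> (1 <= j <= N)%nat ->
  filterlim (gvar j) (Rbar_locally p_infty) (locally 0).
Proof.
  intros HLam Hj. destruct Hmode as [H _]. destruct (H j Hj) as [_ [[_ Hinf] _]].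

  (* mu / r^2 tends to - Lam / 3, so that h is bounded below *)
  set (c := sqrt (- Lam / 12)).
  assert (Hc : 0 < c) by (apply sqrt_lt_R0; lra).
  apply filterlim_locally. intros eps.
  assert (He : 0 < eps * c) by (apply Rmult_lt_0_compat; [apply cond_pos|trivial]).
  destruct (proj1 (filterlim_locally _ _) Hinf (mkposreal _ He)) as [A HA].
  (* Beyond this radius 2M/r is at most -Lam/4. With r > 1 this leaves mu >= (1/3 - 1/4)(-Lam) r^2,
     which explains the 12 in [c]. *)
  set (K := 8 * Rabs M / (- Lam) + 1).
  assert (HK : 1 <= K).
  { unfold K. assert (0 <= 8 * Rabs M / - Lam); [|lra].
    unfold Rdiv. apply Rmult_le_pos; [pose proof (Rabs_pos M); lra|left; apply Rinv_0_lt_compat; lra]. }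
  exists (Rmax A (Rmax K r0)). intros r Hr.
  assert (Hr1 : A < r) by (apply Rle_lt_trans with (2 := Hr), Rmax_l).
  assert (Hr2 : K < r).
  { apply Rle_lt_trans with (2 := Hr). apply Rle_trans with (Rmax K r0); [apply Rmax_l|apply Rmax_r]. }
  assert (Hr3 : r0 < r).
  { apply Rle_lt_trans with (2 := Hr). apply Rle_trans with (Rmax K r0); [apply Rmax_r|apply Rmax_r]. }
  specialize (HA r Hr1). change (Rabs (de j r - 0) < eps * c) in HA. rewrite Rminus_0_r in HA.
  change (Rabs (gvar j r - 0) < eps). rewrite Rminus_0_r. unfold gvar.
  assert (Hh : c <= hfun Lam b r).
  { unfold hfun. simpl lapse. rewrite Rmult_1_l.
    apply Rmult_le_reg_r with r; [lra|]. unfold Rdiv. rewrite Rmult_assoc, Rinv_l, Rmult_1_r by lra.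
    replace (c * r) with (sqrt (- Lam / 12 * (r * r))).
    2:{ rewrite sqrt_mult_alt, sqrt_square by nra. reflexivity. }
    apply sqrt_le_1_alt. unfold mu; simpl mass.
    assert (2 * M / r <= 1 / 4 * (- Lam)).
    { apply Rmult_le_reg_r with r; [lra|]. replace (2 * M / r * r) with (2 * M) by (field; lra).
      assert (8 * Rabs M <= - Lam * r).
      { apply Rmult_le_reg_r with (/ - Lam); [apply Rinv_0_lt_compat; lra|].
        replace (- Lam * r * / - Lam) with r by (field; lra). unfold K, Rdiv in Hr2. lra. }
      pose proof (Rle_abs M). nra. }
    assert (1 < r * r) by nra. simpl. nra. }
  rewrite Rabs_mult, Rabs_inv, (Rabs_pos_eq (hfun Lam b r)) by lra.
  apply Rmult_lt_reg_l with (hfun Lam b r); [lra|].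
  rewrite <- Rmult_assoc, Rinv_r, Rmult_1_l by lra.
  apply Rlt_le_trans with (1 := HA). rewrite Rmult_comm.
  apply Rmult_le_compat_r; [left; apply cond_pos|trivial].
Qed.

End Mode.

Lemma vacuum_no_sphal_instability :
  (forall sig2 de dPhi, sig2 < 0 -> sphal_mode N Lam r0 b sig2 de dPhi ->
     strong_gauss N Lam r0 b de dPhi ->
     forall j r, (1 <= j <= N)%nat -> r0 < r -> gvar de j r = 0) ->
  no_sphal_instability N Lam r0 b.
Proof.
  intros H [sig2 [de [dPhi [Hs [Hm [Hg Hne]]]]]].
  destruct (trivial_mode de dPhi Hg (H sig2 de dPhi Hs Hm Hg)) as [H1 H2].
  destruct Hne as [[j [r [Hj [Hr Hn]]]]|[j [r [Hj [Hr Hn]]]]]; apply Hn; auto.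
Qed.

End Sphaleronic.

Lemma vacuum_soliton_sphal N Lam : (2 <= N)%nat -> Lam < 0 ->
  (forall r, 0 < r -> 0 < mu Lam (vacuum N 0) r) -> no_sphal_instability N Lam 0 (vacuum N 0).
Proof.
  intros HN HLam Hmu. apply vacuum_no_sphal_instability; trivial; [lra|].
  intros sig2 de dPhi Hs Hm Hg.
  apply (maximum_principle N Lam 0 (vacuum N 0)).
  - intros r Hr. simpl lapse. rewrite Rmult_1_r. apply Hmu, Hr.
  - intros j Hj. apply (gvar_twice_diff N Lam 0 0 HN ltac:(lra) Hmu sig2 de dPhi Hm Hg j Hj).
  - intros j Hj. split.
    + destruct Hm as [H _]. destruct (H j Hj) as [_ [[H0 _] _]].

      (* 1 / h = r / sqrt mu tends to 0 at the origin *)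
      apply filterlim_locally. intros eps.
      destruct (proj1 (filterlim_locally _ _) H0 eps) as [d Hd].
      assert (Hm1 : 0 < Rmin d 1) by (apply Rmin_pos; [apply cond_pos|lra]).
      exists (mkposreal _ Hm1). intros r Hr Hr0.
      change (Rabs (r - 0) < Rmin d 1) in Hr.
      pose proof (Rmin_l d 1). pose proof (Rmin_r d 1).
      rewrite Rminus_0_r, Rabs_pos_eq in Hr by lra.
      assert (Hdr : ball 0 d r) by (change (Rabs (r - 0) < d); rewrite Rminus_0_r, Rabs_pos_eq; lra).
      specialize (Hd r Hdr Hr0). change (Rabs (de j r - 0) < eps) in Hd.
      change (Rabs (gvar N Lam 0 de j r - 0) < eps). rewrite Rminus_0_r in *.
      unfold gvar.
      assert (Hh : 1 <= hfun Lam (vacuum N 0) r).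
      { unfold hfun. simpl lapse. rewrite Rmult_1_l.
        apply Rmult_le_reg_r with r; [lra|]. unfold Rdiv. rewrite Rmult_assoc, Rinv_l, Rmult_1_r by lra.
        rewrite Rmult_1_l. apply Rle_trans with 1; [lra|]. rewrite <- sqrt_1. apply sqrt_le_1_alt.
        unfold mu; simpl mass. unfold Rdiv. rewrite Rmult_0_r, Rmult_0_l. nra. }
      rewrite Rabs_mult, Rabs_inv, (Rabs_pos_eq (hfun _ _ _)) by lra.
      apply Rle_lt_trans with (2 := Hd). rewrite <- (Rmult_1_l (Rabs (de j r))) at 2.
      apply Rmult_le_compat_r; [apply Rabs_pos|]. rewrite <- Rinv_1. apply Rinv_le_contravar; lra.
    + apply (gvar_at_infinity N Lam 0 0 sig2 de dPhi Hm j HLam Hj).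
  - intros r Hr HE.
    pose proof (gvar_form N Lam 0 0 ltac:(lia) ltac:(lra) Hmu sig2 de dPhi Hm Hg r Hr). nra.
Qed.

Lemma vacuum_black_hole_sphal N Lam rh M K : (2 <= N)%nat -> Lam < 0 -> 0 < rh -> 0 < K ->
  (forall r, rh < r -> 0 < mu Lam (vacuum N M) r) ->
  (forall r, rh < r <= rh + 1 -> mu Lam (vacuum N M) r <= K * (r - rh)) ->
  no_sphal_instability N Lam rh (vacuum N M).
Proof.
  intros HN HLam Hrh HK Hmu HmuK. apply vacuum_no_sphal_instability; trivial; [lra|].
  intros sig2 de dPhi Hs Hm Hg.
  (* By the Gauss constraint the tortoise derivative of y_j is v_(j-1) Phi_(j-1) - v_j Phi_j. Near
     the horizon |Phi| <= 1, so it is at most 2N, and summing N squares gives [eta]. *)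
  apply (horizon_principle N Lam rh (vacuum N M)) with (kap := - sig2) (eta := INR N * (2 * INR N) ^ 2) (K := K); trivial.
  - intros r Hr. simpl lapse. rewrite Rmult_1_r. apply Hmu, Hr.
  - intros j Hj. apply (gvar_twice_diff N Lam rh M HN ltac:(lra) Hmu sig2 de dPhi Hm Hg j Hj).
  - lra.
  - assert (2 <= INR N) by (apply (le_INR 2); lia). nra.
  - intros j Hj. apply (gvar_at_infinity N Lam rh M sig2 de dPhi Hm j HLam Hj).
  - intros r Hr. apply (gvar_form N Lam rh M ltac:(lia) ltac:(lra) Hmu sig2 de dPhi Hm Hg r Hr).
  - assert (Hd : exists d, 0 < d /\ forall r, rh < r < rh + d -> forall k, (1 <= k <= N - 1)%nat -> Rabs (dPhi k r) <= 1).
    { destruct Hm as [_ [H _]]. clear - H.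
      (* Induction on the number of components, to obtain one neighbourhood of the horizon for all
         of them. *)
      assert (G : forall n, (n <= N - 1)%nat -> exists d, 0 < d /\ forall r, rh < r < rh + d ->
         forall k, (1 <= k <= n)%nat -> Rabs (dPhi k r) <= 1).
      { induction n as [|n IH]; intros Hn.
        - exists 1; split; [lra|]. intros; lia.
        - destruct IH as [d [Hd0 Hd]]; [lia|].
          destruct (H (S n) ltac:(lia)) as [_ [[H0 _] _]].
          destruct (proj1 (filterlim_locally _ _) H0 (mkposreal 1 Rlt_0_1)) as [e He].
          exists (Rmin d e); split; [apply Rmin_pos; [trivial|apply cond_pos]|].
          intros r Hr k Hk. pose proof (Rmin_l d e). pose proof (Rmin_r d e).
          destruct (Nat.eq_dec k (S n)) as [->|]; [|apply Hd; [lra|lia]].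
          assert (Hb : ball rh e r) by (change (Rabs (r - rh) < e); rewrite Rabs_pos_eq; lra).
          specialize (He r Hb ltac:(lra)). change (Rabs (dPhi (S n) r - 0) < 1) in He.
          rewrite Rminus_0_r in He. lra. }
      apply G; lia. }
    destruct Hd as [d [Hd0 Hd]].
    pose proof (Rmin_l (d / 2) 1). pose proof (Rmin_r (d / 2) 1).
    assert (0 < Rmin (d / 2) 1) by (apply Rmin_pos; lra).
    exists (rh + Rmin (d / 2) 1). split; [lra|]. intros r Hr. split.
    + apply Rle_trans with (sum_n_m (fun _ => (2 * INR N) ^ 2) 1 N).
      2:{ rewrite sum_n_m_const. replace (S N - 1)%nat with N by lia. lra. }
      apply sumR_le. intros j Hj.
      rewrite (gvar_dstar N Lam rh M HN de dPhi Hg j r Hj ltac:(lra)).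
      assert (B : forall k, Rabs (vac N k * dPhi k r) <= INR N).
      { intros k. rewrite Rabs_mult, (Rabs_pos_eq (vac N k)) by apply vac_nonneg.
        destruct (Nat.eq_dec k 0) as [->|]; [rewrite vac_0, Rmult_0_l; apply pos_INR|].
        destruct (Nat.le_gt_cases k (N - 1)).
        - specialize (Hd r ltac:(lra) k ltac:(lia)). pose proof (vac_le N k). pose proof (vac_nonneg N k).
          pose proof (Rabs_pos (dPhi k r)). nra.
        - rewrite vac_out by lia. rewrite Rmult_0_l. apply pos_INR. }
      pose proof (B j) as B1. pose proof (B (j - 1)%nat) as B2.
      rewrite <- pow2_abs. apply pow_incr. split; [apply Rabs_pos|].
      unfold Rminus. apply Rle_trans with (1 := Rabs_triang _ _). rewrite Rabs_Ropp. lra.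
    + simpl lapse. rewrite Rmult_1_r. apply HmuK. lra.
Qed.

(** * Expansion of the sources about the vacuum *)

Lemma vac_step N j : (1 <= j <= N)%nat ->
  vac N j ^ 2 - vac N (j - 1) ^ 2 - INR N - 1 + 2 * INR j = 0.
Proof.
  intros Hj. rewrite !vac_sq_all by lia. rewrite minus_INR by lia. simpl INR. ring.
Qed.

Lemma WS_expand N (u : nat -> R -> R) (x : nat -> R) (eps : R) (j : nat) (s : R) :
  (1 <= j <= N - 1)%nat -> (forall i, u i s = eps * x i) ->
  WS N u j s * omS N u j s = - (eps * (linW (vac N) x j + eps * quadW (vac N) eps x j)).
Proof.
  intros Hj Hu. pose proof (vacuum_W N 0 j 0 Hj) as E. unfold W in E; simpl gauge in E.
  unfold WS, omS. rewrite !Hu. unfold linW, quadW.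
  replace (1 - (vac N j + eps * x j) ^ 2
    + / 2 * ((vac N (j - 1) + eps * x (j - 1)%nat) ^ 2 + (vac N (j + 1) + eps * x (j + 1)%nat) ^ 2))
    with ((1 - vac N j ^ 2 + / 2 * (vac N (j - 1) ^ 2 + vac N (j + 1) ^ 2))
      - (eps * (2 * vac N j * x j - vac N (j - 1) * x (j - 1)%nat - vac N (j + 1) * x (j + 1)%nat)
        + eps ^ 2 * (x j ^ 2 - / 2 * (x (j - 1)%nat ^ 2 + x (j + 1)%nat ^ 2)))) by field.
  rewrite E. field.
Qed.

Lemma PiS_expand N (u : nat -> R -> R) (x : nat -> R) (eps : R) (s : R) :
  (forall i, u i s = eps * x i) ->
  PiS N u s = 4 * (eps ^ 2 * energy N (vac N) eps x).
Proof.
  intros Hu. unfold PiS, energy.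
  replace (4 * (eps ^ 2 * (/ 4 * sum_n_m (fun j => (2 * vac N j * x j + eps * x j ^ 2
      - 2 * vac N (j - 1) * x (j - 1)%nat - eps * x (j - 1)%nat ^ 2) ^ 2) 1 N)))
    with (eps ^ 2 * sum_n_m (fun j => (2 * vac N j * x j + eps * x j ^ 2
      - 2 * vac N (j - 1) * x (j - 1)%nat - eps * x (j - 1)%nat ^ 2) ^ 2) 1 N) by field.
  rewrite <- sumR_scal. apply sumR_ext. intros j Hj.
  pose proof (vac_step N j Hj) as E. unfold omS. rewrite !Hu.
  replace ((vac N j + eps * x j) ^ 2 - (vac N (j - 1) + eps * x (j - 1)%nat) ^ 2 - INR N - 1 + 2 * INR j)
    with ((vac N j ^ 2 - vac N (j - 1) ^ 2 - INR N - 1 + 2 * INR j)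
      + eps * (2 * vac N j * x j + eps * x j ^ 2 - 2 * vac N (j - 1) * x (j - 1)%nat - eps * x (j - 1)%nat ^ 2)) by ring.
  rewrite E. Rring.
Qed.

Lemma locally_unit (s : R) (P : R -> Prop) :
  0 < s < 1 -> (forall x, 0 < x < 1 -> P x) -> locally s P.
Proof.
  intros Hs H. assert (Hm : 0 < Rmin s (1 - s)) by (apply Rmin_pos; lra).
  exists (mkposreal _ Hm). intros x Hx. change (Rabs (x - s) < Rmin s (1 - s)) in Hx.
  pose proof (Rmin_l s (1 - s)). pose proof (Rmin_r s (1 - s)). apply Rabs_def2 in Hx.
  apply H; lra.
Qed.

(** * From fixed points to static solutions *)

Section Realization.

Variables (N : nat) (L C : R) (eX eZ kX kY kZ mz : nat) (w : R -> R).
Variables (a0 b phi phi' psi chi theta : R -> R) (eta : nat -> R) (dX dY : nat -> R -> R).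
Variables (Lam rh m0 amin al : R) (f : comp -> R -> R).

Notation v := (vac N).
Notation xi := (altern N).
Notation X := (fun j s => sysX N f j s).
Notation Y := (fun j s => sysY eta f j s).
Notation A := (fun s => sysA a0 theta al f s).
Notation nl := (sys_nonlin N a0 b phi psi chi theta eta).

Hypothesis HN : (3 <= N)%nat.
Hypothesis Hamin : 0 < amin.
Hypothesis Hball : in_ball comp (comp_active N) (comp_weight N L) w C f.
Hypothesis HA : forall s, amin <= A s.
Hypothesis Hfix : forall c s, f c s = sysmap comp (comp_active N)
  (sys_exp eX eZ) (sys_ker kX kY kZ) (sys_lin N a0 b) (sys_src dX dY) nl al f c s.
Hypothesis a0_cont : forall s, continuous a0 s.
Hypothesis a0_pos : forall s, 0 < a0 s.
Hypothesis b_cont : forall s, continuous b s.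
Hypothesis phi_cont : forall s, continuous phi s.
Hypothesis psi_cont : forall s, continuous psi s.
Hypothesis chi_cont : forall s, continuous chi s.
Hypothesis theta_cont : forall s, continuous theta s.
Hypothesis dX_cont : forall j s, continuous (dX j) s.
Hypothesis dY_cont : forall j s, continuous (dY j) s.
Hypothesis eta_out : forall j, in_range N j = false -> eta j = 0.

Hypothesis phi_derive : forall s, 0 < s < 1 -> is_derive phi s (phi' s).
(** Power counting for u' = p / AS: the momenta carry s^(kY+1) and AS carries s^eX, so the quotient
    carries s^kX, whose primitive carries s^(kX+1). The factor s^eX of that power stays inside the
    remainder, and [phi] is the rest. *)
Hypothesis phi_eX : forall s, 0 < s < 1 -> phi s * s ^ eX = s ^ S kX.
Hypothesis kX_eX : (kX + eX = S kY)%nat.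
Hypothesis mz_eZ : (mz + eZ = S kZ)%nat.
(** [dX] and [dY] are what the leading pair, phi times [altern] and s^(kY+1) times [eta], leaves
    over in the linearised equations. *)
Hypothesis srcX : forall j s, 0 < s < 1 -> (1 <= j <= N - 1)%nat ->
  phi' s * xi j + s ^ kX * dX j s = s ^ kX * (eta j / a0 s).
Hypothesis srcY : forall j s, 0 < s < 1 -> (1 <= j <= N - 1)%nat ->
  INR (S kY) * eta j + dY j s = b s * linW v xi j.
Hypothesis b_spec : forall s, 0 < s < 1 -> s ^ kY * b s = phi s / rhoS rh s ^ 2.
Hypothesis psi_spec : forall s, 0 < s < 1 ->
  s ^ kY * psi s * (s ^ eX) ^ 2 = 2 * (1 - s) ^ 3 / rhoS rh s * (s ^ S kY) ^ 3.
Hypothesis chi_spec : forall s, 0 < s < 1 -> s ^ kZ * chi s * s ^ eX = (s ^ S kY) ^ 2.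
Hypothesis bZ_spec : forall s, 0 < s < 1 -> s ^ kZ * b s = phi s ^ 2 / rhoS rh s ^ 2.
Hypothesis theta_spec : forall s, 0 < s < 1 ->
  2 * s ^ mz * (1 - s) ^ 3 / rhoS rh s = s ^ eX * theta s.
Hypothesis a0_spec : forall s, 0 < s < 1 ->
  (1 - s) ^ 2 - Lam / 3 * rhoS rh s ^ 2 - 2 * m0 * (1 - s) ^ 3 / rhoS rh s = s ^ eX * a0 s.
Hypothesis rho_pos : forall s, 0 < s < 1 -> 0 < rhoS rh s.

Definition real_u (j : nat) (s : R) : R := al * phi s * X j s.
Definition real_p (j : nat) (s : R) : R := al * clamp s ^ S kY * Y j s.
Definition real_m (s : R) : R := m0 + al * clamp s ^ mz * f cZ s.

Lemma f_cont c s : continuous (f c) s.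
Proof. apply Hball. Qed.

Lemma X_cont j s : continuous (X j) s.
Proof. unfold sysX. cont. apply f_cont. Qed.

Lemma Y_cont j s : continuous (Y j) s.
Proof. unfold sysY. cont. apply f_cont. Qed.

Lemma A_cont s : continuous A s.
Proof. unfold sysA. cont; auto. apply f_cont. Qed.

Lemma A_neq s : A s <> 0.
Proof. pose proof (HA s). cbv beta in *. lra. Qed.

Lemma a0_neq s : a0 s <> 0.
Proof. pose proof (a0_pos s). lra. Qed.

Lemma f_out c s : comp_active N c = false -> f c s = 0.
Proof. intros H. rewrite Hfix. unfold sysmap. rewrite H. reflexivity. Qed.

Lemma X_out j s : in_range N j = false -> X j s = 0.
Proof.
  intros H. unfold sysX. rewrite (f_out (cX j) s) by exact H.
  assert (v j = 0).
  { unfold in_range in H. apply Bool.andb_false_iff in H.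
    destruct H as [H|H]; apply Nat.leb_gt in H.
    - replace j with 0%nat by lia. apply vac_0.
    - apply vac_out. lia. }
  unfold altern, perron. rewrite H0. ring.
Qed.

Lemma vac_range_out j : in_range N j = false -> v j = 0.
Proof.
  intros H. unfold in_range in H. apply Bool.andb_false_iff in H.
  destruct H as [H|H]; apply Nat.leb_gt in H.
  - replace j with 0%nat by lia. apply vac_0.
  - apply vac_out. lia.
Qed.

Lemma Y_out j s : in_range N j = false -> Y j s = 0.
Proof. intros H. unfold sysY. rewrite (f_out (cY j) s) by exact H. rewrite eta_out by trivial. ring. Qed.

Lemma quad_cont (t : R) (i : nat) :
  continuous (fun s => quadW v (al * phi s) (fun k => X k s) i) t.
Proof. unfold quadW. cont; try apply X_cont; auto. Qed.

Lemma energy_cont t : continuous (fun s => energy N v (al * phi s) (fun k => X k s)) t.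
Proof.
  pose proof X_cont as HX. cbv beta in HX.
  unfold energy. cont; solve [apply HX|apply phi_cont].
Qed.

Lemma nl_cont c t : continuous (nl c al f) t.
Proof.
  destruct c as [j|j|].
  - change (continuous (fun s => theta s * (f cZ s * Y j s * / a0 s * / A s)) t).
    pose proof (f_cont cZ t). pose proof (Y_cont j t). pose proof (A_cont t). cbv beta in *.
    pose proof (theta_cont t). pose proof (a0_cont t).
    cont; [apply a0_neq|apply A_neq].
  - change (continuous (fun s => b s * phi s * quadW v (al * phi s) (fun k => X k s) j
       - psi s * (al * sum_n_m (fun i => (Y i s * / A s) ^ 2) 1 (N - 1) * Y j s)) t).
    pose proof (Y_cont j t). pose proof (A_cont t). pose proof (quad_cont t j). cbv beta in *.
    pose proof (b_cont t). pose proof (phi_cont t). pose proof (psi_cont t).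
    apply cont_minus; [cont|].
    cont; [apply (Y_cont j0)|apply A_neq].
  - change (continuous (fun s => chi s * sum_n_m (fun i => Y i s ^ 2 * / A s) 1 (N - 1)
          + b s * energy N v (al * phi s) (fun k => X k s)) t).
    pose proof (A_cont t). pose proof (energy_cont t). cbv beta in *.
    pose proof (b_cont t). pose proof (chi_cont t).
    apply cont_plus; [|cont]. cont; [apply (Y_cont j)|apply A_neq].
Qed.

Lemma drive_cont c t :
  continuous (fun t => sys_lin N a0 b c f t + sys_src dX dY c t + al * nl c al f t) t.
Proof.
  pose proof (nl_cont c t).
  assert (H1 : continuous (sys_lin N a0 b c f) t).
  { destruct c as [j|j|].
    - change (continuous (fun s => f (cY j) s * / a0 s) t).
      pose proof (f_cont (cY j) t). pose proof (a0_cont t). cont. apply a0_neq.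
    - change (continuous (fun s => b s * linW v (fun i => f (cX i) s) j) t).
      pose proof (b_cont t). unfold linW. cont; apply f_cont.
    - apply (continuous_const 0). }
  assert (H2 : continuous (sys_src dX dY c) t).
  { destruct c; [apply dX_cont|apply dY_cont|apply (continuous_const 0)]. }
  cont.
Qed.

Lemma fix_unit c s : comp_active N c = true -> 0 < s < 1 ->
  f c s = s ^ sys_exp eX eZ c * avg (sys_ker kX kY kZ c)
    (fun t => sys_lin N a0 b c f t + sys_src dX dY c t + al * nl c al f t) s.
Proof.
  intros Hc Hs. rewrite Hfix. unfold sysmap. rewrite Hc, clamp_id by lra. reflexivity.
Qed.

(** The factor s^eX is the simple zero of mu at the horizon when [eX] is 1; for solitons [eX] is 0.
    The lower bound on [sysA] thus gives positivity of mu outside the horizon. *)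
Lemma real_A s : 0 < s < 1 -> AS Lam rh real_m s = s ^ eX * A s.
Proof.
  intros Hs. unfold AS, real_m, sysA. rewrite clamp_id by lra.
  pose proof (rho_pos s Hs).
  replace (2 * (m0 + al * s ^ mz * f cZ s) * (1 - s) ^ 3 / rhoS rh s)
    with (2 * m0 * (1 - s) ^ 3 / rhoS rh s + al * f cZ s * (2 * s ^ mz * (1 - s) ^ 3 / rhoS rh s))
    by (field; lra).
  rewrite theta_spec by trivial.
  replace ((1 - s) ^ 2 - Lam / 3 * rhoS rh s ^ 2 - (2 * m0 * (1 - s) ^ 3 / rhoS rh s + al * f cZ s * (s ^ eX * theta s)))
    with ((1 - s) ^ 2 - Lam / 3 * rhoS rh s ^ 2 - 2 * m0 * (1 - s) ^ 3 / rhoS rh s - al * f cZ s * (s ^ eX * theta s)) by ring.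
  rewrite a0_spec by trivial. ring.
Qed.

Lemma real_ratio j s : 0 < s < 1 ->
  real_p j s / AS Lam rh real_m s = al * s ^ kX * (Y j s / A s).
Proof.
  intros Hs. rewrite real_A by trivial. unfold real_p. rewrite clamp_id by lra.
  rewrite <- kX_eX, pow_add. pose proof (A_neq s). cbv beta in *.
  field. split; trivial. apply pow_nonzero; lra.
Qed.

Lemma real_u_derive j s : 0 < s < 1 ->
  is_derive (real_u j) s (real_p j s / AS Lam rh real_m s).
Proof.
  intros Hs. rewrite real_ratio by trivial.
  destruct (in_range N j) eqn:Hj.
  2:{ pose proof (Y_out j s Hj) as E. cbv beta in E. rewrite E.
      replace (al * s ^ kX * (0 / A s)) with 0 by (cbv beta; unfold Rdiv; ring).
      apply (is_derive_ext (fun _ => 0)); [|apply (is_derive_const 0)].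
      intros t. unfold real_u. pose proof (X_out j t Hj) as E2. cbv beta in E2. rewrite E2. Rring. }
  apply in_range_spec in Hj as Hj'.
  set (g := fun t => sys_lin N a0 b (cX j) f t + sys_src dX dY (cX j) t + al * nl (cX j) al f t).
  apply (is_derive_ext_loc (fun t => al * (phi t * xi j + t ^ S kX * avg kX g t))).
  { apply locally_unit; trivial. intros x Hx. unfold real_u, sysX.
    rewrite (fix_unit (cX j) x) by trivial. simpl sys_exp. simpl sys_ker. fold g.
    rewrite <- (phi_eX x Hx). Rring. }
  replace (al * s ^ kX * (Y j s / A s)) with (al * (phi' s * xi j + s ^ kX * g s)).
  { apply (is_derive_scal (fun t => phi t * xi j + t ^ S kX * avg kX g t)).
    apply (is_derive_plus (fun t => phi t * xi j) (fun t => t ^ S kX * avg kX g t)).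
    - apply (is_derive_ext (fun t => xi j * phi t)); [intros; apply Rmult_comm|].
      rewrite Rmult_comm. apply (is_derive_scal phi), phi_derive, Hs.
    - apply avg_derive. intros t. apply drive_cont. }
  unfold g. cbv beta iota delta [sys_lin sys_src sys_nonlin].
  replace (phi' s * xi j + s ^ kX * (f (cY j) s * / a0 s + dX j s + al * (theta s * (f cZ s * sysY eta f j s * / a0 s * / sysA a0 theta al f s))))
    with ((phi' s * xi j + s ^ kX * dX j s) + s ^ kX * (f (cY j) s * / a0 s + al * (theta s * (f cZ s * sysY eta f j s * / a0 s * / sysA a0 theta al f s)))) by ring.
  rewrite srcX by trivial. cbv beta. pose proof (A_neq s) as HA1. pose proof (a0_neq s).
  cbv beta in HA1. unfold sysY, sysA in *. field. split; trivial.
Qed.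

Lemma real_p_derive j s : 0 < s < 1 ->
  is_derive (real_p j) s (p_rate N Lam rh real_u real_p real_m j s).
Proof.
  intros Hs. pose proof (rho_pos s Hs) as Hrho.
  assert (EG : lapse_rate N Lam rh real_p real_m s =
    2 * (1 - s) ^ 3 / rhoS rh s * (al ^ 2 * (s ^ kX) ^ 2 * sum_n_m (fun i => (Y i s * / A s) ^ 2) 1 (N - 1))).
  { unfold lapse_rate, GS. f_equal. rewrite <- sumR_scal. apply sumR_ext. intros i _.
    rewrite real_ratio by trivial. unfold Rdiv. Rring. }
  destruct (in_range N j) eqn:Hj.
  2:{ assert (E0 : real_p j s = 0).
      { unfold real_p. pose proof (Y_out j s Hj) as E. cbv beta in E. rewrite E. ring. }
      assert (E1 : omS N real_u j s = 0).
      { unfold omS, real_u. pose proof (X_out j s Hj) as E. cbv beta in E. rewrite E, vac_range_out by trivial. ring. }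
      unfold p_rate. rewrite E0, E1.
      replace (- _ - _) with 0 by (unfold Rdiv; ring).
      apply (is_derive_ext (fun _ => 0)); [|apply (is_derive_const 0)].
      intros t. unfold real_p. pose proof (Y_out j t Hj) as E2. cbv beta in E2. rewrite E2. Rring. }
  apply in_range_spec in Hj as Hj'.
  set (g := fun t => sys_lin N a0 b (cY j) f t + sys_src dX dY (cY j) t + al * nl (cY j) al f t).
  apply (is_derive_ext_loc (fun t => al * (t ^ S kY * eta j + t ^ S kY * avg kY g t))).
  { apply locally_unit; trivial. intros x Hx. unfold real_p, sysY.
    rewrite (fix_unit (cY j) x) by trivial. simpl sys_exp. simpl sys_ker. fold g.
    rewrite clamp_id by lra. Rring. }
  replace (p_rate N Lam rh real_u real_p real_m j s) with (al * (INR (S kY) * s ^ kY * eta j + s ^ kY * g s)).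
  { apply (is_derive_scal (fun t => t ^ S kY * eta j + t ^ S kY * avg kY g t)).
    apply (is_derive_plus (fun t => t ^ S kY * eta j) (fun t => t ^ S kY * avg kY g t)).
    - apply (is_derive_ext (fun t => eta j * t ^ S kY)); [intros; apply Rmult_comm|].
      replace (INR (S kY) * s ^ kY * eta j) with (eta j * (INR (S kY) * 1 * s ^ Init.Nat.pred (S kY)))
        by (change (Init.Nat.pred (S kY)) with kY; ring).
      apply (is_derive_scal (fun t => t ^ S kY)). apply (is_derive_pow (fun t => t) (S kY)).
      apply (is_derive_id s).
    - apply avg_derive. intros t. apply drive_cont. }
  unfold p_rate. rewrite (WS_expand N real_u (fun i => X i s) (al * phi s) j s Hj') by reflexivity.
  rewrite EG. unfold g. cbv beta iota delta [sys_lin sys_src sys_nonlin].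
  set (S2 := sum_n_m (fun i => (sysY eta f i s * / sysA a0 theta al f s) ^ 2) 1 (N - 1)).
  set (QW := quadW v (al * phi s) (fun i => sysX N f i s) j).
  replace (INR (S kY) * s ^ kY * eta j + s ^ kY * (b s * linW v (fun i => f (cX i) s) j + dY j s
      + al * (b s * phi s * QW - psi s * (al * S2 * sysY eta f j s))))
    with (s ^ kY * (INR (S kY) * eta j + dY j s) + s ^ kY * b s * (linW v (fun i => f (cX i) s) j
      + al * phi s * QW) - al ^ 2 * (s ^ kY * psi s) * S2 * sysY eta f j s) by ring.
  rewrite srcY by trivial.
  replace (s ^ kY * (b s * linW v xi j)) with (s ^ kY * b s * linW v xi j) by ring.
  rewrite !b_spec by trivial.
  (* The lapse friction contains the square of p / AS; the two powers s^eX in its denominator are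
     cancelled here. *)
  assert (Epsi : s ^ kY * psi s = 2 * (1 - s) ^ 3 / rhoS rh s * (s ^ kX) ^ 2 * s ^ S kY).
  { apply Rmult_eq_reg_r with ((s ^ eX) ^ 2); [|apply pow_nonzero, pow_nonzero; lra].
    rewrite psi_spec by trivial. rewrite <- kX_eX, !pow_add. ring. }
  rewrite Epsi.
  replace (linW v (fun i => X i s) j) with (linW v xi j + linW v (fun i => f (cX i) s) j)
    by (unfold linW, sysX; ring).
  unfold real_p. rewrite clamp_id by lra. cbv beta. fold S2 QW. field. lra.
Qed.

Lemma real_m_derive s : 0 < s < 1 ->
  is_derive real_m s (m_rate N Lam rh real_u real_p real_m s).
Proof.
  intros Hs. pose proof (rho_pos s Hs) as Hrho. pose proof (A_neq s) as HAn. cbv beta in HAn.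
  set (g := fun t => sys_lin N a0 b cZ f t + sys_src dX dY cZ t + al * nl cZ al f t).
  apply (is_derive_ext_loc (fun t => m0 + al * (t ^ S kZ * avg kZ g t))).
  { apply locally_unit; trivial. intros x Hx. unfold real_m.
    rewrite (fix_unit cZ x) by trivial. simpl sys_exp. simpl sys_ker. fold g.
    rewrite clamp_id by lra. rewrite <- mz_eZ, pow_add. Rring. }
  replace (m_rate N Lam rh real_u real_p real_m s) with (0 + al * (s ^ kZ * g s)).
  { apply (is_derive_plus (fun _ => m0) (fun t => al * (t ^ S kZ * avg kZ g t))); [apply (is_derive_const m0)|].
    apply (is_derive_scal (fun t => t ^ S kZ * avg kZ g t)). apply avg_derive. intros t; apply drive_cont. }
  unfold m_rate. rewrite (PiS_expand N real_u (fun i => X i s) (al * phi s) s) by reflexivity.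
  set (EN := energy N v (al * phi s) (fun i => X i s)).
  assert (E1 : AS Lam rh real_m s * GS N Lam rh real_p real_m s =
    al ^ 2 * (s ^ kZ * chi s) * sum_n_m (fun i => Y i s ^ 2 * / A s) 1 (N - 1)).
  { unfold GS. rewrite (sumR_ext _ (fun i => (al * s ^ kX * (Y i s / A s)) ^ 2))
      by (intros; rewrite real_ratio by trivial; reflexivity).
    rewrite real_A, <- !sumR_scal by trivial. apply sumR_ext. intros i _. cbv beta.
    assert (Ec : s ^ kZ * chi s = s ^ eX * (s ^ kX) ^ 2).
    { apply Rmult_eq_reg_r with (s ^ eX); [|apply pow_nonzero; lra].
      rewrite chi_spec by trivial. rewrite <- kX_eX, pow_add. ring. }
    rewrite Ec. field. trivial. }
  rewrite E1. unfold g. cbv beta iota delta [sys_lin sys_src sys_nonlin]. fold EN.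
  cbv beta.
  set (SY := sum_n_m (fun i => sysY eta f i s ^ 2 * / sysA a0 theta al f s) 1 (N - 1)).
  replace (energy N v (al * phi s) (fun i => sysX N f i s)) with EN by reflexivity.
  replace (4 * ((al * phi s) ^ 2 * EN) / (4 * rhoS rh s ^ 2))
    with (al ^ 2 * (phi s ^ 2 / rhoS rh s ^ 2) * EN) by (field; lra).
  rewrite <- bZ_spec by trivial. ring.
Qed.

Lemma realization_profile : profile N Lam rh real_u real_p real_m.
Proof.
  split.
  - intros s Hs. split; [|split; [|split]].
    + rewrite real_A by trivial. pose proof (HA s). cbv beta in *.
      apply Rmult_lt_0_compat; [apply pow_lt; lra|lra].
    + intros j; apply real_u_derive, Hs.
    + intros j; apply real_p_derive, Hs.
    + apply real_m_derive, Hs.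
  - intros s _. pose proof (cont_clamp s). pose proof (phi_cont s). split; [|split].
    + intros j. pose proof (X_cont j s). cbv beta in *. unfold real_u. cont.
    + intros j. pose proof (Y_cont j s). cbv beta in *. unfold real_p. cont.
    + pose proof (f_cont cZ s). unfold real_m. cont.
Qed.

End Realization.

(** * Stability and bounds for small profiles *)

Lemma small_profile_stable N Lam rh : (2 <= N)%nat -> Lam < 0 -> 0 <= rh ->
  exists eps, 0 < eps /\ eps <= / 4 /\ forall u p m b,
    profile N Lam rh u p m -> represents N Lam rh u p m b ->
    (forall r, rh < r -> gauge b 0%nat r = 0 /\ gauge b N r = 0) ->
    (forall s j, 0 < s < 1 -> Rabs (u j s) <= eps /\
       Rabs (p j s / AS Lam rh m s) <= eps /\ Rabs (p j s / AS Lam rh m s) <= eps * rhoS rh s) ->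
    no_grav_instability N Lam rh b.
Proof.
  intros HN HLam Hrh.
  assert (HNR : 2 <= INR N) by (apply (le_INR 2); lia).
  set (B := 1 + 8 * INR N + 4 * INR N * (INR N + 1) ^ 2).
  assert (HB : 1 <= B) by (unfold B; nra).
  set (delta := / (4 * INR N ^ 2) / B).
  assert (HN2 : 4 <= INR N ^ 2) by nra.
  assert (Hd0 : 0 < delta).
  { unfold delta. apply Rdiv_lt_0_compat; [apply Rinv_0_lt_compat; lra|lra]. }
  assert (HdB : delta * B = / (4 * INR N ^ 2)) by (unfold delta; field; lra).
  assert (Hd1 : delta <= 1).
  { assert (/ (4 * INR N ^ 2) <= 1) by (rewrite <- Rinv_1; apply Rinv_le_contravar; lra). nra. }
  (* The first part, 4N + 2, is the Lipschitz constant of W in the perturbation; the second bounds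
     (1-s)^2 (1 - Lam r^2), since r (1-s) = rhoS is at most 1 + rh. *)
  set (K := 4 * INR N + 2 + (1 - Lam * (1 + rh) ^ 2)).
  assert (HK : 1 <= K).
  { unfold K. pose proof (pow2_ge_0 (1 + rh)). nra. }
  assert (HK2 : 4 * INR N + 2 <= K /\ 1 - Lam * (1 + rh) ^ 2 <= K).
  { unfold K. pose proof (pow2_ge_0 (1 + rh)). split; nra. }
  exists (delta / (4 * K)).
  assert (He0 : 0 < delta / (4 * K)) by (apply Rdiv_lt_0_compat; lra).
  assert (HeK : delta / (4 * K) * K = delta / 4) by (field; lra).
  set (eps := delta / (4 * K)) in *.
  assert (He1 : eps <= / 4) by nra.
  split; [exact He0|]. split; [exact He1|].
  intros u p m b Hprof Hrep Hends Hb.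
  pose proof (profile_flow N Lam rh u p m b HLam Hrh Hprof Hrep) as Hflow.
  apply (gravitational_stability N Lam rh b (fun j r => p j (sigma rh r))) with (delta := delta); trivial; [lra|fold B; lra|].
  intros r j Hr Hj.
  pose proof (sigma_range rh r Hr) as Hs. pose proof (sigma_rho rh r Hr) as Hrho.
  destruct (Hb (sigma rh r) j Hs) as [Hu [Hg Hg2]].
  destruct (Hflow r Hr) as [Hmu [_ [Hgd _]]].
  assert (ED : Derive (gauge b j) r = (1 - sigma rh r) ^ 2 * (p j (sigma rh r) / AS Lam rh m (sigma rh r))).
  { rewrite (is_derive_unique _ _ _ (Hgd j)).
    rewrite (mu_sigma N Lam rh u p m b Hrh Hrep r Hr).
    destruct (proj1 Hprof _ Hs) as [HA _]. field. split; lra. }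
  destruct (Hrep r Hr) as [Eg _]. rewrite ED.
  set (s := sigma rh r) in *. set (g := p j s / AS Lam rh m s) in *.
  pose proof (rhoS_pos rh s Hrh ltac:(lra)) as Hrp.
  assert (Hv : forall i, Rabs (2 * vac N i * u i s + u i s ^ 2) <= (2 * INR N + 1) * eps).
  { intros i. destruct (Hb s i Hs) as [Hui _].
    apply Rle_trans with (1 := Rabs_triang _ _). rewrite <- RPow_abs, !Rabs_mult.
    rewrite (Rabs_pos_eq 2), (Rabs_pos_eq (vac N i)) by (try lra; apply vac_nonneg).
    pose proof (vac_nonneg N i). pose proof (vac_le N i). pose proof (Rabs_pos (u i s)).
    assert (vac N i * Rabs (u i s) <= INR N * eps) by (apply Rmult_le_compat; trivial). nra. }
  assert (Hg4 : g ^ 2 <= eps ^ 2) by (rewrite <- (pow2_abs g); apply pow_incr; split; [apply Rabs_pos|exact Hg]).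
  assert (H1s : 0 < (1 - s) ^ 2 <= 1).
  { split; [apply pow_lt; lra|]. rewrite <- (pow1 2). apply pow_incr; lra. }
  assert (Hee : eps ^ 2 <= eps) by nra.
  rewrite !Eg. unfold omS.
  split; [|split; [|split; [|split]]].
  - pose proof (vac_ge_1 N j Hj). apply Rabs_le_between in Hu. nra.
  - apply Rle_trans with (1 := Rabs_triang _ _). rewrite (Rabs_pos_eq (vac N j)) by apply vac_nonneg.
    pose proof (vac_le N j). lra.
  - unfold W. rewrite !Eg. unfold omS. pose proof (vacuum_W N 0 j 0 Hj) as E. unfold W in E; simpl gauge in E.
    fold s.
    replace (1 - (vac N j + u j s) ^ 2 + / 2 * ((vac N (j - 1) + u (j - 1)%nat s) ^ 2 + (vac N (j + 1) + u (j + 1)%nat s) ^ 2))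
      with (- (2 * vac N j * u j s + u j s ^ 2)
        + / 2 * ((2 * vac N (j - 1) * u (j - 1)%nat s + u (j - 1)%nat s ^ 2)
          + (2 * vac N (j + 1) * u (j + 1)%nat s + u (j + 1)%nat s ^ 2))) by lra.
    pose proof (Hv j) as A1. pose proof (Hv (j - 1)%nat) as A2. pose proof (Hv (j + 1)%nat) as A3.
    apply Rabs_le_between in A1. apply Rabs_le_between in A2. apply Rabs_le_between in A3.
    assert ((4 * INR N + 2) * eps <= delta / 4)
      by (rewrite <- HeK, (Rmult_comm eps); apply Rmult_le_compat_r; lra).
    apply Rabs_le; lra.
  - assert (Hr2 : (1 - s) ^ 2 * (1 - Lam * r ^ 2) <= 1 - Lam * (1 + rh) ^ 2).
    { replace ((1 - s) ^ 2 * (1 - Lam * r ^ 2)) with ((1 - s) ^ 2 - Lam * (r * (1 - s)) ^ 2) by ring.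
      rewrite <- Hrho.
      assert (rhoS rh s ^ 2 <= (1 + rh) ^ 2) by (apply pow_incr; split; [lra|unfold rhoS; nra]). nra. }
    replace (((1 - s) ^ 2 * g) ^ 2 * (1 - Lam * r ^ 2)) with (g ^ 2 * ((1 - s) ^ 2 * ((1 - s) ^ 2 * (1 - Lam * r ^ 2)))) by ring.
    apply Rle_trans with (eps * K); [|lra].
    assert (0 <= 1 - Lam * r ^ 2) by (pose proof (pow2_ge_0 r); nra).
    assert (0 <= (1 - s) ^ 2 * (1 - Lam * r ^ 2)) by (apply Rmult_le_pos; lra).
    apply Rmult_le_compat; [apply pow2_ge_0|apply Rmult_le_pos; lra|lra|].
    apply Rle_trans with ((1 - s) ^ 2 * (1 - Lam * r ^ 2)); [|lra].
    rewrite <- (Rmult_1_l ((1 - s) ^ 2 * (1 - Lam * r ^ 2))) at 2. apply Rmult_le_compat_r; lra.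
  (* Here the third smallness condition enters: omega' / r is (1-s)^3 g / rhoS, so for solitons [g]
     has to vanish at the origin as fast as s. *)
  - assert (Hq : Rabs ((1 - s) ^ 2 * g / r) <= eps).
    { replace ((1 - s) ^ 2 * g / r) with ((1 - s) ^ 3 * (g * / rhoS rh s)) by (rewrite Hrho; field; lra).
      rewrite !Rabs_mult, Rabs_inv, (Rabs_pos_eq (rhoS rh s)) by lra.
      rewrite (Rabs_pos_eq ((1 - s) ^ 3)) by (apply pow_le; lra).
      assert (H3 : 0 <= (1 - s) ^ 3 <= 1).
      { split; [apply pow_le; lra|]. rewrite <- (pow1 3). apply pow_incr; lra. }
      assert (0 <= Rabs g * / rhoS rh s <= eps); [|nra].
      split; [apply Rmult_le_pos; [apply Rabs_pos|left; apply Rinv_0_lt_compat, Hrp]|].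
      apply Rmult_le_reg_r with (1 := Hrp). rewrite Rmult_assoc, Rinv_l by lra. lra. }
    rewrite <- pow2_abs. apply Rle_trans with (eps ^ 2).
    + apply pow_incr; split; [apply Rabs_pos|exact Hq].
    + nra.
Qed.

Section RealizationBounds.

Variables (N : nat) (L C wm Kc amin : R) (eX kX kY : nat) (w : R -> R)
  (a0 phi theta : R -> R) (eta : nat -> R) (al : R) (f : comp -> R -> R).
Hypothesis HL : 0 <= L.
Hypothesis HC : 0 <= C.
Hypothesis HKc : 0 <= Kc.
Hypothesis Hamin : 0 < amin.
Hypothesis w_bound : forall s, 0 <= s <= 1 -> 0 <= w s <= wm.
Hypothesis Hball : in_ball comp (comp_active N) (comp_weight N L) w C f.
Hypothesis HA : forall s, amin <= sysA a0 theta al f s.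
Hypothesis eta_le : forall j, Rabs (eta j) <= Kc.
Hypothesis phi_le : forall s, Rabs (phi s) <= Kc.

Let PM := INR N * (INR (fact N) * INR (fact N)).

(** The first summand bounds the gauge perturbation per unit amplitude, the second one its
    derivative in s; a single constant then serves all smallness conditions. *)
Definition amplitude_bound : R :=
  Kc * (PM + C * (PM * wm)) + (Kc + C * (L * PM * wm)) / amin.

Lemma PM_nonneg : 0 <= PM.
Proof. apply Rmult_le_pos; [apply pos_INR|]. pose proof (fact_INR_pos N). nra. Qed.

Lemma ball_bound_X j s : Rabs (f (cX j) s) <= C * (PM * wm).
Proof.
  pose proof (w_bound _ (clamp_range s)). pose proof PM_nonneg.
  apply Rle_trans with (1 := proj2 (proj2 Hball) (cX j) s).
  apply Rmult_le_compat_l; trivial. unfold wgt; simpl.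
  destruct (in_range N j); [|apply Rmult_le_pos; lra].
  apply Rmult_le_compat; try lra; [apply perron_nonneg|apply perron_le].
Qed.

Lemma ball_bound_Y j s : Rabs (f (cY j) s) <= C * (L * PM * wm).
Proof.
  pose proof (w_bound _ (clamp_range s)). pose proof PM_nonneg.
  assert (0 <= L * PM) by (apply Rmult_le_pos; trivial).
  apply Rle_trans with (1 := proj2 (proj2 Hball) (cY j) s).
  apply Rmult_le_compat_l; trivial. unfold wgt; simpl.
  destruct (in_range N j); [|apply Rmult_le_pos; lra].
  apply Rmult_le_compat; try lra.
  - apply Rmult_le_pos; [trivial|apply perron_nonneg].
  - apply Rmult_le_compat_l; [trivial|apply perron_le].
Qed.

Lemma wm_nonneg' : 0 <= wm.
Proof. pose proof (w_bound 0 ltac:(lra)). lra. Qed.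

Lemma amplitude_bound_parts : 0 <= Kc * (PM + C * (PM * wm)) /\ 0 <= (Kc + C * (L * PM * wm)) / amin.
Proof.
  pose proof PM_nonneg. pose proof wm_nonneg'. split.
  - apply Rmult_le_pos; trivial. assert (0 <= C * (PM * wm)) by (apply Rmult_le_pos; [|apply Rmult_le_pos]; trivial). lra.
  - assert (0 <= C * (L * PM * wm))
      by (apply Rmult_le_pos; [|apply Rmult_le_pos; [apply Rmult_le_pos|]]; trivial).
    unfold Rdiv. apply Rmult_le_pos; [lra|left; apply Rinv_0_lt_compat, Hamin].
Qed.

Lemma real_u_bound j s : Rabs (real_u N phi al f j s) <= Rabs al * amplitude_bound.
Proof.
  unfold real_u, sysX. rewrite Rmult_assoc, Rabs_mult. apply Rmult_le_compat_l; [apply Rabs_pos|].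
  destruct amplitude_bound_parts. apply Rle_trans with (Kc * (PM + C * (PM * wm))); [|unfold amplitude_bound; lra].
  rewrite Rabs_mult. apply Rmult_le_compat; try apply Rabs_pos; [apply phi_le|].
  apply Rle_trans with (1 := Rabs_triang _ _). apply Rplus_le_compat.
  - rewrite altern_abs. apply perron_le.
  - apply ball_bound_X.
Qed.

Lemma real_ratio_bound j s : 0 < s < 1 ->
  Rabs (al * s ^ kX * (sysY eta f j s / sysA a0 theta al f s)) <= Rabs al * amplitude_bound * s ^ kX.
Proof.
  intros Hs. rewrite Rmult_assoc, (Rmult_comm (s ^ kX)), <- Rmult_assoc, Rabs_mult.
  rewrite (Rabs_pos_eq (s ^ kX)) by (apply pow_le; lra).
  apply Rmult_le_compat_r; [apply pow_le; lra|].
  rewrite Rabs_mult. apply Rmult_le_compat_l; [apply Rabs_pos|].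
  destruct amplitude_bound_parts. apply Rle_trans with ((Kc + C * (L * PM * wm)) / amin); [|unfold amplitude_bound; lra].
  unfold Rdiv. rewrite Rabs_mult, Rabs_inv. specialize (HA s).
  rewrite (Rabs_pos_eq (sysA _ _ _ _ _)) by lra.
  apply Rmult_le_compat; [apply Rabs_pos|left; apply Rinv_0_lt_compat; lra| |apply Rinv_le_contravar; lra].
  unfold sysY. apply Rle_trans with (1 := Rabs_triang _ _). apply Rplus_le_compat; [apply eta_le|apply ball_bound_Y].
Qed.

End RealizationBounds.

(** In an embedded solution |omega_j| / v_j is the same for all j. Here this ratio is below 1 for j
    = 1 and above 1 for j = 2 at the same radius. *)
Lemma nonembedded_of_signs (N : nat) (r0 : R) (b : background) (r : R) :
  (3 <= N)%nat -> r0 < r -> 0 < gauge b 1%nat r < vac N 1 -> vac N 2 < gauge b 2%nat r ->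
  ~ embedded N r0 b.
Proof.
  intros HN Hr H1 H2 [w [e [He H]]].
  pose proof (H 1%nat r ltac:(lia) Hr) as E1. pose proof (H 2%nat r ltac:(lia) Hr) as E2.
  pose proof (vac_ge_1 N 1 ltac:(lia)). pose proof (vac_ge_1 N 2 ltac:(lia)).
  assert (0 < e 1%nat * w r < 1).
  { replace (e 1%nat * vac N 1 * w r) with (vac N 1 * (e 1%nat * w r)) in E1 by ring. nra. }
  assert (1 < e 2%nat * w r).
  { replace (e 2%nat * vac N 2 * w r) with (vac N 2 * (e 2%nat * w r)) in E2 by ring. nra. }
  destruct (He 1%nat) as [F1|F1], (He 2%nat) as [F2|F2]; rewrite F1, F2 in *; lra.
Qed.

Lemma pow_le_1 (x : R) (n : nat) : 0 <= x <= 1 -> 0 <= x ^ n <= 1.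
Proof.
  intros H. split; [apply pow_le; lra|]. rewrite <- (pow1 n). apply pow_incr; lra.
Qed.

Lemma pow_le_base (x : R) (n : nat) : 0 <= x <= 1 -> (1 <= n)%nat -> x ^ n <= x.
Proof.
  intros H Hn. destruct n as [|n]; [lia|]. simpl. pose proof (pow_le_1 x n H). nra.
Qed.

Lemma bernoulli_compl (x : R) (n : nat) : 0 <= x <= 1 -> 1 - (1 - x) ^ n <= INR n * x.
Proof.
  intros H. induction n as [|n IH]; [simpl; lra|].
  rewrite S_INR. simpl pow. pose proof (pow_le_1 (1 - x) n ltac:(lra)). nra.
Qed.

Lemma exp_weight_mono (kap s t : R) : 0 <= kap -> s <= t -> exp (kap * s) <= exp (kap * t).
Proof.
  intros Hk Hst. destruct (Req_dec (kap * s) (kap * t)) as [->|Hn]; [lra|].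
  left. apply exp_increasing. assert (kap * s <= kap * t) by (apply Rmult_le_compat_l; trivial). lra.
Qed.

Lemma exp_weight_cont (kap s : R) : continuous (fun s => exp (kap * s)) s.
Proof.
  apply (continuous_comp (fun s => kap * s) exp); [cont|]. apply continuous_exp.
Qed.

Lemma exp_weight_range (kap s : R) : 0 <= kap -> 0 <= s <= 1 -> 1 <= exp (kap * s) <= exp kap.
Proof.
  intros Hk Hs. split.
  - rewrite <- exp_0, <- (Rmult_0_r kap) at 1. apply exp_weight_mono; lra.
  - rewrite <- (Rmult_1_r kap) at 2. apply exp_weight_mono; lra.
Qed.

Lemma lapse_factor_le (x : R) (n : nat) : 0 <= x <= 1 -> (1 <= n)%nat ->
  Rabs (2 * x ^ n * (1 - x) ^ 3) <= 2 * x.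
Proof.
  intros Hx Hn. pose proof (pow_le_1 x n Hx). pose proof (pow_le_1 (1 - x) 3 ltac:(lra)).
  pose proof (pow_le_base x n Hx Hn). rewrite Rabs_pos_eq by (apply Rmult_le_pos; lra). nra.
Qed.

(** * Solitons *)

Section SolitonInstance.

Variables (N : nat) (Lam : R).
Hypothesis HN : (3 <= N)%nat.
Hypothesis HLam : Lam < 0.

Let l := - Lam / 3.
Let Cq := (3 + l) * (1 + l) / l.
Let kap := 2 * INR N * (INR N + 1) * Cq.
Let PM := INR N * (INR (fact N) * INR (fact N)).
Let Kc := 2 + l + INR N * PM.
Let amin := l / (1 + l).

(** The factor s makes the remainder one order smaller than the leading s^N, which improves the
    gains of the averages to 1/N and 1/(N+1). The exponential absorbs the terms that are small only
    near the origin. *)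
Definition sol_w (kap s : R) : R := s * exp (kap * s).
Definition sol_a0 (Lam s : R) : R := (1 - clamp s) ^ 2 + - Lam / 3 * clamp s ^ 2.
(** Orders at the origin: s^N for omega - v, s^(N-1) for the momenta, s^(2N-1) for the mass. Of the
    last power s^(2N-2) is split off and one factor s stays in the unknown, where it matches the
    weight. The exponents in [sol_psi] and [sol_theta] follow from this. *)
Definition sol_phi (N : nat) (s : R) : R := clamp s ^ N.
Definition sol_psi (N : nat) (s : R) : R := 2 * clamp s ^ (2 * N - 2) * (1 - clamp s) ^ 3.
Definition sol_theta (N : nat) (s : R) : R := 2 * clamp s ^ (2 * N - 3) * (1 - clamp s) ^ 3.
Definition sol_eta (N j : nat) : R := INR N * altern N j.
(** The leading pair solves the gauge equation exactly when a0 = 1, its value at the origin; this is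
    the resulting error. *)
Definition sol_dX (N : nat) (Lam : R) (j : nat) (s : R) : R := INR N * altern N j * (/ sol_a0 Lam s - 1).

Notation one := (fun _ : R => 1).
Notation zero2 := (fun (_ : nat) (_ : R) => 0).

Lemma l_pos : 0 < l.
Proof. unfold l; lra. Qed.

Lemma NR_ge : 3 <= INR N.
Proof. apply (le_INR 3) in HN. simpl in HN. lra. Qed.

Lemma amin_pos : 0 < amin.
Proof. pose proof l_pos. unfold amin. apply Rdiv_lt_0_compat; lra. Qed.

Lemma Cq_pos : 0 < Cq.
Proof. pose proof l_pos. unfold Cq. apply Rdiv_lt_0_compat; nra. Qed.

Lemma kap_pos : 0 < kap.
Proof. pose proof Cq_pos. pose proof NR_ge. unfold kap. apply Rmult_lt_0_compat; nra. Qed.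

(** [amin] is the minimum of (1-c)^2 + l c^2, attained at c = 1/(1+l); hence the square used in the
    proof. *)
Lemma sol_a0_ge s : amin <= sol_a0 Lam s.
Proof.
  pose proof l_pos. unfold sol_a0. fold l. pose proof (clamp_range s). set (c := clamp s) in *.
  unfold amin. apply Rmult_le_reg_r with (1 + l); [lra|].
  unfold Rdiv. rewrite Rmult_assoc, Rinv_l, Rmult_1_r by lra.
  pose proof (pow2_ge_0 ((1 + l) * c - 1)). nra.
Qed.

Lemma sol_a0_le s : Rabs (sol_a0 Lam s) <= 1 + l.
Proof.
  pose proof l_pos. pose proof (sol_a0_ge s). pose proof amin_pos.
  rewrite Rabs_pos_eq by lra. unfold sol_a0. fold l. pose proof (clamp_range s).
  pose proof (pow_le_1 (clamp s) 2 H2). pose proof (pow_le_1 (1 - clamp s) 2 ltac:(lra)). nra.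
Qed.

(** The numerator 1 - a0 vanishes at the origin and is at most (3 + l) s; division by the minimum
    l/(1+l) of a0 gives [Cq]. *)
Lemma sol_a0_inv s : 0 <= s <= 1 -> Rabs (/ sol_a0 Lam s - 1) <= Cq * s.
Proof.
  intros Hs. pose proof l_pos. pose proof (sol_a0_ge s) as Ha. pose proof amin_pos.
  replace (/ sol_a0 Lam s - 1) with ((1 - sol_a0 Lam s) * / sol_a0 Lam s) by (field; lra).
  rewrite Rabs_mult, Rabs_inv, (Rabs_pos_eq (sol_a0 Lam s)) by lra.
  replace (Cq * s) with ((3 + l) * s * / amin) by (unfold Cq, amin; field; lra).
  apply Rmult_le_compat; [apply Rabs_pos|left; apply Rinv_0_lt_compat; lra| |apply Rinv_le_contravar; trivial].
  unfold sol_a0. fold l. rewrite clamp_id by trivial.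
  assert (0 <= s * (1 - s)) by (apply Rmult_le_pos; lra).
  assert (0 <= l * (s * (1 - s))) by (apply Rmult_le_pos; lra).
  assert (0 <= l * s) by (apply Rmult_le_pos; lra).
  assert (0 <= l * s * s) by (apply Rmult_le_pos; lra).
  apply Rabs_le; split; nra.
Qed.

Lemma sol_w_cont s : continuous (sol_w kap) s.
Proof. unfold sol_w. apply cont_mult; [apply continuous_id|apply exp_weight_cont]. Qed.

Lemma sol_w_range s : 0 <= s <= 1 -> s <= sol_w kap s <= exp kap.
Proof.
  intros Hs. pose proof kap_pos. pose proof (exp_weight_range kap s ltac:(lra) Hs).
  unfold sol_w. split; nra.
Qed.

Lemma sol_w_mono s t : 0 <= s -> s <= t -> t <= 1 -> sol_w kap s <= sol_w kap t.
Proof.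
  intros H1 H2 H3. pose proof kap_pos. unfold sol_w.
  apply Rmult_le_compat; trivial; [left; apply exp_pos|apply exp_weight_mono; lra].
Qed.

Lemma clamp_coef (K : R) (g : R -> R) : (forall s, continuous g s) ->
  (forall s, 0 <= s <= 1 -> Rabs (g s) <= K) -> coef K (fun s => g (clamp s)).
Proof.
  intros Hg Hb. split; [|split].
  - intros s. apply (continuous_comp clamp g); [apply cont_clamp|apply Hg].
  - intros s. now rewrite clamp_idem.
  - intros s. apply Hb, clamp_range.
Qed.

Lemma Kc_ge : 2 + l <= Kc.
Proof.
  unfold Kc, PM. pose proof NR_ge. pose proof (fact_INR_pos N).
  assert (0 <= INR N * (INR N * (INR (fact N) * INR (fact N)))) by (repeat apply Rmult_le_pos; lra). lra.
Qed.

Lemma soliton_system : exists C al0, 0 < C /\ 0 < al0 /\ forall al, Rabs al <= al0 -> exists f,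
    in_ball comp (comp_active N) (comp_weight N (INR N)) (sol_w kap) C f /\
    (forall s, amin / 2 <= sysA (sol_a0 Lam) (sol_theta N) al f s) /\
    forall c s, f c s = sysmap comp (comp_active N) (sys_exp 0 1) (sys_ker (N - 1) (N - 2) (2 * N - 2))
      (sys_lin N (sol_a0 Lam) one) (sys_src (sol_dX N Lam) zero2)
      (sys_nonlin N (sol_a0 Lam) one (sol_phi N) (sol_psi N) one (sol_theta N) (sol_eta N)) al f c s.
Proof.
  pose proof l_pos as Hl. pose proof NR_ge as HNR. pose proof amin_pos as Ham. pose proof kap_pos as Hk.
  pose proof Kc_ge as HK. pose proof Cq_pos as HCq.
  assert (Hw0 : forall s, 0 <= s <= 1 -> 0 <= sol_w kap s).
  { intros s Hs. pose proof (sol_w_range s Hs). lra. }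
  (* The contraction factor is met exactly by the step for [cX]: averaging gives N/(N+1), and [kap]
     is chosen so that the correction from 1/a0 - 1 contributes 1/(2(N+1)). The step for [cY] needs
     (N-1)/N, which is smaller. *)
  apply (gauge_system_solution N (INR N) Kc amin 0 1 (N - 1) (N - 2) (2 * N - 2) (sol_w kap) (exp kap)
    (sol_a0 Lam) one (sol_phi N) (sol_psi N) one (sol_theta N) (sol_eta N) (sol_dX N Lam) zero2
    (1 - / (2 * (INR N + 1))) (INR N * Cq)); trivial.
  - lra.
  - lra.
  - apply sol_w_cont.
  - apply sol_w_mono.
  - apply sol_w_range.
  - apply (clamp_coef Kc (fun s => (1 - s) ^ 2 + - Lam / 3 * s ^ 2)).
    + intros; cont.
    + intros s Hs. pose proof (sol_a0_le s) as E. unfold sol_a0 in E. rewrite clamp_id in E by trivial. lra.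
  - split; [|split]; intros; [apply continuous_const|reflexivity|rewrite Rabs_R1; lra].
  - apply (clamp_coef Kc (fun s => s ^ N)); [intros; cont|].
    intros s Hs. pose proof (pow_le_1 s N Hs). rewrite Rabs_pos_eq; lra.
  - apply (clamp_coef Kc (fun s => 2 * s ^ (2 * N - 2) * (1 - s) ^ 3)); [intros; cont|].
    intros s Hs. pose proof (lapse_factor_le s (2 * N - 2) Hs ltac:(lia)). lra.
  - split; [|split]; intros; [apply continuous_const|reflexivity|rewrite Rabs_R1; lra].
  - apply (clamp_coef Kc (fun s => 2 * s ^ (2 * N - 3) * (1 - s) ^ 3)); [intros; cont|].
    intros s Hs. pose proof (lapse_factor_le s (2 * N - 3) Hs ltac:(lia)). lra.
  - apply sol_a0_ge.
  - intros j. unfold sol_eta. rewrite Rabs_mult, altern_abs, (Rabs_pos_eq (INR N)) by lra.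
    unfold Kc. pose proof (perron_le N j). fold PM in H.
    assert (INR N * perron N j <= INR N * PM) by (apply Rmult_le_compat_l; lra). lra.
  - intros s Hs. unfold sol_theta. rewrite clamp_id by trivial.
    pose proof (lapse_factor_le s (2 * N - 3) Hs ltac:(lia)). pose proof (sol_w_range s Hs). nra.
  - intros s Hs. unfold sol_phi. rewrite clamp_id by trivial. rewrite Rmult_1_l.
    pose proof (pow_le_base s N Hs ltac:(lia)). pose proof (pow_le_1 s N Hs). pose proof (sol_w_range s Hs).
    rewrite Rabs_pos_eq by lra. nra.
  - intros s Hs. unfold sol_psi. rewrite clamp_id by trivial.
    pose proof (lapse_factor_le s (2 * N - 2) Hs ltac:(lia)). pose proof (sol_w_range s Hs). nra.
  - left; reflexivity.
  - intros s Hs. pose proof (sol_w_range s Hs). rewrite pow_1. nra.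
  - assert (0 < / (2 * (INR N + 1)) <= 1); [|lra].
    split; [apply Rinv_0_lt_compat; lra|]. rewrite <- Rinv_1. apply Rinv_le_contravar; lra.
  - nra.
  - intros j s. unfold sol_dX. apply cont_mult; [apply continuous_const|].
    apply cont_minus; [|apply continuous_const]. pose proof (sol_a0_ge s).
    apply cont_inv; [|lra]. unfold sol_a0. pose proof (cont_clamp s). cont.
  - intros j s. apply continuous_const.
  - (* The factor 1 / (N + 1) gained by averaging s^(N-1) against a weight vanishing at the origin beats the factor N lost in Y; what remains is absorbed by the exponential. *)
    intros r f j s Hr Hf Hb Hj Hs.
    set (B := r * (INR N * perron N j)).
    assert (HB : 0 <= B) by (unfold B; pose proof (perron_nonneg N j); apply Rmult_le_pos; [lra|apply Rmult_le_pos; lra]).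
    apply (avg_bound (N - 1) 0 (fun s => f s * / sol_a0 Lam s) (fun s => (1 - / (2 * (INR N + 1))) * r * perron N j * sol_w kap s)
      (fun t => B * (exp (kap * s) * (t ^ S N / INR (S N)) + Cq * s ^ S N * (exp (kap * t) / kap)))
      (fun t => B * (exp (kap * s) * t ^ N + Cq * s ^ S N * exp (kap * t)))); try lra.
    + intros t. apply cont_mult; [apply Hf|]. pose proof (sol_a0_ge t). apply cont_inv; [|lra].
      unfold sol_a0. pose proof (cont_clamp t). cont.
    + intros t _. pose proof (exp_weight_cont kap t). cont; try (apply not_0_INR; lia); lra.
    + intros t Ht. apply (is_derive_scal (fun t => exp (kap * s) * (t ^ S N / INR (S N)) + Cq * s ^ S N * (exp (kap * t) / kap))).
      apply (is_derive_plus (fun t => exp (kap * s) * (t ^ S N / INR (S N))) (fun t => Cq * s ^ S N * (exp (kap * t) / kap))).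
      * apply (is_derive_scal (fun t => t ^ S N / INR (S N))).
        assert (INR (S N) <> 0) by (apply not_0_INR; lia).
        auto_derive; trivial. change (Init.Nat.pred (S N)) with N. field. trivial.
      * apply (is_derive_scal (fun t => exp (kap * t) / kap)). auto_derive; trivial. field. lra.
    + intros t Ht. rewrite Rabs_mult, Rabs_inv. pose proof (sol_a0_ge t) as Ha.
      rewrite (Rabs_pos_eq (sol_a0 Lam t)) by lra.
      assert (Hi : / sol_a0 Lam t <= 1 + Cq * t).
      { pose proof (sol_a0_inv t ltac:(lra)) as E. apply Rabs_le_between in E. lra. }
      specialize (Hb t ltac:(lra)).
      assert (Hft : Rabs (f t) <= B * (t * exp (kap * t))) by (unfold B; unfold sol_w in Hb; lra).
      assert (Hp : 0 <= t ^ (N - 1)) by (apply pow_le; lra).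
      assert (He := exp_pos (kap * t)).
      apply Rle_trans with (t ^ (N - 1) * (B * (t * exp (kap * t)) * (1 + Cq * t))).
      { apply Rmult_le_compat_l; [exact Hp|]. apply Rmult_le_compat; trivial; [apply Rabs_pos|].
        left; apply Rinv_0_lt_compat; lra. }
      assert (EN : t ^ N = t ^ (N - 1) * t).
      { replace N with (S (N - 1)) at 1 by lia. simpl. ring. }
      replace (t ^ (N - 1) * (B * (t * exp (kap * t)) * (1 + Cq * t)))
        with (B * (exp (kap * t) * t ^ N + Cq * t ^ S N * exp (kap * t))) by (simpl pow; rewrite EN; ring).
      apply Rmult_le_compat_l; [exact HB|]. apply Rplus_le_compat.
      * apply Rmult_le_compat_r; [apply pow_le; lra|]. apply exp_weight_mono; lra.
      * apply Rmult_le_compat_r; [lra|]. apply Rmult_le_compat_l; [lra|]. apply pow_incr; lra.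
    + rewrite pow_O, Rmult_1_l. replace (S (N - 1)) with N by lia.
      replace (0 ^ S N) with 0 by (simpl; ring). rewrite Rmult_0_r, exp_0.
      replace (0 / INR (S N)) with 0 by (unfold Rdiv; ring). rewrite Rmult_0_r, Rplus_0_l.
      assert (Hp : 0 < s ^ N) by (apply pow_lt; lra). assert (He := exp_pos (kap * s)).
      assert (Hsub : 0 <= B * (Cq * s ^ S N * (1 / kap))).
      { apply Rmult_le_pos; [exact HB|]. apply Rmult_le_pos; [apply Rmult_le_pos; [lra|apply pow_le; lra]|].
        left; apply Rdiv_lt_0_compat; lra. }
      apply Rle_trans with (B * (exp (kap * s) * (s ^ S N / INR (S N)) + Cq * s ^ S N * (exp (kap * s) / kap))); [lra|].
      right. unfold B, sol_w. rewrite S_INR. unfold kap. simpl pow. field. repeat split; lra.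
  - intros r f j s Hr Hf Hb Hj Hs.
    (* The matrix costs N(N-1), the average of s^(N-2) against a weight of first order gains 1/N,
       and [L = N] gains another 1/N. *)
    set (B := INR N * (INR N - 1) * (r * perron N j)).
    assert (HB0 : 0 <= r * perron N j) by (apply Rmult_le_pos; [lra|apply perron_nonneg]).
    assert (HB : 0 <= B) by (unfold B; apply Rmult_le_pos; [nra|trivial]).
    apply (avg_bound (N - 2) 0 (fun s => 1 * f s) (fun s => (1 - / (2 * (INR N + 1))) * r * (INR N * perron N j) * sol_w kap s)
      (fun t => B * exp (kap * s) * (t ^ N / INR N))
      (fun t => B * exp (kap * s) * t ^ (N - 1))); try lra.
    + intros t. cont. apply Hf.
    + intros t _. cont. lra.
    + intros t Ht. apply (is_derive_scal (fun t => t ^ N / INR N)).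
      auto_derive; trivial. replace (Init.Nat.pred N) with (N - 1)%nat by lia. field. lra.
    + intros t Ht. rewrite Rmult_1_l. specialize (Hb t ltac:(lra)).
      assert (Hp : 0 <= t ^ (N - 2)) by (apply pow_le; lra).
      apply Rle_trans with (t ^ (N - 2) * (B * (t * exp (kap * t)))).
      { apply Rmult_le_compat_l; [exact Hp|]. unfold B; unfold sol_w in Hb. lra. }
      replace (t ^ (N - 1)) with (t ^ (N - 2) * t) by (replace (N - 1)%nat with (S (N - 2)) by lia; simpl; ring).
      replace (t ^ (N - 2) * (B * (t * exp (kap * t)))) with (B * exp (kap * t) * (t ^ (N - 2) * t)) by ring.
      apply Rmult_le_compat_r; [apply Rmult_le_pos; lra|]. apply Rmult_le_compat_l; [exact HB|].
      apply exp_weight_mono; lra.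
    + rewrite pow_O, Rmult_1_l. replace (S (N - 2)) with (N - 1)%nat by lia.
      replace (0 ^ N) with 0 by (symmetry; apply pow_i; lia).
      replace (0 / INR N) with 0 by (unfold Rdiv; ring). rewrite Rmult_0_r, Rminus_0_r.
      replace (s ^ N) with (s ^ (N - 1) * s) by (replace N with (S (N - 1)) at 2 by lia; simpl; ring).
      assert (Hp : 0 < s ^ (N - 1)) by (apply pow_lt; lra). assert (He := exp_pos (kap * s)).
      set (Q := s ^ (N - 1) * s * exp (kap * s) * (r * perron N j)).
      assert (HQ : 0 <= Q).
      { unfold Q. apply Rmult_le_pos; [|exact HB0]. apply Rmult_le_pos; [apply Rmult_le_pos|]; lra. }
      replace (B * exp (kap * s) * (s ^ (N - 1) * s / INR N)) with ((INR N - 1) * Q) by (unfold B, Q; field; lra).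
      replace (s ^ (N - 1) * ((1 - / (2 * (INR N + 1))) * r * (INR N * perron N j) * sol_w kap s))
        with ((1 - / (2 * (INR N + 1))) * INR N * Q) by (unfold Q, sol_w; ring).
      apply Rmult_le_compat_r; [exact HQ|].
      assert (/ (2 * (INR N + 1)) * INR N <= 1); [|lra].
      apply Rmult_le_reg_l with (2 * (INR N + 1)); [lra|].
      rewrite <- Rmult_assoc, Rinv_r by lra. lra.
  - intros j s Hj Hs.
    apply (avg_weight_bound (sol_w kap)); trivial.
    + apply sol_w_mono.
    + pose proof (perron_nonneg N j). apply Rmult_le_pos; [nra|trivial].
    + intros t. unfold sol_dX. apply cont_mult; [apply continuous_const|].
      apply cont_minus; [|apply continuous_const]. pose proof (sol_a0_ge t).
      apply cont_inv; [|lra]. unfold sol_a0. pose proof (cont_clamp t). cont.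
    + intros t Ht. unfold sol_dX. rewrite !Rabs_mult, altern_abs, (Rabs_pos_eq (INR N)) by lra.
      pose proof (sol_a0_inv t ltac:(lra)). pose proof (sol_w_range t ltac:(lra)).
      pose proof (perron_nonneg N j).
      replace (INR N * Cq * perron N j * sol_w kap t) with (INR N * perron N j * (Cq * sol_w kap t)) by ring.
      apply Rmult_le_compat_l; [nra|]. nra.
  - intros j s Hj Hs. rewrite avg_zero, Rmult_0_r, Rabs_R0.
    pose proof (perron_nonneg N j). pose proof (Hw0 s ltac:(lra)).
    apply Rmult_le_pos; [|trivial]. apply Rmult_le_pos; [nra|]. apply Rmult_le_pos; lra.
Qed.

End SolitonInstance.

(** * Backgrounds built from soliton fixed points *)

Definition profile_background (N : nat) (Lam rh : R) (u p : nat -> R -> R) (m : R -> R) : background :=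
  Background (fun r => m (sigma rh r))
    (fun r => exp (RInt (lapse_rate N Lam rh p m) 1 (sigma rh r)))
    (fun j r => omS N u j (sigma rh r)).

Lemma profile_background_represents N Lam rh u p m :
  represents N Lam rh u p m (profile_background N Lam rh u p m).
Proof. intros r _. repeat split. Qed.

Lemma bigO_everywhere (f g : R -> R) (r0 K : R) :
  (forall r, r0 < r -> Rabs (f r) <= K * Rabs (g r)) -> is_bigO (at_right r0) f g.
Proof. intros H. exists K. exists (mkposreal 1 Rlt_0_1). intros r _ Hr. apply H, Hr. Qed.

(* Taylor coefficients at the origin of the soliton of amplitude [al]: only orders [0] and [N] are present. *)
Definition sol_coef (N : nat) (al : R) (j k : nat) : R := kron 0 k * vac N j + kron N k * (al * altern N j).

Lemma sol_coef_sum N al j r : (1 <= N)%nat ->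
  sum_n (fun k => sol_coef N al j k * r ^ k) N = vac N j + al * altern N j * r ^ N.
Proof.
  intros HN. unfold sum_n, sol_coef.
  rewrite (sumR_ext _ (fun k => kron 0 k * (vac N j * r ^ k) + kron N k * (al * altern N j * r ^ k)))
    by (intros; Rring).
  rewrite sumR_plus, !sum_kron_l. unfold guard. simpl. rewrite Nat.leb_refl. ring.
Qed.

Lemma sigma_inv (s : R) : 0 < s < 1 -> exists r, 0 < r /\ sigma 0 r = s.
Proof.
  intros Hs. exists (s / (1 - s)). split; [apply Rdiv_lt_0_compat; lra|].
  unfold sigma. field. split; lra.
Qed.

Section SolitonBackground.

Variables (N : nat) (Lam C al : R) (f : comp -> R -> R).
Hypothesis HN : (3 <= N)%nat.
Hypothesis HLam : Lam < 0.
Hypothesis HC : 0 < C.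

Let l := - Lam / 3.
Let Cq := (3 + l) * (1 + l) / l.
Let kap := 2 * INR N * (INR N + 1) * Cq.
Let PM := INR N * (INR (fact N) * INR (fact N)).
Let Kc := 2 + l + INR N * PM.
Let amin := l / (1 + l).

Notation one := (fun _ : R => 1).
Notation zero2 := (fun (_ : nat) (_ : R) => 0).
Notation U := (real_u N (sol_phi N) al f).
Notation Pf := (real_p (N - 2) (sol_eta N) al f).
Notation M := (real_m (2 * N - 2) 0 al f).
Notation A := (sysA (sol_a0 Lam) (sol_theta N) al f).
Notation Y := (fun j s => sysY (sol_eta N) f j s).

Hypothesis Hball : in_ball comp (comp_active N) (comp_weight N (INR N)) (sol_w kap) C f.
Hypothesis HA : forall s, amin / 2 <= A s.
Hypothesis Hfix : forall c s, f c s =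
  sysmap comp (comp_active N) (sys_exp 0 1) (sys_ker (N - 1) (N - 2) (2 * N - 2))
      (sys_lin N (sol_a0 Lam) one) (sys_src (sol_dX N Lam) zero2)
      (sys_nonlin N (sol_a0 Lam) one (sol_phi N) (sol_psi N) one (sol_theta N) (sol_eta N)) al f c s.

(** All powers are written over s^(N-3), so that truncated subtraction disappears and [field] can
    compare them. *)
Lemma sol_pows s : s ^ N = s ^ (N - 3) * s ^ 3 /\ s ^ (N - 1) = s ^ (N - 3) * s ^ 2 /\
  s ^ (N - 2) = s ^ (N - 3) * s /\ s ^ (2 * N - 2) = (s ^ (N - 3)) ^ 2 * s ^ 4 /\
  s ^ (2 * N - 3) = (s ^ (N - 3)) ^ 2 * s ^ 3.
Proof.
  rewrite <- !pow_mult, <- !pow_add.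
  replace (s ^ (N - 2)) with (s ^ (N - 3) * s)
    by (replace (N - 2)%nat with (S (N - 3)) by lia; simpl; ring).
  repeat split; f_equal; lia.
Qed.

Lemma sol_amin : 0 < amin.
Proof. apply (amin_pos Lam HLam). Qed.

Lemma sol_a0_pos s : 0 < sol_a0 Lam s.
Proof. pose proof (sol_a0_ge Lam HLam s). pose proof sol_amin. unfold amin, l in *. lra. Qed.

Lemma sol_a0_cont s : continuous (sol_a0 Lam) s.
Proof. unfold sol_a0. pose proof (cont_clamp s). cont. Qed.

Lemma sol_theta_cont s : continuous (sol_theta N) s.
Proof. unfold sol_theta. pose proof (cont_clamp s). cont. Qed.

Lemma rhoS_0 s : rhoS 0 s = s.
Proof. unfold rhoS. ring. Qed.

Lemma sol_theta_spec s : 0 < s < 1 ->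
  2 * s ^ (2 * N - 2) * (1 - s) ^ 3 / rhoS 0 s = s ^ 0 * sol_theta N s.
Proof.
  intros Hs. unfold sol_theta. rewrite clamp_id, rhoS_0 by lra.
  destruct (sol_pows s) as [_ [_ [_ [-> ->]]]]. simpl. field. lra.
Qed.

Lemma sol_a0_spec s : 0 < s < 1 ->
  (1 - s) ^ 2 - Lam / 3 * rhoS 0 s ^ 2 - 2 * 0 * (1 - s) ^ 3 / rhoS 0 s = s ^ 0 * sol_a0 Lam s.
Proof.
  intros Hs. unfold sol_a0. rewrite clamp_id, rhoS_0 by lra. simpl. field. lra.
Qed.

Lemma soliton_profile : profile N Lam 0 U Pf M.
Proof.
  pose proof sol_amin as Ham.
  apply (realization_profile N (INR N) C 0 1 (N - 1) (N - 2) (2 * N - 2) (2 * N - 2) (sol_w kap)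
    (sol_a0 Lam) one (sol_phi N) (fun s => INR N * s ^ (N - 1)) (sol_psi N) one (sol_theta N) (sol_eta N)
    (sol_dX N Lam) zero2 Lam 0 0 (amin / 2) al f); trivial; try lia.
  - lra.
  - apply sol_a0_cont.
  - apply sol_a0_pos.
  - intros; apply continuous_const.
  - intros s. unfold sol_phi. pose proof (cont_clamp s). cont.
  - intros s. unfold sol_psi. pose proof (cont_clamp s). cont.
  - intros; apply continuous_const.
  - apply sol_theta_cont.
  - intros j s. unfold sol_dX. apply cont_mult; [apply continuous_const|].
    apply cont_minus; [|apply continuous_const]. pose proof (sol_a0_pos s).
    apply cont_inv; [apply sol_a0_cont|lra].
  - intros; apply continuous_const.
  - intros j Hj. unfold sol_eta, altern, perron. rewrite (vac_range_out N 0 1 (N - 1) (N - 2) (2 * N - 2) (2 * N - 2)) by (trivial; lia). ring.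
  - intros s Hs. apply (is_derive_ext_loc (fun s => s ^ N)).
    { apply locally_unit; trivial. intros x Hx. unfold sol_phi. rewrite clamp_id by lra. reflexivity. }
    replace (INR N * s ^ (N - 1)) with (INR N * 1 * s ^ Init.Nat.pred N)
      by (replace (Init.Nat.pred N) with (N - 1)%nat by lia; ring).
    apply (is_derive_pow (fun t => t) N). apply (is_derive_id s).
  - intros s Hs. unfold sol_phi. rewrite clamp_id by lra. replace (S (N - 1)) with N by lia. simpl. ring.
  - intros j s Hs Hj. unfold sol_dX, sol_eta. pose proof (sol_a0_pos s). field. lra.
  (* The eigenvalue matches here: (N-1) times N [altern] equals the matrix applied to [altern], so
     the momenta need no source. *)
  - intros j s Hs Hj. unfold sol_eta.
    pose proof (linW_altern N 1 j Hj) as E.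
    replace (fun i => 1 * altern N i) with (altern N) in E
      by (apply functional_extensionality; intros; ring).
    rewrite E. replace (S (N - 2)) with (N - 1)%nat by lia. rewrite minus_INR by lia. simpl INR. ring.
  - intros s Hs. unfold sol_phi. rewrite clamp_id, rhoS_0 by lra.
    destruct (sol_pows s) as [-> [_ [-> _]]]. field. lra.
  - intros s Hs. unfold sol_psi. rewrite clamp_id, rhoS_0 by lra. replace (S (N - 2)) with (N - 1)%nat by lia.
    destruct (sol_pows s) as [_ [-> [-> [-> _]]]]. simpl pow at 6. field. lra.
  - intros s Hs. replace (S (N - 2)) with (N - 1)%nat by lia.
    destruct (sol_pows s) as [_ [-> [_ [-> _]]]]. simpl. ring.
  - intros s Hs. unfold sol_phi. rewrite clamp_id, rhoS_0 by lra.
    destruct (sol_pows s) as [-> [_ [_ [-> _]]]]. field. lra.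
  - apply sol_theta_spec.
  - apply sol_a0_spec.
  - intros s Hs. rewrite rhoS_0. lra.
Qed.

Lemma sol_ball_X j s : 0 <= s <= 1 -> Rabs (f (cX j) s) <= C * (perron N j * (exp kap * s)).
Proof.
  intros Hs. apply Rle_trans with (1 := proj2 (proj2 Hball) (cX j) s).
  apply Rmult_le_compat_l; [lra|]. unfold wgt; simpl. rewrite clamp_id by trivial.
  pose proof (perron_nonneg N j). pose proof (kap_pos N Lam HN HLam) as Hk. fold l Cq kap in Hk.
  pose proof (exp_weight_range kap s ltac:(lra) Hs).
  destruct (in_range N j).
  - apply Rmult_le_compat_l; trivial. unfold sol_w. rewrite Rmult_comm. apply Rmult_le_compat_r; lra.
  - apply Rmult_le_pos; trivial. apply Rmult_le_pos; lra.
Qed.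

Lemma sol_ball_Z s : 0 <= s <= 1 -> Rabs (f cZ s) <= C * (exp kap * s).
Proof.
  intros Hs. apply Rle_trans with (1 := proj2 (proj2 Hball) cZ s).
  apply Rmult_le_compat_l; [lra|]. unfold wgt; simpl. rewrite clamp_id by trivial.
  pose proof (kap_pos N Lam HN HLam) as Hk. fold l Cq kap in Hk.
  pose proof (exp_weight_range kap s ltac:(lra) Hs). unfold sol_w.
  rewrite Rmult_1_l, Rmult_comm. apply Rmult_le_compat_r; lra.
Qed.

Definition sol_amp : R := amplitude_bound N (INR N) C (exp kap) Kc (amin / 2).

Lemma sol_w_bound s : 0 <= s <= 1 -> 0 <= sol_w kap s <= exp kap.
Proof. intros Hs. pose proof (sol_w_range N Lam HN HLam s Hs) as E. fold l Cq kap in E. lra. Qed.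

Lemma sol_eta_le j : Rabs (sol_eta N j) <= Kc.
Proof.
  pose proof (NR_ge N HN). pose proof (l_pos Lam HLam) as Hl. fold l in Hl.
  unfold sol_eta. rewrite Rabs_mult, altern_abs, (Rabs_pos_eq (INR N)) by lra.
  unfold Kc. pose proof (perron_le N j) as E. fold PM in E.
  assert (INR N * perron N j <= INR N * PM) by (apply Rmult_le_compat_l; lra). lra.
Qed.

Lemma sol_Kc_ge : 2 <= Kc.
Proof. pose proof (Kc_ge N Lam HN) as E. fold l PM Kc in E. pose proof (l_pos Lam HLam) as Hl. fold l in Hl. lra. Qed.

Lemma sol_u_bound j s : Rabs (U j s) <= Rabs al * sol_amp.
Proof.
  pose proof (NR_ge N HN). pose proof sol_amin. pose proof sol_Kc_ge.
  apply (real_u_bound N (INR N) C (exp kap) Kc (amin / 2) (sol_w kap)); try lra; trivial.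
  - apply sol_w_bound.
  - intros t. unfold sol_phi. pose proof (pow_le_1 (clamp t) N (clamp_range t)). rewrite Rabs_pos_eq; lra.
Qed.

Lemma sol_ratio j s : 0 < s < 1 ->
  Pf j s / AS Lam 0 M s = al * s ^ (N - 1) * (Y j s / A s).
Proof.
  intros Hs. pose proof sol_amin.
  apply (real_ratio 0 (N - 1) (N - 2) (2 * N - 2) (sol_a0 Lam) (sol_theta N) (sol_eta N) Lam 0 0 (amin / 2) al f);
    trivial; try lia; try lra.
  - apply sol_theta_spec.
  - apply sol_a0_spec.
  - intros t Ht. rewrite rhoS_0. lra.
Qed.

Lemma sol_ratio_bound j s : 0 < s < 1 -> Rabs (Pf j s / AS Lam 0 M s) <= Rabs al * sol_amp * s.
Proof.
  intros Hs. rewrite sol_ratio by trivial.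
  pose proof (NR_ge N HN). pose proof sol_amin. pose proof sol_Kc_ge.
  apply Rle_trans with (Rabs al * sol_amp * s ^ (N - 1)).
  - apply (real_ratio_bound N (INR N) C (exp kap) Kc (amin / 2) (N - 1) (sol_w kap)); try lra; trivial.
    + apply sol_w_bound.
    + apply sol_eta_le.
  - apply Rmult_le_compat_l; [|apply pow_le_base; [lra|lia]].
    pose proof (Rabs_pos (U 1%nat s)). pose proof (sol_u_bound 1 s). lra.
Qed.

Lemma sol_u_out j s : in_range N j = false -> U j s = 0.
Proof.
  intros Hj. unfold real_u.
  pose proof (X_out N 0 1 (N - 1) (N - 2) (2 * N - 2) (2 * N - 2) (sol_a0 Lam) one (sol_phi N) (sol_psi N)
    one (sol_theta N) (sol_eta N) (sol_dX N Lam) zero2 al f HN Hfix ltac:(lia) ltac:(lia) j s Hj) as E.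
  cbv beta in E. rewrite E. ring.
Qed.

Notation bg := (profile_background N Lam 0 U Pf M).

Lemma sol_gauge_ends r : gauge bg 0%nat r = 0 /\ gauge bg N r = 0.
Proof.
  simpl gauge. unfold omS. rewrite vac_0, vac_out, !sol_u_out by (trivial; unfold in_range; simpl;
    try reflexivity; apply Bool.andb_false_iff; right; apply Nat.leb_gt; lia).
  lra.
Qed.

(** The logarithmic derivative of the lapse extends continuously to s = 0 as [sol_theta] times a
    bounded sum, and is at most 2 K s. So the lapse exceeds its limit at the origin by at most K
    s^2. *)
Lemma sol_lapse_origin : exists S0, 0 < S0 /\
  is_bigO (at_right 0) (fun r => lapse bg r - S0) (fun r => r ^ 2).
Proof.
  set (sq := fun s => al ^ 2 * sum_n_m (fun i => (Y i s / A s) ^ 2) 1 (N - 1)).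
  set (g := fun s => sol_theta N s * sq s).
  pose proof sol_amin as Ham.
  assert (Hsq : forall s, continuous sq s).
  { intros s. unfold sq.
    pose proof (A_cont N (INR N) C (sol_w kap) (sol_a0 Lam) (sol_theta N) al f Hball sol_a0_cont sol_theta_cont s) as H1.
    cbv beta in H1. specialize (HA s).
    cont; [apply (Y_cont N (INR N) C (sol_w kap) (sol_eta N) f Hball j s)|lra]. }
  assert (Hg : forall s, continuous g s) by (intros s; unfold g; apply cont_mult; [apply sol_theta_cont|apply Hsq]).
  assert (Hsq0 : forall s, 0 <= sq s).
  { intros s. unfold sq. apply Rmult_le_pos; [apply pow2_ge_0|]. apply sumR_nonneg; intros; apply pow2_ge_0. }
  destruct (continuity_ab_maj sq 0 1) as [x [Hx _]]; [lra| |].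
  { intros c Hc. apply continuity_pt_filterlim. apply Hsq. }
  set (K := sq x). assert (HK : 0 <= K) by apply Hsq0.
  assert (Hgb : forall s, 0 <= s <= 1 -> 0 <= g s <= 2 * s * K).
  { intros s Hs. unfold g, sol_theta. rewrite clamp_id by trivial.
    pose proof (lapse_factor_le s (2 * N - 3) Hs ltac:(lia)) as E1.
    assert (E0 : 0 <= 2 * s ^ (2 * N - 3) * (1 - s) ^ 3).
    { apply Rmult_le_pos; [|apply pow_le; lra]. apply Rmult_le_pos; [lra|apply pow_le; lra]. }
    rewrite Rabs_pos_eq in E1 by trivial. specialize (Hx s Hs). pose proof (Hsq0 s).
    split; [apply Rmult_le_pos; trivial|]. apply Rmult_le_compat; trivial. }
  set (F := fun s => exp (RInt g 1 s)).
  assert (HF : forall s, is_derive F s (g s * F s)).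
  { intros s. unfold F. apply (is_derive_comp exp (fun s => RInt g 1 s)).
    - apply is_derive_exp.
    - apply is_derive_primitive, Hg. }
  assert (HFc : forall s, continuous F s) by (intros s; apply (ex_derive_continuous F); eexists; apply HF).
  assert (F1 : F 1 = 1) by (unfold F; rewrite RInt_point; apply exp_0).
  assert (HFpos : forall s, 0 < F s) by (intros; apply exp_pos).
  assert (HF1 : forall s, 0 <= s <= 1 -> F s <= 1).
  { intros s Hs. rewrite <- F1. apply (nonneg_derive_mono F (fun s => g s * F s)); try lra; auto.
    intros y Hy. apply Rmult_le_pos; [apply Hgb; lra|left; apply HFpos]. }
  exists (F 0). split; [apply HFpos|].
  apply bigO_everywhere with (K := K). intros r Hr.
  pose proof (sigma_range 0 r Hr) as Hs.
  change (lapse bg r) with (exp (RInt (lapse_rate N Lam 0 Pf M) 1 (sigma 0 r))).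
  assert (E : RInt (lapse_rate N Lam 0 Pf M) 1 (sigma 0 r) = RInt g 1 (sigma 0 r)).
  { apply RInt_ext. intros y Hy. rewrite Rmin_right, Rmax_left in Hy by lra.
    unfold lapse_rate, GS, g, sq.
    rewrite (sumR_ext _ (fun j => (al * y ^ (N - 1)) ^ 2 * (Y j y / A y) ^ 2))
      by (intros; rewrite sol_ratio by lra; Rring).
    rewrite sumR_scal, rhoS_0. unfold sol_theta. rewrite clamp_id by lra.
    destruct (sol_pows y) as [_ [-> [_ [_ ->]]]].
    set (SS := sum_n_m _ 1 (N - 1)). match goal with |- @eq _ ?a ?b => change (@eq R a b) end. field. lra. }
  rewrite E. fold (F (sigma 0 r)). set (s := sigma 0 r) in *.
  assert (Hsr : s <= r).
  { unfold s, sigma. rewrite Rminus_0_r. apply Rmult_le_reg_r with (1 + r); [lra|].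
    unfold Rdiv. rewrite Rmult_assoc, Rinv_l by lra. nra. }
  assert (L1 : F 0 <= F s).
  { apply (nonneg_derive_mono F (fun s => g s * F s)); try lra; auto.
    intros y Hy. apply Rmult_le_pos; [apply Hgb; lra|left; apply HFpos]. }
  assert (L2 : K * 0 ^ 2 - F 0 <= K * s ^ 2 - F s).
  { apply (nonneg_derive_mono (fun t => K * t ^ 2 - F t) (fun t => K * (2 * t) - g t * F t)); try lra.
    - intros y Hy. apply cont_minus; [cont|auto].
    - intros y Hy. apply (is_derive_minus (fun t => K * t ^ 2) F); [|apply HF].
      auto_derive; trivial. ring.
    - intros y Hy. pose proof (Hgb y ltac:(lra)). pose proof (HF1 y ltac:(lra)). pose proof (HFpos y). nra. }
  rewrite (Rabs_pos_eq (r ^ 2)) by apply pow2_ge_0.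
  rewrite Rabs_pos_eq by lra. assert (s ^ 2 <= r ^ 2) by (apply pow_incr; lra). nra.
Qed.

Lemma sol_sigma_le r : 0 < r -> 0 < sigma 0 r <= r /\ sigma 0 r < 1 /\ sigma 0 r = r * (1 - sigma 0 r).
Proof.
  intros Hr. pose proof (sigma_range 0 r Hr). pose proof (sigma_rho 0 r Hr) as E.
  rewrite rhoS_0 in E. repeat split; try lra. rewrite E. nra.
Qed.

(** Two errors of order r^(N+1): the remainder, which vanishes linearly at the origin, and the
    replacement of s^N by r^N, where s = r (1-s) and Bernoulli's inequality bounds 1 - (1-s)^N by N
    s. *)
Lemma sol_origin_coefficients : origin_coefficients N bg (sol_coef N al).
Proof.
  intros j Hj. apply bigO_everywhere with (K := Rabs al * (C * (perron N j * exp kap) + perron N j * INR N)).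
  intros r Hr. rewrite sol_coef_sum by lia. simpl gauge. unfold omS, real_u, sysX.
  destruct (sol_sigma_le r Hr) as [Hs1 [Hs2 Hs3]]. set (s := sigma 0 r) in *.
  unfold sol_phi. rewrite clamp_id by lra.
  replace (vac N j + al * s ^ N * (altern N j + f (cX j) s) - (vac N j + al * altern N j * r ^ N))
    with (al * (s ^ N * f (cX j) s - altern N j * (r ^ N - s ^ N))) by ring.
  rewrite Rabs_mult, (Rmult_assoc (Rabs al)). apply Rmult_le_compat_l; [apply Rabs_pos|].
  rewrite Nat.add_1_r, (Rabs_pos_eq (r ^ S N)) by (apply pow_le; lra).
  unfold Rminus. apply Rle_trans with (1 := Rabs_triang _ _). rewrite Rabs_Ropp, !Rabs_mult.
  rewrite Rmult_plus_distr_r. apply Rplus_le_compat.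
  - rewrite Rabs_pos_eq by (apply pow_le; lra).
    apply Rle_trans with (s ^ N * (C * (perron N j * (exp kap * s)))).
    + apply Rmult_le_compat_l; [apply pow_le; lra|]. apply sol_ball_X; lra.
    + replace (s ^ N * (C * (perron N j * (exp kap * s)))) with (C * (perron N j * exp kap) * s ^ S N) by (simpl; ring).
      apply Rmult_le_compat_l; [|apply pow_incr; lra].
      pose proof (perron_nonneg N j). pose proof (exp_pos kap). apply Rmult_le_pos; [lra|]. apply Rmult_le_pos; lra.
  - rewrite altern_abs, Rmult_assoc. apply Rmult_le_compat_l; [apply perron_nonneg|].
    assert (E : s ^ N = r ^ N * (1 - s) ^ N) by (rewrite Hs3 at 1; apply Rpow_mult_distr).
    assert (Hp : 0 <= r ^ N) by (apply pow_le; lra).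
    replace (r ^ N + - s ^ N) with (r ^ N * (1 - (1 - s) ^ N)) by (rewrite E; ring).
    pose proof (bernoulli_compl s N ltac:(lra)) as Bn.
    pose proof (pow_le_1 (1 - s) N ltac:(lra)).
    rewrite Rabs_pos_eq by (apply Rmult_le_pos; lra).
    apply Rle_trans with (r ^ N * (INR N * s)); [apply Rmult_le_compat_l; trivial|].
    replace (INR N * r ^ S N) with (r ^ N * (INR N * r)) by (simpl; ring).
    apply Rmult_le_compat_l; trivial. apply Rmult_le_compat_l; [apply pos_INR|lra].
Qed.

Lemma sol_is_soliton : Rabs al * sol_amp <= / 4 -> soliton N Lam bg.
Proof.
  intros Hsmall.
  pose proof (profile_flow N Lam 0 U Pf M bg HLam (Rle_refl 0) soliton_profile (profile_background_represents _ _ _ _ _ _)) as Hflow.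
  split; [|split; [|split; [|split; [|split]]]].
  - split; [apply sol_gauge_ends|]. intros j Hj. exists 1; split; [lra|]. simpl gauge. unfold omS.
    pose proof (vac_ge_1 N j Hj). pose proof (sol_u_bound j (sigma 0 1)) as E.
    apply Rabs_le_between in E. lra.
  - intros r Hr. destruct (Hflow r Hr) as [H1 [H2 _]].
    split; [apply (flow_regular N Lam 0 bg _ (Rle_refl 0) Hflow r Hr)|].
    split; [trivial|]. split; [trivial|].
    apply (flow_field_equations N Lam 0 bg _ (Rle_refl 0) Hflow r Hr).
  - apply bigO_everywhere with (K := Rabs al * (C * exp kap)). intros r Hr.
    change (mass bg r) with (M (sigma 0 r)).
    destruct (sol_sigma_le r Hr) as [Hs1 [Hs2 _]]. set (s := sigma 0 r) in *.
    unfold real_m. rewrite clamp_id by lra. rewrite Rplus_0_l, !Rabs_mult, !Rmult_assoc.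
    apply Rmult_le_compat_l; [apply Rabs_pos|].
    rewrite (Rabs_pos_eq (s ^ _)), (Rabs_pos_eq (r ^ 3)) by (apply pow_le; lra).
    apply Rle_trans with (s ^ (2 * N - 2) * (C * (exp kap * s))).
    + apply Rmult_le_compat_l; [apply pow_le; lra|apply sol_ball_Z; lra].
    + pose proof (exp_pos kap).
      replace (s ^ (2 * N - 2)) with (s ^ (2 * N - 4) * s ^ 2) by (rewrite <- pow_add; f_equal; lia).
      pose proof (pow_le_1 s (2 * N - 4) ltac:(lra)).
      assert (s ^ 3 <= r ^ 3) by (apply pow_incr; lra).
      assert (0 <= s ^ 3) by (apply pow_le; lra).
      replace (s ^ (2 * N - 4) * s ^ 2 * (C * (exp kap * s))) with (C * (exp kap * (s ^ (2 * N - 4) * s ^ 3))) by ring.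
      apply Rmult_le_compat_l; [lra|]. apply Rmult_le_compat_l; [lra|]. nra.
  - apply sol_lapse_origin.
  - intros j Hj. exists 1. split; [left; reflexivity|].
    apply bigO_everywhere with (K := Rabs al * (perron N j + C * (perron N j * exp kap))). intros r Hr. simpl gauge.
    destruct (sol_sigma_le r Hr) as [Hs1 [Hs2 _]]. set (s := sigma 0 r) in *.
    unfold omS, real_u, sysX, sol_phi. rewrite clamp_id by lra.
    replace (vac N j + al * s ^ N * (altern N j + f (cX j) s) - 1 * vac N j)
      with (al * (s ^ N * (altern N j + f (cX j) s))) by ring.
    rewrite !Rabs_mult, Rmult_assoc. apply Rmult_le_compat_l; [apply Rabs_pos|].
    rewrite (Rabs_pos_eq (s ^ N)), (Rabs_pos_eq (r ^ 2)) by (apply pow_le; lra).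
    rewrite Rmult_comm. apply Rmult_le_compat; [apply Rabs_pos|apply pow_le; lra| |].
    + apply Rle_trans with (1 := Rabs_triang _ _). rewrite altern_abs. apply Rplus_le_compat_l.
      apply Rle_trans with (1 := sol_ball_X j s ltac:(lra)). pose proof (perron_nonneg N j). pose proof (exp_pos kap).
      apply Rmult_le_compat_l; [lra|]. apply Rmult_le_compat_l; trivial. nra.
    + apply Rle_trans with (s ^ 2); [|apply pow_incr; lra].
      replace (s ^ N) with (s ^ (N - 2) * s ^ 2) by (rewrite <- pow_add; f_equal; lia).
      pose proof (pow_le_1 s (N - 2) ltac:(lra)). pose proof (pow2_ge_0 s). nra.
  - apply (profile_asymptotics N Lam 0 U Pf M bg HLam (Rle_refl 0) soliton_profile (profile_background_represents _ _ _ _ _ _)).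
Qed.

Lemma sol_nonembedded : 0 < al -> Rabs al * sol_amp <= / 4 -> ~ embedded N 0 bg.
Proof.
  intros Hal Hsmall. set (B := C * exp kap). assert (HB : 0 < B) by (unfold B; apply Rmult_lt_0_compat; [trivial|apply exp_pos]).
  (* So close to the origin the remainder is smaller than [perron], and the signs of the
     perturbations are those of [altern]. *)
  set (s := / (2 * (B + 1))).
  assert (Hs : 0 < s < 1).
  { unfold s. split; [apply Rinv_0_lt_compat; lra|]. rewrite <- Rinv_1. apply Rinv_lt_contravar; lra. }
  assert (HBs : B * s < 1).
  { unfold s. apply Rmult_lt_reg_r with (2 * (B + 1)); [lra|]. rewrite Rmult_assoc, Rinv_l by lra. lra. }
  destruct (sigma_inv s Hs) as [r [Hr Hrs]].
  assert (HX : forall j, (1 <= j <= N - 1)%nat -> Rabs (f (cX j) s) < perron N j).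
  { intros j Hj. apply Rle_lt_trans with (1 := sol_ball_X j s ltac:(lra)).
    pose proof (perron_bounds N j Hj). replace (C * (perron N j * (exp kap * s))) with (perron N j * (B * s)) by (unfold B; ring). nra. }
  assert (Hp : 0 < al * s ^ N) by (apply Rmult_lt_0_compat; [trivial|apply pow_lt; lra]).
  pose proof (HX 1%nat ltac:(lia)) as X1. pose proof (HX 2%nat ltac:(lia)) as X2.
  apply Rabs_def2 in X1. apply Rabs_def2 in X2.
  pose proof (vac_ge_1 N 1 ltac:(lia)). pose proof (sol_u_bound 1 s) as U1. apply Rabs_le_between in U1.
  apply (nonembedded_of_signs N 0 bg r HN Hr); simpl gauge; unfold omS; rewrite Hrs.
  - split; [lra|].
    assert (U 1%nat s < 0); [|lra].
    unfold real_u, sysX, sol_phi. rewrite clamp_id by lra. unfold altern. simpl pow at 2. nra.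
  - assert (0 < U 2%nat s); [|lra].
    unfold real_u, sysX, sol_phi. rewrite clamp_id by lra. unfold altern. simpl pow at 2.
    apply Rmult_lt_0_compat; lra.
Qed.

End SolitonBackground.

Lemma soliton_family (N : nat) (Lam : R) : (3 <= N)%nat -> Lam < 0 ->
  exists al1, 0 < al1 /\ forall al, 0 < al <= al1 -> exists b,
    soliton N Lam b /\ ~ embedded N 0 b /\ no_grav_instability N Lam 0 b /\
    origin_coefficients N b (sol_coef N al).
Proof.
  intros HN HLam.
  destruct (soliton_system N Lam HN HLam) as [C [al0 [HC [Hal0 Hsys]]]].
  destruct (small_profile_stable N Lam 0 ltac:(lia) HLam (Rle_refl 0)) as [eps [Heps [Heps4 Hst]]].
  set (Q := sol_amp N Lam C) in *.
  assert (HQ : 0 <= Q).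
  { destruct (Hsys 0) as [f [Hf _]]; [rewrite Rabs_R0; lra|].
    unfold Q, sol_amp, amplitude_bound.
    pose proof (NR_ge N HN). pose proof (sol_Kc_ge N Lam HN HLam) as HK.
    pose proof (sol_amin Lam HLam) as Ham.
    edestruct (amplitude_bound_parts N (INR N) C) as [P1 P2].
    - lra.
    - lra.
    - instantiate (1 := _). apply Rle_trans with (2 := HK). lra.
    - apply Rdiv_lt_0_compat; [exact Ham|]. instantiate (1 := 2). lra.
    - apply (sol_w_bound N Lam HN HLam).
    - apply Rplus_le_le_0_compat; [exact P1|exact P2]. }
  (* The perturbation is bounded by [al] times [Q]. Keeping this below [eps] gives stability and, as
     eps <= 1/4, also the bounds that make the background a soliton and tell it from embedded
     ones. *)
  exists (Rmin al0 (eps / (Q + 1))). split.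
  { apply Rmin_pos; [trivial|apply Rdiv_lt_0_compat; lra]. }
  intros al Hal. pose proof (Rmin_l al0 (eps / (Q + 1))). pose proof (Rmin_r al0 (eps / (Q + 1))).
  assert (Ha : Rabs al = al) by (apply Rabs_pos_eq; lra).
  assert (HalQ : Rabs al * Q <= eps).
  { rewrite Ha. apply Rle_trans with (eps / (Q + 1) * (Q + 1)); [|right; field; lra].
    apply Rmult_le_compat; lra. }
  destruct (Hsys al) as [f [Hball [HA Hfix]]]; [lra|].
  exists (profile_background N Lam 0 (real_u N (sol_phi N) al f) (real_p (N - 2) (sol_eta N) al f) (real_m (2 * N - 2) 0 al f)).
  split; [|split; [|split]].
  - apply (sol_is_soliton N Lam C al f HN HLam HC Hball HA Hfix). fold Q. lra.
  - apply (sol_nonembedded N Lam C al f HN HLam HC Hball); [lra|fold Q; lra].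
  - apply (Hst _ _ _ _ (soliton_profile N Lam C al f HN HLam Hball HA Hfix) (profile_background_represents _ _ _ _ _ _)).
    + intros r _. apply (sol_gauge_ends N Lam al f HN Hfix).
    + intros s j Hs. pose proof (sol_u_bound N Lam C al f HN HLam HC Hball j s) as E1.
      pose proof (sol_ratio_bound N Lam C al f HN HLam HC Hball HA j s Hs) as E2.
      fold Q in E1, E2. rewrite rhoS_0.
      assert (Rabs al * Q * s <= eps * s) by (apply Rmult_le_compat_r; lra).
      split; [lra|]. split; [nra|lra].
  - apply (sol_origin_coefficients N Lam C al f HN HLam HC Hball).
Qed.

(** * The vacuum as a static solution *)

Lemma C2_const (c r : R) : C2_at (fun _ => c) r.
Proof.
  apply (C2_of_derive (r - 1) (fun _ => c) (fun _ => 0)); [intros; apply (is_derive_const c)|apply C1_const|lra].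
Qed.

Lemma vacuum_regular N M r : regular_at N (vacuum N M) r.
Proof. split; [|split]; [apply (C2_const M)|apply (C2_const 1)|intros j _; apply (C2_const (vac N j))]. Qed.

Lemma vacuum_field_equations N Lam M r : 0 < r -> field_equations N Lam (vacuum N M) r.
Proof.
  intros Hr.
  assert (EG : Gam N (vacuum N M) r = 0).
  { apply sumR_zero. intros j _. simpl gauge. rewrite Derive_const. ring. }
  split; [|split].
  - rewrite EG, vacuum_Pi. simpl mass. rewrite Derive_const. ring.
  - rewrite EG. simpl lapse. rewrite Derive_const. field. lra.
  - intros j Hj. rewrite vacuum_W_gauge.
    replace (Derive_n (gauge (vacuum N M) j) 2 r) with 0.
    + simpl gauge. rewrite Derive_const. ring.
    + symmetry. simpl. rewrite (Derive_ext _ (fun _ => 0)) by (intros; apply Derive_const). apply Derive_const.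
Qed.

Lemma vacuum_asymptotics N M : asymptotics N (vacuum N M).
Proof.
  split; [|split].
  - exists M, 0, 0. intros r Hr. simpl. rewrite Rminus_eq_0, Rabs_R0. lra.
  - exists 0, 0. intros r Hr. simpl. rewrite Rminus_eq_0, Rabs_R0. lra.
  - intros j Hj. exists (vac N j), 0, 0, 0. intros r Hr. simpl.
    replace (vac N j - vac N j - 0 / r) with 0 by (unfold Rdiv; ring). rewrite Rabs_R0. lra.
Qed.

Lemma vacuum_gauge_convention N r0 M : gauge_convention N r0 (vacuum N M).
Proof.
  split.
  - intros r. simpl. split; [apply vac_0|apply vac_out; lia].
  - intros j Hj. exists (r0 + 1). split; [lra|]. simpl. pose proof (vac_ge_1 N j Hj). lra.
Qed.

Lemma vacuum_embedded N r0 M : embedded N r0 (vacuum N M).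
Proof.
  exists (fun _ => 1), (fun _ => 1). split; [intros; left; reflexivity|]. intros j r _ _. simpl. ring.
Qed.

Lemma ads_mu_pos N Lam r : Lam < 0 -> 0 < r -> 0 < mu Lam (vacuum N 0) r.
Proof.
  intros HLam Hr. unfold mu. simpl mass. unfold Rdiv. rewrite Rmult_0_r, Rmult_0_l.
  pose proof (pow2_ge_0 r). nra.
Qed.

Lemma vacuum_soliton N Lam : Lam < 0 -> soliton N Lam (vacuum N 0).
Proof.
  intros HLam. split; [apply vacuum_gauge_convention|]. split; [|split; [|split; [|split]]].
  - intros r Hr. split; [apply vacuum_regular|]. split; [simpl; lra|].
    split; [apply ads_mu_pos; trivial|apply vacuum_field_equations, Hr].
  - apply bigO_everywhere with (K := 0). intros r _. simpl. rewrite Rabs_R0. lra.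
  - exists 1. split; [lra|]. apply bigO_everywhere with (K := 0). intros r _. simpl.
    rewrite Rminus_eq_0, Rabs_R0. lra.
  - intros j _. exists 1. split; [left; reflexivity|]. apply bigO_everywhere with (K := 0). intros r _. simpl.
    rewrite Rmult_1_l, Rminus_eq_0, Rabs_R0. lra.
  - apply vacuum_asymptotics.
Qed.

Lemma vacuum_soliton_stable N Lam : (2 <= N)%nat -> Lam < 0 -> stable N Lam 0 (vacuum N 0).
Proof.
  intros HN HLam. split.
  - apply vacuum_no_grav_instability; trivial; [lra|]. intros; apply ads_mu_pos; trivial.
  - apply vacuum_soliton_sphal; trivial. intros; apply ads_mu_pos; trivial.
Qed.

Lemma vacuum_origin_coefficients N : (1 <= N)%nat ->
  origin_coefficients N (vacuum N 0) (sol_coef N 0).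
Proof.
  intros HN j _. apply bigO_everywhere with (K := 0). intros r _. rewrite sol_coef_sum by trivial. simpl gauge.
  replace (vac N j - (vac N j + 0 * altern N j * r ^ N)) with 0 by ring. rewrite Rabs_R0. lra.
Qed.

Lemma small_amplitude (N : nat) (al1 eps : R) : 0 < al1 -> 0 < eps ->
  exists al, 0 < al <= al1 /\ forall j, Rabs (al * altern N j) < eps.
Proof.
  intros H1 He. set (PM := INR N * (INR (fact N) * INR (fact N))).
  assert (HP : 0 <= PM) by (apply (PM_nonneg N)).
  exists (Rmin al1 (eps / (PM + 1) / 2)).
  assert (H2 : 0 < eps / (PM + 1) / 2) by (apply Rdiv_lt_0_compat; [apply Rdiv_lt_0_compat|]; lra).
  pose proof (Rmin_l al1 (eps / (PM + 1) / 2)). pose proof (Rmin_r al1 (eps / (PM + 1) / 2)).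
  assert (H3 : 0 < Rmin al1 (eps / (PM + 1) / 2)) by (apply Rmin_pos; trivial).
  set (al := Rmin al1 (eps / (PM + 1) / 2)) in *.
  split; [lra|]. intros j. rewrite Rabs_mult, altern_abs, Rabs_pos_eq by lra.
  pose proof (perron_le N j) as Hp. fold PM in Hp. pose proof (perron_nonneg N j).
  apply Rle_lt_trans with (eps / (PM + 1) / 2 * (PM + 1)).
  - apply Rmult_le_compat; lra.
  - replace (eps / (PM + 1) / 2 * (PM + 1)) with (eps / 2) by (field; lra). lra.
Qed.

Lemma soliton_near_vacuum (N : nat) (Lam eps : R) : (3 <= N)%nat -> Lam < 0 -> 0 < eps ->
  exists b, soliton N Lam b /\ ~ embedded N 0 b /\
    close_at_origin N eps (vacuum N 0) b /\ no_grav_instability N Lam 0 b.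
Proof.
  intros HN HLam He. destruct (soliton_family N Lam HN HLam) as [al1 [Hal1 H]].
  destruct (small_amplitude N al1 eps Hal1 He) as [al [Hal Hsm]].
  destruct (H al Hal) as [b [Hb1 [Hb2 [Hb3 Hb4]]]].
  exists b. split; [trivial|]. split; [trivial|]. split; [|trivial].
  exists (sol_coef N 0), (sol_coef N al).
  split; [apply vacuum_origin_coefficients; lia|]. split; [trivial|].
  intros j k _ _. unfold sol_coef.
  replace (kron 0 k * vac N j + kron N k * (0 * altern N j) - (kron 0 k * vac N j + kron N k * (al * altern N j)))
    with (- (kron N k * (al * altern N j))) by ring.
  rewrite Rabs_Ropp, Rabs_mult. unfold kron. destruct (Nat.eqb N k).
  - rewrite Rabs_R1, Rmult_1_l. apply Hsm.
  - rewrite Rabs_R0, Rmult_0_l. trivial.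
Qed.

(** * Black holes *)

(** The mass that places the horizon of Schwarzschild-anti-de Sitter space at [rh]. *)
Definition bh_mass (Lam rh : R) : R := (rh + - Lam / 3 * rh ^ 3) / 2.

Lemma bh_mu_eq N Lam rh r : r <> 0 ->
  mu Lam (vacuum N (bh_mass Lam rh)) r
  = (r - rh) * ((1 + - Lam / 3 * (r ^ 2 + r * rh + rh ^ 2)) / r).
Proof. intros Hr. unfold mu, bh_mass; simpl mass. field. trivial. Qed.

Lemma bh_mu_pos N Lam rh r : Lam < 0 -> 0 < rh -> rh < r ->
  0 < mu Lam (vacuum N (bh_mass Lam rh)) r.
Proof.
  intros HLam Hrh Hr. rewrite bh_mu_eq by lra. apply Rmult_lt_0_compat; [lra|].
  apply Rdiv_lt_0_compat; [|lra].
  assert (0 < r ^ 2 + r * rh + rh ^ 2) by (assert (0 < r * rh) by nra; pose proof (pow2_ge_0 r); pose proof (pow2_ge_0 rh); lra).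
  nra.
Qed.

Lemma vacuum_black_hole N Lam rh : Lam < 0 -> 0 < rh ->
  black_hole N Lam rh (vacuum N (bh_mass Lam rh)).
Proof.
  intros HLam Hrh. split; [trivial|]. split; [apply vacuum_gauge_convention|].
  split; [|split; [|split; [|split]]].
  - intros r Hr. split; [apply vacuum_regular|]. split; [simpl; lra|apply vacuum_field_equations; lra].
  - rewrite bh_mu_eq by lra. ring.
  - rewrite (is_derive_unique _ _ _ (mu_derive Lam (vacuum N (bh_mass Lam rh)) rh 0 ltac:(lra) (is_derive_const (bh_mass Lam rh) rh))).
    simpl mass. unfold bh_mass. apply Rgt_not_eq.
    replace (-2 * 0 / rh + 2 * ((rh + - Lam / 3 * rh ^ 3) / 2) / rh ^ 2 - 2 * Lam * rh / 3)
      with (/ rh + - Lam * rh) by (field; lra).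
    assert (0 < / rh) by (apply Rinv_0_lt_compat; lra). nra.
  - intros r Hr. apply bh_mu_pos; trivial.
  - apply vacuum_asymptotics.
Qed.

Lemma vacuum_black_hole_stable N Lam rh : (2 <= N)%nat -> Lam < 0 -> 0 < rh ->
  stable N Lam rh (vacuum N (bh_mass Lam rh)).
Proof.
  intros HN HLam Hrh. split.
  - apply vacuum_no_grav_instability; trivial; [lra|]. intros; apply bh_mu_pos; trivial.
  - apply (vacuum_black_hole_sphal N Lam rh (bh_mass Lam rh)
      ((1 + - Lam / 3 * (3 * (rh + 1) ^ 2)) / rh)); trivial.
    + apply Rdiv_lt_0_compat; trivial. pose proof (pow2_ge_0 (rh + 1)). nra.
    + intros; apply bh_mu_pos; trivial.
    + intros r Hr. rewrite bh_mu_eq by lra. rewrite Rmult_comm. apply Rmult_le_compat_r; [lra|].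
      assert (E : r ^ 2 + r * rh + rh ^ 2 <= 3 * (rh + 1) ^ 2) by nra.
      assert (E0 : 0 < r ^ 2 + r * rh + rh ^ 2) by nra.
      unfold Rdiv at 1. unfold Rdiv at 2. apply Rmult_le_compat.
      * nra.
      * left; apply Rinv_0_lt_compat; lra.
      * nra.
      * apply Rinv_le_contravar; lra.
Qed.

Definition bh_rho (rh s : R) : R := rhoS rh (clamp s).
(** The vacuum [AS] with its simple zero at s = 0 divided out. The bracket is the quotient of a
    difference of cubes, those of rho and of rh (1-s), whose bases differ by s. *)
Definition bh_a0 (Lam rh s : R) : R :=
  ((1 - clamp s) ^ 2 + - Lam / 3 * (bh_rho rh s ^ 2 + bh_rho rh s * (rh * (1 - clamp s)) + (rh * (1 - clamp s)) ^ 2))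
  / bh_rho rh s.
Definition bh_b (rh s : R) : R := / bh_rho rh s ^ 2.
Definition bh_psi (rh s : R) : R := 2 * clamp s * (1 - clamp s) ^ 3 / bh_rho rh s.
Definition bh_theta (rh s : R) : R := 2 * (1 - clamp s) ^ 3 / bh_rho rh s.
(** At the horizon the leading gauge perturbation is the constant vector [altern] and the leading
    momentum is 0; this is the force of the former on the latter. *)
Definition bh_dY (N : nat) (rh : R) (j : nat) (s : R) : R :=
  bh_b rh s * (INR N * (INR N - 1) * altern N j).

Section BlackHoleInstance.

Variables (N : nat) (Lam rh : R).
Hypothesis HN : (3 <= N)%nat.
Hypothesis HLam : Lam < 0.
Hypothesis Hrh : 0 < rh.

Let l := - Lam / 3.
Let rm := Rmin 1 rh.
Let L := 1 + 2 * (INR N * (INR N - 1)) / rm ^ 2.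
Let amin := l * rm.
Let kap := 2 * L / amin.
Let Kc := 2 + / rm ^ 2 + 2 / rm + (1 + 3 * l * (1 + rh) ^ 2) / rm.

Notation one := (fun _ : R => 1).
Notation zero2 := (fun (_ : nat) (_ : R) => 0).
Notation w := (fun s => exp (kap * s)).

Lemma bh_l_pos : 0 < l.
Proof. unfold l; lra. Qed.

Lemma bh_rm_pos : 0 < rm /\ rm <= 1 /\ rm <= rh.
Proof. unfold rm. split; [apply Rmin_pos; lra|]. split; [apply Rmin_l|apply Rmin_r]. Qed.

Lemma bh_amin_pos : 0 < amin.
Proof. pose proof bh_l_pos. pose proof bh_rm_pos. unfold amin. apply Rmult_lt_0_compat; lra. Qed.

Lemma bh_L_ge : 1 <= L.
Proof.
  pose proof bh_rm_pos. pose proof (NR_ge N HN). unfold L.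
  assert (0 < 2 * (INR N * (INR N - 1)) / rm ^ 2) by (apply Rdiv_lt_0_compat; nra). lra.
Qed.

Lemma bh_kap_pos : 0 < kap.
Proof. pose proof bh_L_ge. pose proof bh_amin_pos. unfold kap. apply Rdiv_lt_0_compat; lra. Qed.

Lemma bh_rho_range s : rm <= bh_rho rh s <= 1 + rh.
Proof.
  pose proof (clamp_range s). pose proof bh_rm_pos. unfold bh_rho, rhoS. split; nra.
Qed.

Lemma bh_rho_neq s : bh_rho rh s <> 0.
Proof. pose proof (bh_rho_range s). pose proof bh_rm_pos. lra. Qed.

Lemma bh_rho_cont s : continuous (bh_rho rh) s.
Proof. unfold bh_rho, rhoS. pose proof (cont_clamp s). cont. Qed.

Lemma bh_a0_ge s : amin <= bh_a0 Lam rh s.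
Proof.
  pose proof bh_l_pos. pose proof bh_rm_pos. pose proof (bh_rho_range s). pose proof (clamp_range s).
  unfold bh_a0. fold l. set (c := clamp s) in *. set (q := bh_rho rh s) in *.
  apply Rmult_le_reg_r with q; [lra|]. unfold Rdiv. rewrite Rmult_assoc, Rinv_l, Rmult_1_r by lra.
  assert (amin * q <= l * q ^ 2).
  { unfold amin. simpl. rewrite Rmult_1_r, Rmult_assoc. apply Rmult_le_compat_l; [lra|]. apply Rmult_le_compat_r; lra. }
  assert (0 <= q * (rh * (1 - c))) by (apply Rmult_le_pos; [lra|apply Rmult_le_pos; lra]).
  pose proof (pow2_ge_0 (rh * (1 - c))). pose proof (pow2_ge_0 (1 - c)). nra.
Qed.

Lemma bh_inv_rho s : 0 < / bh_rho rh s <= / rm.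
Proof.
  pose proof bh_rm_pos. pose proof (bh_rho_range s).
  split; [apply Rinv_0_lt_compat; lra|apply Rinv_le_contravar; lra].
Qed.

Lemma bh_a0_le s : bh_a0 Lam rh s <= (1 + 3 * l * (1 + rh) ^ 2) / rm.
Proof.
  pose proof bh_l_pos. pose proof bh_rm_pos. pose proof (bh_rho_range s). pose proof (clamp_range s).
  pose proof (bh_inv_rho s).
  unfold bh_a0, Rdiv at 1. fold l. set (c := clamp s) in *. set (q := bh_rho rh s) in *.
  assert (0 <= rh * (1 - c) <= 1 + rh) by (split; [apply Rmult_le_pos; lra|nra]).
  assert (E1 : 0 <= q ^ 2 + q * (rh * (1 - c)) + (rh * (1 - c)) ^ 2 <= 3 * (1 + rh) ^ 2).
  { split.
    - assert (0 <= q * (rh * (1 - c))) by (apply Rmult_le_pos; lra).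
      pose proof (pow2_ge_0 (rh * (1 - c))). pose proof (pow2_ge_0 q). lra.
    - assert (q ^ 2 <= (1 + rh) ^ 2) by (apply pow_incr; lra).
      assert ((rh * (1 - c)) ^ 2 <= (1 + rh) ^ 2) by (apply pow_incr; lra).
      assert (q * (rh * (1 - c)) <= (1 + rh) * (1 + rh)) by (apply Rmult_le_compat; lra). nra. }
  pose proof (pow_le_1 (1 - c) 2 ltac:(lra)).
  apply Rmult_le_compat; try lra; nra.
Qed.

Lemma bh_Kc_parts : 2 <= Kc /\ / rm ^ 2 <= Kc /\ 2 / rm <= Kc /\ (1 + 3 * l * (1 + rh) ^ 2) / rm <= Kc.
Proof.
  pose proof bh_l_pos. pose proof bh_rm_pos. unfold Kc.
  assert (0 < / rm ^ 2) by (apply Rinv_0_lt_compat, pow_lt; lra).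
  assert (0 < 2 / rm) by (apply Rdiv_lt_0_compat; lra).
  assert (0 < (1 + 3 * l * (1 + rh) ^ 2) / rm).
  { apply Rdiv_lt_0_compat; [|lra]. pose proof (pow2_ge_0 (1 + rh)). nra. }
  lra.
Qed.

Lemma bh_b_range s : 0 < bh_b rh s <= / rm ^ 2.
Proof.
  pose proof bh_rm_pos. pose proof (bh_rho_range s). unfold bh_b. split.
  - apply Rinv_0_lt_compat, pow_lt; lra.
  - apply Rinv_le_contravar; [apply pow_lt; lra|apply pow_incr; lra].
Qed.

Lemma bh_b_cont s : continuous (bh_b rh) s.
Proof.
  unfold bh_b. pose proof (bh_rho_cont s). cont. apply pow_nonzero, bh_rho_neq.
Qed.

Lemma bh_theta_range s : 0 <= bh_theta rh s <= 2 / rm.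
Proof.
  pose proof bh_rm_pos. pose proof (clamp_range s). pose proof (bh_inv_rho s).
  pose proof (pow_le_1 (1 - clamp s) 3 ltac:(lra)). unfold bh_theta, Rdiv. split.
  - apply Rmult_le_pos; lra.
  - apply Rmult_le_compat; lra.
Qed.

Lemma bh_psi_range s : 0 <= bh_psi rh s <= 2 / rm.
Proof.
  pose proof (bh_theta_range s). pose proof (clamp_range s).
  replace (bh_psi rh s) with (clamp s * bh_theta rh s) by (unfold bh_psi, bh_theta, Rdiv; ring). split; nra.
Qed.

Lemma bh_w_range s : 0 <= s <= 1 -> 1 <= exp (kap * s) <= exp kap.
Proof. intros Hs. apply exp_weight_range; trivial. left; apply bh_kap_pos. Qed.

Lemma bh_a0_cont s : continuous (bh_a0 Lam rh) s.
Proof.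
  unfold bh_a0. pose proof (cont_clamp s). pose proof (bh_rho_cont s). cont. apply bh_rho_neq.
Qed.

Lemma bh_theta_cont s : continuous (bh_theta rh) s.
Proof. unfold bh_theta. pose proof (cont_clamp s). pose proof (bh_rho_cont s). cont. apply bh_rho_neq. Qed.

Lemma bh_psi_cont s : continuous (bh_psi rh) s.
Proof. unfold bh_psi. pose proof (cont_clamp s). pose proof (bh_rho_cont s). cont. apply bh_rho_neq. Qed.

(** The leading term is not a power here, so the contraction is not tight and both steps are given
    the factor 1/2. [L] is large enough that N(N-1)/rm^2 <= L/2. The step for [cX] is a plain
    integral, which gains 1/kap from the exponential weight against the cost L/amin. *)
Lemma black_hole_system : exists C al0, 0 < C /\ 0 < al0 /\ forall al, Rabs al <= al0 -> exists f,
    in_ball comp (comp_active N) (comp_weight N L) w C f /\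
    (forall s, amin / 2 <= sysA (bh_a0 Lam rh) (bh_theta rh) al f s) /\
    forall c s, f c s = sysmap comp (comp_active N) (sys_exp 1 0) (sys_ker 0 0 0)
      (sys_lin N (bh_a0 Lam rh) (bh_b rh)) (sys_src zero2 (bh_dY N rh))
      (sys_nonlin N (bh_a0 Lam rh) (bh_b rh) one (bh_psi rh) clamp (bh_theta rh) (fun _ => 0)) al f c s.
Proof.
  pose proof bh_l_pos as Hl. pose proof (NR_ge N HN) as HNR. pose proof bh_amin_pos as Ham.
  pose proof bh_kap_pos as Hk. pose proof bh_L_ge as HL. pose proof bh_rm_pos as Hrm.
  destruct bh_Kc_parts as [HK1 [HK2 [HK3 HK4]]].
  assert (Hw0 : forall s, 0 <= s <= 1 -> 0 <= exp (kap * s)) by (intros; left; apply exp_pos).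
  assert (Hmono : forall s t, 0 <= s -> s <= t -> t <= 1 -> exp (kap * s) <= exp (kap * t)).
  { intros s t H1 H2 H3. apply exp_weight_mono; lra. }
  assert (Hgain : forall x s, 0 <= s <= 1 -> Rabs x <= Kc -> Rabs x <= Kc * exp (kap * s)).
  { intros x s Hs Hx. pose proof (bh_w_range s Hs). pose proof (Rabs_pos x). nra. }
  assert (HbL : / rm ^ 2 * (INR N * (INR N - 1)) <= L / 2).
  { unfold L. unfold Rdiv. lra. }
  apply (gauge_system_solution N L Kc amin 1 0 0 0 0 w (exp kap)
    (bh_a0 Lam rh) (bh_b rh) one (bh_psi rh) clamp (bh_theta rh) (fun _ => 0) zero2 (bh_dY N rh)
    (1 / 2) 1); trivial; try lra.
  - intros s. apply exp_weight_cont.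
  - apply bh_w_range.
  - split; [|split]; intros s.
    + apply bh_a0_cont.
    + unfold bh_a0, bh_rho. now rewrite !clamp_idem.
    + pose proof (bh_a0_ge s). pose proof (bh_a0_le s). rewrite Rabs_pos_eq; lra.
  - split; [|split]; intros s.
    + apply bh_b_cont.
    + unfold bh_b, bh_rho. now rewrite !clamp_idem.
    + pose proof (bh_b_range s). rewrite Rabs_pos_eq; lra.
  - split; [|split]; intros; [apply continuous_const|reflexivity|rewrite Rabs_R1; lra].
  - split; [|split]; intros s.
    + apply bh_psi_cont.
    + unfold bh_psi, bh_rho. now rewrite !clamp_idem.
    + pose proof (bh_psi_range s). rewrite Rabs_pos_eq; lra.
  - split; [|split]; intros s.
    + apply cont_clamp.
    + now rewrite !clamp_idem.
    + pose proof (clamp_range s). rewrite Rabs_pos_eq; lra.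
  - split; [|split]; intros s.
    + apply bh_theta_cont.
    + unfold bh_theta, bh_rho. now rewrite !clamp_idem.
    + pose proof (bh_theta_range s). rewrite Rabs_pos_eq; lra.
  - apply bh_a0_ge.
  - intros j. rewrite Rabs_R0. lra.
  - intros s Hs. apply Hgain; trivial. pose proof (bh_theta_range s). rewrite Rabs_pos_eq; lra.
  - intros s Hs. apply Hgain; trivial. pose proof (bh_b_range s). rewrite Rabs_pos_eq; lra.
  - intros s Hs. apply Hgain; trivial. pose proof (bh_psi_range s). rewrite Rabs_pos_eq; lra.
  - right. intros s Hs. pose proof (bh_w_range s Hs). nra.
  - intros s Hs. pose proof (bh_w_range s Hs). simpl. nra.
  - intros j s. apply continuous_const.
  - intros j s. unfold bh_dY. pose proof (bh_b_cont s). cont.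
  - intros r f j s Hr Hf Hb Hj Hs.
    set (B := r * (L * perron N j) * / amin).
    pose proof (perron_nonneg N j) as Hp.
    assert (Hia : 0 < / amin) by (apply Rinv_0_lt_compat, Ham).
    assert (HB0 : 0 <= r * (L * perron N j)) by (apply Rmult_le_pos; [lra|apply Rmult_le_pos; lra]).
    assert (HB : 0 <= B) by (apply Rmult_le_pos; lra).
    apply (avg_bound 0 1 (fun s => f s * / bh_a0 Lam rh s) (fun s => 1 / 2 * r * perron N j * exp (kap * s))
      (fun t => B * (exp (kap * t) / kap)) (fun t => B * exp (kap * t))); try lra.
    + intros t. pose proof (bh_a0_ge t). apply cont_mult; [apply Hf|]. apply cont_inv; [apply bh_a0_cont|lra].
    + intros t _. pose proof (exp_weight_cont kap t). cont. lra.
    + intros t Ht. apply (is_derive_scal (fun t => exp (kap * t) / kap)). auto_derive; trivial. field. lra.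
    + intros t Ht. rewrite pow_O, Rmult_1_l, Rabs_mult, Rabs_inv.
      pose proof (bh_a0_ge t). rewrite (Rabs_pos_eq (bh_a0 Lam rh t)) by lra.
      specialize (Hb t ltac:(lra)).
      replace (B * exp (kap * t)) with (r * (L * perron N j * exp (kap * t)) * / amin) by (unfold B; ring).
      apply Rmult_le_compat; trivial; [apply Rabs_pos|left; apply Rinv_0_lt_compat; lra|apply Rinv_le_contravar; lra].
    + rewrite Rmult_0_r, exp_0. rewrite !pow_1. apply Rmult_le_compat_l; [lra|].
      apply Rle_trans with (B * (exp (kap * s) / kap)).
      * assert (0 <= B * (1 / kap)); [|lra]. apply Rmult_le_pos; [exact HB|]. left; apply Rdiv_lt_0_compat; lra.
      * right. unfold B, kap. field. split; lra.
  - intros r f j s Hr Hf Hb Hj Hs.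
    pose proof (perron_nonneg N j) as Hp.
    apply (avg_weight_bound w Hmono Hw0).
    + apply Rmult_le_pos; [lra|apply Rmult_le_pos; lra].
    + intros t. apply cont_mult; [apply bh_b_cont|apply Hf].
    + exact Hs.
    + intros t Ht. rewrite Rabs_mult. pose proof (bh_b_range t). rewrite (Rabs_pos_eq (bh_b rh t)) by lra.
      specialize (Hb t ltac:(lra)).
      apply Rle_trans with (/ rm ^ 2 * (INR N * (INR N - 1) * (r * perron N j * exp (kap * t)))).
      * apply Rmult_le_compat; trivial; [lra|apply Rabs_pos|lra].
      * rewrite <- Rmult_assoc.
        replace (1 / 2 * r * (L * perron N j) * exp (kap * t)) with (L / 2 * (r * perron N j * exp (kap * t))) by field.
        apply Rmult_le_compat_r; [|exact HbL].
        apply Rmult_le_pos; [apply Rmult_le_pos; lra|left; apply exp_pos].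
  - intros j s Hj Hs. rewrite avg_zero, Rmult_0_r, Rabs_R0.
    pose proof (perron_nonneg N j). pose proof (Hw0 s ltac:(lra)).
    apply Rmult_le_pos; [lra|trivial].
  - intros j s Hj Hs. pose proof (perron_nonneg N j) as Hp.
    apply (avg_weight_bound w Hmono Hw0).
    + rewrite Rmult_1_l. apply Rmult_le_pos; lra.
    + intros t. unfold bh_dY. pose proof (bh_b_cont t). cont.
    + exact Hs.
    + intros t Ht. unfold bh_dY. rewrite !Rabs_mult, altern_abs.
      pose proof (bh_b_range t). rewrite (Rabs_pos_eq (bh_b rh t)), (Rabs_pos_eq (INR N)), (Rabs_pos_eq (INR N - 1)) by lra.
      pose proof (bh_w_range t ltac:(lra)).
      apply Rle_trans with (/ rm ^ 2 * (INR N * (INR N - 1)) * perron N j).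
      * rewrite <- Rmult_assoc. apply Rmult_le_compat_r; trivial. apply Rmult_le_compat_r; [nra|lra].
      * apply Rle_trans with (L / 2 * perron N j); [apply Rmult_le_compat_r; trivial|].
        assert (0 <= L * perron N j) by (apply Rmult_le_pos; lra).
        assert (L * perron N j <= L * perron N j * exp (kap * t)) by nra. lra.
Qed.

End BlackHoleInstance.

(** * Regularity at the horizon *)

Definition C1_unit (f : R -> R) : Prop :=
  (forall s, continuous f s) /\
  exists f', (forall s, continuous f' s) /\ forall s, 0 < s < 1 -> is_derive f s (f' s).

Lemma C1u_const (c : R) : C1_unit (fun _ => c).
Proof.
  split; [intros; apply continuous_const|]. exists (fun _ => 0).
  split; [intros; apply continuous_const|intros; apply (is_derive_const c)].
Qed.

(** [C1_unit] asks for the derivative inside (0, 1) only, given by a function continuous on all of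
    R. This is why [clamp], which has corners at 0 and 1, qualifies. *)
Lemma C1u_clamp : C1_unit clamp.
Proof.
  split; [apply cont_clamp|]. exists (fun _ => 1). split; [intros; apply continuous_const|].
  intros s Hs. apply (is_derive_ext_loc (fun x => x)); [|apply (is_derive_id s)].
  apply locally_unit; trivial. intros x Hx. rewrite clamp_id; lra.
Qed.

Lemma C1u_plus (f g : R -> R) : C1_unit f -> C1_unit g -> C1_unit (fun s => f s + g s).
Proof.
  intros [Hf [f' [Hf1 Hf2]]] [Hg [g' [Hg1 Hg2]]]. split; [intros; apply cont_plus; auto|].
  exists (fun s => f' s + g' s). split; [intros; apply cont_plus; auto|].
  intros s Hs. apply (is_derive_plus f g); auto.
Qed.

Lemma C1u_opp (f : R -> R) : C1_unit f -> C1_unit (fun s => - f s).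
Proof.
  intros [Hf [f' [Hf1 Hf2]]]. split; [intros; apply cont_opp; auto|].
  exists (fun s => - f' s). split; [intros; apply cont_opp; auto|].
  intros s Hs. apply (is_derive_opp f); auto.
Qed.

Lemma C1u_minus (f g : R -> R) : C1_unit f -> C1_unit g -> C1_unit (fun s => f s - g s).
Proof. intros Hf Hg. apply (C1u_plus f (fun s => - g s)); [|apply C1u_opp]; trivial. Qed.

Lemma C1u_mult (f g : R -> R) : C1_unit f -> C1_unit g -> C1_unit (fun s => f s * g s).
Proof.
  intros [Hf [f' [Hf1 Hf2]]] [Hg [g' [Hg1 Hg2]]]. split; [intros; apply cont_mult; auto|].
  exists (fun s => f' s * g s + f s * g' s).
  split; [intros; apply cont_plus; apply cont_mult; auto|].
  intros s Hs. apply (is_derive_mult f g); auto. intros; apply Rmult_comm.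
Qed.

Lemma C1u_pow (f : R -> R) (n : nat) : C1_unit f -> C1_unit (fun s => f s ^ n).
Proof.
  intros Hf. induction n as [|n IH]; simpl; [apply C1u_const|apply C1u_mult; trivial].
Qed.

Lemma C1u_inv (f : R -> R) : C1_unit f -> (forall s, f s <> 0) -> C1_unit (fun s => / f s).
Proof.
  intros [Hf [f' [Hf1 Hf2]]] H0. split; [intros; apply cont_inv; auto|].
  exists (fun s => - f' s / f s ^ 2). split.
  - intros s. apply cont_div; [apply cont_opp; auto|apply cont_pow; auto|apply pow_nonzero; auto].
  - intros s Hs. apply (is_derive_inv f); auto.
Qed.

Lemma C1u_sum (F : nat -> R -> R) (a b : nat) :
  (forall j, C1_unit (F j)) -> C1_unit (fun s => sum_n_m (fun j => F j s) a b).
Proof.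
  intros H. destruct (Nat.le_gt_cases a b) as [Hab|Hab].
  - induction Hab as [|m Hm IH].
    + replace (fun s => sum_n_m (fun j => F j s) a a) with (F a); [apply H|].
      apply functional_extensionality; intros s. symmetry. apply (sum_n_n (fun j => F j s)).
    + replace (fun s => sum_n_m (fun j => F j s) a (S m))
        with (fun s => sum_n_m (fun j => F j s) a m + F (S m) s); [apply C1u_plus; auto|].
      apply functional_extensionality; intros s. symmetry. apply (sum_n_Sm (fun j => F j s)); lia.
  - replace (fun s => sum_n_m (fun j => F j s) a b) with (fun _ : R => 0); [apply C1u_const|].
    apply functional_extensionality; intros s. symmetry. apply (sumR_empty (fun j => F j s)); trivial.
Qed.

Ltac smooth_unit1 :=
  match goal with
  | H : ?P |- ?P => exact H
  | |- C1_unit (fun _ => ?c) => apply C1u_const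
  | |- C1_unit clamp => apply C1u_clamp
  | |- C1_unit (fun s => clamp s) => apply C1u_clamp
  | |- C1_unit (fun s => @?f s + @?g s) => apply (C1u_plus f g)
  | |- C1_unit (fun s => @?f s - @?g s) => apply (C1u_minus f g)
  | |- C1_unit (fun s => - @?f s) => apply (C1u_opp f)
  | |- C1_unit (fun s => @?f s * @?g s) => apply (C1u_mult f g)
  | |- C1_unit (fun s => @?f s / @?g s) => apply (C1u_mult f (fun s => / g s)); [|apply (C1u_inv g)]
  | |- C1_unit (fun s => / @?f s) => apply (C1u_inv f)
  | |- C1_unit (fun s => @?f s ^ ?n) => apply (C1u_pow f n)
  | |- C1_unit (fun s => sum_n_m (fun j => @?F s j) ?a ?b) =>
      apply (C1u_sum (fun j s => F s j) a b); intros; cbv beta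
  end.
Ltac smooth_unit := repeat (cbv beta; smooth_unit1).

Lemma C1u_ext (f g : R -> R) : C1_unit f -> (forall s, continuous g s) ->
  (forall s, 0 < s < 1 -> f s = g s) -> C1_unit g.
Proof.
  intros [_ [f' [Hf1 Hf2]]] Hg E. split; [trivial|]. exists f'; split; [trivial|].
  intros s Hs. apply (is_derive_ext_loc f); auto. apply locally_unit; trivial.
Qed.

Lemma eq_of_derive (f g f' : R -> R) (a b : R) : a <= b ->
  (forall x, a <= x <= b -> continuous f x) -> (forall x, a <= x <= b -> continuous g x) ->
  (forall x, a < x < b -> is_derive f x (f' x)) -> (forall x, a < x < b -> is_derive g x (f' x)) ->
  f a = g a -> f b = g b.
Proof.
  intros Hab Hf Hg Hdf Hdg E.
  assert (H1 : f a - g a <= f b - g b).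
  { apply (nonneg_derive_mono (fun x => f x - g x) (fun x => f' x - f' x)); trivial.
    - intros; apply cont_minus; auto.
    - intros; apply (is_derive_minus f g); auto.
    - intros; lra. }
  assert (H2 : g a - f a <= g b - f b).
  { apply (nonneg_derive_mono (fun x => g x - f x) (fun x => f' x - f' x)); trivial.
    - intros; apply cont_minus; auto.
    - intros; apply (is_derive_minus g f); auto.
    - intros; lra. }
  lra.
Qed.

(** Weaker than C1, yet sufficient for the average to be C1. It admits the products of s with
    functions known merely to be continuous, which breaks a circularity in the regularity of the
    momenta. *)
Definition divisible (f : R -> R) : Prop :=
  (forall s, continuous f s) /\
  exists q, (forall s, continuous q s) /\ forall s, 0 < s < 1 -> f s = f 0 + s * q s.

Lemma divisible_C1u (f : R -> R) : C1_unit f -> divisible f.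
Proof.
  intros [Hf [f' [Hf1 Hf2]]]. split; [trivial|]. exists (avg 0 f').
  split; [apply avg_cont, Hf1|]. intros s Hs.
  replace (s * avg 0 f' s) with (s ^ 1 * avg 0 f' s) by ring.
  apply (eq_of_derive f (fun s => f 0 + s ^ 1 * avg 0 f' s) f' 0 s); trivial; try lra.
  - intros x _. pose proof (avg_cont 0 f' Hf1 x). cont.
  - intros x Hx. apply Hf2; lra.
  - intros x Hx. replace (f' x) with (0 + x ^ 0 * f' x) by ring.
    apply (is_derive_plus (fun _ => f 0)); [apply (is_derive_const (f 0))|apply avg_derive, Hf1].
Qed.

Lemma divisible_plus (f g : R -> R) : divisible f -> divisible g -> divisible (fun s => f s + g s).
Proof.
  intros [Hf [p [Hp Ep]]] [Hg [q [Hq Eq]]]. split; [intros; apply cont_plus; auto|].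
  exists (fun s => p s + q s). split; [intros; apply cont_plus; auto|].
  intros s Hs. rewrite (Ep s Hs), (Eq s Hs). ring.
Qed.

Lemma divisible_clamp_mult (h : R -> R) : (forall s, continuous h s) -> divisible (fun s => clamp s * h s).
Proof.
  intros Hh. split; [intros s; apply cont_mult; [apply cont_clamp|auto]|].
  exists h; split; trivial. intros s Hs. rewrite !clamp_id by lra. ring.
Qed.

Lemma divisible_scal (c : R) (f : R -> R) : divisible f -> divisible (fun s => c * f s).
Proof.
  intros [Hf [q [Hq Eq]]]. split; [intros s; apply cont_mult; [apply continuous_const|auto]|].
  exists (fun s => c * q s). split; [intros s; apply cont_mult; [apply continuous_const|auto]|].
  intros s Hs. rewrite (Eq s Hs). ring.
Qed.

(** If f = f(0) + s q, then avg f = f(0) + s avg_1 q. The derivative (f - avg f)/s of the average is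
    then q - avg_1 q, continuous up to s = 0. *)
Lemma avg_divisible (f : R -> R) : divisible f -> C1_unit (avg 0 f).
Proof.
  intros [Hf [q [Hq Eq]]]. split; [apply avg_cont, Hf|].
  exists (fun s => q s - avg 1 q s). split; [intros s; apply cont_minus; [auto|apply avg_cont, Hq]|].
  intros s Hs.
  assert (E : forall x, 0 < x < 1 -> avg 0 f x = f 0 + x * avg 1 q x).
  { intros x Hx. apply Rmult_eq_reg_l with (x ^ 1); [|simpl; lra].
    rewrite avg_pow.
    replace (x ^ 1 * (f 0 + x * avg 1 q x)) with (f 0 * x + x ^ 2 * avg 1 q x) by (simpl; ring).
    rewrite avg_pow.
    apply (eq_of_derive (fun x => RInt (fun t => t ^ 0 * f t) 0 x)
      (fun x => f 0 * x + RInt (fun t => t ^ 1 * q t) 0 x) (fun x => x ^ 0 * f x) 0 x); try lra.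
    - intros y _. apply (ex_derive_continuous (fun x => RInt (fun t => t ^ 0 * f t) 0 x)).
      eexists. apply (is_derive_primitive (fun t => t ^ 0 * f t)). intros; cont; auto.
    - intros y _. apply cont_plus; [cont|].
      apply (ex_derive_continuous (fun x => RInt (fun t => t ^ 1 * q t) 0 x)).
      eexists. apply (is_derive_primitive (fun t => t ^ 1 * q t)). intros; cont; auto.
    - intros y _. apply (is_derive_primitive (fun t => t ^ 0 * f t)). intros; cont; auto.
    - intros y Hy. replace (y ^ 0 * f y) with (f 0 * 1 + y ^ 1 * q y) by (rewrite (Eq y) by lra; simpl; ring).
      apply (is_derive_plus (fun x => f 0 * x) (fun x => RInt (fun t => t ^ 1 * q t) 0 x)).
      + apply (is_derive_scal (fun x => x)). apply (is_derive_id y).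
      + apply (is_derive_primitive (fun t => t ^ 1 * q t)). intros; cont; auto.
    - rewrite !RInt_point. unfold zero; simpl. ring. }
  apply (is_derive_ext_loc (fun x => x ^ 1 * avg 0 f x / x)).
  { apply locally_unit; trivial. intros x Hx. simpl. field. lra. }
  replace (q s - avg 1 q s) with ((s ^ 0 * f s * s - s ^ 1 * avg 0 f s * 1) / s ^ 2).
  { apply (is_derive_div (fun x => x ^ 1 * avg 0 f x) (fun x => x)); [apply avg_derive, Hf|apply (is_derive_id s)|lra]. }
  rewrite (E s Hs), (Eq s Hs). simpl. field. lra.
Qed.

(** The second r-derivative of the composite extends continuously to the horizon. It is continued
    inwards as a constant and integrated twice, which yields a C2 function that agrees with the
    composite outside. *)
Lemma horizon_extension (G g : R -> R) (rh : R) :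
  (forall s, continuous G s) -> (forall s, 0 < s < 1 -> is_derive G s (g s)) -> C1_unit g ->
  exists F, (forall r, rh < r -> F r = G (sigma rh r)) /\ F rh = G 0 /\ C2_at F rh.
Proof.
  intros HG HGd [Hg [g' [Hg' Hgd]]].
  assert (Hsr : forall r, rh <= r -> 0 <= sigma rh r < 1).
  { intros r Hr. destruct (Req_dec r rh) as [->|].
    - unfold sigma. rewrite Rminus_eq_0. lra.
    - pose proof (sigma_range rh r ltac:(lra)). lra. }
  (* Freezes the compactified radius at its horizon value for r < rh. *)
  set (sp := fun r => sigma rh (Rmax r rh)).
  assert (Hmax : forall r, continuous (fun r => Rmax r rh) r).
  { intros r. apply filterlim_locally; intros eps. exists eps; intros y Hy.
    change (Rabs (Rmax y rh - Rmax r rh) < eps). change (Rabs (y - r) < eps) in Hy.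
    refine (Rle_lt_trans _ _ _ _ Hy). unfold Rmax.
    destruct (Rle_dec y rh), (Rle_dec r rh); apply Rabs_le; pose proof (Rle_abs (y - r));
    pose proof (Rle_abs (- (y - r))); rewrite Rabs_Ropp in *; lra. }
  assert (Hsig : forall r, rh <= r -> continuous (sigma rh) r).
  { intros r Hr. unfold sigma. cont. lra. }
  assert (Hsp : forall r, continuous sp r).
  { intros r. apply (continuous_comp (fun r => Rmax r rh) (sigma rh)); [apply Hmax|].
    apply Hsig, Rmax_r. }
  set (k := fun r => (1 - sp r) ^ 2 * (- 2 * (1 - sp r) * g (sp r) + (1 - sp r) ^ 2 * g' (sp r))).
  assert (Hk : forall r, continuous k r).
  { intros r. pose proof (Hsp r) as H1.
    assert (H2 : continuous (fun r => g (sp r)) r) by (apply (continuous_comp sp g); trivial).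
    assert (H3 : continuous (fun r => g' (sp r)) r) by (apply (continuous_comp sp g'); trivial).
    unfold k. cont. }
  set (g1 := fun t => g 0 + RInt k rh t).
  assert (Hg1d : forall r, is_derive g1 r (k r)).
  { intros r. replace (k r) with (0 + k r) by ring.
    apply (is_derive_plus (fun _ => g 0)); [apply (is_derive_const (g 0))|apply is_derive_primitive, Hk]. }
  assert (Hg1 : forall r, continuous g1 r) by (intros r; apply (ex_derive_continuous g1); eexists; apply Hg1d).
  set (F := fun r => G 0 + RInt g1 rh r).
  assert (HFd : forall r, is_derive F r (g1 r)).
  { intros r. replace (g1 r) with (0 + g1 r) by ring.
    apply (is_derive_plus (fun _ => G 0)); [apply (is_derive_const (G 0))|apply is_derive_primitive, Hg1]. }
  assert (HF : forall r, continuous F r) by (intros r; apply (ex_derive_continuous F); eexists; apply HFd).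
  assert (Hs0 : sigma rh rh = 0) by (unfold sigma; rewrite Rminus_eq_0; lra).
  assert (E1 : forall r, rh <= r -> g1 r = (1 - sigma rh r) ^ 2 * g (sigma rh r)).
  { intros r Hr. apply (eq_of_derive g1 (fun r => (1 - sigma rh r) ^ 2 * g (sigma rh r)) k rh r);
      [exact Hr|intros; apply Hg1| |intros; apply Hg1d| |].
    - intros x Hx. assert (H1 : continuous (sigma rh) x) by (apply Hsig; lra).
      assert (H2 : continuous (fun r => g (sigma rh r)) x) by (apply (continuous_comp (sigma rh) g); trivial).
      cont.
    - intros x Hx. unfold k, sp. rewrite Rmax_left by lra.
      pose proof (sigma_range rh x ltac:(lra)) as Hs.
      apply (comp_sigma_derive rh (fun s => (1 - s) ^ 2 * g s)); [lra|].
      apply (is_derive_mult (fun s => (1 - s) ^ 2) g).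
      + auto_derive; trivial. ring.
      + apply Hgd, Hs.
      + intros; apply Rmult_comm.
    - unfold g1. rewrite RInt_point, Hs0. unfold zero; simpl. ring. }
  exists F. split; [|split].
  - intros r Hr. apply (eq_of_derive F (fun r => G (sigma rh r)) g1 rh r);
      [lra|intros; apply HF| |intros; apply HFd| |].
    + intros x Hx. apply (continuous_comp (sigma rh) G); [apply Hsig; lra|apply HG].
    + intros x Hx. rewrite E1 by lra. apply (comp_sigma_derive rh G); [lra|].
      apply HGd. apply sigma_range; lra.
    + unfold F. rewrite RInt_point, Hs0. unfold zero; simpl. ring.
  - unfold F. rewrite RInt_point. unfold zero; simpl. ring.
  - apply (C2_of_derive (rh - 1) F g1); [intros; apply HFd| |lra].
    apply (C1_of_derive (rh - 1) g1 k); intros; [apply Hg1d|apply Hk].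
Qed.

Lemma C2_cont f r : C2_at f r -> continuous f r.
Proof. intros [H _]. apply (ex_derive_continuous f). apply (locally_singleton _ _ H). Qed.

Lemma C2_ex_derive f r : C2_at f r -> ex_derive f r.
Proof. intros [H _]. apply (locally_singleton _ _ H). Qed.

Lemma C2_cont_derive f r : C2_at f r -> continuous (Derive f) r.
Proof. intros [H _]. apply (ex_derive_continuous (Derive f)). apply (locally_singleton _ _ H). Qed.

Lemma cont_zero_right (h : R -> R) (x : R) :
  continuous h x -> (forall r, x < r -> h r = 0) -> h x = 0.
Proof.
  intros Hc H0. apply Rabs_eq_0, Rle_antisym; [|apply Rabs_pos].
  apply le_epsilon; intros eps He.
  destruct (proj1 (filterlim_locally _ _) Hc (mkposreal eps He)) as [d Hd].
  pose proof (cond_pos d).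
  assert (Hb : ball x d (x + d / 2)) by (change (Rabs (x + d / 2 - x) < d); rewrite Rabs_pos_eq; lra).
  specialize (Hd _ Hb). change (Rabs (h (x + d / 2) - h x) < eps) in Hd.
  rewrite (H0 (x + d / 2)) in Hd by lra. rewrite Rminus_0_l, Rabs_Ropp in Hd. lra.
Qed.

(** Both sides are continuous at the horizon for a C2 background with nonzero lapse, so the
    equations pass to the limit from outside. *)
Lemma field_equations_at_boundary N Lam rh b : 0 < rh ->
  regular_at N b rh -> lapse b rh <> 0 ->
  (forall r, gauge b 0%nat r = 0 /\ gauge b N r = 0) ->
  (forall r, rh < r -> field_equations N Lam b r) -> field_equations N Lam b rh.
Proof.
  intros Hrh [Hm [Hl Hg]] Hl0 Hends Hfe.
  assert (Hgc : forall j, (j <= N)%nat -> continuous (gauge b j) rh).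
  { intros j Hj. destruct (Nat.eq_dec j 0) as [->|].
    - apply (continuous_ext (fun _ => 0)); [intros; symmetry; apply Hends|apply continuous_const].
    - destruct (Nat.eq_dec j N) as [->|].
      + apply (continuous_ext (fun _ => 0)); [intros; symmetry; apply Hends|apply continuous_const].
      + apply C2_cont, Hg; lia. }
  pose proof (C2_cont _ _ Hm) as Cm. pose proof (C2_cont_derive _ _ Hm) as Cm1.
  pose proof (C2_cont _ _ Hl) as Cl. pose proof (C2_cont_derive _ _ Hl) as Cl1.
  assert (Cmu : continuous (mu Lam b) rh) by (unfold mu; cont; lra).
  assert (CG : continuous (Gam N b) rh).
  { unfold Gam. apply (cont_sum (fun j r => Derive (gauge b j) r ^ 2)). intros j Hj.
    apply (cont_pow (Derive (gauge b j))), C2_cont_derive, Hg, Hj. }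
  assert (CP : continuous (Pi N b) rh).
  { unfold Pi. apply cont_mult.
    - cont. apply Rmult_integral_contrapositive_currified; [lra|apply pow_nonzero; lra].
    - apply (cont_sum (fun j r => (gauge b j r ^ 2 - gauge b (j - 1) r ^ 2 - INR N - 1 + 2 * INR j) ^ 2)).
      intros j Hj. pose proof (Hgc j ltac:(lia)). pose proof (Hgc (j - 1)%nat ltac:(lia)). cont. }
  split; [|split].
  - apply Rminus_diag_uniq.
    apply (cont_zero_right (fun r => Derive (mass b) r - (mu Lam b r * Gam N b r + r ^ 2 * Pi N b r)) rh).
    + cont.
    + intros r Hr. destruct (Hfe r Hr) as [E _]. lra.
  - apply Rminus_diag_uniq.
    apply (cont_zero_right (fun r => Derive (lapse b) r / lapse b r - 2 * Gam N b r / r) rh).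
    + cont; lra.
    + intros r Hr. destruct (Hfe r Hr) as [_ [E _]]. lra.
  - intros j Hj.
    apply (cont_zero_right (fun r => r ^ 2 * mu Lam b r * Derive_n (gauge b j) 2 r
      + (2 * mass b r - 2 * r ^ 3 * Pi N b r - 2 * Lam * r ^ 3 / 3) * Derive (gauge b j) r
      + W b j r * gauge b j r) rh).
    + pose proof (C2_cont_derive _ _ (Hg j Hj)) as C1. pose proof (proj2 (Hg j Hj)) as C2.
      pose proof (Hgc j ltac:(lia)). pose proof (Hgc (j - 1)%nat ltac:(lia)). pose proof (Hgc (j + 1)%nat ltac:(lia)).
      unfold W. change (Derive_n (gauge b j) 2) with (fun r => Derive_n (gauge b j) 2 r) in C2.
      cont; lra.
    + intros r Hr. destruct (Hfe r Hr) as [_ [_ E]]. apply E, Hj.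
Qed.

Lemma derive_ge_slope (f : R -> R) (x c : R) :
  ex_derive f x -> f x = 0 -> (forall r, x < r -> c * (r - x) <= f r) -> c <= Derive f x.
Proof.
  intros Hf H0 H. apply Derive_correct, is_derive_Reals in Hf.
  apply le_epsilon; intros eps He.
  destruct (Hf eps He) as [d Hd]. pose proof (cond_pos d).
  specialize (Hd (d / 2) ltac:(lra) ltac:(rewrite Rabs_pos_eq; lra)).
  apply Rabs_def2 in Hd. specialize (H (x + d / 2) ltac:(lra)). rewrite H0 in Hd.
  assert (c <= (f (x + d / 2) - 0) / (d / 2)); [|lra].
  apply Rmult_le_reg_r with (d / 2); [lra|].
  replace ((f (x + d / 2) - 0) / (d / 2) * (d / 2)) with (f (x + d / 2)) by (field; lra).
  replace (x + d / 2 - x) with (d / 2) in H by ring. lra.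
Qed.

(** * Backgrounds built from black hole fixed points *)

Section BlackHoleBackground.

Variables (N : nat) (Lam rh C al : R) (f : comp -> R -> R).
Hypothesis HN : (3 <= N)%nat.
Hypothesis HLam : Lam < 0.
Hypothesis Hrh : 0 < rh.
Hypothesis HC : 0 < C.

Let l := - Lam / 3.
Let rm := Rmin 1 rh.
Let L := 1 + 2 * (INR N * (INR N - 1)) / rm ^ 2.
Let amin := l * rm.
Let kap := 2 * L / amin.

Notation one := (fun _ : R => 1).
Notation zero1 := (fun _ : nat => 0).
Notation zero2 := (fun (_ : nat) (_ : R) => 0).
Notation w := (fun s => exp (kap * s)).
Notation M0 := (bh_mass Lam rh).
Notation U := (real_u N one al f).
Notation Pf := (real_p 0 zero1 al f).
Notation M := (real_m 1 M0 al f).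
Notation A := (sysA (bh_a0 Lam rh) (bh_theta rh) al f).
Notation X := (fun j s => sysX N f j s).
Notation Y := (fun j s => sysY zero1 f j s).
Notation nl := (sys_nonlin N (bh_a0 Lam rh) (bh_b rh) one (bh_psi rh) clamp (bh_theta rh) zero1).

Hypothesis Hball : in_ball comp (comp_active N) (comp_weight N L) w C f.
Hypothesis HA : forall s, amin / 2 <= A s.
Hypothesis Hfix : forall c s, f c s = sysmap comp (comp_active N) (sys_exp 1 0) (sys_ker 0 0 0)
      (sys_lin N (bh_a0 Lam rh) (bh_b rh)) (sys_src zero2 (bh_dY N rh)) nl al f c s.

Lemma bh_amin2_pos : 0 < amin / 2.
Proof. pose proof (bh_amin_pos Lam rh HLam Hrh) as E. fold l rm amin in E. lra. Qed.

Lemma bh_rho_unit s : 0 < s < 1 -> bh_rho rh s = rhoS rh s.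
Proof. intros Hs. unfold bh_rho. rewrite clamp_id by lra. reflexivity. Qed.

Lemma bh_theta_spec s : 0 < s < 1 ->
  2 * s ^ 1 * (1 - s) ^ 3 / rhoS rh s = s ^ 1 * bh_theta rh s.
Proof.
  intros Hs. unfold bh_theta. rewrite bh_rho_unit, clamp_id by lra.
  pose proof (rhoS_pos rh s ltac:(lra) ltac:(lra)). field. lra.
Qed.

Lemma bh_a0_spec s : 0 < s < 1 ->
  (1 - s) ^ 2 - Lam / 3 * rhoS rh s ^ 2 - 2 * M0 * (1 - s) ^ 3 / rhoS rh s = s ^ 1 * bh_a0 Lam rh s.
Proof.
  intros Hs. unfold bh_a0. rewrite bh_rho_unit, clamp_id by lra. unfold bh_mass.
  pose proof (rhoS_pos rh s ltac:(lra) ltac:(lra)) as Hr. unfold rhoS in *. field. lra.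
Qed.

Lemma bh_a0_pos s : 0 < bh_a0 Lam rh s.
Proof. pose proof (bh_a0_ge Lam rh HLam Hrh s) as E. fold l rm amin in E. pose proof bh_amin2_pos. lra. Qed.

Lemma bh_dY_cont j s : continuous (bh_dY N rh j) s.
Proof. unfold bh_dY. pose proof (bh_b_cont rh Hrh s). cont. Qed.

Lemma black_hole_profile : profile N Lam rh U Pf M.
Proof.
  pose proof bh_amin2_pos as Ham.
  apply (realization_profile N L C 1 0 0 0 0 1 w (bh_a0 Lam rh) (bh_b rh) one (fun _ => 0)
    (bh_psi rh) clamp (bh_theta rh) zero1 zero2 (bh_dY N rh) Lam rh M0 (amin / 2) al f); trivial.
  - apply bh_a0_cont, Hrh.
  - apply bh_a0_pos.
  - apply bh_b_cont, Hrh.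
  - intros; apply continuous_const.
  - apply bh_psi_cont, Hrh.
  - apply cont_clamp.
  - apply bh_theta_cont, Hrh.
  - intros; apply continuous_const.
  - apply bh_dY_cont.
  - intros s _. apply (is_derive_const 1).
  - intros s _. ring.
  - intros j s _ _. unfold Rdiv. ring.
  - intros j s Hs Hj. unfold bh_dY. pose proof (linW_altern N 1 j Hj) as E.
    replace (fun i => 1 * altern N i) with (altern N) in E by (apply functional_extensionality; intros; ring).
    rewrite E. ring.
  - intros s Hs. unfold bh_b. rewrite bh_rho_unit by trivial. unfold Rdiv. ring.
  - intros s Hs. unfold bh_psi. rewrite bh_rho_unit, clamp_id by lra. unfold Rdiv. ring.
  - intros s Hs. rewrite clamp_id by lra. ring.
  - intros s Hs. unfold bh_b. rewrite bh_rho_unit by trivial. unfold Rdiv. ring.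
  - apply bh_theta_spec.
  - apply bh_a0_spec.
  - intros s Hs. apply rhoS_pos; lra.
Qed.

Lemma bh_ratio j s : 0 < s < 1 -> Pf j s / AS Lam rh M s = al * s ^ 0 * (Y j s / A s).
Proof.
  intros Hs.
  apply (real_ratio 1 0 0 1 (bh_a0 Lam rh) (bh_theta rh) zero1 Lam rh M0 (amin / 2) al f bh_amin2_pos HA eq_refl);
    trivial.
  - apply bh_theta_spec.
  - apply bh_a0_spec.
  - intros t Ht. apply rhoS_pos; lra.
Qed.

Lemma bh_f_cont c s : continuous (f c) s.
Proof. apply Hball. Qed.

Lemma bh_A_cont s : continuous A s.
Proof. apply (A_cont N L C w _ _ al f Hball (bh_a0_cont Lam rh Hrh) (bh_theta_cont rh Hrh) s). Qed.

Lemma bh_A_neq s : A s <> 0.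
Proof. pose proof (HA s). pose proof bh_amin2_pos. lra. Qed.

Lemma bh_drive_cont c t :
  continuous (fun t => sys_lin N (bh_a0 Lam rh) (bh_b rh) c f t + sys_src zero2 (bh_dY N rh) c t + al * nl c al f t) t.
Proof.
  apply (drive_cont N L C w (bh_a0 Lam rh) (bh_b rh) one (bh_psi rh) clamp (bh_theta rh) zero1 zero2 (bh_dY N rh)
    (amin / 2) al f bh_amin2_pos Hball HA); trivial.
  - apply bh_a0_cont, Hrh.
  - apply bh_a0_pos.
  - apply bh_b_cont, Hrh.
  - intros; apply continuous_const.
  - apply bh_psi_cont, Hrh.
  - apply cont_clamp.
  - apply bh_theta_cont, Hrh.
  - intros; apply continuous_const.
  - apply bh_dY_cont.
Qed.

Lemma bh_fix c s : comp_active N c = true -> 0 < s < 1 -> f c s = s ^ sys_exp 1 0 c * avg 0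
    (fun t => sys_lin N (bh_a0 Lam rh) (bh_b rh) c f t + sys_src zero2 (bh_dY N rh) c t + al * nl c al f t) s.
Proof.
  intros Hc Hs.
  rewrite (fix_unit N 1 0 0 0 0 (bh_a0 Lam rh) (bh_b rh) one (bh_psi rh) clamp (bh_theta rh) zero1 zero2
    (bh_dY N rh) al f Hfix c s Hc Hs) at 1.
  destruct c; reflexivity.
Qed.

Lemma bh_out c : comp_active N c = false -> f c = fun _ => 0.
Proof.
  intros Hc. apply functional_extensionality; intros s. rewrite Hfix. unfold sysmap. rewrite Hc. reflexivity.
Qed.

Lemma bh_rho_C1u : C1_unit (bh_rho rh).
Proof. unfold bh_rho, rhoS. smooth_unit. Qed.

Lemma bh_theta_C1u : C1_unit (bh_theta rh).
Proof. pose proof bh_rho_C1u. unfold bh_theta. smooth_unit. intros; apply bh_rho_neq, Hrh. Qed.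

Lemma bh_a0_C1u : C1_unit (bh_a0 Lam rh).
Proof. pose proof bh_rho_C1u. unfold bh_a0. smooth_unit. intros; apply bh_rho_neq, Hrh. Qed.

Lemma bh_b_C1u : C1_unit (bh_b rh).
Proof.
  pose proof bh_rho_C1u. unfold bh_b. smooth_unit. intros; apply pow_nonzero, bh_rho_neq, Hrh.
Qed.

(** For [cX] the power in front cancels the singular factor, so the equation is a plain integral of
    a continuous function. This starts the bootstrap. *)
Lemma bh_X_C1u j : C1_unit (f (cX j)).
Proof.
  destruct (in_range N j) eqn:Hj; [|rewrite (bh_out (cX j)) by exact Hj; apply C1u_const].
  split; [apply bh_f_cont|].
  set (g := fun t => sys_lin N (bh_a0 Lam rh) (bh_b rh) (cX j) f t + sys_src zero2 (bh_dY N rh) (cX j) t + al * nl (cX j) al f t).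
  exists g. split; [apply bh_drive_cont|].
  intros s Hs. apply (is_derive_ext_loc (fun s => s ^ 1 * avg 0 g s)).
  - apply locally_unit; trivial. intros x Hx. rewrite (bh_fix (cX j) x Hj Hx). reflexivity.
  - replace (g s) with (s ^ 0 * g s) by (simpl; ring). apply avg_derive. apply bh_drive_cont.
Qed.

Lemma bh_sysX_C1u j : C1_unit (fun s => sysX N f j s).
Proof. pose proof (bh_X_C1u j). unfold sysX. apply (C1u_plus (fun _ => altern N j) (f (cX j))); [apply C1u_const|trivial]. Qed.

(** At this stage only the components [cX] are known to be C1. The terms containing momenta and A
    come with [bh_psi], which has a factor s, so they are divisible although merely continuous. *)
Lemma bh_Y_C1u j : C1_unit (f (cY j)).
Proof.
  destruct (in_range N j) eqn:Hj; [|rewrite (bh_out (cY j)) by exact Hj; apply C1u_const].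
  set (g := fun t => sys_lin N (bh_a0 Lam rh) (bh_b rh) (cY j) f t + sys_src zero2 (bh_dY N rh) (cY j) t + al * nl (cY j) al f t).
  apply (C1u_ext (avg 0 g)); [|apply bh_f_cont|].
  2:{ intros s Hs. rewrite (bh_fix (cY j) s Hj Hs). simpl pow. fold g. ring. }
  apply avg_divisible.
  set (S2 := fun t => sum_n_m (fun i => (sysY zero1 f i t * / A t) ^ 2) 1 (N - 1)).
  replace g with (fun t =>
    (bh_b rh t * linW (vac N) (fun i => f (cX i) t) j + bh_dY N rh j t
      + al * (bh_b rh t * 1 * quadW (vac N) (al * 1) (fun i => sysX N f i t) j))
    + (- al) * (clamp t * (bh_theta rh t * (al * S2 t * sysY zero1 f j t)))).
  2:{ apply functional_extensionality; intros t. unfold g.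
      cbv beta iota delta [sys_lin sys_src sys_nonlin]. fold (S2 t).
      replace (bh_psi rh t) with (clamp t * bh_theta rh t) by (unfold bh_psi, bh_theta, Rdiv; ring). ring. }
  apply divisible_plus.
  - apply divisible_C1u. pose proof bh_b_C1u. unfold bh_dY, linW, quadW.
    pose proof (bh_X_C1u j). pose proof (bh_X_C1u (j - 1)). pose proof (bh_X_C1u (j + 1)).
    pose proof (bh_sysX_C1u j). pose proof (bh_sysX_C1u (j - 1)). pose proof (bh_sysX_C1u (j + 1)).
    smooth_unit.
  - apply divisible_scal, divisible_clamp_mult. intros t.
    assert (HY : forall i, continuous (fun t => sysY zero1 f i t) t) by (intros i; apply (Y_cont N L C w zero1 f Hball i t)).
    pose proof (bh_theta_cont rh Hrh t). pose proof (bh_A_cont t). pose proof (HY j).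
    unfold S2. cont; [apply (HY j0)|apply bh_A_neq].
Qed.

Lemma bh_sysY_C1u j : C1_unit (fun s => sysY zero1 f j s).
Proof. unfold sysY. apply (C1u_plus (fun _ => 0) (f (cY j))); [apply C1u_const|apply bh_Y_C1u]. Qed.

Lemma bh_Z_C1u : C1_unit (f cZ).
Proof.
  set (g := fun t => sys_lin N (bh_a0 Lam rh) (bh_b rh) cZ f t + sys_src zero2 (bh_dY N rh) cZ t + al * nl cZ al f t).
  apply (C1u_ext (avg 0 g)); [|apply bh_f_cont|].
  2:{ intros s Hs. rewrite (bh_fix cZ s eq_refl Hs). simpl pow. fold g. ring. }
  apply avg_divisible.
  set (S2 := fun t => sum_n_m (fun i => sysY zero1 f i t ^ 2 * / A t) 1 (N - 1)).
  replace g with (fun t => al * (clamp t * S2 t) + al * (bh_b rh t * energy N (vac N) (al * 1) (fun i => sysX N f i t))).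
  2:{ apply functional_extensionality; intros t. unfold g.
      cbv beta iota delta [sys_lin sys_src sys_nonlin]. fold (S2 t). ring. }
  apply divisible_plus.
  - apply divisible_scal, divisible_clamp_mult. intros t.
    assert (HY : forall i, continuous (fun t => sysY zero1 f i t) t) by (intros i; apply (Y_cont N L C w zero1 f Hball i t)).
    pose proof (bh_A_cont t). unfold S2. cont; [apply (HY j)|apply bh_A_neq].
  - apply divisible_C1u. pose proof bh_b_C1u. unfold energy.
    smooth_unit; apply bh_sysX_C1u.
Qed.

Lemma bh_A_C1u : C1_unit A.
Proof.
  pose proof bh_a0_C1u. pose proof bh_theta_C1u. pose proof bh_Z_C1u. unfold sysA. smooth_unit.
Qed.

Lemma bh_YA_C1u j : C1_unit (fun s => sysY zero1 f j s / A s).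
Proof.
  pose proof (bh_sysY_C1u j). pose proof bh_A_C1u.
  apply (C1u_mult (fun s => sysY zero1 f j s) (fun s => / A s)); trivial.
  apply (C1u_inv A); trivial. apply bh_A_neq.
Qed.

Lemma bh_U_C1u j : C1_unit (U j).
Proof. pose proof (bh_sysX_C1u j). unfold real_u. smooth_unit. Qed.

Lemma bh_u_extension j : exists F, (forall r, rh < r -> F r = omS N U j (sigma rh r)) /\
  F rh = omS N U j 0 /\ C2_at F rh.
Proof.
  apply (horizon_extension (omS N U j) (fun s => 0 + al * (sysY zero1 f j s / A s))).
  - intros s. unfold omS. pose proof (proj1 (bh_U_C1u j) s). cont.
  - intros s Hs. unfold omS. apply (is_derive_plus (fun _ => vac N j) (U j)); [apply (is_derive_const (vac N j))|].
    replace (al * (sysY zero1 f j s / A s)) with (Pf j s / AS Lam rh M s)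
      by (rewrite bh_ratio by trivial; simpl; ring).
    apply (proj1 black_hole_profile s Hs).
  - pose proof (bh_YA_C1u j).
    apply (C1u_plus (fun _ => 0)); [apply C1u_const|]. apply (C1u_mult (fun _ => al)); [apply C1u_const|trivial].
Qed.

Let rate (s : R) : R := al ^ 2 * sum_n_m (fun i => (sysY zero1 f i s / A s) ^ 2) 1 (N - 1).

Lemma bh_rate_C1u : C1_unit rate.
Proof.
  unfold rate. apply (C1u_mult (fun _ => al ^ 2)); [apply C1u_const|].
  apply (C1u_sum (fun i s => (sysY zero1 f i s / A s) ^ 2)). intros i.
  apply (C1u_pow (fun s => sysY zero1 f i s / A s)), bh_YA_C1u.
Qed.

Lemma bh_GS s : 0 < s < 1 -> GS N Lam rh Pf M s = rate s.
Proof.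
  intros Hs. unfold GS, rate. rewrite <- sumR_scal. apply sumR_ext. intros i _.
  rewrite bh_ratio by trivial. simpl. Rring.
Qed.

Lemma bh_m_extension : exists F, (forall r, rh < r -> F r = M (sigma rh r)) /\ F rh = M 0 /\ C2_at F rh.
Proof.
  assert (HMc : forall s, continuous M s).
  { intros s. unfold real_m. pose proof (cont_clamp s). pose proof (bh_f_cont cZ s). cont. }
  apply (horizon_extension M (fun s => clamp s * A s * rate s + PiS N U s / (4 * bh_rho rh s ^ 2))); trivial.
  - intros s Hs. destruct (proj1 black_hole_profile s Hs) as [_ [_ [_ Hm]]].
    replace (clamp s * A s * rate s + PiS N U s / (4 * bh_rho rh s ^ 2)) with (m_rate N Lam rh U Pf M s); trivial.
    unfold m_rate. rewrite bh_GS, bh_rho_unit, clamp_id by lra.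
    rewrite (real_A 1 1 (bh_a0 Lam rh) (bh_theta rh) Lam rh M0 al f bh_theta_spec bh_a0_spec); trivial.
    + rewrite pow_1. reflexivity.
    + intros t Ht. apply rhoS_pos; lra.
  - pose proof bh_A_C1u. pose proof bh_rate_C1u. pose proof bh_rho_C1u.
    apply C1u_plus.
    + apply (C1u_mult (fun s => clamp s * A s)); trivial. apply (C1u_mult clamp); trivial. apply C1u_clamp.
    + apply (C1u_mult (PiS N U) (fun s => / (4 * bh_rho rh s ^ 2))).
      * unfold PiS, omS. smooth_unit; apply bh_U_C1u.
      * smooth_unit. intros s. apply Rmult_integral_contrapositive_currified; [lra|].
        apply pow_nonzero, bh_rho_neq, Hrh.
Qed.

Lemma bh_lapse_extension : exists F,
  (forall r, rh < r -> F r = exp (RInt (lapse_rate N Lam rh Pf M) 1 (sigma rh r))) /\ 0 < F rh /\ C2_at F rh.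
Proof.
  set (g := fun s => bh_theta rh s * rate s).
  assert (Hg : C1_unit g) by (apply C1u_mult; [apply bh_theta_C1u|apply bh_rate_C1u]).
  set (E := fun s => exp (RInt g 1 s)).
  assert (HE : forall s, is_derive E s (g s * E s)).
  { intros s. unfold E. apply (is_derive_comp exp (fun s => RInt g 1 s)).
    - apply is_derive_exp.
    - apply is_derive_primitive, Hg. }
  assert (HEc : forall s, continuous E s) by (intros s; apply (ex_derive_continuous E); eexists; apply HE).
  destruct (horizon_extension E (fun s => g s * E s) rh HEc) as [F [F1 [F2 F3]]].
  - intros s _. apply HE.
  - apply C1u_mult; trivial. split; [trivial|]. exists (fun s => g s * E s).
    split; [intros s; apply cont_mult; [apply Hg|trivial]|intros s _; apply HE].
  - exists F. split; [|split; [rewrite F2; apply exp_pos|trivial]].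
    intros r Hr. rewrite F1 by trivial. unfold E. f_equal. apply RInt_ext. intros y Hy.
    pose proof (sigma_range rh r Hr). rewrite Rmin_right, Rmax_left in Hy by lra.
    unfold g, lapse_rate. rewrite bh_GS by lra. unfold bh_theta. rewrite bh_rho_unit, clamp_id by lra. reflexivity.
Qed.

Lemma bh_X0 j : f (cX j) 0 = 0.
Proof.
  rewrite Hfix. unfold sysmap. rewrite clamp_id by lra. destruct (comp_active N (cX j)); trivial.
  simpl sys_exp. rewrite pow_1. ring.
Qed.

Lemma bh_u_out j s : in_range N j = false -> U j s = 0.
Proof.
  intros Hj. unfold real_u, sysX. rewrite (bh_out (cX j)) by exact Hj.
  unfold altern, perron. rewrite (vac_range_out N 1 0 0 0 0 1 HN eq_refl eq_refl j Hj). ring.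
Qed.

Lemma black_hole_background : exists b,
  represents N Lam rh U Pf M b /\ regular_at N b rh /\ 0 < lapse b rh /\ mass b rh = M0 /\
  (forall j, (1 <= j <= N - 1)%nat -> gauge b j rh = vac N j + al * altern N j) /\
  (forall r, gauge b 0%nat r = 0 /\ gauge b N r = 0).
Proof.
  destruct bh_m_extension as [Fm [Hm1 [Hm2 Hm3]]].
  destruct bh_lapse_extension as [Fl [Hl1 [Hl2 Hl3]]].
  (* Each gauge function has its own extension; a choice of one for every j makes them a single
     family. *)
  set (Fu := fun j => proj1_sig (constructive_indefinite_description _ (bh_u_extension j))).
  assert (HFu : forall j, (forall r, rh < r -> Fu j r = omS N U j (sigma rh r)) /\
     Fu j rh = omS N U j 0 /\ C2_at (Fu j) rh).
  { intros j. unfold Fu. destruct (constructive_indefinite_description _ _) as [F HF]. exact HF. }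
  (* Outside the range of indices the zero function is used, so that the gauge convention holds at
     every radius, also inside the horizon. *)
  exists (Background Fm Fl (fun j => if in_range N j then Fu j else fun _ => 0)).
  split; [|split; [|split; [|split; [|split]]]]; simpl.
  - intros r Hr. simpl. split; [|split; [apply Hm1, Hr|apply Hl1, Hr]].
    intros j. destruct (in_range N j) eqn:Hj; [apply HFu, Hr|].
    unfold omS. rewrite bh_u_out, (vac_range_out N 1 0 0 0 0 1 HN eq_refl eq_refl j Hj) by trivial. ring.
  - split; [exact Hm3|]. split; [exact Hl3|]. intros j Hj. simpl.
    apply in_range_spec in Hj. rewrite Hj. apply HFu.
  - exact Hl2.
  - rewrite Hm2. unfold real_m. rewrite clamp_id by lra. simpl. ring.
  - intros j Hj. apply in_range_spec in Hj. rewrite Hj. rewrite (proj1 (proj2 (HFu j))).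
    unfold omS, real_u, sysX. rewrite bh_X0. ring.
  - intros r. split; [reflexivity|].
    assert (EN : in_range N N = false) by (unfold in_range; apply Bool.andb_false_iff; right; apply Nat.leb_gt; lia).
    rewrite EN. reflexivity.
Qed.

Definition bh_amp : R :=
  amplitude_bound N L C (exp kap) 1 (amin / 2).

Lemma bh_w_bound s : 0 <= s <= 1 -> 0 <= exp (kap * s) <= exp kap.
Proof.
  intros Hs. pose proof (bh_kap_pos N Lam rh HN HLam Hrh) as Hk. fold l rm L amin kap in Hk.
  pose proof (exp_weight_range kap s ltac:(lra) Hs). lra.
Qed.

Lemma bh_u_bound j s : Rabs (U j s) <= Rabs al * bh_amp.
Proof.
  pose proof (bh_L_ge N rh HN Hrh) as HL. fold rm L in HL.
  apply (real_u_bound N L C (exp kap) 1 (amin / 2) w); try lra; trivial.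
  - apply bh_amin2_pos.
  - apply bh_w_bound.
  - intros; rewrite Rabs_R1; lra.
Qed.

Lemma bh_ratio_bound j s : 0 < s < 1 -> Rabs (Pf j s / AS Lam rh M s) <= Rabs al * bh_amp.
Proof.
  intros Hs. rewrite bh_ratio by trivial.
  pose proof (bh_L_ge N rh HN Hrh) as HL. fold rm L in HL.
  replace (Rabs al * bh_amp) with (Rabs al * bh_amp * s ^ 0) by (simpl; ring).
  apply (real_ratio_bound N L C (exp kap) 1 (amin / 2) 0 w); try lra; trivial.
  - apply bh_amin2_pos.
  - apply bh_w_bound.
  - intros; rewrite Rabs_R0; lra.
Qed.

Lemma bh_is_black_hole b : Rabs al * bh_amp <= / 4 ->
  represents N Lam rh U Pf M b -> regular_at N b rh -> 0 < lapse b rh -> mass b rh = M0 ->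
  (forall r, gauge b 0%nat r = 0 /\ gauge b N r = 0) -> black_hole N Lam rh b.
Proof.
  intros Hsmall Hrep Hreg Hlap Hmass Hends.
  assert (Hrh0 : 0 <= rh) by lra.
  pose proof (profile_flow N Lam rh U Pf M b HLam Hrh0 black_hole_profile Hrep) as Hflow.
  assert (Hfe : forall r, rh < r -> field_equations N Lam b r).
  { intros r Hr. apply (flow_field_equations N Lam rh b _ Hrh0 Hflow r Hr). }
  assert (Hmu0 : mu Lam b rh = 0).
  { unfold mu. rewrite Hmass. unfold bh_mass. field. lra. }
  split; [trivial|]. split; [|split; [|split; [|split; [|split]]]]; trivial.
  - split; [trivial|]. intros j Hj. exists (rh + 1); split; [lra|].
    rewrite (proj1 (Hrep (rh + 1) ltac:(lra))). unfold omS.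
    pose proof (vac_ge_1 N j Hj). pose proof (bh_u_bound j (sigma rh (rh + 1))) as E.
    apply Rabs_le_between in E. lra.
  - intros r Hr. destruct (Req_dec r rh) as [->|Hne].
    + split; [trivial|]. split; [trivial|].
      apply field_equations_at_boundary; trivial. lra.
    + assert (Hr' : rh < r) by lra. split; [apply (flow_regular N Lam rh b _ Hrh0 Hflow r Hr')|].
      split; [apply (Hflow r Hr')|apply Hfe, Hr'].
  (* The horizon is non-extremal: mu = (r - rh) A / (1-s) is at least (amin/2)(r - rh), which bounds
     its slope at [rh] from below. *)
  - apply Rgt_not_eq. apply Rlt_le_trans with (amin / 2); [apply bh_amin2_pos|].
    apply derive_ge_slope; trivial.
    + destruct (C2_ex_derive _ _ (proj1 Hreg)) as [m' Hm']. eexists. apply (mu_derive Lam b rh m'); trivial. lra.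
    + intros r Hr. rewrite (mu_sigma N Lam rh U Pf M b Hrh0 Hrep r Hr).
      pose proof (sigma_range rh r Hr) as Hs.
      rewrite (real_A 1 1 (bh_a0 Lam rh) (bh_theta rh) Lam rh M0 al f bh_theta_spec bh_a0_spec); trivial.
      2:{ intros t Ht. apply rhoS_pos; lra. }
      cbv beta. pose proof (HA (sigma rh r)) as HAr. pose proof bh_amin2_pos.
      assert (E : sigma rh r = (r - rh) * (1 - sigma rh r)).
      { rewrite sigma_compl by trivial. unfold sigma. field. lra. }
      set (s := sigma rh r) in *.
      replace (s ^ 1 * A s / (1 - s) ^ 2) with ((r - rh) * (A s / (1 - s))).
      2:{ replace (s ^ 1 * A s) with ((r - rh) * (1 - s) * A s) by (rewrite <- E; ring). field. lra. }
      rewrite Rmult_comm. apply Rmult_le_compat_l; [lra|].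
      apply Rmult_le_reg_r with (1 - s); [lra|]. unfold Rdiv at 2. rewrite Rmult_assoc, Rinv_l, Rmult_1_r by lra. nra.
  - intros r Hr. apply (Hflow r Hr).
  - apply (profile_asymptotics N Lam rh U Pf M b HLam Hrh0 black_hole_profile Hrep).
Qed.

Lemma bh_nonembedded b : 0 < al -> Rabs al * bh_amp <= / 4 -> represents N Lam rh U Pf M b ->
  ~ embedded N rh b.
Proof.
  intros Hal Hsmall Hrep.
  assert (Hnear : forall j, exists d, 0 < d /\ forall s, 0 < s < d -> Rabs (f (cX j) s) < 1).
  { intros j. destruct (proj1 (filterlim_locally _ _) (bh_f_cont (cX j) 0) (mkposreal 1 Rlt_0_1)) as [d Hd].
    exists d; split; [apply cond_pos|]. intros s Hs.
    assert (Hb : ball 0 d s) by (change (Rabs (s - 0) < d); rewrite Rminus_0_r, Rabs_pos_eq; lra).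
    specialize (Hd s Hb). change (Rabs (f (cX j) s - f (cX j) 0) < 1) in Hd.
    rewrite bh_X0, Rminus_0_r in Hd. exact Hd. }
  destruct (Hnear 1%nat) as [d1 [Hd1 H1]]. destruct (Hnear 2%nat) as [d2 [Hd2 H2]].
  (* The remainders of the first two gauge functions vanish at the horizon. At this point they are
     below 1, hence below [perron], and the signs are those of [altern]. *)
  set (s := Rmin (Rmin d1 d2) 1 / 2).
  assert (Hmin : 0 < Rmin (Rmin d1 d2) 1) by (apply Rmin_pos; [apply Rmin_pos|]; lra).
  pose proof (Rmin_l (Rmin d1 d2) 1). pose proof (Rmin_r (Rmin d1 d2) 1).
  pose proof (Rmin_l d1 d2). pose proof (Rmin_r d1 d2).
  assert (Hs : 0 < s < 1) by (unfold s; lra).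
  specialize (H1 s ltac:(unfold s; lra)). specialize (H2 s ltac:(unfold s; lra)).
  set (r := rh + s / (1 - s)).
  assert (Hr : rh < r) by (unfold r; assert (0 < s / (1 - s)) by (apply Rdiv_lt_0_compat; lra); lra).
  assert (Hrs : sigma rh r = s) by (unfold sigma, r; field; split; lra).
  apply Rabs_def2 in H1. apply Rabs_def2 in H2.
  pose proof (perron_bounds N 1 ltac:(lia)). pose proof (perron_bounds N 2 ltac:(lia)).
  pose proof (vac_ge_1 N 1 ltac:(lia)). pose proof (bh_u_bound 1 s) as U1. apply Rabs_le_between in U1.
  destruct (Hrep r Hr) as [Eg _].
  apply (nonembedded_of_signs N rh b r HN Hr); rewrite !Eg, Hrs; unfold omS.
  - split; [lra|]. assert (U 1%nat s < 0); [|lra].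
    unfold real_u, sysX, altern. simpl pow. nra.
  - assert (0 < U 2%nat s); [|lra].
    unfold real_u, sysX, altern. simpl pow. apply Rmult_lt_0_compat; lra.
Qed.

End BlackHoleBackground.

Lemma black_hole_near_vacuum (N : nat) (Lam rh eps : R) : (3 <= N)%nat -> Lam < 0 -> 0 < rh -> 0 < eps ->
  exists b, black_hole N Lam rh b /\ ~ embedded N rh b /\
    close_at_horizon N rh eps (vacuum N (bh_mass Lam rh)) b /\ no_grav_instability N Lam rh b.
Proof.
  intros HN HLam Hrh Heps.
  destruct (black_hole_system N Lam rh HN HLam Hrh) as [C [al0 [HC [Hal0 Hsys]]]].
  destruct (small_profile_stable N Lam rh ltac:(lia) HLam ltac:(lra)) as [e [He [He4 Hst]]].
  set (Q := bh_amp N Lam rh C) in *.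
  assert (Hrm : 0 < Rmin 1 rh) by (apply Rmin_pos; lra).
  (* Stability asks for a derivative of size e times rhoS, and rhoS is at least the minimum of 1 and
     rh; the smaller tolerance covers this. *)
  set (e' := e * Rmin 1 rh). assert (He' : 0 < e') by (apply Rmult_lt_0_compat; trivial).
  pose proof (Rmin_l 1 rh). pose proof (Rmin_r 1 rh).
  assert (Hee : e' <= e) by (unfold e'; nra).
  (* The horizon values differ from the vacuum by exactly [al * altern N j], since the remainder
     vanishes there; so one small amplitude gives both closeness and stability. Taking |Q| + 1 keeps
     the denominator positive. *)
  destruct (small_amplitude N (Rmin al0 (e' / (Rabs Q + 1))) eps) as [al [Hal Hsm]]; trivial.
  { apply Rmin_pos; [trivial|]. apply Rdiv_lt_0_compat; trivial. pose proof (Rabs_pos Q). lra. }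
  pose proof (Rmin_l al0 (e' / (Rabs Q + 1))). pose proof (Rmin_r al0 (e' / (Rabs Q + 1))).
  assert (Ha : Rabs al = al) by (apply Rabs_pos_eq; lra).
  assert (HalQ : Rabs al * Q <= e').
  { pose proof (Rle_abs Q). pose proof (Rabs_pos Q). rewrite Ha.
    apply Rle_trans with (e' / (Rabs Q + 1) * (Rabs Q + 1)); [|right; field; lra].
    apply Rle_trans with (al * (Rabs Q + 1)); [apply Rmult_le_compat_l; lra|apply Rmult_le_compat_r; lra]. }
  destruct (Hsys al) as [f [Hball [HA Hfix]]]; [lra|].
  destruct (black_hole_background N Lam rh C al f HN HLam Hrh Hball HA Hfix) as [b [Hrep [Hreg [Hl [Hm [Hg Hends]]]]]].
  exists b. split; [|split; [|split]].
  - apply (bh_is_black_hole N Lam rh C al f HN HLam Hrh HC Hball HA Hfix b); trivial. fold Q. lra.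
  - apply (bh_nonembedded N Lam rh C al f HN HLam Hrh HC Hball Hfix b); trivial; [lra|fold Q; lra].
  - intros j Hj. simpl gauge. rewrite Hg by trivial.
    replace (vac N j - (vac N j + al * altern N j)) with (- (al * altern N j)) by ring.
    rewrite Rabs_Ropp. apply Hsm.
  - apply (Hst _ _ _ _ (black_hole_profile N Lam rh C al f HN HLam Hrh Hball HA Hfix) Hrep).
    + intros r _. apply Hends.
    + intros s j Hs. pose proof (bh_u_bound N Lam rh C al f HN HLam Hrh HC Hball j s) as E1.
      pose proof (bh_ratio_bound N Lam rh C al f HN HLam Hrh HC Hball HA j s Hs) as E2.
      fold Q in E1, E2. split; [lra|]. split; [lra|].
      apply Rle_trans with (1 := E2). apply Rle_trans with (1 := HalQ). unfold e'.
      apply Rmult_le_compat_l; [lra|]. unfold rhoS. nra.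
Qed.
Theorem mainTheorem2 (N : nat) (hN : (3 <= N)%nat) :
  (exists L0 : R, 0 < L0 /\ forall Lam : R, Lam < 0 -> L0 < Rabs Lam ->
     exists b0 : background,
       soliton N Lam b0 /\ embedded N 0 b0 /\ stable N Lam 0 b0 /\
       forall eps : R, 0 < eps ->
         exists b : background,
           soliton N Lam b /\ ~ embedded N 0 b /\
           close_at_origin N eps b0 b /\
           no_grav_instability N Lam 0 b)
  /\
  (forall rh : R, 0 < rh ->
   exists L0 : R, 0 < L0 /\ forall Lam : R, Lam < 0 -> L0 < Rabs Lam ->
     exists b0 : background,
       black_hole N Lam rh b0 /\ embedded N rh b0 /\ stable N Lam rh b0 /\
       forall eps : R, 0 < eps ->
         exists b : background,
           black_hole N Lam rh b /\ ~ embedded N rh b /\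
           close_at_horizon N rh eps b0 b /\
           no_grav_instability N Lam rh b).
Proof.
  split.
  - exists 1. split; [lra|]. intros Lam HLam _. exists (vacuum N 0).
    split; [|split; [|split]].
    + apply vacuum_soliton; trivial; lia.
    + apply vacuum_embedded.
    + apply vacuum_soliton_stable; trivial; lia.
    + intros eps Heps. apply soliton_near_vacuum; trivial.
  - intros rh Hrh. exists 1. split; [lra|]. intros Lam HLam _. exists (vacuum N (bh_mass Lam rh)).
    split; [|split; [|split]].
    + apply vacuum_black_hole; trivial; lia.
    + apply vacuum_embedded.
    + apply vacuum_black_hole_stable; trivial; lia.
    + intros eps Heps. apply black_hole_near_vacuum; trivial.
Qed.
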